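(* Let $D^\pi:\mathrm{Dom}(D^\pi)\subset L^2(\Omega)\to L^2(\Omega,L^2(W,\mathbb{R}^d))$ be the operator defined in the context. Then $D^\pi$ is closable and admits a closable adjoint $\delta^\pi$ from $L^2(\Omega,L^2(W,\mathbb{R}^d))$ into $L^2(\Omega)$, and the following duality relation holds: $$\mathbb{E}\left[\int_W D_x^\pi F\cdot V(x)\,\mathrm{d}x\right]=\mathbb{E}\left[F\,\delta^\pi(V)\right],\qquad \forall F\in \mathrm{Dom}(D^\pi),\ \forall V\in \mathrm{Dom}(\delta^\pi).$$ In particular, this relation extends, with $D^\pi,\delta^\pi$ replaced by their closures $\overline{D}^\pi,\overline{\delta}^\pi$, to all $F\in\mathrm{Dom}(\overline{D}^\pi)$ and $V\in\mathrm{Dom}(\overline{\delta}^\pi)$. Moreover, let $V\in L^\infty(W,\mathbb{R}^d)$ be deterministic and define $\mathcal V^\pi:W\to\mathbb{R}^d$ by $$\mathcal V^\pi(u)=\int_W V(x)\,\pi(u,x)\,\mathrm{d}x .$$ Then $\mathcal V^\pi$ is an element of $\mathcal C^1(W,\mathbb{R}^d)$, and $\delta^\pi$ has the explicit expression $$\delta^\pi(V)=\sum_{u\in \mathbf{X}_W}\nabla\cdot\mathcal V^\pi(u)-\theta\int_W\nabla\cdot\mathcal V^\pi(u)\,\mathrm{d}u .$$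
   Context: Point process. $W\subset\mathbb{R}^d$ is a compact set with positive Lebesgue measure $|W|$ and $\mathcal{C}^2$ boundary. $\mathbf{X}$ is a homogeneous Poisson point process on $\mathbb{R}^d$ with intensity $\theta>0$, $\mathbf{X}_W=\mathbf{X}\cap W$, $N(W)$ is the number of points of $\mathbf{X}_W$, and given $N(W)=n$ the points are denoted $X_1,\dots,X_n\in W$. $\mathcal{F}_W$ is the $\sigma$-field generated by the points of $\mathbf{X}$ in $W$, and $L^2(\Omega)=L^2(\Omega,\mathcal F_W,\mathbb P)$. Functionals. $\mathcal S$ is the set of Poisson functionals $F=f_0\mathbf 1(N(W)=0)+\sum_{n\ge1}\mathbf 1(N(W)=n)f_n(X_1,\dots,X_n)$ with $f_0\in\mathbb{R}$ and each $f_n\in L^1(W^n,\mathbb{R})$ symmetric; the $f_n$ are the form functions of $F$. $\mathcal S'$ is the set of $F\in\mathcal S$ for which there is $C>0$ such that for all $n\ge1$, $f_n\in\mathcal C^1(W^n,\mathbb{R})$ and $\|f_n\|_{L^\infty(W^n)}+\sum_{i=1}^n\|\nabla_{x_i}f_n\|_{L^\infty(W^n,\mathbb{R}^d)}\le C^n$, where $\nabla_{x_i}$ is the gradient in the $i$-th variable $x_i\in\mathbb{R}^d$. Weight function. $\pi:W^2\to\mathbb{R}$ is a fixed bounded function such that for a.e. $x\in W$ the map $z\mapsto\pi(z,x)$ is in $\mathcal C^1(W,\mathbb{R})$. Derivative. For $F\in\mathcal S'$ and $x\in W$, $$D^\pi_xF=-\sum_{n\ge1}\mathbf 1(N(W)=n)\sum_{i=1}^n(\nabla_{x_i}f_n)(X_1,\dots,X_n)\,\pi(X_i,x)\in\mathbb{R}^d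 .$$ $D^\pi F$ denotes the random field $x\mapsto D^\pi_xF$. $\mathrm{Dom}(D^\pi)$ is the set of $F\in\mathcal S'$ whose form functions satisfy the compatibility conditions: $f_{n+1}(z_1,\dots,z_n,z_{n+1})=f_n(z_1,\dots,z_n)$ for all $n\ge1$, $z_1,\dots,z_n\in W$, $z_{n+1}\in\partial W$, and $f_1(z)=f_0$ for $z\in\partial W$. This set is dense in $L^2(\Omega)$. $L^2(\Omega,L^2(W,\mathbb{R}^d))$ is the Hilbert space of random fields $Y$ on $W$ with $\mathbb{E}\int_W\|Y(x)\|^2\mathrm dx<\infty$; deterministic $V$ are viewed as elements of it. Operators. A linear $T:\mathrm{Dom}(T)\subset H_1\to H_2$ between Hilbert spaces is closable if $f_\ell\in\mathrm{Dom}(T)$, $f_\ell\to0$ and $Tf_\ell\to g$ imply $g=0$; its closure $\overline T$ is defined on the set $\mathrm{Dom}(\overline T)$ of limits $f=\lim f_\ell$ with $f_\ell\in\mathrm{Dom}(T)$ and $(Tf_\ell)$ convergent, by $\overline Tf=\lim Tf_\ell$. If $\mathrm{Dom}(T)$ is dense, $g\in\mathrm{Dom}(T^* )$ iff there is $h\in H_1$ with $\langle Tf,g\rangle_{H_2}=\langle f,h\rangle_{H_1}$ for all $f\in\mathrm{Dom}(T)$, and $T^*g=h$. $\nabla\cdot$ is the divergence.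
   Formalization: π is taken jointly measurable; that V^π is C¹ is proved only if the z-gradient of π(z,x) is dominated, uniformly in z, by an integrable function of x (it fails for π(z,x)=sin(z/x) on [0,1], V=1); the formula for δ^π(V) is stated for every bounded V with V^π in C¹. *)

(* Defs.v *)
From HB Require Import structures.
From mathcomp Require Import all_boot all_order all_algebra.
From mathcomp Require Import all_classical all_reals all_analysis.
From mathcomp Require Import perm measurable_realfun.
Set Implicit Arguments.
Unset Strict Implicit.
Unset Printing Implicit Defensive.
Import Order.TTheory GRing.Theory Num.Theory.
Import numFieldNormedType.Exports.
Local Open Scope classical_set_scope.
Local Open Scope ring_scope.

(* Matrices 'M[R]_(m, n) carry their Borel sigma-algebra.  Points of R^d are
   row vectors 'rV[R]_d, and elements of (R^d)^n are matrices 'M[R]_(n, d)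
   whose i-th row is the i-th point. *)
Definition mx_display : measure_display. Proof. exact. Qed.

Section borel_mx.
Context (R : realType) (m n : nat).
Let E := 'M[R]_(m, n).
Let borel : set (set E) := <<s [set A : set E | open A] >>.

Let borel0 : borel set0.
Proof. exact: sigma_algebra0. Qed.

Let borelC A : borel A -> borel (~` A).
Proof. exact: sigma_algebraC. Qed.

Let borel_bigcup (F : (set E)^nat) :
  (forall i, borel (F i)) -> borel (\bigcup_i F i).
Proof. exact: sigma_algebra_bigcup. Qed.

HB.instance Definition _ := @isMeasurable.Build mx_display
  'M[R]_(m, n) borel borel0 borelC borel_bigcup.

End borel_mx.

Section mx_measurable.
Context (R : realType).

Lemma open_measurable_mx m n (A : set 'M[R]_(m, n)) : open A -> measurable A.
Proof. by move=> oA; exact: sub_sigma_algebra. Qed.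

Lemma measurable_coord_mx m n i j :
  measurable_fun setT (fun M : 'M[R]_(m, n) => M i j).
Proof.
apply: (measurability _ (RGenOpens.measurableE R)) => _ [_ [a [b ->]] <-].
rewrite setTI; apply: open_measurable_mx.
apply: open_comp; last exact: interval_open.
by move=> x _; exact: coord_continuous.
Qed.

Lemma measurable_fun_mx d (T : measurableType d) m n (g : T -> 'M[R]_(m, n)) :
  (forall i j, measurable_fun setT (fun t => g t i j)) -> measurable_fun setT g.
Proof.
move=> mg.
apply: (measurability [set A : set 'M[R]_(m, n) | open A] erefl).
move=> _ [A oA <-]; rewrite setTI.
pose C (q : 'M[rat]_(m, n)) : 'M[R]_(m, n) := map_mx ratr q.
pose B (qk : 'M[rat]_(m, n) * nat) := ball (C qk.1) (qk.2.+1%:R^-1 : R).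
rewrite (_ : g @^-1` A =
    \bigcup_qk (if `[< B qk `<=` A >] then g @^-1` B qk else set0)); last first.
  apply/seteqP; split => [t At|t [qk _]]; last first.
    by case: asboolP => // BA; exact: BA.
  have /nbhs_ballP[e /= e0 eA] : nbhs (g t) A by exact: open_nbhs_nbhs.
  have e20 : 0 < e / 2 by rewrite divr_gt0.
  have [k _ /(_ _ (leqnn k)) /= ke] := near_infty_natSinv_lt (PosNum e20).
  have qP i j : exists q : rat, `|ratr q - g t i j| < k.+1%:R^-1.
    have [q] : exists q : rat, ratr q \in
        `](g t i j - k.+1%:R^-1), (g t i j + k.+1%:R^-1)[.
      by apply: rat_in_itvoo; rewrite ltrBlDr -addrA ltrDl addr_gt0.
    by rewrite in_itv/= => /andP[a b]; exists q; rewrite ltr_distl a b.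
  pose q : 'M[rat]_(m, n) := \matrix_(i, j) sval (cid (qP i j)).
  have Bt : B (q, k) (g t).
    by split=> [|i j] /=; rewrite ?invr_gt0 ?ltr0n// /C !mxE; case: cid.
  exists (q, k) => //; rewrite asboolT// => M BM.
  apply: eA; rewrite (splitr e).
  apply: (@ball_triangle _ _ (C q)); last first.
    by apply: le_ball BM; exact: ltW.
  by apply: ball_sym; apply: le_ball Bt; exact: ltW.
apply: countable_bigcupT_measurable => // qk.
case: asboolP => // _.
rewrite (_ : _ @^-1` _ = \bigcap_(ij in [set: 'I_m * 'I_n])
    ((fun t => g t ij.1 ij.2) @^-1` ball (C qk.1 ij.1 ij.2) qk.2.+1%:R^-1)).
  apply: fin_bigcap_measurable => // ij _; rewrite -[X in measurable X]setTI.
  by apply: mg => //; exact: measurable_ball.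
apply/seteqP; split => [t [_ Bt] [i j] _|t Bt]; first exact: Bt.
by split=> [|i j]; [rewrite invr_gt0 ltr0n|exact: (Bt (i, j))].
Qed.

End mx_measurable.

Section lebesgue_mx.
Context (R : realType).

Definition cons_mx n (p : 'rV[R]_n * measurableTypeR R) : 'rV[R]_n.+1 :=
  row_mx (p.2%:M : 'rV_1) p.1.

Lemma measurable_cons_mx n : measurable_fun setT (@cons_mx n).
Proof.
apply: measurable_fun_mx => i j; case: (@split_ordP 1 n j) => k ->.
  rewrite (_ : (fun _ => _) = snd); first exact: measurable_snd.
  apply: funext => -[v x].
  by rewrite /cons_mx [LHS]row_mxEl mxE ord1 [k]ord1 eqxx mulr1n.
rewrite (_ : (fun _ => _) = (fun v : 'rV[R]_n => v i k) \o fst).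
  exact: (measurableT_comp (measurable_coord_mx _ _) measurable_fst).
by apply: funext => -[v x]; rewrite /cons_mx [LHS]row_mxEr.
Qed.

Definition image_measure d1 d2 (T1 : measurableType d1)
    (T2 : measurableType d2) (mu : {measure set T1 -> \bar R}) (f : T1 -> T2)
    (mf : measurable_fun setT f) : {measure set T2 -> \bar R} :=
  measure_function_pushforward__canonical__measure_function_Measure mu mf.

Fixpoint lebesgue_rV n : {measure set 'rV[R]_n -> \bar R} :=
  if n is n'.+1 then
    image_measure (lebesgue_rV n' \x @lebesgue_measure R)%E
      (@measurable_cons_mx n')
  else dirac (0 : 'rV[R]_0).

Lemma measurable_vec_mx m n :
  measurable_fun setT (@vec_mx R m n).
Proof.
apply: measurable_fun_mx => i j; under eq_fun do rewrite mxE.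
exact: measurable_coord_mx.
Qed.

Definition lebesgue_mx m n : {measure set 'M[R]_(m, n) -> \bar R} :=
  image_measure (lebesgue_rV (m * n)) (@measurable_vec_mx m n).

End lebesgue_mx.

Arguments lebesgue_mx {R m n}.
Notation leb := lebesgue_mx.

Section calculus.
Context {R : realType}.

Definition dot n (u v : 'rV[R]_n) : R := \sum_k u 0 k * v 0 k.
Definition enorm n (u : 'rV[R]_n) : R := Num.sqrt (dot u u).

Definition frontier m n (K : set 'M[R]_(m, n)) : set 'M[R]_(m, n) :=
  closure K `\` K°.

Definition C1_open m n (U : set 'M[R]_(m, n)) (f : 'M[R]_(m, n) -> R) :=
  forall i j x, U x ->
    derivable f x (delta_mx i j) /\
    {for x, continuous (fun y => 'D_(delta_mx i j) f y)}.

Definition C2_open m n (U : set 'M[R]_(m, n)) (f : 'M[R]_(m, n) -> R) :=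
  C1_open U f /\
  forall i j, C1_open U (fun y => 'D_(delta_mx i j) f y).

(* The partial derivative of a function on a closed set K: the derivative in
   the interior of K, extended to K by its limit from the interior. *)
Definition partial m n (K : set 'M[R]_(m, n)) (i : 'I_m) (j : 'I_n)
    (f : 'M[R]_(m, n) -> R) (x : 'M[R]_(m, n)) : R :=
  lim ('D_(delta_mx i j) f y @[y --> within K° (nbhs x)]).

(* C^1 functions on a closed set K: continuous on K, C^1 in the interior of K,
   with partial derivatives extending continuously to K.  Only the values of f
   on K are relevant. *)
Definition C1_on m n (K : set 'M[R]_(m, n)) (f : 'M[R]_(m, n) -> R) :=
  [/\ {within K, continuous f},
      C1_open K° f
    & forall i j, {within K, continuous (partial K i j f)}].

Definition C1_on_vec n p (K : set 'rV[R]_n) (f : 'rV[R]_n -> 'rV[R]_p) :=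
  forall k, C1_on K (fun x => f x 0 k).

Definition grad m n (K : set 'M[R]_(m, n)) (i : 'I_m)
    (f : 'M[R]_(m, n) -> R) (x : 'M[R]_(m, n)) : 'rV[R]_n :=
  \row_j partial K i j f x.

Definition divergence n (K : set 'rV[R]_n) (f : 'rV[R]_n -> 'rV[R]_n)
    (x : 'rV[R]_n) : R :=
  \sum_k partial K 0 k (fun y => f y 0 k) x.

(* The boundary of K is C^2: near each boundary point, K is the sublevel set
   {phi <= 0} of a C^2 function phi whose gradient does not vanish there. *)
Definition C2_boundary n (K : set 'rV[R]_n) :=
  forall p, frontier K p ->
    exists (U : set 'rV[R]_n) (phi : 'rV[R]_n -> R),
      [/\ open U /\ U p, C2_open U phi,
          exists k, 'D_(delta_mx 0 k) phi p != 0
        & K `&` U = [set x | phi x <= 0] `&` U].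

Definition Linfty_norm m n (K : set 'M[R]_(m, n)) (f : 'M[R]_(m, n) -> R) :
    \bar R :=
  'N[leb]_+oo[EFin \o (f \_ K)]%E.

End calculus.

(* An L^2 space presented by representatives: a vector space of functions, the
   measurable ones among them, and the (extended-real) inner product.  Elements
   are functions modulo l2ip (f - g) (f - g) = 0. *)
Record l2space (R : realType) := L2Space {
  l2car :> lmodType R ;
  l2meas : set l2car ;
  l2ip : l2car -> l2car -> \bar R }.

Section operators.
Context {R : realType}.
Implicit Types H : l2space R.

Definition in_l2 H (f : H) := l2meas f /\ (l2ip f f < +oo)%E.

Definition l2cvg H (f_ : nat -> H) (f : H) :=
  l2ip (f_ l - f) (f_ l - f) @[l --> \oo] --> (0 : \bar R).

(* Unbounded operators are given by their graphs. *)
Definition linear_operator H1 H2 (T : H1 -> H2 -> Prop) :=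
  (forall f g, T f g -> in_l2 f /\ in_l2 g) /\
  (forall (a : R) f f' g g', T f g -> T f' g' ->
     T (a *: f + f') (a *: g + g')).

Definition densely_defined H1 H2 (T : H1 -> H2 -> Prop) :=
  forall f, in_l2 f ->
    exists f_ : nat -> H1, (forall l, exists g, T (f_ l) g) /\ l2cvg f_ f.

Definition closable H1 H2 (T : H1 -> H2 -> Prop) :=
  forall (f_ : nat -> H1) (g_ : nat -> H2) (g : H2), in_l2 g ->
    (forall l, T (f_ l) (g_ l)) -> l2cvg f_ 0 -> l2cvg g_ g ->
    l2ip g g = 0%E.

Definition closure_op H1 H2 (T : H1 -> H2 -> Prop) (f : H1) (g : H2) :=
  [/\ in_l2 f, in_l2 g
    & exists (f_ : nat -> H1) (g_ : nat -> H2),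
        [/\ forall l, T (f_ l) (g_ l), l2cvg f_ f & l2cvg g_ g]].

Definition adjoint H1 H2 (T : H1 -> H2 -> Prop) (g : H2) (h : H1) :=
  [/\ in_l2 g, in_l2 h & forall f Tf, T f Tf -> l2ip Tf g = l2ip f h].

End operators.

Section poisson_functionals.
Context {R : realType} {d : nat} {dT : measure_display}
  {T : measurableType dT}.
Let Rd := 'rV[R]_d.

Definition points (X : T -> set Rd) (B : set Rd) (w : T) : seq Rd :=
  finmap.enum_fset (fset_set (X w `&` B)).

Definition count (X : T -> set Rd) (B : set Rd) (w : T) : nat :=
  size (points X B w).

(* A homogeneous Poisson point process with intensity theta, as a random
   locally finite subset of R^d. *)
Definition poisson_process (P : probability T R) (theta : R)
    (X : T -> set Rd) :=
  [/\ forall w B, bounded_set B -> finite_set (X w `&` B),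
      forall (B : set Rd) k, measurable B -> bounded_set B ->
        measurable [set w | count X B w = k],
      forall (B : set Rd) k, measurable B -> bounded_set B ->
        let r := theta * fine (leb B) in
        P [set w | count X B w = k] = (r ^+ k / k`!%:R * expR (- r))%:E
    & forall p (B : 'I_p -> set Rd) (k : 'I_p -> nat),
        (forall i, measurable (B i) /\ bounded_set (B i)) ->
        trivIset setT B ->
        P [set w | forall i, count X (B i) w = k i] =
        (\prod_(i < p) P [set w | count X (B i) w = k i])%E].

(* Generators of F_W, the sigma-field generated by the points in W. *)
Definition F_W_gen (X : T -> set Rd) (W : set Rd) : set (set T) :=
  [set A | exists (B : set Rd) k, [/\ measurable B, B `<=` W &
    A = [set w | count X B w = k]]].

Definition F_W_type X W := g_sigma_algebraType (F_W_gen X W).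

Variables (P : probability T R) (X : T -> set Rd) (W : set Rd).

Definition L2_Omega : l2space R :=
  @L2Space R (T -> R)
    [set F | measurable_fun setT (F : F_W_type X W -> R)]
    (fun F G => \int[P]_w (F w * G w)%:E)%E.

(* Only the values Y w x with x in W are relevant. *)
Definition L2_field : l2space R :=
  @L2Space R (T -> Rd -> Rd)
    [set Y | measurable_fun (setT `*` W)
               (fun p : F_W_type X W * Rd => Y p.1 p.2)]
    (fun Y Z => \int[P]_w \int[leb]_(x in W) (dot (Y w x) (Z w x))%:E)%E.

(* The points X_1, ..., X_n of the process in W, when N(W) = n. *)
Definition X_W (w : T) : 'M[R]_(count X W w, d) :=
  \matrix_i nth 0 (points X W w) i.

Definition Wpow n : set 'M[R]_(n, d) := [set z | forall i, W (row i z)].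
Arguments Wpow : clear implicits.

(* Form functions; f 0, evaluated at the only element of 'M_(0, d), is the
   constant f_0. *)
Definition forms := forall n, 'M[R]_(n, d) -> R.

Definition functional (f : forms) (w : T) : R := f (count X W w) (X_W w).

Definition in_S (f : forms) :=
  (forall n (s : 'S_n) z, Wpow n z -> f n (row_perm s z) = f n z) /\
  (forall n, (0 < n)%N -> leb.-integrable (Wpow n) (EFin \o f n)).

Definition in_S' (f : forms) :=
  in_S f /\
  exists2 C : R, 0 < C & forall n, (0 < n)%N ->
    C1_on (Wpow n) (f n) /\
    (Linfty_norm (Wpow n) (f n) +
     \sum_(i < n) Linfty_norm (Wpow n) (fun z => enorm (grad (Wpow n) i (f n) z))
     <= (C ^+ n)%:E)%E.

(* For n = 0 this reads f_1(z) = f_0 for z in the boundary of W. *)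
Definition compatible (f : forms) :=
  forall n (z : 'M[R]_(n, d)) (y : Rd), Wpow n z -> frontier W y ->
    f (n + 1)%N (col_mx z y) = f n z.

Definition derivative_field (pi : Rd -> Rd -> R) (f : forms) (w : T) (x : Rd)
    : Rd :=
  - \sum_(i < count X W w)
      pi (row i (X_W w)) x *:
      grad (Wpow (count X W w)) i (f (count X W w)) (X_W w).

(* The graph of D^pi. *)
Definition D_op (pi : Rd -> Rd -> R) (F : L2_Omega) (Y : L2_field) :=
  exists f : forms, [/\ in_S' f, compatible f,
    F = functional f & Y = derivative_field pi f].

Definition delta_op (pi : Rd -> Rd -> R) : L2_field -> L2_Omega -> Prop :=
  adjoint (D_op pi).

Definition V_pi (pi : Rd -> Rd -> R) (V : Rd -> Rd) (u : Rd) : Rd :=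
  \row_k \int[leb]_(x in W) (V x 0 k * pi u x).

(* The partial derivatives of pi in its first variable are dominated, uniformly
   in this variable, by an integrable function: the condition under which V_pi
   can be differentiated under the integral sign. *)
Definition dominated_gradient (pi : Rd -> Rd -> R) :=
  exists2 g : Rd -> R, leb.-integrable W (EFin \o g) &
    {ae leb, forall x, W x -> forall z k, W z ->
      `|partial W 0 k (pi ^~ x) z| <= g x}.

End poisson_functionals.

(* Main.v *)
(* For a deterministic field V with V_pi of class C^1, the duality is integration
   by parts: given N(W) = n, the points are a symmetrized sample of the product
   measure, the divergence theorem in the last variable z_n of f_n V_pi(z_n)
   leaves a boundary term, and the compatibility condition makes it vanish after
   f_(n-1) is subtracted; summing over n against the Poisson weights telescopes to
   delta(V) = sum of divergences - theta * integral.

   The domain of D is dense because it contains the products prod_i g(X_i) with g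
   of class C^1 and equal to 1 on the boundary: these approximate the indicators of
   the events "no point in O", O open, which form a pi-system generating F_W.
   Hence delta is well defined, and adjoints are closable.

   D is closable as soon as a field Y orthogonal to the domain of delta vanishes.
   By the product rule, G V is in the domain of delta for every G in the domain of
   D, so by density 1_A V is orthogonal to Y for every A in F_W.  Restricting V to
   the set of those x for which pi(., x) is m-Lipschitz makes the C^1 condition on
   V_pi automatic, and a monotone class argument gives Y = 0. *)

Require Import Defs.
From HB Require Import structures.
From mathcomp Require Import all_boot all_order all_algebra.
From mathcomp Require Import all_classical all_reals all_analysis.
From mathcomp Require Import perm measurable_realfun ess_sup_inf ring lra.
Set Implicit Arguments.
Unset Strict Implicit.
Unset Printing Implicit Defensive.
Import Order.TTheory GRing.Theory Num.Theory.
Import numFieldNormedType.Exports.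
Local Open Scope classical_set_scope.
Local Open Scope ring_scope.
Local Notation count := Defs.count.
Arguments Wpow {R d} W n z.

(** * L^2 spaces and unbounded operators *)

(** The hypotheses on the process speak of counts only, and [X_W] lists the points in an order that
    comes from an arbitrary choice. Hence a measurable enumeration has to be built; its law, summed
    over permutations, is compared with the product measure on cells with distinct rows, where it is
    a joint law of counts, the diagonal being null for both. No surface integral occurs. The C^2
    boundary serves for two facts: W lies in the closure of its interior, which gives a meaning to
    [partial] up to the boundary, and the frontier is null. The boundary term disappears because a
    C^1 function vanishing on the frontier is continuous once extended by 0, and its partial
    derivative integrates to 0 along each line. Integrability rests throughout on the exponential
    moments of the Poisson count, which absorb the growth C^n of the form functions. *)

Lemma cvgR_unique (R : realType) (u : nat -> R) (a b : R) :
  u @ \oo --> a -> u @ \oo --> b -> a = b.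
Proof. by move=> ua ub; apply: cvg_unique ua ub; exact: norm_hausdorff. Qed.

Section l2_theory.
Context {R : realType}.

(** An [l2space] is bare data without axioms. Closure, finiteness and linearity are asked between
    square-integrable elements only, because elsewhere the pairing may be infinite and integrals
    need not add up. *)
Record l2_laws (H : l2space R) : Prop := L2Laws {
  l2_closed : forall a (f g : H), in_l2 f -> in_l2 g -> in_l2 (a *: f + g) ;
  l2_fin : forall f g : H, in_l2 f -> in_l2 g -> l2ip f g \is a fin_num ;
  l2_sym : forall f g : H, l2ip f g = l2ip g f ;
  l2_linl : forall a (f g h : H), in_l2 f -> in_l2 g -> in_l2 h ->
    l2ip (a *: f + g) h = (a%:E * l2ip f h + l2ip g h)%E ;
  l2_ge0 : forall f : H, (0 <= l2ip f f)%E }.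

Section one_space.
Context (H : l2space R) (HH : l2_laws H).
Implicit Types f g h : H.

Definition ip f g : R := fine (l2ip f g).

Lemma ipE f g : in_l2 f -> in_l2 g -> l2ip f g = (ip f g)%:E.
Proof. by move=> fL gL; rewrite /ip fineK// l2_fin. Qed.

Lemma ip_sym f g : ip f g = ip g f.
Proof. by rewrite /ip l2_sym. Qed.

Lemma ip_ge0 f : 0 <= ip f f.
Proof. by rewrite fine_ge0// l2_ge0. Qed.

Lemma ip_linl a f g h : in_l2 f -> in_l2 g -> in_l2 h ->
  ip (a *: f + g) h = a * ip f h + ip g h.
Proof.
by move=> fL gL hL; apply: EFin_inj; rewrite EFinD EFinM -!ipE// ?l2_linl//;
  exact: l2_closed.
Qed.

Lemma in_l2_0 f : in_l2 f -> in_l2 (0 : H).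
Proof. by move=> fL; rewrite -(addNr f) -scaleN1r; exact: l2_closed. Qed.

Lemma in_l2B f g : in_l2 f -> in_l2 g -> in_l2 (f - g).
Proof. by move=> fL gL; rewrite addrC -scaleN1r; exact: l2_closed. Qed.

Lemma in_l2D f g : in_l2 f -> in_l2 g -> in_l2 (f + g).
Proof. by move=> fL gL; rewrite -(scale1r f); exact: l2_closed. Qed.

Lemma in_l2Z a f : in_l2 f -> in_l2 (a *: f).
Proof.
by move=> fL; rewrite -(addr0 (a *: f)); apply: l2_closed => //; exact: in_l2_0 fL.
Qed.

Lemma ipBl f g h : in_l2 f -> in_l2 g -> in_l2 h ->
  ip (f - g) h = ip f h - ip g h.
Proof.
by move=> fL gL hL; rewrite addrC -scaleN1r ip_linl// mulN1r addrC.
Qed.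

Lemma ipDl f g h : in_l2 f -> in_l2 g -> in_l2 h ->
  ip (f + g) h = ip f h + ip g h.
Proof. by move=> fL gL hL; rewrite -(scale1r f) ip_linl// mul1r scale1r. Qed.

Lemma ipBr f g h : in_l2 f -> in_l2 g -> in_l2 h ->
  ip h (f - g) = ip h f - ip h g.
Proof. by move=> fL gL hL; rewrite ip_sym ipBl// !(ip_sym h). Qed.

Lemma ipZl a f g : in_l2 f -> in_l2 g -> ip (a *: f) g = a * ip f g.
Proof.
move=> fL gL; have L0 := in_l2_0 fL.
have ip0 : ip 0 g = 0 by rewrite -(subrr f) ipBl// subrr.
by rewrite -(addr0 (a *: f)) ip_linl// ip0 addr0.
Qed.

Lemma cauchy_schwarz_ip f g : in_l2 f -> in_l2 g ->
  `|ip f g| <= Num.sqrt (ip f f) * Num.sqrt (ip g g).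
Proof.
move=> fL gL.
have quad t : 0 <= t ^+ 2 * ip f f + 2 * t * ip f g + ip g g.
  have tL : in_l2 (t *: f + g) by exact: l2_closed.
  have := ip_ge0 (t *: f + g).
  rewrite ip_linl// ip_sym [ip g _]ip_sym !ip_linl// (ip_sym g f).
  by congr (_ <= _); ring.
rewrite -sqrtrM ?ip_ge0// -(sqrtr_sqr (ip f g)) ler_wsqrtr//.
have [f0|f0] := eqVneq (ip f f) 0.
  have [->|fg0] := eqVneq (ip f g) 0; first by rewrite expr0n/= f0 mul0r.
  (* When [ip f f = 0] the quadratic polynomial is affine in t, and this t gives it the value -1. *)
  have := quad (- (ip g g + 1) / (2 * ip f g)); rewrite f0 mulr0 add0r.
  rewrite (_ : _ + _ = -1); first by rewrite oppr_ge0 ler10.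
  by field.
have fgt0 : 0 < ip f f by rewrite lt_neqAle eq_sym f0 ip_ge0.
(* The minimizer of the quadratic polynomial. *)
have := quad (- ip f g / ip f f).
rewrite (_ : _ + _ = (ip f f * ip g g - ip f g ^+ 2) / ip f f); last by field.
by rewrite pmulr_lge0 ?invr_gt0// subr_ge0.
Qed.

Lemma l2cvgE (f_ : nat -> H) f : (forall l, in_l2 (f_ l)) -> in_l2 f ->
  l2cvg f_ f <-> ip (f_ l - f) (f_ l - f) @[l --> \oo] --> (0 : R).
Proof.
move=> fL fL'; rewrite /l2cvg.
rewrite (_ : (fun l => _) = EFin \o (fun l => ip (f_ l - f) (f_ l - f))).
  by split => [/fine_cvg//|h]; apply: cvg_EFin => //; exact: nearW.
  by apply/funext => l; rewrite /= ipE//; exact: in_l2B.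
Qed.

Lemma ip_cvg0 (f_ g_ : nat -> H) :
  (forall l, in_l2 (f_ l)) -> (forall l, in_l2 (g_ l)) ->
  ip (f_ l) (f_ l) @[l --> \oo] --> (0 : R) ->
  cvgn (fun l => ip (g_ l) (g_ l)) ->
  ip (f_ l) (g_ l) @[l --> \oo] --> (0 : R).
Proof.
move=> fL gL f0 gcv.
have h : Num.sqrt (ip (f_ l) (f_ l)) * Num.sqrt (ip (g_ l) (g_ l))
    @[l --> \oo] --> (0 : R).
  rewrite -(mul0r (Num.sqrt (limn (fun l => ip (g_ l) (g_ l))))).
  apply: cvgM.
    by rewrite -[X in _ --> X]sqrtr0; apply: cvg_comp f0 _; exact: sqrt_continuous.
  by apply: cvg_comp gcv _; exact: sqrt_continuous.
apply/norm_cvg0P; apply: (squeeze_cvgr _ (cvg_cst (0 : R)) h).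
by apply: nearW => l; rewrite normr_ge0/=; exact: cauchy_schwarz_ip.
Qed.

(** The pairing is expanded around the two limits; each of the three error terms has a factor
    tending to 0 in norm, the other factor having convergent norms. *)
Lemma ip_cvg (f_ g_ : nat -> H) f g :
  (forall l, in_l2 (f_ l)) -> (forall l, in_l2 (g_ l)) ->
  in_l2 f -> in_l2 g -> l2cvg f_ f -> l2cvg g_ g ->
  ip (f_ l) (g_ l) @[l --> \oo] --> ip f g.
Proof.
move=> fL gL fL' gL' /(l2cvgE fL fL') cf /(l2cvgE gL gL') cg.
have e l : ip (f_ l) (g_ l) = ip (f_ l - f) (g_ l - g) + ip (f_ l - f) g
    + ip (g_ l - g) f + ip f g.
  rewrite ipBl//; last exact: in_l2B.
  by rewrite !ipBr// !ipBl// (ip_sym g f) (ip_sym (g_ l) f); ring.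
rewrite (funext e) -[X in _ --> X]add0r.
have L1 l : in_l2 (f_ l - f) by exact: in_l2B.
have L2 l : in_l2 (g_ l - g) by exact: in_l2B.
have c1 := ip_cvg0 L1 L2 cf (cvgP _ cg).
have c2 : ip (f_ l - f) g @[l --> \oo] --> (0 : R).
  by apply: (ip_cvg0 L1 (fun=> gL') cf); exact: is_cvg_cst.
have c3 : ip (g_ l - g) f @[l --> \oo] --> (0 : R).
  by apply: (ip_cvg0 L2 (fun=> fL') cg); exact: is_cvg_cst.
rewrite (_ : 0 + ip f g = 0 + 0 + 0 + ip f g); last by rewrite !addr0.
apply: cvgD; last exact: cvg_cst.
by apply: cvgD => //; exact: cvgD.
Qed.

Lemma l2cvg_cst f : in_l2 f -> l2cvg (fun=> f) f.
Proof.
move=> fL; apply/l2cvgE => //; rewrite subrr.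
have L0 := in_l2_0 fL.
have -> : ip 0 0 = 0 by rewrite -(subrr f) ipBl// ?subrr//; exact: in_l2B.
exact: cvg_cst.
Qed.

End one_space.

Section two_spaces.
Context (H1 H2 : l2space R) (HH1 : l2_laws H1) (HH2 : l2_laws H2).
Variable T : H1 -> H2 -> Prop.
Hypothesis TL : forall f g, T f g -> in_l2 f /\ in_l2 g.

(** If [g_] tends to 0 while [h_] tends to [h], passing to the limit in the duality shows that [h]
    is orthogonal to the domain of [T]; by density it is orthogonal to itself. *)
Lemma closable_adjoint : densely_defined T -> closable (adjoint T).
Proof.
move=> dT g_ h_ h hL aT g0 hh.
have gL l : in_l2 (g_ l) by have [] := aT l.
have hL' l : in_l2 (h_ l) by have [] := aT l.
have Tfh f Tf : T f Tf -> ip f h = 0.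
  move=> TfTf; have [fL TfL] := TL TfTf.
  have c1 := ip_cvg HH1 (fun=> fL) hL' fL hL (l2cvg_cst HH1 fL) hh.
  have c2 := ip_cvg HH2 (fun=> TfL) gL TfL (in_l2_0 HH2 TfL)
    (l2cvg_cst HH2 TfL) g0.
  have e l : ip f (h_ l) = ip Tf (g_ l).
    by rewrite /ip; congr fine; have [_ _ /(_ _ _ TfTf)->] := aT l.
  move: c1; rewrite (funext e) => /(cvgR_unique c2) <-.
  have L0 := in_l2_0 HH2 TfL.
  by rewrite (ip_sym HH2) -(subrr Tf) ipBl// subrr.
have [f_ [fT fh]] := dT _ hL.
have fL l : in_l2 (f_ l) by have [g /TL[]] := fT l.
have := ip_cvg HH1 fL (fun=> hL) hL hL fh (l2cvg_cst HH1 hL).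
rewrite (_ : (fun l => _) = cst 0); last first.
  by apply/funext => l; have [g /Tfh] := fT l.
move/(cvgR_unique (cvg_cst 0)) => /= ip0.
by rewrite ipE// -ip0//.
Qed.

(** Both arguments of the pairing converge, so the duality relation passes to the limit along the
    two sequences at once. *)
Lemma closure_adjoint f Tf g h : closure_op T f Tf ->
  closure_op (adjoint T) g h -> l2ip Tf g = l2ip f h.
Proof.
move=> [fL TfL [f_ [Tf_ [fT cf cTf]]]] [gL hL [g_ [h_ [ga cg ch]]]].
have fL' l : in_l2 (f_ l) by have [] := TL (fT l).
have TfL' l : in_l2 (Tf_ l) by have [] := TL (fT l).
have gL' l : in_l2 (g_ l) by have [] := ga l.
have hL' l : in_l2 (h_ l) by have [] := ga l.
have c1 := ip_cvg HH1 fL' hL' fL hL cf ch.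
have c2 := ip_cvg HH2 TfL' gL' TfL gL cTf cg.
rewrite !ipE//; congr EFin; apply: cvgR_unique c2 _.
rewrite (_ : (fun l => _) = (fun l => ip (f_ l) (h_ l)))//.
by apply/funext => l; rewrite /ip; have [_ _ /(_ _ _ (fT l))->] := ga l.
Qed.

(** If [f_] tends to 0 and [T f_] to [g], then [<g, v>] is the limit of [<f_, T* v>], that is 0, for
    every [v] in the domain of the adjoint. Asking that only null vectors be orthogonal to that
    domain, rather than that it be dense, spares orthogonal projections. *)
Lemma closable_of_adjoint :
  (forall g, in_l2 g -> (forall v h, adjoint T v h -> l2ip g v = 0%E) ->
     l2ip g g = 0%E) ->
  closable T.
Proof.
move=> dense f_ Tf_ g gL fT f0 cTf; apply: dense => // v h aT.
have [vL hL vh] := aT.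
have fL' l : in_l2 (f_ l) by have [] := TL (fT l).
have TfL' l : in_l2 (Tf_ l) by have [] := TL (fT l).
have L0 := in_l2_0 HH1 hL.
have c1 := ip_cvg HH1 fL' (fun=> hL) L0 hL f0 (l2cvg_cst HH1 hL).
have c2 := ip_cvg HH2 TfL' (fun=> vL) gL vL cTf (l2cvg_cst HH2 vL).
have e : (fun l => ip (f_ l) h) = (fun l => ip (Tf_ l) v).
  by apply/funext => l; rewrite /ip (vh _ _ (fT l)).
move: c1; rewrite e => /(cvgR_unique c2) /= {}e.
by rewrite ipE// e// -(subrr h) ipBl// subrr.
Qed.

End two_spaces.
End l2_theory.

(** * Lebesgue measure on matrices *)

Lemma bounded_integrable d (T : measurableType d) (R : realType)
    (mu : {measure set T -> \bar R}) (A : set T) (f : T -> R) (M : R) :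
  measurable A -> (mu A < +oo)%E -> measurable_fun A f ->
  (forall x, A x -> `|f x| <= M) -> mu.-integrable A (EFin \o f).
Proof.
move=> mA Afin mf fM; apply: measurable_bounded_integrable => //.
by exists M; split; rewrite ?num_real// => N MN x /= /fM /le_trans; apply; exact: ltW.
Qed.

Lemma integrable_indic_fin d (T : measurableType d) (R : realType)
    (mu : {measure set T -> \bar R}) (A : set T) :
  measurable A -> (mu A < +oo)%E -> mu.-integrable setT (fun x => (\1_A x)%:E).
Proof.
move=> mA Afin; apply/integrableP; split.
  by apply/measurable_EFinP; exact: measurable_indic.
under eq_integral do rewrite gee0_abs ?lee_fin//.
by rewrite integral_indic// setIT.
Qed.

Section lebesgue_facts.
Context {R : realType}.

Lemma cons_mx0 n (p : 'rV[R]_n * measurableTypeR R) : cons_mx p 0 ord0 = p.2.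
Proof.
have -> : ord0 = lshift n (ord0 : 'I_1) by apply/val_inj.
by rewrite /cons_mx [LHS]row_mxEl mxE eqxx mulr1n.
Qed.

Lemma cons_mx_lift n (p : 'rV[R]_n * measurableTypeR R) j :
  cons_mx p 0 (lift ord0 j) = p.1 0 j.
Proof.
have -> : lift ord0 j = rshift 1 j by apply/val_inj.
by rewrite /cons_mx [LHS]row_mxEr.
Qed.

Lemma cons_mx_line_lift n (v : 'rV[R]_n) (x : measurableTypeR R) j (t : R) :
  cons_mx (v, x) + t *: delta_mx 0 (lift ord0 j) =
  cons_mx (v + t *: delta_mx 0 j, x).
Proof.
apply/rowP => i; rewrite [LHS]mxE [X in _ + X]mxE [X in _ + _ * X]mxE.
case: (unliftP ord0 i) => [i' ->|->]; rewrite ?cons_mx_lift ?cons_mx0 /=.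
  by rewrite !mxE (inj_eq lift_inj).
by rewrite mulr0 addr0.
Qed.

Lemma cons_mx_line0 n (v : 'rV[R]_n) (t : measurableTypeR R) :
  cons_mx (v, 0) + t *: delta_mx 0 ord0 = cons_mx (v, t).
Proof.
apply/rowP => i; rewrite [LHS]mxE [X in _ + X]mxE [X in _ + _ * X]mxE.
case: (unliftP ord0 i) => [i' ->|->]; rewrite ?cons_mx_lift ?cons_mx0 /=.
  by rewrite mulr0 addr0.
by rewrite mulr1 add0r.
Qed.

Definition box n (a b : 'I_n -> R) : set 'rV[R]_n :=
  [set v | forall j, a j < v 0 j < b j].

Lemma measurable_box n (a b : 'I_n -> R) : measurable (box a b).
Proof.
rewrite (_ : box a b = \bigcap_(j in [set: 'I_n])
    ((fun v : 'rV[R]_n => v 0 j) @^-1` `]a j, b j[%classic)).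
  apply: fin_bigcap_measurable => // j _; rewrite -[X in measurable X]setTI.
  by apply: measurable_coord_mx => //; exact: measurable_itv.
by apply/seteqP; split => v vb j => [_|]; have := vb j; rewrite /= in_itv/=; exact.
Qed.

Lemma lebesgue_rV_box n (a b : 'I_n -> R) : (forall j, a j <= b j) ->
  lebesgue_rV R n (box a b) = (\prod_(j < n) (b j - a j))%:E.
Proof.
elim: n a b => [|n IH] a b ab /=.
  rewrite big_ord0 /= diracE (_ : _ \in _ = true)//; apply/mem_set => -[].
  by [].
rewrite /pushforward (_ : _ @^-1` _ =
   box (a \o lift ord0) (b \o lift ord0) `*` `]a ord0, b ord0[%classic).
  rewrite product_measure1E//; last exact: measurable_box.
  rewrite IH//; last by move=> j; exact: ab.
  have L : @lebesgue_measure R `]a ord0, b ord0[%classic = (b ord0 - a ord0)%:E.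
    rewrite lebesgue_measure_itv/= lte_fin.
    by case: ltgtP (ab ord0) => // ->; rewrite subrr.
  apply: etrans (congr2 mule erefl L) _.
  by rewrite big_ord_recl/= EFinM muleC.
apply/seteqP; split => -[v x] /=.
  move=> vb; split => [j|] /=.
    by have := vb (lift ord0 j); rewrite cons_mx_lift.
  by have := vb ord0; rewrite cons_mx0 in_itv.
move=> [vb]; rewrite in_itv/= => xab j.
case: (unliftP ord0 j) => [j' ->|->]; last by rewrite cons_mx0.
by rewrite cons_mx_lift; exact: vb.
Qed.

Lemma sigma_finite_lebesgue_rV n : sigma_finite setT (lebesgue_rV R n).
Proof.
exists (fun k => box (fun=> - k%:R) (fun=> k%:R)).
  apply/seteqP; split => // v _.
  have [k kv] : exists k : nat, \sum_j `|v 0 j| < k%:R.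
    by eexists; apply: archi_boundP; exact: sumr_ge0.
  exists k => // j; rewrite -ltr_norml; apply: le_lt_trans kv.
  by rewrite (bigD1 j)//= lerDl sumr_ge0.
move=> k; split; first exact: measurable_box.
rewrite lebesgue_rV_box ?ltry// => j.
by rewrite (@le_trans _ _ 0)// oppr_le0.
Qed.

(** A name of its own for the recursively defined measure, to which the sigma-finiteness required by
    Fubini is attached as a structure. *)
Definition lrV n : set 'rV[R]_n -> \bar R := lebesgue_rV R n.
Arguments lrV n A : clear implicits.

HB.instance Definition _ n := Measure.on (lrV n).
HB.instance Definition _ n := @Measure_isSigmaFinite.Build _ _ _ (lrV n)
  (sigma_finite_lebesgue_rV n).

Lemma lrVS n : lrV n.+1 = pushforward (lrV n \x @lebesgue_measure R)%E (@cons_mx R n).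
Proof. by []. Qed.

(* Peeling off the first coordinate, Fubini reduces the statement either to the
   inner integral or to the remaining coordinates. *)
Lemma lrV_slice0 n (j : 'I_n) (g : 'rV[R]_n -> \bar R) :
  (lrV n).-integrable setT g ->
  (forall x, \int[lebesgue_measure]_t g (x + t *: delta_mx 0 j)%R = 0)%E ->
  (\int[lrV n]_x g x = 0)%E.
Proof.
elim: n j g => [[]//|n IH] j g gint g0.
have mg : measurable_fun setT g by have /integrableP[] := gint.
have mc := @measurable_cons_mx R n.
have gcint : (lrV n \x @lebesgue_measure R)%E.-integrable setT
    (g \o @cons_mx R n).
  have [_ gfin] := integrableP _ _ _ gint.
  apply/integrableP; split; first exact: measurableT_comp.
  have := gfin; rewrite lrVS ge0_integral_pushforward//=.
  exact: measurableT_comp.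
rewrite lrVS integral_pushforward// preimage_setT.
case: (unliftP ord0 j) => [j'|] jE.
  rewrite -integral21_prod_meas1//.
  transitivity (\int[@lebesgue_measure R]_x (cst 0 x : \bar R))%E; last first.
    by rewrite integral_cst//= mul0e.
  apply: ae_eq_integral => //.
    exact: (measurable_fubini_G gcint).
  have := ae_integrable2 gcint; apply: filterS => x xint _.
  rewrite /fubini_G; apply: (IH j') => // v.
  rewrite -[RHS](g0 (cons_mx (v, x))); apply: eq_integral => t _ /=.
  by rewrite /= jE cons_mx_line_lift.
rewrite -integral12_prod_meas1//.
rewrite (_ : fubini_F _ _ = cst 0%E) ?integral_cst//= ?mul0e//.
apply/funext => v /=; rewrite /fubini_F -[RHS](g0 (cons_mx (v, 0))).
by apply: eq_integral => t _ /=; rewrite jE cons_mx_line0.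
Qed.

Lemma lebE m n : @lebesgue_mx R m n = pushforward (lrV (m * n)) (@vec_mx R m n)
  :> (set _ -> \bar R).
Proof. by []. Qed.

(** This single principle serves two purposes. Applied to an indicator, it shows that a set meeting
    each line of one direction in at most one point is null; applied to a partial derivative, it is
    the integration by parts. *)
Lemma leb_slice0 m n i j (g : 'M[R]_(m, n) -> \bar R) :
  leb.-integrable setT g ->
  (forall x, \int[lebesgue_measure]_t g (x + t *: delta_mx i j)%R = 0)%E ->
  (\int[leb]_x g x = 0)%E.
Proof.
move=> gint g0.
have mg : measurable_fun setT g by have /integrableP[] := gint.
have mv := @measurable_vec_mx R m n.
have gcint : (lrV (m * n)).-integrable setT (g \o @vec_mx R m n).
  have [_ gfin] := integrableP _ _ _ gint.
  apply/integrableP; split; first exact: measurableT_comp.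
  have := gfin; rewrite lebE ge0_integral_pushforward//=.
  exact: measurableT_comp.
rewrite lebE integral_pushforward// preimage_setT.
apply: (@lrV_slice0 _ (mxvec_index i j)) => // x.
rewrite -[RHS](g0 (vec_mx x)); apply: eq_integral => t _ /=.
by rewrite linearD linearZ/= -mxvec_delta mxvecK.
Qed.

Definition mbox m n (a b : 'M[R]_(m, n)) : set 'M[R]_(m, n) :=
  [set z | forall i j, a i j < z i j < b i j].

Lemma leb_mbox m n (a b : 'M[R]_(m, n)) : (forall i j, a i j <= b i j) ->
  leb (mbox a b) = (\prod_(k < m * n) (mxvec b 0 k - mxvec a 0 k))%:E.
Proof.
move=> ab; rewrite lebE /pushforward.
rewrite (_ : _ @^-1` _ = box (mxvec a 0) (mxvec b 0)).
  rewrite [LHS]lebesgue_rV_box// => k.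
  by case/mxvec_indexP: k => i j; rewrite !mxvecE.
apply/seteqP; split => v vb /=.
  by move=> k; case/mxvec_indexP: k => i j; have := vb i j; rewrite !mxvecE !mxE.
by move=> i j; have := vb (mxvec_index i j); rewrite !mxvecE !mxE.
Qed.

Lemma measurable_mbox m n (a b : 'M[R]_(m, n)) : measurable (mbox a b).
Proof.
rewrite (_ : mbox a b = \bigcap_(ij in [set: 'I_m * 'I_n])
    ((fun v : 'M[R]_(m, n) => v ij.1 ij.2) @^-1` `]a ij.1 ij.2, b ij.1 ij.2[%classic)).
  apply: fin_bigcap_measurable => // j _; rewrite -[X in measurable X]setTI.
  by apply: measurable_coord_mx => //; exact: measurable_itv.
apply/seteqP; split => [v vb [i j] _|v vb i j].
  by rewrite /= in_itv/=; exact: vb.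
by have := vb (i, j) I; rewrite /= in_itv.
Qed.

Lemma ball_mbox m n (x : 'M[R]_(m, n)) (e : R) : 0 < e ->
  ball x e = mbox (x - const_mx e) (x + const_mx e).
Proof.
move=> e0; apply/seteqP; split => z /=.
  by move=> [_ zx] i j; have := zx i j; rewrite /ball/= !mxE distrC ltr_distl.
by move=> zx; split => // i j; have := zx i j; rewrite /ball/= !mxE distrC ltr_distl.
Qed.

Lemma leb_ball_fin m n (x : 'M[R]_(m, n)) (e : R) : 0 < e ->
  (leb (ball x e) < +oo)%E.
Proof.
move=> e0; rewrite ball_mbox// leb_mbox ?ltry// => i j; rewrite !mxE.
by rewrite lerD2l (@le_trans _ _ 0)// ?oppr_le0 ltW.
Qed.

Lemma leb_open_gt0 m n (A : set 'M[R]_(m, n)) : open A -> A !=set0 ->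
  (0 < leb A)%E.
Proof.
move=> oA [x Ax].
have /nbhs_ballP[e /= e0 eA] : nbhs x A by exact: open_nbhs_nbhs.
have eb : leb (ball x e) = (\prod_(k < m * n)
    (mxvec (x + const_mx e) 0 k - mxvec (x - const_mx e) 0 k))%:E.
  by rewrite ball_mbox// leb_mbox// => i j; rewrite !mxE; lra.
apply: (@lt_le_trans _ _ (leb (ball x e))).
  rewrite eb lte_fin prodr_gt0// => k _.
  by case/mxvec_indexP: k => i j; rewrite !mxvecE !mxE; lra.
apply: le_measure; rewrite ?inE//; last exact: open_measurable_mx.
by rewrite ball_mbox//; exact: measurable_mbox.
Qed.

Lemma leb_bounded_fin m n (A : set 'M[R]_(m, n)) : measurable A ->
  bounded_set A -> (leb A < +oo)%E.
Proof.
move=> mA [M [Mr bM]].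
pose e : R := `|M| + 2.
have e0 : 0 < e by rewrite /e ltr_pwDr.
apply: le_lt_trans (@leb_ball_fin m n 0 e e0).
apply: le_measure; rewrite ?inE//.
  by rewrite ball_mbox//; exact: measurable_mbox.
move=> z Az; rewrite -ball_normE /= sub0r normrN.
apply: (@le_lt_trans _ _ (`|M| + 1)); last by rewrite /e; lra.
by apply: bM => //; rewrite (le_lt_trans (ler_norm M))// ltrDl.
Qed.

End lebesgue_facts.
Arguments lrV {R} n A.

(** * The fundamental theorem of calculus on bounded open subsets of the line *)

Section one_dim.
Context {R : realType}.
Local Notation mu := (@lebesgue_measure R).

Lemma measurable_continuous_open (O : set R) (g : R -> R) : open O ->
  (forall x, O x -> {for x, continuous g}) -> measurable_fun O g.
Proof.
move=> oO cg; apply: open_continuous_measurable_fun => //.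
by move=> x /set_mem /cg.
Qed.

Lemma lebesgue_oo_fin (a b : R) : (mu `]a, b[%classic < +oo)%E.
Proof. by rewrite lebesgue_measure_itv/=; case: ifP => // _; rewrite -EFinD ltry. Qed.

Lemma integral_derive_itv (h g : R -> R) (a b M : R) : a < b ->
  continuous h -> h a = 0 -> h b = 0 ->
  (forall x, a < x < b -> [/\ derivable h x 1, 'D_1 h x = g x,
     {for x, continuous g} & `|g x| <= M]) ->
  (\int[mu]_(x in `]a, b[) (g x)%:E = 0)%E.
Proof.
move=> ab ch ha hb hg.
(* Denominators start at 3 so that [2 * e n < b - a] and the shrunken interval is never
   degenerate. *)
pose e (n : nat) := (b - a) / n.+3%:R.
have e0 n : 0 < e n by rewrite divr_gt0// subr_gt0.
have ecv : e n @[n --> \oo] --> (0 : R).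
  rewrite -(mulr0 (b - a)); apply: cvgM; first exact: cvg_cst.
  have := @cvg_harmonic R; rewrite -(cvg_shiftn 2) => h0.
  rewrite (_ : (fun _ => _) = (fun n => harmonic (n + 2)))//.
  by apply/funext => n; rewrite /harmonic -[n.+3]/(n.+2.+1) -addn2.
have e2 n : a + e n < b - e n.
  suff : e n * 2 < b - a by lra.
  rewrite /e mulrAC -mulrA gtr_pMr ?subr_gt0//.
  by rewrite ltr_pdivrMr// mul1r ltr_nat.
pose I n := `[a + e n, b - e n]%classic.
have Iab n x : I n x -> a < x < b.
  by rewrite /I /= in_itv/= => /andP[ax xb]; have := e0 n; lra.
have In0 n : (\int[mu]_(x in I n) (g x)%:E = (h (b - e n) - h (a + e n))%:E)%E.
  rewrite EFinB; apply: continuous_FTC2 => //.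
  - apply: continuous_in_subspaceT => x /set_mem /Iab /hg[_ _ cg _].
    exact: cg.
  - split.
    + move=> x; rewrite in_itv/= => /andP[xa xb].
      by have /hg[] : a < x < b by have := e0 n; lra.
    + by apply: cvg_at_right_filter; exact: ch.
    + by apply: cvg_at_left_filter; exact: ch.
  - move=> x; rewrite in_itv/= => /andP[xa xb]; rewrite derive1E.
    by have /hg[] : a < x < b by have := e0 n; lra.
have mg : measurable_fun `]a, b[ g.
  apply: measurable_continuous_open; first exact: interval_open.
  by move=> x; rewrite /= in_itv/= => /hg[].
have lim1 : (\int[mu]_(x in I n) (g x)%:E)%E @[n --> \oo] --> (0 : \bar R).
  rewrite (funext In0); apply: cvg_EFin; first exact: nearW.
  rewrite (_ : (0 : R) = h (b - 0) - h (a + 0)); last first.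
    by rewrite subr0 addr0 ha hb subrr.
  apply: cvgB; (apply: continuous_cvg; first exact: ch).
    by apply: cvgB => //; exact: cvg_cst.
  by apply: cvgD => //; exact: cvg_cst.
have lim2 : (\int[mu]_(x in I n) (g x)%:E)%E @[n --> \oo] -->
    (\int[mu]_(x in `]a, b[) (g x)%:E)%E.
  have ie n : (\int[mu]_(x in I n) (g x)%:E =
      \int[mu]_(x in `]a, b[) ((EFin \o g) \_ (I n)) x)%E.
    rewrite -integral_mkcondr; congr integral.
    by apply/seteqP; split => x //= Ix; [split => //; have := Iab _ _ Ix;
      rewrite in_itv|case: Ix].
  rewrite (funext ie).
  have mgE : measurable_fun `]a, b[ (EFin \o g) by exact/measurable_EFinP.
  have [||||_ _ //] := @dominated_convergence _ _ _ mu `]a, b[%classic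
    (measurable_itv _) (fun n => (EFin \o g) \_ (I n)) (EFin \o g) (cst M%:E) _ mgE.
  - move=> n; apply/measurable_restrict; [exact: measurable_itv| |].
      exact: measurable_itv.
    by apply: (measurable_funS _ _ mgE) => //; apply: measurable_itv.
  - apply: aeW => x /=; rewrite in_itv/= => /andP[ax xb].
    apply: cvg_near_cst.
    have d0 : 0 < Num.min (x - a) (b - x) by rewrite lt_min !subr_gt0 ax xb.
    have := ecv; move/cvgrPdist_lt => /(_ _ d0).
    apply: filterS => n; rewrite sub0r normrN gtr0_norm// lt_min => /andP[ex ex'].
    rewrite /patch mem_set// /I/= in_itv/=; lra.
  - apply: (@bounded_integrable _ _ _ mu _ (cst M) `|M|) => //.
    exact: lebesgue_oo_fin.
  - apply: aeW => x n /= xab; rewrite /patch; case: ifPn => [_|_] /=.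
      by rewrite lee_fin; move: xab; rewrite in_itv/= => /hg[].
    rewrite normr0 lee_fin; move: xab; rewrite in_itv/= => /hg[_ _ _].
    exact: le_trans.
by apply: cvg_unique lim2 lim1; exact: ereal_hausdorff.
Qed.

(** An open set of the line is a countable disjoint union of open intervals. Their end points lie
    outside [O], where [h] vanishes, so every component contributes 0. *)
Lemma integral_derive_open (O : set R) (h g : R -> R) (M B : R) :
  open O -> (forall x, O x -> `|x| <= B) ->
  continuous h -> (forall x, ~ O x -> h x = 0) ->
  (forall x, O x -> [/\ derivable h x 1, 'D_1 h x = g x,
     {for x, continuous g} & `|g x| <= M]) ->
  (\int[mu]_(x in O) (g x)%:E = 0)%E.
Proof.
move=> oO bO ch h0 hg.
have mO : measurable O by exact: open_measurable.
have mg : measurable_fun O g.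
  by apply: measurable_continuous_open => // x /hg[].
have Ofin : (mu O < +oo)%E.
  apply: (@le_lt_trans _ _ (mu `[- B, B]%classic)).
    apply: le_measure; rewrite ?inE//.
    by move=> x /bO; rewrite /= in_itv/= ler_norml.
  by rewrite /= lebesgue_measure_itv/=; case: ifP => // _; rewrite -EFinD ltry.
have gint : mu.-integrable O (EFin \o g).
  by apply: (bounded_integrable (M := M)) => // x /hg[].
have Oe := open_disjoint_itv_bigcup oO.
rewrite [in LHS]Oe integral_bigcup//; last 3 first.
- exact: open_disjoint_itv_trivIset.
- by move=> k; apply: open_measurable; exact: open_disjoint_itv_open.
- by rewrite -Oe.
apply: eseries0 => k _ _.
set I := open_disjoint_itv oO k.
have oI : open I by exact: open_disjoint_itv_open.
have IO : I `<=` O by rewrite Oe; exact: bigcup_sup.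
have [->|/set0P[c Ic]] := eqVneq I set0; first by rewrite integral_set0.
have ubI : has_ubound I by exists B => x /IO /bO; exact: le_trans (ler_norm _).
have lbI : has_lbound I.
  by exists (- B) => x /IO /bO; rewrite ler_norml => /andP[].
have I0 : I !=set0 by exists c.
have IE : I = `]inf I, sup I[%classic.
  have /is_intervalP IR := @open_disjoint_itv_is_interval _ _ oO k.
  have openP (J : set R) : open J -> has_ubound J -> ~ J (sup J).
    move=> oJ ubJ Js; have /nbhs_ballP[e /= e0 eJ] : nbhs (sup J) J.
      exact: open_nbhs_nbhs.
    have : J (sup J + e / 2).
      by apply: eJ; rewrite /ball/= opprD addrA subrr sub0r normrN gtr0_norm; lra.
    move/(ub_le_sup ubJ); lra.
  have openP' (J : set R) : open J -> has_lbound J -> ~ J (inf J).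
    move=> oJ ubJ Js; have /nbhs_ballP[e /= e0 eJ] : nbhs (inf J) J.
      exact: open_nbhs_nbhs.
    have : J (inf J - e / 2).
      by apply: eJ; rewrite /ball/= opprB addrC subrK gtr0_norm; lra.
    move/(ge_inf ubJ); lra.
  have nI1 := openP' _ oI lbI; have nI2 := openP _ oI ubI.
  by rewrite [LHS]IR /Rhull (asboolT lbI) (asboolT ubI) (asboolF nI1) (asboolF nI2).
(* A point of [O] in the closure of the component [I] lies in a component that meets [I], hence in
   [I] itself by disjointness. *)
have edge x : closure I x -> ~ I x -> ~ O x.
  move=> cx nIx Ox; have [q _ qx] : (\bigcup_q open_disjoint_itv oO q) x.
    by rewrite -Oe.
  have [y [Iy qy]] : I `&` open_disjoint_itv oO q !=set0.
    by apply: cx; apply: open_nbhs_nbhs; split => //; exact: open_disjoint_itv_open.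
  have kq := @open_disjoint_itv_trivIset _ _ oO k q Logic.I Logic.I.
  by apply: nIx; rewrite /I kq//; exists y.
have cab : inf I < c < sup I by move: Ic; rewrite {1}IE /= in_itv.
have ab : inf I < sup I by lra.
rewrite IE; apply: (integral_derive_itv ab ch (M := M)).
- apply: h0; apply: edge; last by rewrite {1}IE /= in_itv/= ltxx.
  move=> A /nbhs_ballP[e /= e0 eA].
  have [y Iy ye] := inf_adherent e0 (conj I0 lbI).
  exists y; split => //; apply: eA; rewrite /ball/= distrC ger0_norm; first lra.
  by rewrite subr_ge0 ge_inf.
- apply: h0; apply: edge; last by rewrite {1}IE /= in_itv/= ltxx andbF.
  by apply: closure_sup => //.
- by move=> x xab; apply: hg; apply: IO; rewrite IE /= in_itv.
Qed.

End one_dim.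

(** * Functions of class C^1 on closed sets *)

Section within.
Context {R : realType} {m n : nat}.
Local Notation M := 'M[R]_(m, n).
Implicit Types (K : set M) (f g : M -> R).

Lemma mx_hausdorff : hausdorff_space M.
Proof. exact: norm_hausdorff. Qed.

Lemma compact_measurable_mx K : compact K -> measurable K.
Proof.
move=> cK; rewrite -[K]setCK; apply: measurableC; apply: open_measurable_mx.
by apply: closed_openC; exact: compact_closed mx_hausdorff cK.
Qed.

Lemma within_continuous_measurable K f : measurable K ->
  {within K, continuous f} -> measurable_fun K f.
Proof.
move=> mK /continuousP cf; apply: (measurability _ (RGenOpens.measurableE R)).
move=> _ [_ [a [b ->] <-]].
have : open (f @^-1` `]a, b[%classic : set (subspace K)).
  by apply: cf; exact: interval_open.
move=> /open_subspaceP[V oV VK]; rewrite setIC -VK.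
by apply: measurableI => //; exact: open_measurable_mx.
Qed.

Lemma within_continuousP K f : {within K, continuous f} <->
  forall x, K x -> forall e, 0 < e ->
    exists2 r, 0 < r & forall y, K y -> ball x r y -> `|f x - f y| < e.
Proof.
rewrite subspace_continuousP; split => cf x Kx.
  move=> e e0; have /cvgrPdist_lt/(_ _ e0) := cf _ Kx.
  rewrite near_withinE => /nbhs_ballP[r /= r0 rf].
  by exists r => // y Ky xy; exact: rf.
apply/cvgrPdist_lt => e e0; rewrite near_withinE.
have [r r0 rf] := cf _ Kx _ e0.
by apply/nbhs_ballP; exists r => // y xy Ky; exact: rf.
Qed.

Lemma continuous_atP f (x : M) : {for x, continuous f} <->
  forall e, 0 < e -> exists2 r, 0 < r & forall y, ball x r y -> `|f x - f y| < e.
Proof.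
split => [cf e e0|h].
  have /nbhs_ballP[r /= r0 rf] : nbhs x (f @^-1` ball (f x) e).
    by apply: cf; exact: nbhsx_ballx.
  by exists r.
move=> A /nbhs_ballP[e /= e0 eA].
have [r r0 rf] := h e e0.
by apply/nbhs_ballP; exists r => // y xy; apply: eA; exact: rf.
Qed.

Lemma within_continuousD K f g : {within K, continuous f} ->
  {within K, continuous g} -> {within K, continuous (f + g)}.
Proof.
move=> /subspace_continuousP cf /subspace_continuousP cg.
apply/subspace_continuousP => x Kx.
by apply: cvgD; [exact: cf|exact: cg].
Qed.

Lemma within_continuousM K f g : {within K, continuous f} ->
  {within K, continuous g} -> {within K, continuous (f * g)}.
Proof.
move=> /subspace_continuousP cf /subspace_continuousP cg.
apply/subspace_continuousP => x Kx.
by apply: cvgM; [exact: cf|exact: cg].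
Qed.

Lemma within_continuousZ K f (a : R) : {within K, continuous f} ->
  {within K, continuous (a *: f)}.
Proof.
move=> /subspace_continuousP cf; apply/subspace_continuousP => x Kx.
by apply: cvgM; [exact: cvg_cst|exact: cf].
Qed.

Lemma within_continuous_bounded K f : compact K -> {within K, continuous f} ->
  exists2 c, 0 <= c & forall x, K x -> `|f x| <= c.
Proof.
move=> cK cf; have /compact_bounded[c [_ cP]] := continuous_compact cf cK.
exists (`|c| + 1); first by rewrite addr_ge0.
move=> x Kx; apply: cP; last by exists x.
by rewrite (le_lt_trans (ler_norm c))// ltrDl.
Qed.

End within.

Section C1.
Context {R : realType} {m n : nat}.
Local Notation M := 'M[R]_(m, n).
Variables (K : set M) (regK : K `<=` closure K°).
Implicit Types (f g : M -> R).

(** Regularity of [K] makes the filter in the definition of [partial] proper at every point of [K],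
    so that the limit there is unique. *)
Local Instance within_interior_proper x : K x -> ProperFilter (within K° (nbhs x)).
Proof.
by move=> Kx; apply: within_nbhs_proper; exact: regK.
Qed.

Lemma partial_unique f i j x (l : R) : K x ->
  'D_(delta_mx i j) f y @[y --> within K° (nbhs x)] --> l ->
  partial K i j f x = l.
Proof.
move=> Kx h; have FF := within_interior_proper Kx.
by apply: cvg_lim h; exact: norm_hausdorff.
Qed.

Lemma partial_interior f i j x : C1_open K° f -> K° x ->
  partial K i j f x = 'D_(delta_mx i j) f x.
Proof.
move=> C1f Kx; apply: partial_unique; first exact: interior_subset.
by apply: cvg_within_filter; have [] := C1f i j x Kx.
Qed.

(** The entry point for membership in C^1 on a closed set: a candidate [p], continuous on [K] and
    equal to the derivatives in the interior, is necessarily their limit at the boundary as well. *)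
Lemma C1_on_intro f (p : 'I_m -> 'I_n -> M -> R) :
  {within K, continuous f} ->
  (forall i j x, K° x -> derivable f x (delta_mx i j)) ->
  (forall i j x, K° x -> 'D_(delta_mx i j) f x = p i j x) ->
  (forall i j, {within K, continuous (p i j)}) ->
  C1_on K f /\ forall i j x, K x -> partial K i j f x = p i j x.
Proof.
move=> cf df Dp cp.
have pE i j x : K x -> partial K i j f x = p i j x.
  move=> Kx; apply: partial_unique => //.
  have /subspace_continuousP/(_ _ Kx)/cvgrPdist_lt h := cp i j.
  apply/cvgrPdist_lt => e e0; have := h _ e0; rewrite !near_withinE.
  by apply: filterS => y hy Ky; rewrite Dp//; apply: hy; exact: interior_subset.
split => //; split => //; last first.
  move=> i j; apply/within_continuousP => x Kx e e0.
  have [r r0 h] := (within_continuousP _ _).1 (cp i j) x Kx e e0.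
  by exists r => // y Ky xy; rewrite !pE//; exact: h.
move=> i j x Kx; split; first exact: df.
apply/continuous_atP => e e0.
have [r r0 h] := (within_continuousP _ _).1 (cp i j) x (interior_subset Kx) e e0.
have /nbhs_ballP[r' /= r'0 K'] : nbhs x K°.
  by apply: open_nbhs_nbhs; split => //; exact: open_interior.
exists (Num.min r r'); first by rewrite lt_min r0.
move=> y xy.
have Ky : K° y by apply: K'; apply: le_ball xy; rewrite ge_min lexx orbT.
rewrite !Dp//; apply: h; first exact: interior_subset.
by apply: le_ball xy; rewrite ge_min lexx.
Qed.

Lemma C1_on_D a f g : C1_on K f -> C1_on K g ->
  C1_on K (a *: f + g) /\ forall i j x, K x ->
    partial K i j (a *: f + g) x = a * partial K i j f x + partial K i j g x.
Proof.
move=> C1f C1g; have [cf of_ pf] := C1f; have [cg og pg] := C1g.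
apply: (C1_on_intro (p := fun i j => a *: partial K i j f + partial K i j g)).
- by apply: within_continuousD => //; exact: within_continuousZ.
- move=> i j x Kx; apply: derivableD; last by have [] := og i j x Kx.
  by apply: derivableZ; have [] := of_ i j x Kx.
- move=> i j x Kx; have [df _] := of_ i j x Kx; have [dg _] := og i j x Kx.
  rewrite (deriveD (derivableZ (k := a) df) dg) (deriveZ a df).
  by rewrite -(partial_interior i j of_ Kx) -(partial_interior i j og Kx).
- by move=> i j; apply: within_continuousD => //; exact: within_continuousZ.
Qed.

Lemma C1_on_M f g : C1_on K f -> C1_on K g ->
  C1_on K (f * g) /\ forall i j x, K x ->
    partial K i j (f * g) x = f x * partial K i j g x + g x * partial K i j f x.
Proof.
move=> C1f C1g; have [cf of_ pf] := C1f; have [cg og pg] := C1g.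
apply: (C1_on_intro (p := fun i j =>
   f * partial K i j g + g * partial K i j f)).
- exact: within_continuousM.
- move=> i j x Kx; apply: derivableM; last by have [] := og i j x Kx.
  by have [] := of_ i j x Kx.
- move=> i j x Kx; have [df _] := of_ i j x Kx; have [dg _] := og i j x Kx.
  by rewrite (deriveM df dg) -(partial_interior i j of_ Kx) -(partial_interior i j og Kx).
- by move=> i j; apply: within_continuousD => //; exact: within_continuousM.
Qed.

Lemma C1_on_global f : C1_open setT f -> {within K, continuous f} ->
  C1_on K f /\ forall i j x, K x -> partial K i j f x = 'D_(delta_mx i j) f x.
Proof.
move=> C1f cf; apply: C1_on_intro => //.
  by move=> i j x _; have [] := C1f i j x I.
move=> i j; apply/subspace_continuousP => x Kx; apply: cvg_within_filter.
by have [] := C1f i j x I.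
Qed.

(** A violation of the bound at [x] persists near [x] by continuity. By regularity that
    neighbourhood contains a nonempty open piece of the interior, which has positive measure. *)
Lemma regular_ae_bound (g : M -> R) c : {within K, continuous g} ->
  {ae leb, forall x, K x -> `|g x| <= c} -> forall x, K x -> `|g x| <= c.
Proof.
move=> /subspace_continuousP cg [N [mN N0 NP]] x Kx.
rewrite leNgt; apply/negP => cgx.
have /cvgrPdist_lt : g y @[y --> within K (nbhs x)] --> g x by exact: cg.
move=> /(_ (`|g x| - c)); rewrite subr_gt0 => /(_ cgx).
rewrite near_withinE nbhsE => -[U [oU Ux] UP].
have [y [Ky Uy]] : K° `&` U !=set0.
  by apply: (regK Kx); exact: open_nbhs_nbhs.
have oKU : open (K° `&` U) by apply: openI => //; exact: open_interior.
have := leb_open_gt0 oKU; move=> /(_ (ex_intro _ y (conj Ky Uy))).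
rewrite ltNge => /negP; apply; rewrite -N0; apply: le_measure; rewrite ?inE//.
  exact: open_measurable_mx.
move=> z [Kz Uz]; apply: NP => /= /(_ (interior_subset Kz)).
have := UP _ Uz (interior_subset Kz) => /= h1 h2.
have := ler_dist_dist (g x) (g z); have := ler_norm (`|g x| - `|g z|); lra.
Qed.

(** Nonnegativity of [c] serves at the points outside [K], where the extended function is 0, and for
    the convention that the norm is 0 when the whole space is null. *)
Lemma Linfty_norm_le f c : (forall x, K x -> `|f x| <= c) -> 0 <= c ->
  (Linfty_norm K f <= c%:E)%E.
Proof.
move=> fc c0; rewrite /Linfty_norm unlock /Lnorm; case: ifPn => _; last first.
  by rewrite lee_fin.
apply/ess_supP; apply: aeW => x /=; rewrite lee_fin /patch.
by case: ifPn => [/set_mem /fc//|_]; rewrite normr0.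
Qed.

Lemma Linfty_norm_ae f c : measurable K -> (0 < leb K)%E ->
  (Linfty_norm K f <= c%:E)%E -> {ae leb, forall x, K x -> `|f x| <= c}.
Proof.
rewrite /Linfty_norm unlock /Lnorm => mK K0; case: ifPn => [_|]; last first.
  move=> /negP[]; apply: lt_le_trans K0 _.
  by apply: le_measure; rewrite ?inE.
move=> /ess_supP; apply: filterS => x /= h Kx.
by move: h; rewrite /patch mem_set// lee_fin.
Qed.

End C1.

(** * Windows with C^2 boundary *)

Section lines.
Context {R : realType} {m n : nat}.
Local Notation M := 'M[R]_(m, n).
Implicit Types (f : M -> R) (z e : M).

Lemma derive_lineP f z e t :
  (derivable (fun s : R => f (z + s *: e)) t 1 <-> derivable f (z + t *: e) e) /\
  'D_1 (fun s : R => f (z + s *: e)) t = 'D_e f (z + t *: e).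
Proof.
rewrite /derivable /derive.
suff -> : (fun h : R => h^-1 *: (f (z + (h *: 1 + t) *: e) - f (z + t *: e))) =
    (fun h : R => h^-1 *: (f (h *: e + (z + t *: e)) - f (z + t *: e))) by [].
apply/funext => h; congr (_ *: (f _ - _)).
by rewrite scalerDl addrCA scaler1.
Qed.

Lemma line_lipschitz f z e (a b c : R) : a <= b ->
  (forall t, a <= t <= b -> derivable f (z + t *: e) e /\
     `|'D_e f (z + t *: e)| <= c) ->
  `|f (z + b *: e) - f (z + a *: e)| <= c * (b - a).
Proof.
move=> ab h; pose g s := f (z + s *: e).
have dg t : a <= t <= b -> derivable g t 1.
  by move=> /h[df _]; exact/(derive_lineP f z e t).1.
have [||t] := @MVT_segment R g ('D_1 g) a b ab.
- move=> x; rewrite in_itv/= => /andP[ax xb].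
  by apply: DeriveDef => //; apply: dg; rewrite !ltW.
- by apply: derivable_within_continuous => t; rewrite in_itv/=; exact: dg.
rewrite in_itv/= => tab; rewrite -/(g b) -/(g a) => ->.
rewrite normrM [`|b - a|]ger0_norm ?subr_ge0// ler_wpM2r ?subr_ge0//.
by rewrite (derive_lineP f z e t).2; have [] := h t tab.
Qed.

Lemma line_lipschitz0 f z e (a c : R) :
  (forall t, `|t| <= `|a| -> derivable f (z + t *: e) e /\
     `|'D_e f (z + t *: e)| <= c) ->
  `|f (z + a *: e) - f z| <= c * `|a|.
Proof.
move=> h; have [a0|a0] := leP 0 a.
  rewrite -{2}(addr0 z) -(scale0r e) (le_trans (line_lipschitz a0 (c := c) _))//.
    by move=> t /andP[t0 ta]; apply: h; rewrite !ger0_norm.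
  by rewrite subr0 ger0_norm.
rewrite distrC -{1}(addr0 z) -(scale0r e).
rewrite (le_trans (line_lipschitz (ltW a0) (c := c) _))//.
  by move=> t /andP[ta t0]; apply: h; rewrite !ler0_norm ?lerN2// ltW.
by rewrite sub0r ltr0_norm.
Qed.

End lines.

Section C1_continuous.
Context {R : realType} {n : nat}.
Local Notation V := 'rV[R]_n.

Lemma ball_coord (x y : V) r : 0 < r ->
  (forall j, `|x 0 j - y 0 j| < r) -> ball x r y.
Proof. by move=> r0 h; split => // i j; rewrite ord1; exact: h. Qed.

(* Move from x to y one coordinate at a time. *)
Lemma C1_open_continuous (U : set V) (f : V -> R) x : open U -> C1_open U f ->
  U x -> {for x, continuous f}.
Proof.
move=> oU C1f Ux.
have [c [r [r0 c0 rU]]] : exists c r, [/\ 0 < r, 0 < c & forall y, ball x r y ->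
    U y /\ forall j, `|'D_(delta_mx 0 j) f y| <= c].
  pose c := \sum_j `|'D_(delta_mx 0 j) f x| + 1.
  have c0 : 0 < c by rewrite ltr_wpDl// sumr_ge0.
  have nU : \forall y \near x, U y by exact: open_nbhs_nbhs.
  have nD : \forall y \near x, forall j, `|'D_(delta_mx 0 j) f y| <= c.
    apply: (@filter_forall V 'I_n
      (fun j y => `|'D_(delta_mx 0 j) f y| <= c) (nbhs x)) => j.
    have [_ cD] := C1f 0 j x Ux.
    have /nbhs_ballP[s /= s0 sP] : nbhs x ('D_(delta_mx 0 j) f @^-1`
      ball ('D_(delta_mx 0 j) f x) 1) by apply: cD; exact: nbhsx_ballx.
    apply/nbhs_ballP; exists s => // y /sP; rewrite /ball/= => h.
    have : `|'D_(delta_mx 0 j) f x| <= c - 1.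
      by rewrite /c addrK (bigD1 j)//= lerDl sumr_ge0.
    have := lerB_dist ('D_(delta_mx 0 j) f y) ('D_(delta_mx 0 j) f x).
    by rewrite distrC in h; lra.
  have [r /= r0 rP] := (nbhs_ballP _ _).1 (filterI nU nD).
  by exists c, r; split.
apply/continuous_atP => e e0.
have n0 : 0 < n.+1%:R :> R by rewrite ltr0n.
(* Each of the n coordinates contributes at most [e / n.+1], which keeps the sum strictly below
   [e]. *)
pose s := Num.min r (e / (c * n.+1%:R)).
have s0 : 0 < s by rewrite lt_min r0 divr_gt0// mulr_gt0.
exists s => // y [_ xy].
pose z k : V := \row_j (if (j < k)%N then y 0 j else x 0 j).
rewrite distrC.
have -> : f y - f x = \sum_(0 <= k < n) (f (z k.+1) - f (z k)).
  rewrite telescope_sumr//; congr (f _ - f _); apply/rowP => j; rewrite mxE//.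
  by rewrite ltn_ord.
rewrite big_mkord (le_lt_trans (ler_norm_sum _ _ _))//.
apply: (@le_lt_trans _ _ (\sum_(k < n) c * (e / (c * n.+1%:R)))); last first.
  rewrite sumr_const card_ord.
  have -> : c * (e / (c * n.+1%:R)) = e / n.+1%:R.
    by rewrite invfM mulrCA (mulrA c) divff ?gt_eqF// mul1r.
  rewrite -mulrnAr -[ltRHS]mulr1 ltr_pM2l// -mulr_natr mulrC.
  by rewrite ltr_pdivrMr// mul1r ltr_nat.
apply: ler_sum => k _.
have -> : z k.+1 = z k + (y 0 k - x 0 k) *: delta_mx 0 k.
  apply/rowP => j; rewrite !mxE eqxx/= ltnS.
  have [->|jk] := eqVneq j k; first by rewrite leqnn ltnn mulr1 addrC subrK.
  by rewrite mulr0 addr0 ltn_neqAle jk.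
have xyk : `|y 0 k - x 0 k| < s by have := xy 0 k; rewrite /ball/= distrC.
apply: (@le_trans _ _ (c * `|y 0 k - x 0 k|)); last first.
  rewrite ler_wpM2l ?(ltW c0)// (le_trans (ltW xyk))//.
  by rewrite ge_min lexx orbT.
apply: line_lipschitz0 => t tk.
have /rU[Uz cz] : ball x r (z k + t *: delta_mx 0 k).
  apply: ball_coord => // j; rewrite !mxE eqxx/=.
  have sr : s <= r by rewrite ge_min lexx.
  have [->|jk] := eqVneq j k.
    rewrite ltnn mulr1 opprD addrA subrr sub0r normrN.
    by apply: lt_le_trans sr; exact: le_lt_trans tk xyk.
  rewrite mulr0 addr0; case: ifPn => _; last by rewrite subrr normr0.
  by apply: lt_le_trans sr; have := xy 0 j.
split; last exact: cz.
by have [] := C1f 0 k _ Uz.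
Qed.

Lemma ball_convex_line (x y : V) r k (s t u : R) : ball x r (y + s *: delta_mx 0 k) ->
  ball x r (y + t *: delta_mx 0 k) -> s <= u <= t ->
  ball x r (y + u *: delta_mx 0 k).
Proof.
move=> [r0 xs] [_ xt] /andP[su ut]; apply: ball_coord => // j.
have := xs 0 j; have := xt 0 j; rewrite /ball/= !mxE eqxx/=.
have [_|_] := eqVneq j k; rewrite ?mulr1 ?mulr0 ?addr0//.
by rewrite !ltr_norml; lra.
Qed.

End C1_continuous.

Section boundary.
Context {R : realType} {n : nat}.
Local Notation V := 'rV[R]_n.
Variables (K : set V) (cK : compact K) (C2K : C2_boundary K).

Let closedK : closed K.
Proof. exact: compact_closed mx_hausdorff cK. Qed.

Let frontier_sub : frontier K `<=` K.
Proof. by move=> x [cx _]; rewrite (closure_id K).1. Qed.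

Lemma closed_frontier : closed (frontier K).
Proof.
rewrite /frontier setDE; apply: closedI; first exact: closed_closure.
by apply: open_closedC; exact: open_interior.
Qed.

Lemma compact_frontier : compact (frontier K).
Proof. exact: subclosed_compact closed_frontier cK frontier_sub. Qed.

Let sublevel_interior (U : set V) (phi : V -> R) x : open U -> C2_open U phi ->
  K `&` U = [set x | phi x <= 0] `&` U -> U x -> phi x < 0 -> K° x.
Proof.
move=> oU [C1phi _] KU Ux phi0.
have /continuous_atP := C1_open_continuous oU C1phi Ux.
move=> /(_ (- phi x)); rewrite oppr_gt0 => /(_ phi0)[r r0 rP].
have /nbhs_ballP[r' /= r'0 UP] : nbhs x U by exact: open_nbhs_nbhs.
apply/nbhs_ballP; exists (Num.min r r'); first by rewrite /= lt_min r0.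
move=> y xy.
have yr : ball x r y by apply: le_ball xy; rewrite ge_min lexx.
have yr' : ball x r' y by apply: le_ball xy; rewrite ge_min lexx orbT.
have : (K `&` U) y.
  rewrite KU; split; last exact: UP.
  by have := rP _ yr; rewrite ltr_norml /=; lra.
by case.
Qed.

Lemma frontier_level (U : set V) (phi : V -> R) x : open U -> C2_open U phi ->
  K `&` U = [set x | phi x <= 0] `&` U -> U x -> frontier K x -> phi x = 0.
Proof.
move=> oU C2phi KU Ux Fx.
have [+ _] : ([set x | phi x <= 0] `&` U) x by rewrite -KU; split => //; exact: frontier_sub.
rewrite /= le_eqVlt => /predU1P[//|phi0]; have [_] := Fx; case.
exact: (sublevel_interior oU C2phi KU Ux phi0).
Qed.

(** At a frontier point [phi] vanishes with a nonzero partial derivative, so a short move along that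
    coordinate makes [phi] negative and enters the interior. *)
Lemma C2_regular : K `<=` closure K°.
Proof.
move=> x Kx; have [Ix|nIx] := pselect (K° x); first exact: subset_closure.
have Fx : frontier K x by split => //; exact: subset_closure.
have [U [phi [[oU Ux] C2phi [k Dphi] KU]]] := C2K Fx.
have phi0 : phi x = 0 by exact: frontier_level KU Ux Fx.
move=> A /nbhs_ballP[r /= r0 rA].
have /nbhs_ballP[r' /= r'0 UP] : nbhs x U by exact: open_nbhs_nbhs.
have [dphi _] := C2phi.1 0 k x Ux.
set c := 'D_(delta_mx 0 k) phi x in Dphi.
have c0 : 0 < `|c| by rewrite normr_gt0.
have : h^-1 *: (phi (h *: delta_mx 0 k + x) - phi x) @[h --> 0^'] --> c.
  exact: dphi.
move=> /cvgrPdist_lt/(_ _ c0); rewrite near_withinE => /nbhs_ballP[s /= s0 sP].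
pose t := Num.min (Num.min r r') s / 2.
have t0 : 0 < t by rewrite divr_gt0// !lt_min r0 r'0 s0.
have tm : t < Num.min (Num.min r r') s.
  by rewrite /t ltr_pdivrMr// ltr_pMr// ?ltr1n// !lt_min r0 r'0 s0.
(* A step against the sign of the derivative. Its size keeps [y] in both balls and the difference
   quotient at distance less than [|c|] from [c], so the quotient has the sign of [c] and
   [c * h < 0] forces [phi y < 0]. *)
pose h := - (Num.sg c * t).
have nh : `|h| = t by rewrite normrN normrM normr_sg Dphi mul1r gtr0_norm.
have h0 : h != 0 by rewrite -normr_gt0 nh.
pose y := x + h *: delta_mx 0 k.
have yb e : t < e -> ball x e y.
  move=> te; apply: ball_coord; first exact: lt_trans te.
  move=> j; rewrite !mxE eqxx/= opprD addrA subrr sub0r normrN.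
  by case: (j == k); rewrite ?mulr1 ?mulr0 ?normr0 ?nh//; exact: lt_trans te.
have phiy : phi y < 0.
  have : ball 0 s h by rewrite /ball/= sub0r normrN nh; move: tm; rewrite lt_min => /andP[].
  move=> /sP/(_ h0); rewrite phi0 subr0 addrC (addrC _ x) -/y => hP.
  have cq : 0 < c * (h^-1 * phi y).
    move: hP; rewrite -[h^-1 *: phi y]/(h^-1 * phi y).
    move: (h^-1 * phi y) => q; have [cp|cn|c00] := ltgtP c 0.
    - by rewrite nmulr_rgt0// (ltr0_norm cp) ltr_norml; lra.
    - by rewrite pmulr_rgt0// (gtr0_norm cn) ltr_norml; lra.
    - by rewrite c00 eqxx in Dphi.
  have ch : c * h < 0.
    rewrite mulrN mulrA (mulrC c) -normrEsg oppr_lt0 mulr_gt0//.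
  rewrite -(nmulr_rgt0 _ ch) (_ : c * h * phi y = c * (h^-1 * phi y) * h ^+ 2).
    by rewrite mulr_gt0// exprn_even_gt0.
  by field.
move: tm; rewrite !lt_min => /andP[/andP[tr tr'] ts].
exists y; split; last by apply: rA; exact: yb.
by apply: (sublevel_interior oU C2phi KU _ phiy); apply: UP; exact: yb.
Qed.

(** Near a frontier point some partial derivative of [phi] does not vanish. Two frontier points on
    one line of that direction would be two zeros of [phi], contradicting the mean value theorem; so
    lines meet the frontier locally at most once, and compactness leaves finitely many such
    pieces. *)
Lemma frontier_null : leb (frontier K) = 0%E.
Proof.
have loc p : frontier K p -> exists2 r, 0 < r & leb (frontier K `&` ball p r) = 0%E.
  move=> Fp; have [U [phi [[oU Up] C2phi [k Dphi] KU]]] := C2K Fp.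
  have [dphi cphi] := C2phi.1 0 k p Up.
  have [s s0 sP] : exists2 s, 0 < s & forall y, ball p s y ->
      U y /\ 'D_(delta_mx 0 k) phi y != 0.
    have /nbhs_ballP[r' /= r'0 UP] : nbhs p U by exact: open_nbhs_nbhs.
    have c0 : 0 < `|'D_(delta_mx 0 k) phi p| by rewrite normr_gt0.
    have [s s0 sP] := (continuous_atP _ _).1 cphi _ c0.
    exists (Num.min r' s) => [|y py]; first by rewrite lt_min r'0.
    split; first by apply: UP; apply: le_ball py; rewrite ge_min lexx.
    have /sP : ball p s y by apply: le_ball py; rewrite ge_min lexx orbT.
    by apply: contraTneq => ->; rewrite subr0 ltxx.
  exists s => //; set N := _ `&` _.
  have mN : measurable N.
    apply: measurableI; first exact: compact_measurable_mx compact_frontier.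
    by rewrite ball_mbox//; exact: measurable_mbox.
  have Nfin : (leb N < +oo)%E.
    apply: le_lt_trans (leb_ball_fin p s0); apply: le_measure; rewrite ?inE//.
    - by rewrite ball_mbox//; exact: measurable_mbox.
    - exact: subIsetr.
  have <- : (\int[leb]_x (\1_N x)%:E = leb N)%E by rewrite integral_indic// setIT.
  apply: (leb_slice0 (i := 0) (j := k)).
    exact: integrable_indic_fin.
  move=> x; pose S := [set t : R | N (x + t *: delta_mx 0 k)].
  have lt_ne (s1 s2 : R) : S s1 -> S s2 -> s1 < s2 -> False.
    move=> [F1 b1] [F2 b2] s12.
    have line t : s1 <= t <= s2 -> U (x + t *: delta_mx 0 k) /\
        'D_(delta_mx 0 k) phi (x + t *: delta_mx 0 k) != 0.
      by move=> st; apply: sP; exact: (ball_convex_line b1 b2 st).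
    have [||u] := @MVT R (fun t => phi (x + t *: delta_mx 0 k))
      ('D_1 (fun t : R => phi (x + t *: delta_mx 0 k))) s1 s2 s12.
    - move=> t; rewrite in_itv/= => /andP[t1 t2]; apply: DeriveDef; last by [].
      apply/(derive_lineP phi x (delta_mx 0 k) t).1.
      have [|Ut _] := line t; first by rewrite !ltW.
      by have [] := C2phi.1 0 k _ Ut.
    - apply: derivable_within_continuous => t; rewrite in_itv/= => t12.
      apply/(derive_lineP phi x (delta_mx 0 k) t).1.
      have [Ut _] := line t t12.
      by have [] := C2phi.1 0 k _ Ut.
    rewrite in_itv/= => /andP[u1 u2].
    have [U1 _] := sP _ b1; have [U2 _] := sP _ b2.
    rewrite (frontier_level oU C2phi KU U1 F1) (frontier_level oU C2phi KU U2 F2).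
    rewrite subrr => /esym/eqP; rewrite mulf_eq0 subr_eq0 (gt_eqF s12) orbF.
    rewrite (derive_lineP phi x (delta_mx 0 k) u).2.
    by have [|_ /negP] := line u; first by rewrite !ltW.
  have S1 : S = set0 \/ exists t, S = [set t].
    have [->|/set0P[t St]] := eqVneq S set0; [by left|right; exists t].
    apply/seteqP; split => [u Su|_ -> //].
    by case: (ltgtP u t) => [ut|ut|//]; [case: (lt_ne _ _ Su St ut)|
      case: (lt_ne _ _ St Su ut)].
  have NS t : ((x + t *: delta_mx 0 k) \in N) = (t \in S).
    by apply/idP/idP => /set_mem h; apply/mem_set.
  under eq_integral do rewrite indicE NS -indicE.
  case: S1 => [->|[t ->]].
    by rewrite integral_indic// set0I measure0.
  by rewrite integral_indic// setIT; exact: lebesgue_measure_set1.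
pose r p := if pselect (frontier K p) is left Fp then
  sval (cid2 (loc p Fp)) else 1.
have rP p : frontier K p -> 0 < r p /\ leb (frontier K `&` ball p (r p)) = 0%E.
  by move=> Fp; rewrite /r; case: pselect => // Fp'; case: cid2.
have := compact_frontier; rewrite compact_cover.
move=> /(_ V (frontier K) (fun p => (ball p (r p))°)) [].
- by move=> p _; exact: open_interior.
- move=> p Fp; exists p => //; apply: nbhsx_ballx.
  by have [] := rP p Fp.
move=> D DF cov.
suff : leb.-negligible (frontier K).
  case=> N [mN N0 KN]; apply: (subset_measure0 _ mN KN N0).
  exact: compact_measurable_mx compact_frontier.
have sub : frontier K `<=` \big[setU/set0]_(p <- finmap.enum_fset D) (frontier K `&` ball p (r p)).
  move=> x Fx; have [p /= pD xp] := cov _ Fx.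
  rewrite -bigcup_seq; exists p => //=; split => //.
  exact: interior_subset xp.
apply: (negligibleS sub).
rewrite big_seq; elim/big_ind : _ => [||p pD].
- exact: negligible_set0.
- exact: negligibleU.
- have Fp : frontier K p by apply/set_mem; apply: DF.
  have [r0 rN] := rP p Fp.
  exists (frontier K `&` ball p (r p)); split => //.
  apply: measurableI; first exact: compact_measurable_mx compact_frontier.
  by rewrite ball_mbox//; exact: measurable_mbox.
Qed.

End boundary.

(** * Measurable enumeration of the points *)

Section enumeration.
Context {R : realType} {d : nat} {dT : measure_display} {T : measurableType dT}.
Local Notation Rd := 'rV[R]_d.
Variables (X : T -> set Rd) (W : set Rd) (mW : measurable W).
Hypothesis finX : forall w, finite_set (X w `&` W).

Let finXB B w : B `<=` W -> finite_set (X w `&` B).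
Proof. by move=> BW; apply: sub_finite_set (finX w); exact: setIS. Qed.

Lemma mem_points B w u : B `<=` W ->
  (u \in points X B w) = (u \in X w `&` B).
Proof. by move=> BW; rewrite /points in_fset_set//; exact: finXB. Qed.

Lemma uniq_points B w : uniq (points X B w).
Proof. exact: finmap.fset_uniq. Qed.

Lemma count_set1 B w u : X w `&` B = [set u] -> count X B w = 1%N.
Proof. by move=> e; rewrite /Defs.count /points e fset_set1; exact: finmap.cardfs1. Qed.

Lemma count_le1P B w : B `<=` W -> count X B w = 1%N ->
  X w `&` B = [set nth 0 (points X B w) 0].
Proof.
move=> BW; rewrite /Defs.count; case E : (points X B w) => [|u [|]]//= _.
apply/seteqP; split => v.
  by move=> /mem_set; rewrite -mem_points// E inE => /eqP.
by move=> ->; apply/set_mem; rewrite -mem_points// E inE.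
Qed.

Local Notation FW := (F_W_type X W).

Lemma measurable_count B k : measurable B -> B `<=` W ->
  measurable ([set w | count X B w = k] : set FW).
Proof. by move=> mB BW; apply: sub_sigma_algebra; exists B, k. Qed.

(** The type of [X_W] depends on the outcome through the number of points. [Xn] carries the same
    rows in a type fixed in advance, and [at_count] passes from one to the other on the event of n
    points. *)
Definition Xn n (w : T) : 'M[R]_(n, d) := \matrix_i nth 0 (points X W w) i.

Lemma at_count (A : Type) (G : forall n, 'M[R]_(n, d) -> A) n w :
  count X W w = n -> G (count X W w) (X_W X W w) = G n (Xn n w).
Proof. by case: n /. Qed.

Section fixed_n.
Variable n : nat.

(** A family of n balls with rational centres and a common radius; such families are countable in
    number. *)
Definition cell (q : 'M[rat]_(n, d) * nat) (i : 'I_n) : set Rd :=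
  ball (map_mx ratr (row i q.1) : Rd) (q.2.+1%:R^-1 : R).

Definition sep (q : 'M[rat]_(n, d) * nat) :=
  forall i j, i != j -> cell q i `&` cell q j = set0.

Definition isolating q : set T :=
  [set w | [/\ sep q, count X W w = n &
    forall i, count X (W `&` cell q i) w = 1%N]].

Let mcell q i : measurable (W `&` cell q i).
Proof.
apply: measurableI => //; rewrite /cell ball_mbox ?invr_gt0//.
exact: measurable_mbox.
Qed.

Lemma measurable_isolating q : measurable (isolating q : set FW).
Proof.
have [sq|nsq] := pselect (sep q); last first.
  by rewrite (_ : isolating q = set0)// -subset0 => w [].
rewrite (_ : isolating q = [set w | count X W w = n] `&`
    \bigcap_(i in [set: 'I_n]) [set w | count X (W `&` cell q i) w = 1%N]).
  apply: measurableI; first exact: measurable_count.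
  by apply: fin_bigcap_measurable => // i _; apply: measurable_count.
by apply/seteqP; split => w; [case=> _ ? h; split => // i _; exact: h|
  case=> ? h; split => // i; exact: h].
Qed.

(** Finitely many distinct points are at positive mutual distance, so balls of small enough radius
    around rational approximations of the points separate them. *)
Lemma exists_isolating w : count X W w = n -> exists q, isolating q w.
Proof.
move=> wn; pose s (i : 'I_n) : Rd := nth 0 (points X W w) i.
have sW i : (X w `&` W) (s i).
  by apply/set_mem; rewrite -mem_points//; apply: mem_nth; rewrite -/(count X W w) wn.
have s_inj i j : s i = s j -> i = j.
  move/eqP; rewrite nth_uniq ?uniq_points// -/(count X W w) ?wn//.
  by move/eqP/val_inj.
(* The factor 4: each centre is within the radius of its point, so a common element of two balls
   would put two of the points within four radii. *)
have : \forall k \near \oo, forall ij : 'I_n * 'I_n, ij.1 != ij.2 ->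
    4 * (k.+1%:R)^-1 < `|s ij.1 - s ij.2|.
  apply: (@filter_forall nat ('I_n * 'I_n)%type (fun ij k => ij.1 != ij.2 ->
    4 * (k.+1%:R)^-1 < `|s ij.1 - s ij.2|) \oo) => -[i j] /=.
  have [->|ij] := eqVneq i j; first exact: nearW.
  have sij : 0 < `|s i - s j| / 4.
    rewrite divr_gt0// normr_gt0 subr_eq0.
    by apply: contra_neq ij; exact: s_inj.
  apply: filterS (near_infty_natSinv_lt (PosNum sij)) => k /= h _.
  by move: h; rewrite ltr_pdivlMr// mulrC.
move=> [k _ /(_ k (leqnn k))] /= kP.
pose e : R := k.+1%:R^-1; have e0 : 0 < e by rewrite invr_gt0.
have qP i j : exists q : rat, `|ratr q - s i 0 j| < e.
  have [q] : exists q : rat, ratr q \in `](s i 0 j - e), (s i 0 j + e)[.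
    by apply: rat_in_itvoo; rewrite ltrBlDr -addrA ltrDl addr_gt0.
  by rewrite in_itv/= => /andP[a b]; exists q; rewrite ltr_distl a b.
pose q : 'M[rat]_(n, d) := \matrix_(i, j) sval (cid (qP i j)).
have sc i : cell (q, k) i (s i).
  apply: ball_coord => // j /=; rewrite !mxE.
  by case: cid.
have sepq : sep (q, k).
  move=> i j ij; rewrite -subset0 => z [iz jz].
  have := kP (i, j) ij; rewrite /= -/e => h.
  have := sc i; have := sc j; move: iz jz; rewrite /cell/= -/e -!ball_normE /=.
  set ci := map_mx _ _; set cj := map_mx _ _ => h1 h2 h3 h4.
  have : `|s i - s j| <= `|s i - ci| + `|ci - z| + (`|z - cj| + `|cj - s j|).
    by apply: (le_trans (ler_distD z _ _)); apply: lerD; exact: ler_distD.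
  rewrite [`|s i - ci|]distrC [`|z - cj|]distrC; lra.
exists (q, k); split => // i; apply: (@count_set1 _ _ (s i)).
apply/seteqP; split => [u [Xu [Wu cu]]|_ ->]; last first.
  by have [] := sW i; split => //; split.
have : u \in points X W w by rewrite mem_points// inE.
move=> /(nthP 0)[j]; rewrite -/(count X W w) wn => jn ju.
have uE : u = s (Ordinal jn) by rewrite -ju.
apply: contrapT => us; have ij : i != Ordinal jn.
  by apply/eqP => ij; apply: us; rewrite /= uE ij.
by have := sepq _ _ ij; rewrite -subset0 => /(_ u); apply; split => //; rewrite uE.
Qed.

Let F m := if (unpickle m : option ('M[rat]_(n, d) * nat)) is Some q
  then isolating q else set0.

Definition pick_points (q : 'M[rat]_(n, d) * nat) (w : T) : 'M[R]_(n, d) :=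
  \matrix_i nth 0 (points X (W `&` cell q i) w) 0.

(* A measurable enumeration of the points: the first rational family of balls
   isolating the points orders them. *)
Definition xi (w : T) : 'M[R]_(n, d) :=
  if pselect (exists m, seqDU F m w) is left e then
    if unpickle (sval (cid e)) is Some q then pick_points q w else 0
  else 0.

Let mF m : measurable (F m : set FW).
Proof. by rewrite /F; case: unpickle => [q|//]; exact: measurable_isolating. Qed.

Let xiE m q w : unpickle m = Some q -> seqDU F m w -> xi w = pick_points q w.
Proof.
move=> mq Fw; rewrite /xi; case: pselect => [e|[]]; last by exists m.
case: (cid e) => m' /= Fw'.
by rewrite (@trivIset_seqDU _ F m' m I I) ?mq//; exists w.
Qed.

(** On the event that a given family is the first isolating one, a coordinate of the i-th point lies
    in [Y] exactly when the part of the i-th ball where that coordinate is in [Y] contains one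
    point. This is an event on counts, hence in F_W. *)
Lemma measurable_xi : measurable_fun setT (xi : FW -> 'M[R]_(n, d)).
Proof.
apply: measurable_fun_mx => i j _ Y mY; rewrite setTI.
pose G m : set FW := if (unpickle m : option ('M[rat]_(n, d) * nat)) is Some q
  then [set w | count X (W `&` cell q i `&` (fun u => u 0 j) @^-1` Y) w = 1%N]
  else set0.
(* Where no family isolates, [xi] is 0, and the preimage of [Y] is everything or nothing. *)
pose Z : set FW := if `[< Y 0 >] then setT else set0.
rewrite (_ : _ @^-1` _ = \bigcup_m (seqDU F m `&` G m) `|`
    (~` (\bigcup_m seqDU F m) `&` Z)).
  have mD m : measurable (seqDU F m : set FW).
    apply: measurableD; first exact: mF.
    by apply: bigsetU_measurable => k _; exact: mF.
  apply: measurableU.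
    apply: bigcupT_measurable => m; apply: measurableI; first exact: mD.
    rewrite /G; case: unpickle => [q|//]; apply: measurable_count.
      apply: measurableI; first exact: mcell.
      by rewrite -[X in measurable X]setTI; exact: measurable_coord_mx.
    by move=> u [[]].
  apply: measurableI; last by rewrite /Z; case: ifP.
  by apply: measurableC; exact: bigcupT_measurable.
have key m w : seqDU F m w -> (Y (xi w i j) <-> G m w).
  move=> Fw; rewrite /G; have [Fmw _] := Fw; move: Fmw; rewrite {1}/F.
  case mq : unpickle => [q|//] [sq wn c1].
  rewrite (xiE mq Fw) mxE.
  have cW : W `&` cell q i `<=` W by exact: subIsetl.
  have e := count_le1P cW (c1 i); set u := nth _ _ _ in e *.
  split => [Yu|Gu] /=.
    apply: (@count_set1 _ _ u); apply/seteqP; split => [v [Xv [cv _]]|_ ->].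
      by rewrite -e.
    have [Xu cu] : (X w `&` (W `&` cell q i)) u by rewrite e.
    by split => //; split.
  have cW' : W `&` cell q i `&` (fun u => u 0 j) @^-1` Y `<=` W by move=> v [[]].
  have e' := count_le1P cW' Gu; set v := nth _ _ _ in e'.
  have [Xv [cv Yv]] : (X w `&` (W `&` cell q i `&` (fun u => u 0 j) @^-1` Y)) v.
    by rewrite e'.
  have : (X w `&` (W `&` cell q i)) v by [].
  by rewrite e => <-.
apply/seteqP; split => w /=.
  move=> Yw; have [[m Fw]|nF] := pselect (exists m, seqDU F m w).
    by left; exists m => //; split => //; exact/(key m w Fw).
  right; split; first by move=> [m _ Fw]; apply: nF; exists m.
  move: Yw; rewrite /xi; case: pselect => // _; rewrite mxE /Z => Y0.
  by rewrite asboolT.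
move=> [[m _ [Fw Gw]]|[nF Zw]]; first exact/(key m w Fw).
rewrite /xi; case: pselect => [[m Fw]|_].
  by exfalso; apply: nF; exists m.
by rewrite mxE; move: Zw; rewrite /Z; case: asboolP.
Qed.

(** Disjoint balls pick n distinct points out of n, that is, all of them in some order. *)
Lemma xi_perm w : count X W w = n -> exists s : 'S_n, xi w = row_perm s (Xn n w).
Proof.
move=> wn; have [q qw] := exists_isolating wn.
have [m Fw] : exists m, seqDU F m w.
  have : (\bigcup_m seqDU F m) w.
    by rewrite -seqDU_bigcup_eq; exists (pickle q) => //; rewrite /F pickleK.
  by case=> m _ ?; exists m.
have [Fmw _] := Fw; move: Fmw; rewrite {1}/F; case mq : unpickle => [q'|//].
move=> [sq' _ c1]; rewrite (xiE mq Fw).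
have mem i : (X w `&` (W `&` cell q' i)) (row i (pick_points q' w)).
  rewrite (count_le1P _ (c1 i)); last exact: subIsetl.
  by rewrite rowK.
pose t1 := [tuple row i (pick_points q' w) | i < n].
have sz : size (points X W w) == n by apply/eqP.
pose t2 := Tuple sz.
have u1 : uniq t1.
  apply/tuple_uniqP => i j; rewrite !tnth_mktuple => ij.
  apply/eqP; apply: contrapT => /negP nij.
  have := sq' _ _ nij; rewrite -subset0 => /(_ (row i (pick_points q' w))); apply.
  by have [_ [_ ?]] := mem i; have [_ [_]] := mem j; rewrite -ij.
have sub : {subset t1 <= t2}.
  move=> u /mapP[i _ ->]; rewrite mem_points// inE.
  by have [? []] := mem i.
have p12 : perm_eq t1 t2.
  apply: uniq_perm => //; first exact: uniq_points.
  have [|//] := @uniq_min_size _ (t1 : seq _) (t2 : seq _) u1 sub.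
  by rewrite !size_tuple.
have /tuple_permP[s sE] := p12.
exists s; apply/row_matrixP => i.
have := congr1 (fun t => tnth t i) (val_inj sE : t1 = [tuple tnth t2 (s i) | i < n]).
rewrite !tnth_mktuple => ->; apply/rowP => j.
by rewrite !mxE (tnth_nth 0).
Qed.

Lemma xi_Wpow w : count X W w = n -> Wpow W n (xi w).
Proof.
move=> wn; have [s ->] := xi_perm wn => i.
have -> : row i (row_perm s (Xn n w)) = nth 0 (points X W w) (s i).
  by apply/rowP => j; rewrite !mxE.
have : nth 0 (points X W w) (s i) \in points X W w.
  by apply: mem_nth; rewrite -/(count X W w) wn.
by rewrite mem_points// inE => -[].
Qed.

Lemma Xn_Wpow w : count X W w = n -> Wpow W n (Xn n w).
Proof.
move=> wn i; rewrite rowK.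
have : nth 0 (points X W w) i \in points X W w.
  by apply: mem_nth; rewrite -/(count X W w) wn.
by rewrite mem_points// inE => -[].
Qed.

End fixed_n.

(** Nothing is known on how the order of [X_W] depends on the outcome. A symmetric [G] does not see
    the order, so [X_W] may be replaced by the measurable [xi]. The parameter in [D] makes the
    statement usable for random fields. *)
Lemma measurable_symmetric d' (S : measurableType d') (D : set S)
    (G : forall n, 'M[R]_(n, d) -> S -> R) : measurable D ->
  (forall n, measurable_fun (Wpow W n `*` D) (fun p => G n p.1 p.2)) ->
  (forall n (s : 'S_n) z y, Wpow W n z -> D y -> G n (row_perm s z) y = G n z y) ->
  measurable_fun (setT `*` D)
    (fun p : FW * S => G (count X W p.1) (X_W X W p.1) p.2).
Proof.
move=> mD mG symG.
pose A n : set (FW * S) := [set w | count X W w = n] `*` D.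
have mA n : measurable (A n) by apply: measurableX => //; exact: measurable_count.
have -> : setT `*` D = \bigcup_n A n.
  apply/seteqP; split => -[w y] /=; first by move=> [_ Dy]; exists (count X W w).
  by move=> [n _ [_ Dy]].
apply/measurable_fun_bigcup => // n.
apply: (@eq_measurable_fun _ _ _ _ _
  ((fun p => G n p.1 p.2) \o (fun p : FW * S => (xi n p.1, p.2)))).
  move=> [w y]; rewrite inE => -[/= wn Dy].
  rewrite (@at_count _ (fun n z => G n z y) n)//.
  by have [s ->] := xi_perm wn; rewrite symG//; exact: Xn_Wpow.
apply: (@measurable_comp _ _ _ _ _ _ (Wpow W n `*` D)).
- apply: measurableX => //.
  rewrite (_ : Wpow W n = \bigcap_(i in [set: 'I_n]) (row i @^-1` W)).
    apply: fin_bigcap_measurable => // i _; rewrite -[X in measurable X]setTI.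
    have : measurable_fun setT (row i : 'M[R]_(n, d) -> Rd).
      apply: measurable_fun_mx => k j; under eq_fun do rewrite mxE.
      exact: measurable_coord_mx.
    exact.
  by apply/seteqP; split => z h i; [move=> _|]; exact: h.
- by move=> _ [[w y] [/= wn Dy] <-]; split => //=; exact: xi_Wpow.
- exact: mG.
- apply: measurable_funTS; apply: measurable_fun_pair; last exact: measurable_snd.
  rewrite (_ : (fun x : FW * S => xi n x.1) = (xi n : FW -> _) \o fst)//.
  by apply: measurableT_comp; [exact: measurable_xi|exact: measurable_fst].
Qed.

End enumeration.

(** * Appending a point, product sets and the diagonal *)

Section append_row.
Context {R : realType} {d : nat}.
Local Notation Rd := 'rV[R]_d.

(** Unlike [col_mx], whose number of rows is [n + 1], this lands in [n.+1] rows without a cast;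
    [forms_app] reconciles it with the compatibility condition. *)
Definition app n (z : 'M[R]_(n, d)) (u : Rd) : 'M[R]_(n.+1, d) :=
  \matrix_(i, j) if unlift ord_max i is Some i' then z i' j else u 0 j.

Lemma row_app_max n (z : 'M[R]_(n, d)) u : row ord_max (app z u) = u.
Proof. by apply/rowP => j; rewrite !mxE unlift_none. Qed.

Lemma row_app_lift n (z : 'M[R]_(n, d)) u i :
  row (lift ord_max i) (app z u) = row i z.
Proof. by apply/rowP => j; rewrite !mxE liftK. Qed.

Lemma appE n (z : 'M[R]_(n, d)) u :
  app z u = castmx (addn1 n, erefl d) (col_mx z u).
Proof.
apply/matrixP => i j; rewrite castmxE mxE.
case: (unliftP ord_max i) => [i' ->|->].
  rewrite (_ : cast_ord _ _ = lshift 1 i'); last first.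
    by apply/val_inj; exact: lift_max.
  by rewrite cast_ord_id col_mxEu.
rewrite (_ : cast_ord _ _ = rshift n ord0); last first.
  by apply/val_inj => /=; rewrite addn0.
by rewrite cast_ord_id col_mxEd.
Qed.

Lemma forms_app (f : forms (R := R) (d := d)) n (z : 'M[R]_(n, d)) u :
  f (n + 1)%N (col_mx z u) = f n.+1 (app z u).
Proof.
rewrite appE; move: (col_mx z u); move: (addn1 n).
by case: _ / => M; rewrite castmx_id.
Qed.

Lemma Wpow_app (B : set Rd) n (z : 'M[R]_(n, d)) u :
  Wpow B n.+1 (app z u) <-> Wpow B n z /\ B u.
Proof.
split => [h|[zB uB] i].
  split; last by have := h ord_max; rewrite row_app_max.
  by move=> i; have := h (lift ord_max i); rewrite row_app_lift.
by case: (unliftP ord_max i) => [i' ->|->]; rewrite ?row_app_lift ?row_app_max.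
Qed.

Lemma measurable_app n :
  measurable_fun setT (fun p : 'M[R]_(n, d) * Rd => app p.1 p.2).
Proof.
apply: measurable_fun_mx => i j; under eq_fun do rewrite mxE.
case: unlift => [i'|].
  by apply: (measurableT_comp (measurable_coord_mx i' j)); exact: measurable_fst.
by apply: (measurableT_comp (measurable_coord_mx 0 j)); exact: measurable_snd.
Qed.

Lemma measurable_row n (i : 'I_n) :
  measurable_fun setT (row i : 'M[R]_(n, d) -> Rd).
Proof.
apply: measurable_fun_mx => k j; under eq_fun do rewrite mxE.
exact: measurable_coord_mx.
Qed.

Lemma measurable_row_perm n (s : 'S_n) :
  measurable_fun setT (row_perm s : 'M[R]_(n, d) -> 'M[R]_(n, d)).
Proof.
apply: measurable_fun_mx => k j; under eq_fun do rewrite mxE.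
exact: measurable_coord_mx.
Qed.

Definition rect n (B : 'I_n -> set Rd) : set 'M[R]_(n, d) :=
  [set z | forall i, B i (row i z)].

Lemma measurable_rect n (B : 'I_n -> set Rd) : (forall i, measurable (B i)) ->
  measurable (rect B).
Proof.
move=> mB; rewrite (_ : rect B = \bigcap_(i in [set: 'I_n]) (row i @^-1` B i)).
  apply: fin_bigcap_measurable => // i _; rewrite -[X in measurable X]setTI.
  exact: measurable_row.
by apply/seteqP; split => z h i; [move=> _|]; exact: h.
Qed.

Lemma measurable_Wpow (B : set Rd) n : measurable B -> measurable (Wpow B n).
Proof. by move=> mB; exact: (@measurable_rect n (fun=> B)). Qed.

Definition diagonal n : set 'M[R]_(n, d) :=
  [set z | exists i j, i != j /\ row i z = row j z].

Arguments diagonal n z : clear implicits.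

Lemma measurable_diagonal n : measurable (diagonal n).
Proof.
pose D (ij : 'I_n * 'I_n) : set 'M[R]_(n, d) :=
  if ij.1 == ij.2 then set0 else
  \bigcap_(k in [set: 'I_d]) ((fun z : 'M[R]_(n, d) => z ij.1 k - z ij.2 k) @^-1` [set 0]).
rewrite (_ : diagonal n = \bigcup_(ij in [set: 'I_n * 'I_n]) D ij).
  apply: fin_bigcup_measurable => // -[i j] _; rewrite /D/=; case: ifP => // _.
  apply: fin_bigcap_measurable => // k _; rewrite -[X in measurable X]setTI.
  by apply: measurable_funB => //; exact: measurable_coord_mx.
apply/seteqP; split => z.
  move=> [i [j [ij zij]]]; exists (i, j) => //; rewrite /D/= (negbTE ij) => k _ /=.
  by have /rowP/(_ k) := zij; rewrite !mxE => ->; rewrite subrr.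
move=> [[i j] _]; rewrite /D/=; case: ifPn => // ij h; exists i, j; split => //.
by apply/rowP => k; have := h k I; rewrite !mxE /= => /subr0_eq.
Qed.

End append_row.
Arguments diagonal {R d} n z.

(** * Dyadic cells *)

Section dyadic.
Context {R : realType}.

(** That the integer part of [2 * x] determines the one of [x] is what makes the dyadic grids
    nested. *)
Lemma floor_half (x y : R) : Num.floor (2 * x) = Num.floor (2 * y) ->
  Num.floor x = Num.floor y.
Proof.
move=> e; symmetry; apply: floor_def.
have /andP[x1 x2] := floor_itv x; set a := Num.floor x in x1 x2 *.
have xl : 2 * a <= Num.floor (2 * x) by rewrite floor_ge_int intrM; lra.
have xr : Num.floor (2 * x) < 2 * (a + 1).
  by rewrite floor_lt_int intrM; move: x2; rewrite intrD; lra.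
rewrite e floor_ge_int in xl; rewrite e floor_lt_int in xr.
by move: xl xr; rewrite !intrM intrD; lra.
Qed.

Lemma floor_coarse (k l : nat) (x y : R) :
  Num.floor (2 ^+ (k + l) * x) = Num.floor (2 ^+ (k + l) * y) ->
  Num.floor (2 ^+ k * x) = Num.floor (2 ^+ k * y).
Proof.
elim: l => [|l IH]; first by rewrite addn0.
by rewrite addnS exprS -!mulrA => /floor_half/IH.
Qed.

Context {m n : nat}.

Definition dcell (k : nat) (q : 'M[int]_(m, n)) : set 'M[R]_(m, n) :=
  [set z | forall i j, Num.floor (2 ^+ k * z i j) = q i j].

Lemma measurable_dcell k q : measurable (dcell k q).
Proof.
rewrite (_ : dcell k q = \bigcap_(ij in [set: 'I_m * 'I_n])
  ((fun z : 'M[R]_(m, n) => 2 ^+ k * z ij.1 ij.2) @^-1`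
    `[(q ij.1 ij.2)%:~R, (q ij.1 ij.2 + 1)%:~R[%classic)).
  apply: fin_bigcap_measurable => // -[i j] _; rewrite -[X in measurable X]setTI.
  have mf : measurable_fun setT (fun z : 'M[R]_(m, n) => 2 ^+ k * z i j).
    by apply: measurable_funM => //; exact: measurable_coord_mx.
  by apply: mf => //; exact: measurable_itv.
apply/seteqP; split => [z zq [i j] _|z zq i j].
  by rewrite /= in_itv/= -zq floor_itv.
by apply: floor_def; have := zq (i, j) I; rewrite /= in_itv.
Qed.

Lemma dcell_nested k l q q' : (k <= l)%N ->
  dcell k q `&` dcell l q' !=set0 -> dcell l q' `<=` dcell k q.
Proof.
move=> kl [z [zq zq']] y yq' i j; rewrite -zq.
apply: (@floor_coarse k (l - k)); rewrite subnKC//.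
by rewrite yq' zq'.
Qed.

Lemma dcell_small k q (z y : 'M[R]_(m, n)) : dcell k q z -> dcell k q y ->
  forall i j, `|z i j - y i j| < 2 ^- k.
Proof.
move=> zq yq i j; have /andP[z1 z2] := floor_itv (2 ^+ k * z i j).
have /andP[y1 y2] := floor_itv (2 ^+ k * y i j).
rewrite yq -zq in y1 y2; rewrite intrD in z2 y2.
rewrite -(@ltr_pM2l _ (2 ^+ k)) ?exprn_gt0// divff ?expf_neq0//.
rewrite -{1}(@ger0_norm _ (2 ^+ k)) ?exprn_ge0// -normrM mulrBr.
by rewrite ltr_norml; lra.
Qed.

Lemma near_half_lt (e : R) : 0 < e -> \forall k \near \oo, 2 ^- k < e.
Proof.
move=> e0; have : (2^-1 : R) ^+ k @[k --> \oo] --> (0 : R).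
  by apply: cvg_expr; rewrite ger0_norm ?invf_lt1 ?ltr1n.
move/cvgrPdist_lt => /(_ _ e0); apply: filterS => k.
by rewrite sub0r normrN exprVn ger0_norm// invr_ge0 exprn_ge0.
Qed.

End dyadic.

(** * Uniqueness of measures that do not charge the diagonal *)

Section off_diagonal.
Context {R : realType} {d n : nat}.
Local Notation M := 'M[R]_(n, d).

Definition distinct_rows (q : 'M[int]_(n, d)) := forall i j, i != j -> row i q != row j q.

(* Cells with distinct rows avoid the diagonal, on which all measures of
   interest vanish. *)
Definition cells : set (set M) :=
  [set A | exists k q, distinct_rows q /\ A = dcell k q] `|`
  [set A | measurable A /\ A `<=` diagonal n].

Lemma cellsI : setI_closed cells.
Proof.
move=> A B [|[mA Ad]]; last first.
  move=> cB; right; split; last by move=> z [/Ad].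
  apply: measurableI => //; case: cB => [[k [q [_ ->]]]|[//]].
  exact: measurable_dcell.
move=> [k [q [dq ->]]] [|[mB Bd]]; last first.
  right; split; last by move=> z [_ /Bd].
  by apply: measurableI => //; exact: measurable_dcell.
move=> [l [q' [dq' ->]]].
have [->|/set0P ne] := eqVneq (dcell k q `&` dcell l q' : set M) set0.
  by right; split.
left; have [kl|/ltnW lk] := leqP k l.
  exists l, q'; split => //; apply/setIidPr; exact: dcell_nested kl ne.
exists k, q; split => //; apply/setIidPl.
by apply: dcell_nested lk _; rewrite setIC.
Qed.

Lemma distinct_near (z : M) : ~ diagonal n z ->
  \forall k \near \oo, distinct_rows (\matrix_(i, j) Num.floor (2 ^+ k * z i j)).
Proof.
move=> nz; suff : \forall k \near \oo, forall ij : 'I_n * 'I_n, ij.1 != ij.2 ->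
    row ij.1 (\matrix_(i, j) Num.floor (2 ^+ k * z i j)) !=
    row ij.2 (\matrix_(i, j) Num.floor (2 ^+ k * z i j)).
  by apply: filterS => k h i j ij; exact: (h (i, j)).
apply: (@filter_forall nat ('I_n * 'I_n)%type (fun ij k => ij.1 != ij.2 ->
    row ij.1 (\matrix_(i, j) Num.floor (2 ^+ k * z i j)) !=
    row ij.2 (\matrix_(i, j) Num.floor (2 ^+ k * z i j))) \oo) => -[i j] /=.
have [->|ij] := eqVneq i j; first exact: nearW.
have [l zl] : exists l, z i l != z j l.
  apply: contrapT => h; apply: nz; exists i, j; split => //.
  apply/rowP => l; rewrite !mxE; apply/eqP; apply: contrapT => /negP hl.
  by apply: h; exists l.
have e0 : 0 < `|z i l - z j l| by rewrite normr_gt0 subr_eq0.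
apply: filterS (near_half_lt e0) => k kz _.
apply/eqP => /rowP/(_ l); rewrite !mxE => fe.
(* Real numbers are viewed as matrices with one entry, so that [dcell_small] applies to a single
   coordinate. *)
pose y (t : R) : 'M[R]_1 := const_mx t.
have := @dcell_small R 1 1 k (const_mx (Num.floor (2 ^+ k * z i l))) (y (z i l)) (y (z j l)).
move=> /(_ _ _ 0 0); rewrite !mxE => h.
suff : `|z i l - z j l| < 2 ^- k by move/(lt_trans kz); rewrite ltxx.
by apply: h => a b; rewrite !mxE.
Qed.

(** A point of an open set off the diagonal lies in a cell with distinct rows contained in that set,
    as soon as the grid is fine enough. Cells are countable in number, and the part of the open set
    on the diagonal is a generator by itself. *)
Lemma cells_generate : @measurable _ M = <<s cells >>.
Proof.
apply/seteqP; split; last first.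
  apply: smallest_sub; first exact: sigma_algebra_measurable.
  by move=> A [[k [q [_ ->]]]|[]//]; exact: measurable_dcell.
apply: smallest_sub; first exact: smallest_sigma_algebra.
move=> O oO.
pose C (p : nat * 'M[int]_(n, d)) : set M :=
  if `[< distinct_rows p.2 /\ dcell p.1 p.2 `<=` O >] then dcell p.1 p.2 else set0.
have c0 : cells set0 by right; split.
(* Index 0 is reserved for the part on the diagonal; the others enumerate the cells. *)
pose F i : set M := if i is j.+1 then
  if (unpickle j : option (nat * 'M[int]_(n, d))) is Some p then C p else set0
  else O `&` diagonal n.
rewrite (_ : O = \bigcup_i F i).
  apply: sigma_algebra_bigcup => -[|i]; apply: sub_sigma_algebra.
    right; split; last exact: subIsetr.
    by apply: measurableI; [exact: open_measurable_mx|exact: measurable_diagonal].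
  rewrite /F; case: unpickle => // p; rewrite /C; case: asboolP => // -[dp _].
  by left; exists p.1, p.2.
apply/seteqP; split => z; last first.
  move=> [[|i] _]; first by case.
  by rewrite /F; case: unpickle => // p; rewrite /C; case: asboolP => // -[_]; exact.
move=> Oz; have [dz|ndz] := pselect (diagonal n z); [by exists 0%N|].
have [e /= e0 eO] := (nbhs_ballP _ _).1 (open_nbhs_nbhs (conj oO Oz)).
have [k _ /(_ k (leqnn k)) [dk ke]] := filterI (distinct_near ndz) (near_half_lt e0).
exists (pickle (k, \matrix_(i, j) Num.floor (2 ^+ k * z i j))).+1 => //.
have zc : dcell k (\matrix_(i, j) Num.floor (2 ^+ k * z i j)) z.
  by move=> i j; rewrite mxE.
rewrite /F pickleK /C /= asboolT//; split => [|y yc]; first exact: dk.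
 apply: eO; split => // i j.
by apply: lt_trans ke; exact: (dcell_small zc yc).
Qed.

(** Agreement is asked on cells with distinct rows only. For those, the position of the points is
    described by one point in each of n disjoint sets, whereas equal rows would require a finer
    count in a single set. *)
Lemma off_diagonal_unique (m1 m2 : {measure set M -> \bar R}) :
  (m1 setT < +oo)%E ->
  m1 (diagonal n) = 0%E -> m2 (diagonal n) = 0%E ->
  (forall k q, distinct_rows q -> m1 (dcell k q) = m2 (dcell k q)) ->
  forall A, measurable A -> m1 A = m2 A.
Proof.
move=> m1fin m10 m20 m12.
pose g i : set M := if (unpickle i : option (nat * 'M[int]_(n, d))) is Some p
  then if `[< distinct_rows p.2 >] then dcell p.1 p.2 else diagonal n
  else diagonal n.
have gc i : cells (g i).
  have cd : cells (diagonal n) by right; split => //; exact: measurable_diagonal.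
  rewrite /g; case: unpickle => // p; case: asboolP => // dp.
  by left; exists p.1, p.2.
apply: (measure_unique cells g) => //.
- exact: cells_generate.
- exact: cellsI.
- apply/seteqP; split => // z _.
  have [dz|ndz] := pselect (diagonal n z).
    (* The diagonal is nonempty here, so there are two different row indices; the zero matrix then
       fails to have distinct rows and its code is sent by [g] to the diagonal. *)
    pose p0 : nat * 'M[int]_(n, d) := (0%N, 0).
    exists (pickle p0); first by [].
    rewrite /g pickleK /=; case: asboolP; last by [].
    move=> d0.
    have [i [j [ij _]]] := dz.
    by have := d0 i j ij; rewrite !raddf0 eqxx.
  have [k _ /(_ k (leqnn k)) dk] := distinct_near ndz.
  exists (pickle (k, \matrix_(i, j) Num.floor (2 ^+ k * z i j))) => //.
  by rewrite /g pickleK /= asboolT// => i j; rewrite mxE.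
- move=> A [[k [q [dq ->]]]|[mA Ad]]; first exact: m12.
  have md := @measurable_diagonal R d n.
  by rewrite (subset_measure0 mA md Ad m10) (subset_measure0 mA md Ad m20).
- move=> k; apply: le_lt_trans m1fin; apply: le_measure; rewrite ?inE//.
  have := gc k => -[[l [q [_ ->]]]|[]//]; exact: measurable_dcell.
Qed.

End off_diagonal.

(** * Powers of a finite measure *)

Section product_measure.
Context {R : realType} {d : nat}.
Local Notation Rd := 'rV[R]_d.
Variable mu : {finite_measure set Rd -> \bar R}.

Fixpoint pmeasure n : {measure set 'M[R]_(n, d) -> \bar R} :=
  if n is n'.+1 then
    image_measure (pmeasure n' \x mu)%E (@measurable_app R d n')
  else dirac (0 : 'M[R]_(0, d)).

Lemma pmeasureS n : pmeasure n.+1 =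
  pushforward (pmeasure n \x mu)%E (fun p => app p.1 p.2) :> (set _ -> \bar R).
Proof. by []. Qed.

Lemma pmeasure_rect n (B : 'I_n -> set Rd) : (forall i, measurable (B i)) ->
  pmeasure n (rect B) = (\prod_(i < n) mu (B i))%E.
Proof.
elim: n B => [|n IH] B mB.
  by rewrite big_ord0 /= diracE mem_set// => -[].
rewrite pmeasureS /pushforward.
rewrite (_ : _ @^-1` _ = rect (B \o lift ord_max) `*` B ord_max).
  have mR : measurable (rect (B \o lift ord_max)).
    by apply: measurable_rect => i; exact: mB.
  rewrite product_measure1E//.
  rewrite IH//; last by move=> i; exact: mB.
  rewrite big_ord_recr/=; congr (_ * _)%E; apply: eq_bigr => i _; congr (mu (B _)).
  by apply/val_inj; exact: lift_max.
apply/seteqP; split => -[z u] /=.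
  move=> h; split; last by have := h ord_max; rewrite row_app_max.
  by move=> i; have := h (lift ord_max i); rewrite row_app_lift.
move=> [h uB] i.
by case: (unliftP ord_max i) => [i' ->|->]; rewrite ?row_app_lift ?row_app_max//; exact: h.
Qed.

Lemma pmeasure_setT n : pmeasure n setT = (fine (mu setT) ^+ n)%:E.
Proof.
rewrite (_ : setT = rect (fun=> setT)); last by apply/seteqP.
rewrite pmeasure_rect//; under eq_bigr do rewrite -(fineK (fin_num_measure mu _ measurableT)).
by rewrite prodEFin prodr_const card_ord.
Qed.

End product_measure.

Lemma mx_entry_le_norm (R : realType) m n (z : 'M[R]_(m, n)) i j : `|z i j| <= `|z|.
Proof.
rewrite leNgt; apply/negP => zz.
have : ball 0 `|z i j| z by rewrite -ball_normE /= sub0r normrN.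
by case=> _ /(_ i j); rewrite /ball/= mxE sub0r normrN ltxx.
Qed.

(** * Partial derivatives of functions vanishing on the boundary *)

Section zero_boundary.
Context {R : realType} {d : nat}.
Local Notation Rd := 'rV[R]_d.
Variables (K : set Rd) (cK : compact K).

Let closedK : closed K.
Proof. exact: compact_closed mx_hausdorff cK. Qed.

Lemma ball_line (x : Rd) k (s t r : R) : 0 < r -> `|s - t| < r ->
  ball (x + s *: delta_mx 0 k) r (x + t *: delta_mx 0 k).
Proof.
move=> r0 st; apply: ball_coord => // j; rewrite !mxE eqxx/=.
by case: (j == k); rewrite ?mulr1 ?mulr0 ?subrr ?normr0// opprD addrACA subrr add0r.
Qed.

(** The delicate points are those of [K] outside the interior: there [h] vanishes, and its
    continuity within [K] makes the nearby values small, while the extension is 0 at the remaining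
    nearby points. *)
Lemma zero_extension_continuous (h : Rd -> R) : {within K, continuous h} ->
  (forall x, K x -> ~ K° x -> h x = 0) ->
  forall x, {for x, continuous (h \_ K°)}.
Proof.
move=> /within_continuousP ch h0 x; apply/continuous_atP => e e0.
have [Kx|nKx] := pselect (K x); last first.
  have [r /= r0 rP] : nbhs_ball x (~` K).
    apply/nbhs_ballP; apply: open_nbhs_nbhs; split => //.
    exact: closed_openC.
  exists r => // y xy; rewrite /patch !memNset ?subrr ?normr0//.
    by move=> /interior_subset Ky; exact: (rP _ xy).
  by move=> /interior_subset.
have [r r0 rP] := ch _ Kx _ e0.
have hx : (h \_ K°) x = h x.
  rewrite /patch; case: ifPn => // /negP xK; rewrite h0//.
  by move=> Kox; apply: xK; exact/mem_set.
have [Kox|nKox] := pselect (K° x).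
  have [s /= s0 sP] : nbhs_ball x K°.
    by apply/nbhs_ballP; apply: open_nbhs_nbhs; split => //; exact: open_interior.
  exists (Num.min r s) => [|y xy]; first by rewrite lt_min r0.
  have Koy : K° y by apply: sP; apply: le_ball xy; rewrite ge_min lexx orbT.
  rewrite hx /patch mem_set//; apply: rP; first exact: interior_subset.
  by apply: le_ball xy; rewrite ge_min lexx.
exists r => // y xy; rewrite hx h0// /patch; case: ifPn => [/set_mem Koy|_].
  by rewrite -(h0 x Kx nKox); apply: rP => //; exact: interior_subset.
by rewrite subrr normr0.
Qed.

(** The divergence theorem in the only form required, one coordinate at a time. On each line of
    direction [k] the interior leaves a bounded open trace, and the zero extension of [h] is
    continuous along the line and vanishes off the trace. *)
Lemma integral_partial0 (h : Rd -> R) k : C1_on K h -> K `<=` closure K° ->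
  (forall x, frontier K x -> h x = 0) ->
  (\int[leb]_(x in K°) (partial K 0 k h x)%:E = 0)%E.
Proof.
move=> C1h regK h0; have [ch oh cp] := C1h.
have mKo : measurable K° by apply: open_measurable_mx; exact: open_interior.
have mK := compact_measurable_mx cK.
have bK := compact_bounded cK.
have [M M0 pM] := within_continuous_bounded cK (cp 0 k).
have Kfin : (leb K < +oo)%E by exact: leb_bounded_fin.
have Kofin : (leb K° < +oo)%E.
  apply: le_lt_trans Kfin; apply: le_measure; rewrite ?inE//.
  exact: interior_subset.
have hz x : {for x, continuous (h \_ K°)}.
  apply: zero_extension_continuous => // y Ky nKoy; apply: h0.
  by split => //; exact: subset_closure.
rewrite integral_mkcond; apply: (leb_slice0 (i := 0) (j := k)).
  apply/(integrable_mkcond _ _).1 => //.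
  apply: (bounded_integrable (M := M)) => //; last first.
    by move=> x Kx; apply: pM; exact: interior_subset.
  apply: (measurable_funS mK) => //; first exact: interior_subset.
  exact: within_continuous_measurable.
move=> x; pose l (t : R) : Rd := x + t *: delta_mx 0 k.
pose O := [set t | K° (l t)].
have lball s t r : 0 < r -> `|s - t| < r -> ball (l s) r (l t) by exact: ball_line.
have oO : open O.
  rewrite openE => t Ot; have [s /= s0 sP] : nbhs_ball (l t) K°.
    by apply/nbhs_ballP; apply: open_nbhs_nbhs; split => //; exact: open_interior.
  by apply/nbhs_ballP; exists s; [exact: s0|move=> u tu]; exact: sP (lball _ _ _ s0 tu).
rewrite (_ : (fun t => _) = (fun t => ((fun t => (partial K 0 k h (l t))%:E) \_ O) t)); last first.
  apply/funext => t; rewrite /patch -/(l t).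
  by case: ifPn.
rewrite -integral_mkcond.
have [B BP] : exists B, forall t, O t -> `|t| <= B.
  have [B [_ hB]] := bK; exists (`|x 0 k| + (`|B| + 1)) => t Ot.
  have hl : `|l t| <= `|B| + 1.
    apply: hB; last exact: interior_subset Ot.
    by rewrite (le_lt_trans (ler_norm B))// ltrDl.
  have : `|l t 0 k| <= `|B| + 1.
    by apply: le_trans hl; exact: mx_entry_le_norm.
  rewrite /l !mxE !eqxx mulr1 => xt.
  have := ler_normB (x 0 k + t) (x 0 k); rewrite addrC addKr; lra.
apply: (@integral_derive_open _ O (fun t => (h \_ K°) (l t)) _ M B) => //.
- move=> t; apply/cvgrPdist_lt => e e0.
  have [r r0 rP] := (continuous_atP _ _).1 (hz (l t)) e e0.
  by apply/nbhs_ballP; exists r => // s ts; apply: rP; exact: lball.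
- by move=> t nOt; rewrite /patch memNset.
- move=> t Ot.
  have hE : \forall s \near t, h (l s) = (h \_ K°) (l s).
    have : nbhs t O by apply: open_nbhs_nbhs.
    by apply: filterS => s Os; rewrite /patch mem_set.
  have [dh cD] := oh 0 k _ Ot.
  have dl := (derive_lineP h x (delta_mx 0 k) t).1.2 dh.
  split.
  + by apply: near_eq_derivable dl; rewrite ?oner_eq0.
  + rewrite -(near_eq_derive _ hE) (derive_lineP h x (delta_mx 0 k) t).2.
    by rewrite partial_interior.
  + apply/cvgrPdist_lt => e e0.
    have [r r0 rP] := (within_continuousP _ _).1 (cp 0 k) _ (interior_subset Ot) e e0.
    have nO : nbhs t O by apply: open_nbhs_nbhs.
    have nr : \forall s \near t, ball t r s by exact: nbhsx_ballx.
    apply: filterS2 nO nr => s Os ts.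
    by apply: rP; [exact: interior_subset|exact: lball].
  + by apply: pM; exact: interior_subset.
Qed.

End zero_boundary.

(** * Interior and slices of powers of the window *)

Section window_power.
Context {R : realType} {d : nat}.
Local Notation Rd := 'rV[R]_d.
Variables (W : set Rd).

Lemma ball_app n (z : 'M[R]_(n, d)) (u v : Rd) r : 0 < r ->
  ball (app z u) r (app z v) <-> ball u r v.
Proof.
move=> r0; split => -[_ h]; split => // i j.
  by have := h ord_max j; rewrite !mxE unlift_none ord1.
by rewrite !mxE; case: unlift => [i'|]; [exact: ballxx|exact: h].
Qed.

Lemma Wpow_interior n : Wpow W° n `<=` (Wpow W n)°.
Proof.
move=> z Wz; have : \forall y \near z, forall i, W° (row i y).
  apply: (@filter_forall 'M[R]_(n, d) 'I_n (fun i y => W° (row i y)) (nbhs z)) => i.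
  have [r /= r0 rP] : nbhs_ball (row i z) W°.
    by apply/nbhs_ballP; apply: open_nbhs_nbhs; split => //; exact: open_interior.
  apply/nbhs_ballP; exists r => // y [_ zy]; apply: rP; split => // k j.
  by rewrite !mxE; exact: zy.
by apply: filterS => y Wy i; exact: interior_subset.
Qed.

Lemma Wpow_regular n : W `<=` closure W° -> Wpow W n `<=` closure (Wpow W n)°.
Proof.
move=> regW z Wz A /nbhs_ballP[r /= r0 rA].
have yP i : exists y, W° y /\ ball (row i z) r y.
  by have [y [? ?]] := regW _ (Wz i) _ (nbhsx_ballx _ _ r0); exists y.
pose y : 'M[R]_(n, d) := \matrix_(i, j) sval (cid (yP i)) 0 j.
have ry i : row i y = sval (cid (yP i)) by apply/rowP => j; rewrite !mxE.
exists y; split.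
  by apply: Wpow_interior => i; rewrite ry; case: cid => /= ? [].
apply: rA; split => // i j; have [_ [_ h]] := svalP (cid (yP i)).
by have := h 0 j; rewrite !mxE.
Qed.

Lemma C1_on_slice n (f : 'M[R]_(n.+1, d) -> R) (z : 'M[R]_(n, d)) :
  W `<=` closure W° -> C1_on (Wpow W n.+1) f -> Wpow W° n z ->
  C1_on W (fun u => f (app z u)) /\ forall i k u, W u ->
    partial W i k (fun u => f (app z u)) u =
    partial (Wpow W n.+1) ord_max k f (app z u).
Proof.
move=> regW C1f Wz; have [cf of_ cp] := C1f.
have Wz' : Wpow W n z by move=> i; exact: interior_subset.
have regn := @Wpow_regular n.+1 regW.
have compc (g : 'M[R]_(n.+1, d) -> R) : {within Wpow W n.+1, continuous g} ->
    {within W, continuous (fun u => g (app z u))}.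
  move=> /within_continuousP cg; apply/within_continuousP => u Wu e e0.
  have [r r0 rP] := cg (app z u) ((Wpow_app _ _ _).2 (conj Wz' Wu)) e e0.
  exists r => // v Wv uv; apply: rP; first exact/Wpow_app.
  exact/ball_app.
have appi u : W° u -> (Wpow W n.+1)° (app z u).
  by move=> Wu; apply: Wpow_interior; exact/Wpow_app.
have appD (u : Rd) k (t : R) : app z (t *: delta_mx 0 k + u) =
    t *: delta_mx ord_max k + app z u.
  apply/matrixP => i j; rewrite !mxE; case: (unliftP ord_max i) => [i' ->|->].
    by rewrite [_ == ord_max]eq_sym (negbTE (neq_lift _ _)) mulr0 add0r.
  by rewrite !eqxx.
have dE k u : (derivable (fun v => f (app z v)) u (delta_mx 0 k) <->
     derivable f (app z u) (delta_mx ord_max k)) /\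
    'D_(delta_mx 0 k) (fun v => f (app z v)) u = 'D_(delta_mx ord_max k) f (app z u).
  rewrite /derivable /derive.
  suff -> : (fun h : R => h^-1 *: (f (app z (h *: delta_mx 0 k + u)) - f (app z u))) =
    (fun h : R => h^-1 *: (f (h *: delta_mx ord_max k + app z u) - f (app z u))) by [].
  by apply/funext => h; rewrite appD.
apply: (C1_on_intro regW (p := fun i k u => partial (Wpow W n.+1) ord_max k f (app z u))).
- exact: compc.
- move=> i k u Wu; rewrite ord1; apply/(dE k u).1.
  by have [] := of_ ord_max k _ (appi _ Wu).
- move=> i k u Wu; rewrite ord1 (dE k u).2.
  by rewrite -(partial_interior regn ord_max k of_ (appi _ Wu)).
- by move=> i k; exact: compc (cp ord_max k).
Qed.

End window_power.

(** * Law of a Poisson process in a window *)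

Lemma measure_bigcup_finType d (T : measurableType d) (R : realType)
    (mu : {measure set T -> \bar R}) (I : finType) (F : I -> set T) :
  (forall i, measurable (F i)) -> trivIset setT F ->
  mu (\bigcup_i F i) = (\sum_i mu (F i))%E.
Proof.
move=> mF tF; rewrite measure_fin_bigcup//.
rewrite (fsbigE (index_enum I)) ?index_enum_uniq//.
- by rewrite big_mkcond/=; apply: eq_bigr => i _; rewrite in_setT.
- by move=> i _; rewrite mem_index_enum.
- exact: finite_finset.
Qed.

Lemma integral_mrestr d (T : measurableType d) (R : realType)
    (mu : {measure set T -> \bar R}) (D : set T) (mD : measurable D)
    (f : T -> \bar R) : measurable_fun setT f ->
  (\int[mrestr mu mD]_x f x = \int[mu]_(x in D) f x)%E.
Proof.
have ge0 (g : T -> \bar R) : measurable_fun setT g -> (forall x, 0 <= g x)%E ->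
    (\int[mrestr mu mD]_x g x = \int[mu]_(x in D) g x)%E.
  move=> mg g0.
  have N0 : mrestr mu mD (~` D) = 0%E by rewrite /mrestr setICl measure0.
  rewrite (@ge0_negligible_integral _ _ _ (mrestr mu mD) setT (~` D))//; last exact: measurableC.
  rewrite setTD setCK; apply: eq_measure_integral => A mA AD.
  by rewrite /= /mrestr setIidl.
move=> mf; rewrite [LHS]integralE [RHS]integralE.
by rewrite (ge0 _ (measurable_funepos mf) (funepos_ge0 f)) (ge0 _ (measurable_funeneg mf) (funeneg_ge0 f)).
Qed.

Section diagonal_null.
Context {R : realType} {d : nat}.
Variable mu : {finite_measure set 'rV[R]_d -> \bar R}.
Hypothesis mu1 : forall u, mu [set u] = 0%E.

(** By induction: either two of the first n points coincide, or the last one equals one of them, and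
    for fixed first points this leaves finitely many positions, each of measure 0. *)
Lemma pmeasure_diagonal n : pmeasure mu n (diagonal n) = 0%E.
Proof.
have m1 (u : 'rV[R]_d) : measurable [set u].
  by apply: compact_measurable_mx; exact: compact_set1.
elim: n => [|n IH].
  rewrite (_ : diagonal 0 = set0) ?measure0// -subset0 => z [[]]//.
pose A (i : 'I_n) : set ('M[R]_(n, d) * 'rV[R]_d) := [set p | row i p.1 = p.2].
have mA i : measurable (A i).
  rewrite (_ : A i = \bigcap_(k in [set: 'I_d])
      ((fun p : 'M[R]_(n, d) * 'rV[R]_d => p.1 i k - p.2 0 k) @^-1` [set 0])).
    apply: fin_bigcap_measurable => // k _; rewrite -[X in measurable X]setTI.
    suff : measurable_fun setT
      (fun p : 'M[R]_(n, d) * 'rV[R]_d => p.1 i k - p.2 0 k) by exact.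
    apply: measurable_funB.
      exact: (measurableT_comp (measurable_coord_mx i k) measurable_fst).
    exact: (measurableT_comp (measurable_coord_mx 0 k) measurable_snd).
  apply/seteqP; split => [[z u] zu k _ /=|[z u] zu].
    have <- : row i z = u := zu.
    by rewrite !mxE subrr.
  by apply/rowP => k; have := zu k I; rewrite !mxE /= => /subr0_eq.
have A0 i : (pmeasure mu n \x mu)%E (A i) = 0%E.
  rewrite /product_measure1 /= (_ : (fun _ => _) = cst 0%E) ?integral_cst ?mul0e//.
  apply/funext => z /=; rewrite (_ : xsection _ _ = [set row i z]) ?mu1//.
  by apply/seteqP; split => u; rewrite /xsection/= inE /A /=; [move=> ->|move=> ->].
rewrite pmeasureS /pushforward.
have mD : measurable (@diagonal R d n `*` [set: 'rV[R]_d]).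
  by apply: measurableX => //; exact: measurable_diagonal.
have mAs : measurable (\bigcup_i A i) by apply: fin_bigcup_measurable.
apply: (@subset_measure0 _ _ _ (pmeasure mu n \x mu)%E _
   ((@diagonal R d n `*` setT) `|` \bigcup_i A i)).
- rewrite -[X in measurable X]setTI; apply: measurable_app => //.
  exact: measurable_diagonal.
- exact: measurableU.
- move=> [z u] /= [i [j [ij]]].
  case: (unliftP ord_max i) ij => [i' ->|->]; case: (unliftP ord_max j) => [j' ->|->].
  + rewrite !row_app_lift => ij zij; left; split => //; exists i', j'; split => //.
    by apply: contra_neq ij => ->.
  + by rewrite row_app_lift row_app_max => _ zu; right; exists i'.
  + by rewrite row_app_lift row_app_max => _ zu; right; exists j'.
  + by rewrite eqxx.
transitivity ((pmeasure mu n \x mu)%E (@diagonal R d n `*` [set: 'rV[R]_d])).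
  apply: measureU0 => //.
  pose A' k : set ('M[R]_(n, d) * 'rV[R]_d) := if insub k is Some i then A i else set0.
  have A'0 : (pmeasure mu n \x mu)%E.-negligible (\bigcup_k A' k).
    apply: negligible_bigcup => k; rewrite /A'; case: insubP => [i _ _|_].
      by exists (A i); split => //; exact: A0.
    exact: negligible_set0.
  apply/negligibleP => //; apply: negligibleS A'0.
  by move=> p [i _ Aip]; exists (val i) => //; rewrite /A' valK.
rewrite product_measure1E//; last exact: measurable_diagonal.
by rewrite [X in (X * _)%E](IH) mul0e.
Qed.

End diagonal_null.

Section poisson.
Context {R : realType} {d : nat} (d_gt0 : (0 < d)%N).
Local Notation Rd := 'rV[R]_d.
Variables (W : set Rd) (cW : compact W) (C2W : C2_boundary W).
Context {dT : measure_display} {T : measurableType dT}.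
Variables (P : probability T R) (theta : R) (theta_gt0 : 0 < theta).
Variables (X : T -> set Rd) (poisX : poisson_process P theta X).
Local Notation FW := (F_W_type X W).

Lemma bounded_window : bounded_set W.
Proof. exact: compact_bounded. Qed.

Lemma measurable_window : measurable W.
Proof. exact: compact_measurable_mx. Qed.

Lemma measurable_interior : measurable W°.
Proof. by apply: open_measurable_mx; exact: open_interior. Qed.

Lemma window_fin : (leb W < +oo)%E.
Proof. exact: leb_bounded_fin measurable_window bounded_window. Qed.

Lemma finite_window w : finite_set (X w `&` W).
Proof. by have [h _ _ _] := poisX; apply: h; exact: bounded_window. Qed.

Lemma bounded_sub B : B `<=` W -> bounded_set B.
Proof.
have [M [Mr hM]] := bounded_window.
by move=> BW; exists M; split => // x /hM h y /BW /h.
Qed.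

Lemma leb_sub_fin B : measurable B -> B `<=` W -> (leb B < +oo)%E.
Proof.
by move=> mB BW; apply: leb_bounded_fin mB _; exact: bounded_sub.
Qed.

Lemma leb_interior B : measurable B -> leb (B `&` W°) = leb (B `&` W).
Proof.
move=> mB; have mW := measurable_window; have mWo := measurable_interior.
have -> : B `&` W = (B `&` W°) `|` (B `&` (W `\` W°)).
  apply/seteqP; split => [x [Bx Wx]|x [[Bx Wx]|[Bx [Wx _]]]].
  - by have [?|?] := pselect (W° x); [left|right].
  - by split => //; exact: interior_subset.
  - by [].
have mF : measurable (B `&` (W `\` W°)).
  by apply: measurableI => //; exact: measurableD.
rewrite measureU0//; first exact: measurableI.
apply: (subset_measure0 mF _ _ (frontier_null cW C2W)).
  exact: compact_measurable_mx (compact_frontier cW).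
by move=> x [_ [Wx nWx]]; split => //; exact: subset_closure.
Qed.

Lemma interior_fin : (leb W° < +oo)%E.
Proof. by apply: leb_sub_fin; [exact: measurable_interior|exact: interior_subset]. Qed.

(* Lebesgue measure on the window, carried by its interior since the boundary
   is null. *)
Definition wmeas : {finite_measure set Rd -> \bar R} :=
  mfrestr measurable_interior interior_fin.

Lemma wmeasE B : wmeas B = leb (B `&` W°).
Proof. by []. Qed.

Lemma wmeas_leb B : measurable B -> wmeas B = leb (B `&` W).
Proof. exact: leb_interior. Qed.

(** A coordinate direction is required, hence [d > 0]: in dimension 0 Lebesgue measure is the unit
    mass at the only point. *)
Lemma leb_set1 (u : Rd) : leb [set u] = 0%E.
Proof.
have m1 : measurable [set u].
  by apply: compact_measurable_mx; exact: compact_set1.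
have f1 : (leb [set u] < +oo)%E.
  apply: leb_bounded_fin => //.
  by apply: compact_bounded; exact: compact_set1.
have <- : (\int[leb]_x (\1_[set u] x)%:E = leb [set u])%E.
  by rewrite integral_indic// setIT.
pose k : 'I_d := Ordinal d_gt0.
apply: (leb_slice0 (i := 0) (j := k)); first exact: integrable_indic_fin.
move=> x; pose S := [set t : R | x + t *: delta_mx 0 k = u].
have NS t : ((x + t *: delta_mx 0 k) \in [set u]) = (t \in S).
  by apply/idP/idP => /set_mem h; apply/mem_set.
under eq_integral do rewrite indicE NS -indicE.
have [->|/set0P[t St]] := eqVneq S set0.
  by rewrite integral_indic// set0I measure0.
have -> : S = [set t].
  apply/seteqP; split => [s Ss|_ -> //].
  have : x + s *: delta_mx 0 k = x + t *: delta_mx 0 k by rewrite Ss.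
  by move=> /addrI /rowP/(_ k); rewrite !mxE !eqxx !mulr1.
by rewrite integral_indic// setIT; exact: lebesgue_measure_set1.
Qed.

Lemma FW_measurable (A : set T) : measurable (A : set FW) -> measurable A.
Proof.
apply: smallest_sub; first exact: sigma_algebra_measurable.
have [_ h _ _] := poisX.
by move=> _ [B [k [mB BW ->]]]; apply: h => //; exact: bounded_sub.
Qed.

Lemma FW_measurable_fun d' (U : measurableType d') (f : T -> U) :
  measurable_fun setT (f : FW -> U) -> measurable_fun setT f.
Proof.
move=> mf _ Y mY; rewrite setTI; apply: FW_measurable.
by rewrite -[X in measurable X]setTI; exact: mf.
Qed.

Definition rate : R := theta * fine (leb W).

Lemma prob_count n :
  P [set w | count X W w = n] = (rate ^+ n / n`!%:R * expR (- rate))%:E.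
Proof.
have [_ _ h _] := poisX.
by rewrite h//; [exact: measurable_window|exact: bounded_window].
Qed.

Lemma measurable_countW n : measurable [set w | count X W w = n].
Proof.
have [_ h _ _] := poisX; apply: h; first exact: measurable_window.
exact: bounded_window.
Qed.

Lemma bigcup_count : setT = \bigcup_n [set w | count X W w = n].
Proof. by apply/seteqP; split => // w _; exists (count X W w). Qed.

Lemma trivIset_count : trivIset setT (fun n => [set w | count X W w = n]).
Proof. by move=> i j _ _ [w [/= <- <-]]. Qed.

Lemma measurable_count_fun (f : nat -> R) :
  measurable_fun setT (fun w => f (count X W w)).
Proof.
rewrite bigcup_count; apply/measurable_fun_bigcup => n.
  exact: measurable_countW.
by apply: (eq_measurable_fun (cst (f n))) => // w; rewrite inE => /= ->.
Qed.

(** Against the Poisson weights, the powers of [C] sum to an exponential series. Since form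
    functions, their gradients and finite sums of these grow at most exponentially with the number
    of points, this is the source of all integrability below. *)
Lemma integral_count_pow (C : R) : 0 <= C ->
  (\int[P]_w (C ^+ count X W w)%:E < +oo)%E.
Proof.
move=> C0; rewrite bigcup_count ge0_integral_bigcup//=; last 4 first.
- by move=> n; exact: measurable_countW.
- by rewrite -bigcup_count; apply/measurable_EFinP; exact: measurable_count_fun.
- by move=> w _; rewrite lee_fin exprn_ge0.
- exact: trivIset_count.
have e n : (\int[P]_(w in [set w | count X W w = n]) (C ^+ count X W w)%:E =
    (expR (- rate) * exp_coeff (C * rate) n)%:E)%E.
  rewrite (eq_integral (cst (C ^+ n)%:E)); last first.
    by move=> w; rewrite inE => /= ->.
  rewrite integral_cst; last exact: measurable_countW.
  transitivity ((C ^+ n)%:E * (rate ^+ n / n`!%:R * expR (- rate))%:E)%E.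
    by congr (_ * _)%E; exact: prob_count.
  rewrite -EFinM; congr EFin; rewrite /exp_coeff/= [(C * rate) ^+ n]exprMn.
  by rewrite [RHS]mulrC !mulrA.
under eq_eseriesr do rewrite e.
have c : cvgn (series (fun n => expR (- rate) * exp_coeff (C * rate) n)).
  by apply: is_cvg_seriesZ; exact: is_cvg_series_exp_coeff.
rewrite (_ : (fun n => _) = EFin \o
   series (fun n => expR (- rate) * exp_coeff (C * rate) n)).
  by rewrite EFin_lim// ltry.
by apply/funext => n /=; rewrite /series/= sumEFin.
Qed.

Lemma integrable_growth (F : T -> R) (A C : R) : 0 <= C ->
  measurable_fun setT F -> (forall w, `|F w| <= A * C ^+ count X W w) ->
  P.-integrable setT (EFin \o F).
Proof.
move=> C0 mF FC.
apply: (@le_integrable _ _ _ _ _ _ _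
  (fun w => (A * C ^+ count X W w)%:E)) => //.
- exact/measurable_EFinP.
- by move=> w _; rewrite lee_fin (le_trans (FC w))// ler_norm.
rewrite (_ : (fun w => _) = (fun w => A%:E * (C ^+ count X W w)%:E)%E)//.
apply: integrableZl => //; apply/integrableP; split.
  by apply/measurable_EFinP; exact: measurable_count_fun.
under eq_integral do rewrite gee0_abs ?lee_fin ?exprn_ge0//.
exact: integral_count_pow.
Qed.

Lemma countE B w : B `<=` W ->
  count X B w = (\sum_(u <- points X W w) (u \in B))%N.
Proof.
move=> BW; have finX := finite_window.
have p : perm_eq (points X B w) [seq u <- points X W w | u \in B].
  apply: uniq_perm; rewrite ?filter_uniq ?uniq_points// => u.
  rewrite mem_filter (mem_points finX w u BW) (mem_points finX w u (@subset_refl _ W)).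
  by rewrite !in_setI; case: (boolP (u \in B)); rewrite ?andbF ?andbT//= => /set_mem/BW/mem_set ->; rewrite andbT.
by rewrite /Defs.count (perm_size p) size_filter -sum1_count big_mkcond.
Qed.

Lemma count_partition p (B : 'I_p -> set Rd) w : trivIset setT B ->
  \bigcup_i B i = W -> count X W w = (\sum_i count X (B i) w)%N.
Proof.
move=> tB BW; have BiW i : B i `<=` W by rewrite -BW; exact: bigcup_sup.
under eq_bigr do rewrite countE//.
rewrite exchange_big/= countE// !big_seq; apply: eq_bigr => u.
rewrite (mem_points finite_window w u (@subset_refl _ W)).
rewrite in_setI => /andP[_ uW]; rewrite uW.
have := set_mem uW; rewrite -BW => -[i _ Biu].
rewrite (bigD1 i)//= mem_set// big1 ?addn0// => j ji.
case: (boolP (u \in B j)) => // /set_mem Bju.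
by exfalso; move/eqP: ji; apply; apply: (tB j i) => //; exists u.
Qed.

Section isolated_cells.
Variables (n k : nat) (q : 'M[int]_(n, d)).
Hypothesis dq : distinct_rows q.

Let C (i : 'I_n) : set Rd := dcell k (row i q).

Let mC i : measurable (W `&` C i).
Proof. by apply: measurableI; [exact: measurable_window|exact: measurable_dcell]. Qed.

Let tC i j u : C i u -> C j u -> i = j.
Proof.
move=> iu ju; apply/eqP; apply: contrapT => /negP ij.
have /eqP := dq ij; apply; apply/rowP => l.
by have := iu 0 l; have := ju 0 l; rewrite /= => -> ->.
Qed.

Definition isolated : set T := [set w | count X W w = n /\
  forall i, count X (W `&` C i) w = 1%N].

(** The n cells inside the window together with the remainder of the window, placed at index
    [ord_max], form a partition; independence of counts applies to the requirement of one point in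
    each cell and none in the remainder. *)
Let Bp (i : 'I_n.+1) : set Rd :=
  if unlift ord_max i is Some i' then W `&` C i' else W `\` \bigcup_i C i.

Let kp (i : 'I_n.+1) : nat := if unlift ord_max i is Some _ then 1%N else 0%N.

Let mBp i : measurable (Bp i).
Proof.
rewrite /Bp; case: unlift => [i'|]; first exact: mC.
apply: measurableD; first exact: measurable_window.
by apply: fin_bigcup_measurable => // j _; exact: measurable_dcell.
Qed.

Let BpW i : Bp i `<=` W.
Proof. by rewrite /Bp; case: unlift => [i'|]; [exact: subIsetl|move=> u []]. Qed.

Let tBp : trivIset setT Bp.
Proof.
move=> i j _ _ [u []]; rewrite /Bp.
case: (unliftP ord_max i) => [i' ->|->]; case: (unliftP ord_max j) => [j' ->|->]//.
- by move=> [_ iu] [_ ju]; rewrite (tC iu ju).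
- by move=> [_ iu] [_ []]; exists i'.
- by move=> [_ nu] [_ ju]; exfalso; apply: nu; exists j'.
Qed.

Let cBp : \bigcup_i Bp i = W.
Proof.
apply/seteqP; split => [u [i _ /BpW]//|u Wu].
have [[i _ iu]|nu] := pselect ((\bigcup_i C i) u).
  by exists (lift ord_max i) => //; rewrite /Bp liftK.
by exists ord_max => //; rewrite /Bp unlift_none.
Qed.

Let lift_widen (i : 'I_n) : widen_ord (leqnSn n) i = lift ord_max i.
Proof. by apply/val_inj; exact/esym/lift_max. Qed.

Lemma isolatedE : isolated = [set w | forall i, count X (Bp i) w = kp i].
Proof.
apply/seteqP; split => w /=.
  move=> [wn c1] i; rewrite /Bp /kp.
  case: (unliftP ord_max i) => [i' _|_]; first exact: c1.
  have := count_partition w tBp cBp; rewrite wn big_ord_recr/=.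
  rewrite (eq_bigr (fun=> 1%N)); last first.
    by move=> j _; rewrite lift_widen /Bp liftK c1.
  rewrite sum_nat_const card_ord muln1 /Bp unlift_none.
  by rewrite -[LHS]addn0 => /addnI <-.
move=> h; have c1 i : count X (W `&` C i) w = 1%N.
  by have := h (lift ord_max i); rewrite /Bp /kp liftK.
split => //; rewrite (count_partition w tBp cBp) big_ord_recr/= h /kp unlift_none addn0.
rewrite (eq_bigr (fun=> 1%N)); last by move=> j _; rewrite lift_widen /Bp liftK c1.
by rewrite sum_nat_const card_ord muln1.
Qed.

(** A product of n Poisson probabilities of the value 1 and one of the value 0; the measures of the
    sets of the partition add up, so the exponentials combine into [expR (- rate)]. *)
Lemma prob_isolated : P isolated =
  (theta ^+ n * expR (- rate) * \prod_i fine (wmeas (C i)))%:E.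
Proof.
have [_ _ hP hI] := poisX; rewrite isolatedE hI//; last first.
  by move=> i; split; [exact: mBp|apply: bounded_sub; exact: BpW].
pose r i := theta * fine (leb (Bp i)).
have bBp i : bounded_set (Bp i) by apply: bounded_sub; exact: BpW.
rewrite (eq_bigr (fun i => (r i ^+ kp i / (kp i)`!%:R * expR (- r i))%:E)); last first.
  by move=> i _; exact: (hP _ _ (mBp i) (bBp i)).
rewrite prodEFin; congr EFin; rewrite big_split/= -expR_sum.
have -> : \sum_i - r i = - rate.
  rewrite sumrN; congr (- _); rewrite /rate -mulr_sumr; congr (_ * _).
  rewrite -cBp (measure_bigcup_finType _ mBp tBp).
  rewrite (eq_bigr (fun i => (fine (leb (Bp i)))%:E)).
    by rewrite sumEFin.
  move=> i _; rewrite fineK// ge0_fin_numE//.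
  by apply: leb_sub_fin; [exact: mBp|exact: BpW].
have kmax : kp ord_max = 0%N by rewrite /kp unlift_none.
rewrite big_ord_recr kmax [RHS]mulrAC; congr (_ * _).
rewrite [X in _ * X = _](_ : _ = 1) ?mulr1; last by rewrite expr0 fact0 divr1.
rewrite (eq_bigr (fun i => theta * fine (wmeas (C i)))).
  by rewrite big_split/= prodr_const card_ord.
move=> i _; rewrite lift_widen /kp liftK expr1 divr1 /r /Bp liftK.
congr (theta * fine _); transitivity (leb (C i `&` W)); last first.
  by symmetry; apply: wmeas_leb; exact: measurable_dcell.
by congr (leb _); exact: setIC.
Qed.

End isolated_cells.

Lemma xi_row_inj n w i j : count X W w = n ->
  row i (xi X W n w) = row j (xi X W n w) -> i = j.
Proof.
move=> wn; have [s ->] := xi_perm finite_window wn.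
have rs k : row k (row_perm s (Xn X W n w)) = nth 0 (points X W w) (s k).
  by apply/rowP => l; rewrite !mxE.
rewrite !rs => /eqP; rewrite nth_uniq ?uniq_points// -/(count X W w) ?wn//.
by move=> /eqP/val_inj/perm_inj.
Qed.

(** The bridge between the event, expressed by counts, and the enumeration: the rows of [q] being
    distinct, the n cells are disjoint and the points can be matched with them in one way only. *)
Lemma isolated_perm n k q w : distinct_rows q -> count X W w = n ->
  (isolated k q w <-> exists s : 'S_n, dcell k q (row_perm s (xi X W n w))).
Proof.
move=> dq wn; set z := xi X W n w.
have finX := finite_window.
have cE i (u : Rd) : dcell k (row i q) u <-> forall j, Num.floor (2 ^+ k * u 0 j) = q i j.
  split => [h j|h a j]; first by have := h 0 j; rewrite mxE.
  by rewrite ord1 mxE.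
have rW i : (X w `&` W) (row i z).
  have [s zE] := xi_perm finX wn; rewrite /z zE.
  have -> : row i (row_perm s (Xn X W n w)) = nth 0 (points X W w) (s i).
    by apply/rowP => j; rewrite !mxE.
  apply/set_mem; rewrite -(mem_points finX w _ (@subset_refl _ W)).
  by apply: mem_nth; rewrite -/(count X W w) wn.
have rall u : (X w `&` W) u -> exists i, u = row i z.
  move=> /mem_set; rewrite -(mem_points finX w _ (@subset_refl _ W)).
  move=> /(nthP 0)[a]; rewrite -/(count X W w) wn => an <-.
  have [s zE] := xi_perm finX wn; exists ((s^-1)%g (Ordinal an)).
  by apply/rowP => j; rewrite /z zE !mxE permKV.
split => [[_ c1]|[s sq]].
  have fP i : exists j, dcell k (row i q) (row j z).
    have e := count_le1P finX (@subIsetl _ W _) (c1 i).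
    set u := nth _ _ _ in e; have [Xu [Wu cu]] : (X w `&` (W `&` dcell k (row i q))) u.
      by rewrite e.
    by have [j uj] := rall u (conj Xu Wu); exists j; rewrite -uj.
  pose f i := sval (cid (fP i)).
  have fq i : dcell k (row i q) (row (f i) z) by rewrite /f; case: cid.
  have f_inj : injective f.
    move=> i j fij; apply/eqP; apply: contrapT => /negP ij.
    have /eqP := dq i j ij; apply; apply/rowP => l; rewrite !mxE.
    have /cE/(_ l) <- := fq i; have /cE/(_ l) <- := fq j.
    by rewrite fij.
  exists (perm f_inj) => i j; rewrite !mxE permE.
  by have /cE/(_ j) := fq i; rewrite mxE.
split => // i; apply: (@count_set1 _ _ _ _ X _ _ (row (s i) z)).
apply/seteqP; split => [u [Xu [Wu cu]]|_ ->]; last first.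
  have [Xu Wu] := rW (s i); split => //; split => //; apply/cE => j.
  by have := sq i j; rewrite !mxE.
have [j uj] := rall u (conj Xu Wu); rewrite /= uj; congr (row _ z).
rewrite -(permKV s j); congr (s _); apply/eqP; apply: contrapT => /negP ij.
have /eqP := dq _ _ ij; apply; apply/rowP => l; rewrite !mxE.
have := sq ((s^-1)%g j) l; rewrite !mxE permKV => <-.
by have /cE/(_ l) := cu; rewrite uj mxE => ->.
Qed.

Let Ev n : set T := [set w | count X W w = n].

Let permxi n (k : nat) (w : T) : 'M[R]_(n, d) :=
  row_perm (nth 1%g (enum 'S_n) k) (xi X W n w).

Let measurable_xiT n : measurable_fun setT (xi X W n : T -> 'M[R]_(n, d)).
Proof. by apply: FW_measurable_fun; apply: measurable_xi; [exact: measurable_window|exact: finite_window]. Qed.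

Let measurable_permxi n k : measurable_fun setT (permxi n k).
Proof.
exact: (measurableT_comp (measurable_row_perm _) (@measurable_xiT n)).
Qed.

Let m_ n k : {measure set 'M[R]_(n, d) -> \bar R} :=
  image_measure (mrestr P (measurable_countW n)) (@measurable_permxi n k).

(** The law of [xi] on the event of n points, summed over all rearrangements and not divided by
    their number. The sum no longer depends on how the enumeration orders the points. *)
Let symlaw n : {measure set 'M[R]_(n, d) -> \bar R} := msum (m_ n) #|'S_n|.

Lemma sum_enum_perm n (F : 'S_n -> \bar R) :
  (\sum_(k < #|'S_n|) F (nth 1%g (enum 'S_n) k) = \sum_s F s)%E.
Proof.
rewrite -(big_mkord xpredT (fun k => F (nth 1%g (enum 'S_n) k))).
by rewrite cardE -(big_nth 1%g xpredT F) big_enum.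
Qed.

Lemma symlawE n A : symlaw n A =
  (\sum_s P ((fun w => row_perm s (xi X W n w)) @^-1` A `&` Ev n))%E.
Proof. by rewrite -sum_enum_perm. Qed.

Let law_const n : {nonneg R} :=
  NngNum (mulr_ge0 (exprn_ge0 n (ltW theta_gt0)) (expR_ge0 (- rate))).

(** For a cell with distinct rows, the events obtained from the different permutations are disjoint
    and their union is [isolated]; both measures vanish on the diagonal, on one side because the
    points are distinct. *)
Lemma symlaw_pmeasure n A : measurable A ->
  symlaw n A = ((theta ^+ n * expR (- rate))%:E * pmeasure wmeas n A)%E.
Proof.
have e : mscale (law_const n) (pmeasure wmeas n) A =
  ((theta ^+ n * expR (- rate))%:E * pmeasure wmeas n A)%E by [].
move=> mA; rewrite -e; apply: off_diagonal_unique mA.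
- rewrite symlawE; apply: (@le_lt_trans _ _ (\sum_(s : 'S_n) 1)%E).
    by apply: lee_sum => s _; rewrite preimage_setT setTI; apply: probability_le1; exact: measurable_countW.
  by rewrite sumEFin ltry.
- rewrite symlawE big1// => s _; rewrite (_ : _ `&` _ = set0) ?measure0//.
  rewrite -subset0 => w [[i [j [ij /rowP zij]]] wn].
  move/eqP: ij; apply; apply: (@perm_inj _ s).
  by apply: (xi_row_inj wn); apply/rowP => l; have := zij l; rewrite !mxE.
- transitivity ((theta ^+ n * expR (- rate))%:E * pmeasure wmeas n (diagonal n))%E => //.
  rewrite pmeasure_diagonal ?mule0// => u.
  apply: (@subset_measure0 _ _ _ leb _ [set u]) => //; last exact: leb_set1.
  + apply: measurableI; last exact: measurable_interior.
    by apply: compact_measurable_mx; exact: compact_set1.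
  + by apply: compact_measurable_mx; exact: compact_set1.
- move=> k q dq; rewrite symlawE -measure_bigcup_finType; last 2 first.
  + move=> s; apply: measurableI; last exact: measurable_countW.
    rewrite -[X in measurable X]setTI.
    apply: (measurableT_comp (measurable_row_perm s) (@measurable_xiT n)) => //.
    exact: measurable_dcell.
  + move=> s t _ _ [w [[sq wn] [tq _]]]; apply/permP => i.
    apply: (xi_row_inj wn); apply: contrapT => st.
    set j := (t^-1)%g (s i); have ij : i != j.
      by apply/eqP => ij; apply: st; rewrite {2}ij /j permKV.
    have /eqP := dq i j ij; apply; apply/rowP => l; rewrite !mxE.
    by have := sq i l; have := tq j l; rewrite !mxE /j permKV => -> ->.
  rewrite (_ : \bigcup_i _ = isolated k q).
    apply: (etrans (prob_isolated k dq)).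
    transitivity ((theta ^+ n * expR (- rate))%:E * pmeasure wmeas n (dcell k q))%E => //.
    rewrite (_ : dcell k q = rect (fun i => dcell k (row i q))).
      rewrite pmeasure_rect; last by move=> i; exact: measurable_dcell.
      rewrite EFinM -prodEFin; congr (_ * _)%E; apply: eq_bigr => i _.
      by rewrite fineK// fin_num_measure//; exact: measurable_dcell.
    apply/seteqP; split => z h i; [move=> a j|move=> j].
      by have := h i j; rewrite !mxE.
    by have := h i 0 j; rewrite !mxE.
  apply/seteqP; split => w.
    by move=> [s _ [sq wn]]; apply/isolated_perm => //; exists s.
  move=> iw; have wn : count X W w = n by case: iw.
  by have /(isolated_perm k dq wn)[s sq] := iw; exists s.
Qed.

(** The Poisson probability of n points without the factor [leb(W) ^ n], which is the total mass of
    the unnormalized product measure. *)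
Definition poisson_weight n : R := theta ^+ n / n`!%:R * expR (- rate).

(** For a symmetric [G] the terms of the symmetrized law are equal, and their number n! is the
    factorial in the Poisson weight. *)
Lemma law_ge0 n (G : 'M[R]_(n, d) -> \bar R) : measurable_fun setT G ->
  (forall z, 0 <= G z)%E ->
  (forall (s : 'S_n) z, Wpow W n z -> G (row_perm s z) = G z) ->
  (\int[P]_(w in Ev n) G (xi X W n w) =
   (poisson_weight n)%:E * \int[pmeasure wmeas n]_z G z)%E.
Proof.
move=> mG G0 symG.
have e1 : (\int[symlaw n]_z G z = (n`!)%:R%:E * \int[P]_(w in Ev n) G (xi X W n w))%E.
  rewrite ge0_integral_measure_sum//.
  rewrite (eq_bigr (fun=> (\int[P]_(w in Ev n) G (xi X W n w))%E)).
    by rewrite big_const card_ord card_Sn; elim: n`! => [|k IHk]; rewrite ?mul0e//= IHk -(natr1 k) EFinD ge0_muleDl ?lee_fin// mul1e addeC.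
  move=> k _.
  transitivity (\int[mrestr P (measurable_countW n)]_w G (permxi n k w))%E.
    exact: (ge0_integral_pushforward (@measurable_permxi n k) _ measurableT mG).
  rewrite integral_mrestr; last exact: (measurableT_comp mG (@measurable_permxi n k)).
  apply: eq_integral => w; rewrite inE => wn; apply: symG.
  by apply: xi_Wpow wn; exact: finite_window.
have e2 : (\int[symlaw n]_z G z =
    (theta ^+ n * expR (- rate))%:E * \int[pmeasure wmeas n]_z G z)%E.
  rewrite -(ge0_integral_mscale _ _ (law_const n))//.
  by apply: eq_measure_integral => A mA _; exact: symlaw_pmeasure.
have n0 : n`!%:R != 0 :> R by rewrite pnatr_eq0 -lt0n fact_gt0.
move: e2; rewrite e1 => /(congr1 (mule (n`!%:R^-1)%:E)).
rewrite !muleA -!EFinM mulVf// mul1e => ->; congr (_%:E * _)%E.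
by rewrite /poisson_weight mulrA; congr (_ * _); rewrite mulrC.
Qed.

End poisson.

(** * Fubini for the powers of a finite measure *)

Section finite_product.
Context {R : realType} {d : nat}.
Variable mu : {finite_measure set 'rV[R]_d -> \bar R}.

(** A name of its own for the recursively defined power, to which finiteness is attached as a
    structure. *)
Definition pm n : set 'M[R]_(n, d) -> \bar R := pmeasure mu n.
Arguments pm n A : clear implicits.

HB.instance Definition _ n := Measure.on (pm n).

Lemma pm_fin n : fin_num_fun (pm n).
Proof.
apply: lty_fin_num_fun; rewrite /pm.
by apply: (@le_lt_trans _ _ ((fine (mu setT) ^+ n)%:E)); rewrite ?ltry// pmeasure_setT.
Qed.

HB.instance Definition _ n := @Measure_isFinite.Build _ _ _ (pm n) (@pm_fin n).

Lemma pm_setD n (B : set 'rV[R]_d) : measurable B -> mu (~` B) = 0%E ->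
  pm n (~` Wpow B n) = 0%E.
Proof.
move=> mB B0; have mBn := @measurable_Wpow R d _ n mB.
have e : (pm n (Wpow B n) = pm n setT)%E.
  rewrite [LHS](@pmeasure_rect _ _ mu n (fun=> B))//.
  rewrite [RHS]pmeasure_setT (eq_bigr (fun=> (fine (mu setT))%:E)).
    by rewrite prodEFin prodr_const card_ord.
  move=> i _; rewrite fineK ?fin_num_measure// -(setUv B) measureU0//.
  exact: measurableC.
rewrite -setTD measureD//=; last by rewrite ltey_eq fin_num_measure.
by rewrite setTI e subee// fin_num_measure.
Qed.

Lemma integral_pm_app n (B : set 'rV[R]_d) (G : 'M[R]_(n.+1, d) -> R) (M : R) :
  measurable B -> measurable_fun (Wpow B n.+1) G ->
  (forall z, Wpow B n.+1 z -> `|G z| <= M) ->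
  (\int[pm n.+1]_(z in Wpow B n.+1) (G z)%:E =
   \int[pm n]_(z in Wpow B n) \int[mu]_(u in B) (G (app z u))%:E)%E.
Proof.
move=> mB mG GM; have mBn k := @measurable_Wpow R d _ k mB.
pose G' := G \_ (Wpow B n.+1).
have mG' : measurable_fun setT G' by exact/(measurable_restrictT G (mBn n.+1)).
have mGa : measurable_fun setT (fun p : 'M[R]_(n, d) * 'rV[R]_d => (G' (app p.1 p.2))%:E).
  apply/measurable_EFinP; exact: (measurableT_comp mG' (@measurable_app R d n)).
have M0 z : `|G' z| <= `|M|.
  rewrite /G' /patch; case: ifPn => [/set_mem/GM h|_]; last by rewrite normr0.
  by apply: le_trans h _; exact: ler_norm.
rewrite integral_mkcond.
transitivity (\int[pm n.+1]_z (G' z)%:E)%E.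
  by apply: eq_integral => z _; rewrite /G' /patch; case: ifPn.
have iG : (pm n \x mu)%E.-integrable setT
    (fun p : 'M[R]_(n, d) * 'rV[R]_d => (G' (app p.1 p.2))%:E).
  apply: (@bounded_integrable _ _ _ (pm n \x mu)%E setT
    (fun p : 'M[R]_(n, d) * 'rV[R]_d => G' (app p.1 p.2)) `|M|) => //.
    have -> : [set: 'M[R]_(n, d) * 'rV[R]_d] = setT `*` setT.
      by apply/seteqP; split.
    have E := product_measure1E (pm n) mu measurableT measurableT.
    apply: (@le_lt_trans _ _ (pm n setT * mu setT)%E); first by rewrite -E.
    by rewrite ltey_eq fin_numM// fin_num_measure.
  by apply/measurable_EFinP.
transitivity (\int[(pm n \x mu)%E]_p (G' (app p.1 p.2))%:E)%E.
  by rewrite (@integral_pushforward _ _ _ _ _ (fun p => app p.1 p.2)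
    (@measurable_app R d n) (pm n \x mu)%E setT (EFin \o G'))//; exact/measurable_EFinP.
rewrite -integral12_prod_meas1// [RHS]integral_mkcond; apply: eq_integral => z _.
rewrite /patch; case: ifPn => [/set_mem zB|/negP zB].
  rewrite [RHS]integral_mkcond; apply: eq_integral => u _.
  rewrite /G' /= /patch; case: (boolP (u \in B)) => uB.
    by rewrite mem_set//; apply/Wpow_app; split => //; exact: set_mem.
  rewrite memNset// => /Wpow_app[_ /mem_set]; exact/negP.
apply: integral0_eq => u _; rewrite /G' /= /patch memNset// => /Wpow_app[].
by move=> /mem_set.
Qed.

End finite_product.
Arguments pm {R d} mu n A.

Section law.
Context {R : realType} {d : nat} (d_gt0 : (0 < d)%N).
Local Notation Rd := 'rV[R]_d.
Variables (W : set Rd) (cW : compact W) (C2W : C2_boundary W).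
Context {dT : measure_display} {T : measurableType dT}.
Variables (P : probability T R) (theta : R) (theta_gt0 : 0 < theta).
Variables (X : T -> set Rd) (poisX : poisson_process P theta X).
Local Notation FW := (F_W_type X W).

Let wm : {finite_measure set Rd -> \bar R} := wmeas cW.
Let mW := measurable_window cW.
Let mWo : measurable W° := measurable_interior W.
Let Ev n : set T := [set w | count X W w = n].
Let mEv n : measurable (Ev n) := measurable_countW cW poisX n.

Lemma integral_wmeas (f : Rd -> \bar R) : measurable_fun setT f ->
  (\int[wmeas cW]_x f x = \int[leb]_(x in W) f x)%E.
Proof.
move=> mf; rewrite -(integral_mrestr leb mW mf).
by apply: eq_measure_integral => A mA _; exact: wmeas_leb.
Qed.

Lemma integral_interior (f : Rd -> \bar R) : measurable_fun W f ->
  (\int[leb]_(x in W°) f x = \int[leb]_(x in W) f x)%E.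
Proof.
move=> mf; have mf' : measurable_fun setT (f \_ W) by exact/(measurable_restrictT f mW).
transitivity (\int[wmeas cW]_x (f \_ W) x)%E.
  rewrite (integral_mrestr leb mWo mf'); apply: eq_integral => x; rewrite inE => xW.
  by rewrite patchT// mem_set//; exact: interior_subset.
rewrite integral_wmeas//; apply: eq_integral => x xW; by rewrite patchT.
Qed.

(** The integral is restricted to configurations of interior points, at no cost since the boundary
    is null: this is where slices of form functions are differentiable. *)
Lemma law n (G : 'M[R]_(n, d) -> R) (M : R) :
  measurable_fun (Wpow W n) G -> (forall z, Wpow W n z -> `|G z| <= M) ->
  (forall (s : 'S_n) z, Wpow W n z -> G (row_perm s z) = G z) ->
  (\int[P]_(w in Ev n) (G (Xn X W n w))%:E = (poisson_weight W theta n)%:E *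
   \int[pm wm n]_(z in Wpow W° n) (G z)%:E)%E.
Proof.
move=> mG GM symG; have mWn := @measurable_Wpow R d _ n mW.
have mWon := @measurable_Wpow R d _ n mWo.
pose G' := EFin \o (G \_ (Wpow W n)).
have mG' : measurable_fun setT G'.
  by apply/measurable_EFinP; exact/(measurable_restrictT G mWn).
have Ws (s : 'S_n) z : Wpow W n z -> Wpow W n (row_perm s z).
  move=> zW i; have := zW (s i); congr W.
  by apply/rowP => j; rewrite !mxE.
have symG' (s : 'S_n) z : Wpow W n z -> G' (row_perm s z) = G' z.
  by move=> zW; rewrite /G' /= !patchT ?symG//; apply/mem_set => //; exact: Ws.
have h := law_ge0 d_gt0 cW C2W theta_gt0 poisX.
have pm_bdd : (pm wm n).-integrable setT G'.
  apply: (@bounded_integrable _ _ _ (pm wm n) setT (G \_ (Wpow W n)) `|M|) => //.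
  - by rewrite ltey_eq fin_num_measure.
  - exact/(measurable_restrictT G mWn).
  - move=> z _; rewrite /patch; case: ifPn => [/set_mem/GM GzM|_]; last by rewrite normr0.
    by apply: le_trans GzM _; exact: ler_norm.
have e1 : (\int[P]_(w in Ev n) G' (xi X W n w) =
   (poisson_weight W theta n)%:E * \int[pm wm n]_z G' z)%E.
  rewrite [LHS]integralE [in RHS]integralE.
  have hp := h n _ (measurable_funepos mG') (funepos_ge0 G').
  have hn := h n _ (measurable_funeneg mG') (funeneg_ge0 G').
  rewrite muleBr//; last first.
    by apply: fin_num_adde_defl; rewrite fin_numN; exact: integrable_neg_fin_num pm_bdd.
  congr (_ - _)%E.
    apply: (etrans _ (etrans (hp _) _)) => [|s z zW|//].
      by apply: eq_integral => w _; rewrite !funeposE.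
    by rewrite !funeposE symG'.
  apply: (etrans _ (etrans (hn _) _)) => [|s z zW|//].
    by apply: eq_integral => w _; rewrite !funenegE.
  by rewrite !funenegE symG'.
transitivity (\int[P]_(w in Ev n) G' (xi X W n w))%E.
  apply: eq_integral => w; rewrite inE => wn.
  have [s ->] := xi_perm (finite_window cW poisX) wn.
  have XW := Xn_Wpow (finite_window cW poisX) wn.
  by rewrite symG'// /G' /= patchT// mem_set.
rewrite e1; congr (_ * _)%E.
rewrite (negligible_integral (N := ~` Wpow W° n))//; last 2 first.
- exact: measurableC.
- apply: pm_setD => //; rewrite wmeasE (_ : _ `&` _ = set0) ?measure0//.
  by apply/seteqP; split => // u [].
rewrite setTD setCK; apply: eq_integral => z; rewrite inE => zW.
have zW' : z \in Wpow W n by apply/mem_set => i; apply: interior_subset; exact: zW.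
by rewrite /G' /= patchT.
Qed.

End law.

(** * The L^2 spaces of the theorem *)

Section l2_of_measure.
Context {R : realType} (H : l2space R) d (S : measurableType d).
Variable nu : {measure set S -> \bar R}.
Variable b : H -> H -> S -> R.
Hypothesis meas_closed : forall a (f g : H),
  l2meas f -> l2meas g -> l2meas (a *: f + g).
Hypothesis b_meas : forall f g : H, l2meas f -> l2meas g ->
  measurable_fun setT (b f g).
Hypothesis b_sym : forall f g, b f g = b g f.
Hypothesis b_lin : forall a f g h s, b (a *: f + g) h s = a * b f h s + b g h s.
Hypothesis b_ge0 : forall f s, 0 <= b f f s.
Hypothesis ip_sym : forall f g : H, l2ip f g = l2ip g f.
Hypothesis ip_ge0 : forall f : H, (0 <= l2ip f f)%E.
Hypothesis ip_sq : forall f : H, l2meas f -> l2ip f f = (\int[nu]_s (b f f s)%:E)%E.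
Hypothesis ip_int : forall f g : H, l2meas f -> l2meas g ->
  nu.-integrable setT (EFin \o b f g) ->
  l2ip f g = (\int[nu]_s (b f g s)%:E)%E.

(** Nonnegativity of the form at [f + g] and at [g - f], as a pointwise substitute for the
    Cauchy-Schwarz inequality. *)
Lemma b_le f g s : `|b f g s| <= b f f s + b g g s.
Proof.
have e a : b (a *: f + g) (a *: f + g) s = a ^+ 2 * b f f s + 2 * a * b f g s + b g g s.
  by rewrite b_lin [b f _]b_sym [b g (_ + _)]b_sym !b_lin [b g f]b_sym; ring.
have := b_ge0 (1 *: f + g) s; have := b_ge0 ((-1) *: f + g) s.
have := b_ge0 f s; have := b_ge0 g s.
by rewrite !e sqrrN !expr1n => *; rewrite ler_norml; apply/andP; split; lra.
Qed.

Lemma sq_integrable (f : H) : in_l2 f -> nu.-integrable setT (EFin \o b f f).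
Proof.
move=> [mf ff]; apply/integrableP; split; first exact/measurable_EFinP/b_meas.
under eq_integral do rewrite gee0_abs ?lee_fin//.
by rewrite -ip_sq.
Qed.

Lemma b_integrable (f g : H) : in_l2 f -> in_l2 g ->
  nu.-integrable setT (EFin \o b f g).
Proof.
move=> fL gL; have h := integrableD measurableT (sq_integrable fL) (sq_integrable gL).
apply: (le_integrable measurableT _ _ h) => [|s _].
  by apply/measurable_EFinP/b_meas; [exact: fL.1|exact: gL.1].
rewrite /= lee_fin; apply: le_trans (b_le f g s) _; exact: ler_norm.
Qed.

(** Random variables and random fields are treated together, as functions with a pointwise symmetric
    positive form integrated against a measure. The pairing is identified with that integral for
    integrable forms only, because the pairing of fields is an iterated integral and Fubini has to
    apply. *)
Lemma l2_laws_of_measure : l2_laws H.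
Proof.
have closed a (f g : H) : in_l2 f -> in_l2 g -> in_l2 (a *: f + g).
  move=> fL gL; have m : l2meas (a *: f + g) by apply: meas_closed; [exact: fL.1|exact: gL.1].
  split => //; rewrite ip_sq//.
  have e : EFin \o b (a *: f + g) (a *: f + g) =
    ((fun s => (a ^+ 2)%:E * (b f f s)%:E) \+
     ((fun s => (2 * a)%:E * (b f g s)%:E) \+ (fun s => (b g g s)%:E)))%E.
    apply/funext => s /=; rewrite -!EFinM -!EFinD; congr EFin.
    by rewrite b_lin [b f _]b_sym [b g (_ + _)]b_sym !b_lin [b g f]b_sym; ring.
  have i : nu.-integrable setT (EFin \o b (a *: f + g) (a *: f + g)).
    rewrite e; apply: integrableD => //.
      by apply: integrableZl => //; exact: b_integrable.
    apply: integrableD => //; last exact: b_integrable.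
    by apply: integrableZl => //; exact: b_integrable.
  have := integrable_fin_num measurableT i; rewrite ge0_fin_numE//.
  by apply: integral_ge0 => s _; rewrite lee_fin.
split => // [f g fL gL|a f g h fL gL hL].
  have i := b_integrable fL gL; rewrite ip_int//; [|exact: fL.1|exact: gL.1].
  exact: integrable_fin_num i.
have afgL := closed a f g fL gL.
rewrite !ip_int//; try exact: b_integrable;
  try exact: fL.1; try exact: gL.1; try exact: hL.1; try exact: afgL.1.
rewrite -integralZl//; last exact: b_integrable.
rewrite -integralD//; last 2 first.
- by apply: integrableZl => //; exact: b_integrable.
- exact: b_integrable.
by apply: eq_integral => s _; rewrite b_lin EFinD EFinM.
Qed.

End l2_of_measure.

Lemma measurable_mxP (R : realType) m n d (S : measurableType d) (D : set S)
    (g : S -> 'M[R]_(m, n)) : measurable D ->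
  measurable_fun D g <-> forall i j, measurable_fun D (fun s => g s i j).
Proof.
move=> mD; split => [mg i j|mg]; first exact: (measurableT_comp (measurable_coord_mx i j) mg).
apply: (eq_measurable_fun (fun s => if s \in D then g s else 0)).
  by move=> s ->.
apply: measurable_funS (@subsetT _ D) _ => //.
apply: measurable_fun_mx => i j.
rewrite (_ : (fun _ => _) = (fun s => g s i j) \_ D).
  exact/(measurable_restrictT _ mD).
by apply/funext => s; rewrite /patch; case: ifPn => // _; rewrite mxE.
Qed.

Section poisson_l2.
Context {R : realType} {d : nat}.
Local Notation Rd := 'rV[R]_d.
Variables (W : set Rd) (cW : compact W) (C2W : C2_boundary W).
Context {dT : measure_display} {T : measurableType dT}.
Variables (P : probability T R) (theta : R).
Variables (X : T -> set Rd) (poisX : poisson_process P theta X).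
Local Notation FW := (F_W_type X W).
Let mW := measurable_window cW.

Lemma dotC n (u v : 'rV[R]_n) : dot u v = dot v u.
Proof. by apply: eq_bigr => k _; rewrite mulrC. Qed.

Lemma dot_linl n a (u v x : 'rV[R]_n) : dot (a *: u + v) x = a * dot u x + dot v x.
Proof.
by rewrite /dot mulr_sumr -big_split; apply: eq_bigr => k _; rewrite !mxE/=; ring.
Qed.

Lemma dot_ge0 n (u : 'rV[R]_n) : 0 <= dot u u.
Proof. by apply: sumr_ge0 => k _; rewrite -expr2 sqr_ge0. Qed.

Lemma L2_Omega_laws : l2_laws (L2_Omega P X W).
Proof.
apply: (@l2_laws_of_measure _ (L2_Omega P X W) _ _ P (fun F G w => F w * G w)).
- move=> a F G mF mG; apply: measurable_funD => //.
  by apply: measurable_funM => //; exact: measurable_cst.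
- move=> F G mF mG; apply: (FW_measurable_fun cW poisX).
  exact: measurable_funM mF mG.
- by move=> F G; apply/funext => w; rewrite mulrC.
- by move=> a F G K w /=; rewrite mulrDl -mulrA.
- by move=> F w; rewrite -expr2 sqr_ge0.
- by move=> F G; apply: eq_integral => w _; rewrite mulrC.
- by move=> F; apply: integral_ge0 => w _; rewrite lee_fin -expr2 sqr_ge0.
- by [].
- by [].
Qed.

Local Notation field := (T -> Rd -> Rd).

(** Fields are constrained on [W] only; the value 0 off [W] makes the pointwise product measurable
    on the whole product space. *)
Definition fdot (Y Z : field) (p : T * Rd) : R :=
  if p.2 \in W then dot (Y p.1 p.2) (Z p.1 p.2) else 0.

Lemma measurable_field (Y : field) :
  measurable_fun (setT `*` W) (fun p : FW * Rd => Y p.1 p.2) ->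
  measurable_fun (setT `*` W) (fun p : T * Rd => Y p.1 p.2).
Proof.
move=> mY; pose j (p : T * Rd) : FW * Rd := (p.1, p.2).
have mid : measurable_fun setT (id : T -> FW).
  by move=> _ A mA; rewrite setTI; exact: (FW_measurable cW poisX).
have mj : measurable_fun setT j.
  apply: measurable_fun_pair; last exact: measurable_snd.
  exact: (measurableT_comp mid measurable_fst).
have mTW : measurable ([set: FW] `*` W) by exact: measurableX.
rewrite (_ : (fun _ => _) = (fun p : FW * Rd => Y p.1 p.2) \o j)//.
have mj' : measurable_fun ([set: T] `*` W) j.
  by apply: measurable_funS mj => //; exact: measurableT.
apply: (measurable_comp mTW _ mY mj') => _ [p [_ pW] <-].
by split.
Qed.

Lemma measurable_fdot (Y Z : field) :
  l2meas (Y : L2_field P X W) -> l2meas (Z : L2_field P X W) ->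
  measurable_fun setT (fdot Y Z).
Proof.
move=> mY mZ.
have mD : measurable ([set: T] `*` W) by exact: measurableX.
have -> : fdot Y Z = (fun p => dot (Y p.1 p.2) (Z p.1 p.2)) \_ ([set: T] `*` W).
  apply/funext => p; rewrite /fdot /patch; case: ifPn => [/set_mem pW|/negP pW].
    by rewrite mem_set.
  by rewrite memNset// => -[_ /mem_set].
apply/(measurable_restrictT _ mD); apply: measurable_sum => k.
apply: measurable_funM.
- apply: (measurableT_comp (measurable_coord_mx 0 k)); exact: measurable_field mY.
- apply: (measurableT_comp (measurable_coord_mx 0 k)); exact: measurable_field mZ.
Qed.

Lemma fdot_slice (Y Z : field) w :
  l2meas (Y : L2_field P X W) -> l2meas (Z : L2_field P X W) ->
  (\int[leb]_(x in W) (dot (Y w x) (Z w x))%:E =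
   \int[wmeas cW]_x (fdot Y Z (w, x))%:E)%E.
Proof.
move=> mY mZ; rewrite integral_wmeas//.
  by apply: eq_integral => x xW; rewrite /fdot/= xW.
apply/measurable_EFinP.
exact: (measurableT_comp (measurable_fdot mY mZ) (pair1_measurable w)).
Qed.

Lemma L2_field_sq (Y : field) : l2meas (Y : L2_field P X W) ->
  (\int[P]_w \int[leb]_(x in W) (dot (Y w x) (Y w x))%:E =
   \int[P \x wmeas cW]_p (fdot Y Y p)%:E)%E.
Proof.
move=> mY; rewrite fubini_tonelli1//.
- by apply: eq_integral => w _; exact: fdot_slice.
- by apply/measurable_EFinP; exact: (measurable_fdot mY).
- by move=> p; rewrite lee_fin /fdot; case: ifP => // _; exact: dot_ge0.
Qed.

Lemma L2_field_ip (Y Z : field) : l2meas (Y : L2_field P X W) ->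
  l2meas (Z : L2_field P X W) ->
  (P \x wmeas cW)%E.-integrable setT (EFin \o fdot Y Z) ->
  (\int[P]_w \int[leb]_(x in W) (dot (Y w x) (Z w x))%:E =
   \int[P \x wmeas cW]_p (fdot Y Z p)%:E)%E.
Proof.
move=> mY mZ i; rewrite -integral12_prod_meas1//.
by apply: eq_integral => w _; exact: fdot_slice.
Qed.

Lemma fdotC Y Z : fdot Y Z = fdot Z Y.
Proof. by apply/funext => p; rewrite /fdot dotC. Qed.

Lemma L2_field_laws : l2_laws (L2_field P X W).
Proof.
apply: (@l2_laws_of_measure _ (L2_field P X W) _ _ (P \x wmeas cW)%E fdot).
- move=> a Y Z mY mZ;
  have mD : measurable ([set: FW] `*` W) by exact: measurableX.
  apply/(measurable_mxP _ mD) => i j.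
  have /(_ i j) hY := proj1 (measurable_mxP _ mD) mY.
  have /(_ i j) hZ := proj1 (measurable_mxP _ mD) mZ.
  rewrite (_ : (fun _ => _) =
      (fun p : FW * Rd => a * Y p.1 p.2 i j + Z p.1 p.2 i j)).
    by apply: measurable_funD => //; apply: measurable_funM => //; exact: measurable_cst.
  by apply/funext => p; rewrite !mxE.
- exact: measurable_fdot.
- exact: fdotC.
- by move=> a Y Z V p; rewrite /fdot; case: ifP => _; rewrite ?dot_linl// mulr0 addr0.
- by move=> Y p; rewrite /fdot; case: ifP => // _; exact: dot_ge0.
- by move=> Y Z; apply: eq_integral => w _; apply: eq_integral => x _; rewrite dotC.
- move=> Y; apply: integral_ge0 => w _; apply: integral_ge0 => x _.
  by rewrite lee_fin dot_ge0.
- exact: L2_field_sq.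
- exact: L2_field_ip.
Qed.

End poisson_l2.

(** * The derivative operator *)

Section tame_forms.
Context {R : realType} {d : nat}.
Local Notation Rd := 'rV[R]_d.
Local Notation form := (forms (R := R) (d := d)).
Variables (W : set Rd) (cW : compact W) (C2W : C2_boundary W).
Let mW := measurable_window cW.
Let regW : W `<=` closure W° := C2_regular cW C2W.

Lemma regular_Wpow n : Wpow W n `<=` closure (Wpow W n)°.
Proof. exact: Wpow_regular. Qed.

Lemma measurable_WpowW n : measurable (Wpow W n).
Proof. exact: measurable_Wpow. Qed.

Lemma bounded_Wpow n : bounded_set (Wpow W n).
Proof.
have [M [Mr hM]] := bounded_window cW.
exists `|M|; split; first exact: num_real.
move=> y My z zW.
have hM' : M < y by apply: le_lt_trans My; exact: ler_norm.
rewrite /Num.norm/= mx_normrE; apply: bigmax_le.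
  by apply: le_trans (ltW My).
move=> [i j] _; have := hM y hM' _ (zW i).
apply: le_trans; apply: le_trans _ (mx_entry_le_norm _ 0 j).
by rewrite mxE.
Qed.

(* A growth bound A * C ^ n on the form functions and their partial derivatives,
   which unlike the condition defining S' also covers n = 0 and is stable under
   sums and products. *)
Definition tame (f : form) (A C : R) :=
  [/\ forall n (s : 'S_n) z, Wpow W n z -> f n (row_perm s z) = f n z,
      forall n, (0 < n)%N -> C1_on (Wpow W n) (f n),
      forall n z, Wpow W n z -> `|f n z| <= A * C ^+ n &
      forall n i k z, Wpow W n z ->
        `|partial (Wpow W n) i k (f n) z| <= A * C ^+ n].

(** The essential bounds of S' become bounds at every point, because form functions and their
    partial derivatives are continuous on the power of the window, which is regular. *)
Lemma in_S'_tame f : in_S' W f -> exists A C, [/\ 1 <= A, 1 <= C & tame f A C].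
Proof.
move=> [[symf intf] [C C0 hC]].
(* S' bounds nothing for n = 0, so the constant f_0 is accounted for in [A]. *)
exists (Num.max 1 `|f 0 0|), (Num.max 1 C); split; rewrite ?le_max ?lexx//.
have A1 : 1 <= Num.max 1 `|f 0 0| by rewrite le_max lexx.
have C1 : 1 <= Num.max 1 C by rewrite le_max lexx.
have CC n : C ^+ n <= Num.max 1 `|f 0 0| * Num.max 1 C ^+ n.
  rewrite -[leLHS]mul1r; apply: ler_pM => //; first exact/exprn_ge0/ltW.
  by rewrite lerXn2r ?nnegrE ?(ltW C0)//; [apply: le_trans C1|rewrite le_max lexx orbT].
have pos n z : Wpow W n z -> (0 < leb (Wpow W n))%E.
  move=> zW; have oI : open (Wpow W n)° by exact: open_interior.
  apply: (@lt_le_trans _ _ (leb (Wpow W n)°)).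
    apply: leb_open_gt0 => //.
    by have [y [yI _]] := regular_Wpow zW (filterT : nbhs z setT); exists y.
  apply: le_measure; rewrite ?inE.
  - exact: open_measurable_mx.
  - exact: measurable_WpowW.
  - exact: interior_subset.
split => //.
- by move=> n n0; have [] := hC n n0.
- move=> [|n] z zW.
    rewrite expr0 mulr1 (_ : z = 0); last by apply/matrixP => -[].
    by rewrite le_max lexx orbT.
  have K0 := pos _ _ zW; have [[fc _ _] b] := hC n.+1 isT; apply: le_trans (CC n.+1).
  apply: (regular_ae_bound (@regular_Wpow n.+1) fc) (zW).
  apply: Linfty_norm_ae; [exact: measurable_WpowW|exact: K0|].
  apply: le_trans b; apply: leeDl; apply: sume_ge0 => i _; exact: Lnorm_ge0.
- move=> n i k z zW; have n0 : (0 < n)%N by case: n i z zW => // -[].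
  have K0 := pos _ _ zW; have [[_ _ pc] b] := hC n n0; apply: le_trans (CC n).
  apply: (regular_ae_bound (@regular_Wpow n) (pc i k)) zW.
  have : {ae leb, forall x, Wpow W n x ->
      `|enorm (grad (Wpow W n) i (f n) x)| <= C ^+ n}.
    apply: Linfty_norm_ae; [exact: measurable_WpowW|exact: K0|].
    apply: le_trans b; rewrite (bigD1 i)//= addeCA; apply: leeDl.
    apply: adde_ge0; first exact: Lnorm_ge0.
    by apply: sume_ge0 => j _; exact: Lnorm_ge0.
  apply: filterS => x h /h; apply: le_trans.
  rewrite [leRHS]ger0_norm ?sqrtr_ge0// /enorm -sqrtr_sqr; apply: ler_wsqrtr.
  rewrite /dot (bigD1 k)//= mxE -expr2 lerDl.
  by apply: sumr_ge0 => j _; rewrite -expr2 sqr_ge0.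
Qed.

Lemma tame_in_S' f A C : 1 <= A -> 1 <= C -> tame f A C -> in_S' W f.
Proof.
move=> A1 C1 [symf c1f bf pf].
have mf n : (0 < n)%N -> measurable_fun (Wpow W n) (f n).
  move=> n0; apply: within_continuous_measurable; first exact: measurable_WpowW.
  by have [] := c1f n n0.
have A0 : 0 <= A by apply: le_trans A1.
have C0 : 0 <= C by apply: le_trans C1.
have AC0 n : 0 <= A * C ^+ n by rewrite mulr_ge0// exprn_ge0.
split.
  split => // n n0; apply: (bounded_integrable _ _ (mf n n0) (bf n)).
    exact: measurable_WpowW.
  by apply: leb_bounded_fin; [exact: measurable_WpowW|exact: bounded_Wpow].
(* The function and its n gradients together are at most [A * C ^+ n * (1 + n * d)]; Bernoulli's
   inequality bounds the last factor by [(1 + d) ^+ n], and [A <= A ^+ n] because [A >= 1]. *)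
exists (A * C * (1 + d%:R)).
  by rewrite !mulr_gt0 ?(lt_le_trans _ A1) ?(lt_le_trans _ C1)// ltr_pwDl.
move=> n n0; split; first exact: c1f.
have L1 : (Linfty_norm (Wpow W n) (f n) <= (A * C ^+ n)%:E)%E.
  by apply: Linfty_norm_le => //; exact: bf.
have L2 i : (Linfty_norm (Wpow W n) (fun z => enorm (grad (Wpow W n) i (f n) z))
    <= (d%:R * (A * C ^+ n))%:E)%E.
  apply: Linfty_norm_le => [z zW|]; last by rewrite mulr_ge0.
  rewrite ger0_norm ?sqrtr_ge0// /enorm.
  have AC1 : 0 <= d%:R * (A * C ^+ n) by exact: mulr_ge0.
  rewrite -(ger0_norm AC1) -sqrtr_sqr ler_wsqrtr//.
  apply: (@le_trans _ _ (\sum_(k < d) (A * C ^+ n) ^+ 2)).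
    apply: ler_sum => k _; rewrite mxE -expr2 -real_normK ?num_real//.
    by rewrite lerXn2r ?nnegrE//; exact: pf.
  rewrite sumr_const card_ord [leRHS]exprMn -[leLHS]mulr_natl.
  apply: ler_wpM2r; first exact: sqr_ge0.
  by rewrite -natrX ler_nat; case: (d) => // e; rewrite leq_pmulr.
apply: (@le_trans _ _ (A * C ^+ n + n%:R * (d%:R * (A * C ^+ n)))%:E).
  rewrite EFinD; apply: leeD => //.
  apply: (@le_trans _ _ (\sum_(i < n) (d%:R * (A * C ^+ n))%:E)%E).
    by apply: lee_sum => i _; exact: L2.
  by rewrite sumEFin lee_fin sumr_const card_ord [leRHS]mulr_natl.
rewrite lee_fin !exprMn.
have b1 : 1 + n%:R * d%:R <= (1 + d%:R) ^+ n :> R.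
  elim: (n) => [|m IH]; first by rewrite mul0r addr0 expr0.
  rewrite exprS; apply: (@le_trans _ _ ((1 + d%:R) * (1 + m%:R * d%:R))).
    rewrite -natr1; have : 0 <= m%:R * d%:R * d%:R :> R by rewrite !mulr_ge0.
    by nra.
  by rewrite ler_wpM2l// addr_ge0.
have b0 : 0 <= 1 + n%:R * d%:R :> R by rewrite addr_ge0// mulr_ge0.
have b2 : A <= A ^+ n by case: n n0 {mf L1 L2 b1 b0} => // m _; rewrite exprS ler_peMr// exprn_ege1.
have -> : A * C ^+ n + n%:R * (d%:R * (A * C ^+ n)) = A * C ^+ n * (1 + n%:R * d%:R) by ring.
apply: ler_pM => //.
by apply: ler_wpM2r b2; exact: exprn_ge0.
Qed.

Lemma tame_le f A C A' C' : 0 <= A -> 0 <= C -> A <= A' -> C <= C' ->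
  tame f A C -> tame f A' C'.
Proof.
move=> A0 C0 AA CC [h1 h2 h3 h4]; have le n : A * C ^+ n <= A' * C' ^+ n.
  by apply: ler_pM => //; rewrite ?exprn_ge0// lerXn2r ?nnegrE// (le_trans C0).
split; [exact: h1|exact: h2| |].
  by move=> n z zW; apply: le_trans (le n); exact: h3.
by move=> n i k z zW; apply: le_trans (le n); exact: h4.
Qed.

Lemma tame_D a f g A B C : 0 <= A -> 0 <= B -> 0 <= C ->
  tame f A C -> tame g B C ->
  tame (fun n => a *: f n + g n) (`|a| * A + B) C /\
  forall n i k z, Wpow W n z -> partial (Wpow W n) i k (a *: f n + g n) z =
    a * partial (Wpow W n) i k (f n) z + partial (Wpow W n) i k (g n) z.
Proof.
move=> A0 B0 C0 [f1 f2 f3 f4] [g1 g2 g3 g4].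
have pD n i k z : Wpow W n z -> partial (Wpow W n) i k (a *: f n + g n) z =
    a * partial (Wpow W n) i k (f n) z + partial (Wpow W n) i k (g n) z.
  move=> zW; have n0 : (0 < n)%N by case: n i z zW => // -[].
  by have [_ ->] := C1_on_D (@regular_Wpow n) a (f2 n n0) (g2 n n0).
have bD x y n : `|x| <= A * C ^+ n -> `|y| <= B * C ^+ n ->
    `|a * x + y| <= (`|a| * A + B) * C ^+ n.
  move=> xA yB; apply: le_trans (ler_normD _ _) _; rewrite mulrDl -mulrA normrM.
  by apply: lerD => //; exact: ler_wpM2l.
split; last exact: pD.
split.
- move=> n s z zW; rewrite [LHS](_ : _ = a * f n (row_perm s z) + g n (row_perm s z))//.
  by rewrite (f1 n s z zW) (g1 n s z zW).
- by move=> n n0; have [] := C1_on_D (@regular_Wpow n) a (f2 n n0) (g2 n n0).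
- by move=> n z zW; apply: bD; [exact: f3|exact: g3].
- by move=> n i k z zW; rewrite (pD n i k z zW); apply: bD; [exact: f4|exact: g4].
Qed.

(** The factor 2 comes from the two terms of the product rule. *)
Lemma tame_M f g A B C E : 0 <= A -> 0 <= B -> 0 <= C -> 0 <= E ->
  tame f A C -> tame g B E ->
  tame (fun n => f n * g n) (2 * (A * B)) (C * E) /\
  forall n i k z, Wpow W n z -> partial (Wpow W n) i k (f n * g n) z =
    f n z * partial (Wpow W n) i k (g n) z + g n z * partial (Wpow W n) i k (f n) z.
Proof.
move=> A0 B0 C0 E0 [f1 f2 f3 f4] [g1 g2 g3 g4].
have pM n i k z : Wpow W n z -> partial (Wpow W n) i k (f n * g n) z =
    f n z * partial (Wpow W n) i k (g n) z + g n z * partial (Wpow W n) i k (f n) z.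
  move=> zW; have n0 : (0 < n)%N by case: n i z zW => // -[].
  by have [_ ->] := C1_on_M (@regular_Wpow n) (f2 n n0) (g2 n n0).
have q n x y : `|x| <= A * C ^+ n -> `|y| <= B * E ^+ n ->
    `|x * y| <= A * B * (C * E) ^+ n.
  move=> xA yB; rewrite normrM exprMn mulrACA; exact: ler_pM.
split; last exact: pM.
split.
- move=> n s z zW; rewrite [LHS](_ : _ = f n (row_perm s z) * g n (row_perm s z))//.
  by rewrite (f1 n s z zW) (g1 n s z zW).
- by move=> n n0; have [] := C1_on_M (@regular_Wpow n) (f2 n n0) (g2 n n0).
- move=> n z zW; apply: le_trans (q n _ _ (f3 n z zW) (g3 n z zW)) _.
  rewrite -[leRHS]mulrA mulr_natl mulr2n lerDl.
  by rewrite mulr_ge0 ?exprn_ge0// mulr_ge0.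
- move=> n i k z zW; rewrite (pM n i k z zW); apply: le_trans (ler_normD _ _) _.
  rewrite -mulrA mulr_natl mulr2n; apply: lerD.
    by apply: q; [exact: f3|exact: g4].
  by rewrite mulrC; apply: q; [exact: f4|exact: g3].
Qed.

Lemma tame_measurable f A C n : tame f A C -> measurable_fun (Wpow W n) (f n).
Proof.
move=> [_ c1 _ _]; case: n => [|n].
  apply: (eq_measurable_fun (cst (f 0 0))) => // z _.
  by rewrite (_ : z = 0)//; apply/matrixP => -[].
apply: within_continuous_measurable; first exact: measurable_WpowW.
by have [] := c1 n.+1 isT.
Qed.

Lemma tame_measurable_partial f A C n i k : tame f A C ->
  measurable_fun (Wpow W n) (partial (Wpow W n) i k (f n)).
Proof.
move=> [_ c1 _ _]; apply: within_continuous_measurable; first exact: measurable_WpowW.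
have n0 : (0 < n)%N by case: n i => // -[].
by have [_ _] := c1 n n0; exact.
Qed.

Lemma Wpow_perm n (s : 'S_n) z : Wpow W n z -> Wpow W n (row_perm s z).
Proof.
move=> zW i; have := zW (s i); congr W; by apply/rowP => j; rewrite !mxE.
Qed.

Lemma ball_row_perm n (s : 'S_n) (z y : 'M[R]_(n, d)) r :
  ball z r y -> ball (row_perm s z) r (row_perm s y).
Proof. by move=> [r0 h]; split => // i j; rewrite !mxE; exact: h. Qed.

Lemma interior_perm n (s : 'S_n) z :
  (Wpow W n)° z -> (Wpow W n)° (row_perm s z).
Proof.
move=> /nbhs_ballP[e /= e0 he]; apply/nbhs_ballP; exists e => // y yz.
have yz' := ball_row_perm (s^-1)%g yz.
rewrite -row_permM (mulVg s) row_perm1 in yz'.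
have := Wpow_perm s (he _ yz').
by rewrite -row_permM (mulgV s) row_perm1.
Qed.

(* By continuity it is enough to compare the two sides in the interior. *)
Lemma partial_perm n (f : 'M[R]_(n, d) -> R) (s : 'S_n) i k z :
  (forall (s : 'S_n) z, Wpow W n z -> f (row_perm s z) = f z) ->
  C1_on (Wpow W n) f -> Wpow W n z ->
  partial (Wpow W n) i k f (row_perm s z) = partial (Wpow W n) (s i) k f z.
Proof.
move=> symf c1 zW.
have n0 : (0 < n)%N by case: n i {f s z symf c1 zW} => // -[].
have inI y : (Wpow W n)° y ->
  partial (Wpow W n) i k f (row_perm s y) = partial (Wpow W n) (s i) k f y.
  move=> yI; have [_ c1o _] := c1.
  rewrite !(partial_interior (@regular_Wpow n))//; last exact: interior_perm.
  pose g := f \o row_perm s.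
  have -> : 'D_(delta_mx (s i) k) f y = 'D_(delta_mx (s i) k) g y.
    apply: near_eq_derive; near do rewrite /g /= symf//.
    exact: yI.
  have E : (fun t => t^-1 *: ((f \o shift (row_perm s y)) (t *: delta_mx i k) - f (row_perm s y))) =
      (fun t => t^-1 *: ((g \o shift y) (t *: delta_mx (s i) k) - g y)).
    apply/funext => t; rewrite /g /=; congr (_ *: (f _ - _)).
    by apply/matrixP => a b; rewrite !mxE (inj_eq perm_inj).
  by rewrite /derive E.
have [_ _ pc] := c1; apply: subr0_eq.
set h := (X in X = 0); apply/eqP; rewrite -normr_le0 leNgt; apply/negP => h0.
have h2 : 0 < `|h| / 2 by rewrite divr_gt0.
have [r1 r10 H1] := (within_continuousP _ _).1 (pc i k) _ (Wpow_perm s zW) _ h2.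
have [r2 r20 H2] := (within_continuousP _ _).1 (pc (s i) k) _ zW _ h2.
have r0 : 0 < Num.min r1 r2 by rewrite lt_min r10.
have m1 : Num.min r1 r2 <= r1 by rewrite ge_min lexx.
have m2 : Num.min r1 r2 <= r2 by rewrite ge_min lexx orbT.
have [y [yI zy]] := regular_Wpow zW (nbhsx_ballx z (Num.min r1 r2) r0).
have yW := interior_subset yI.
have {}H1 := H1 _ (Wpow_perm s yW) (ball_row_perm s (le_ball m1 zy)).
have {}H2 := H2 _ yW (le_ball m2 zy).
rewrite (inI y yI) in H1.
have tri (a b c : R) : `|a - b| <= `|a - c| + `|b - c|.
  by rewrite [`|b - c|]distrC -{1}(subrK c a) -addrA ler_normD.
have := le_lt_trans (tri _ _ _) (ltrD H1 H2).
by rewrite -splitr ltxx.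
Unshelve. all: by end_near. Qed.

End tame_forms.

Local Opaque partial.

Section derivative_operator.
Context {R : realType} {d : nat}.
Local Notation Rd := 'rV[R]_d.
Local Notation form := (forms (R := R) (d := d)).
Variables (W : set Rd) (cW : compact W) (C2W : C2_boundary W).
Context {dT : measure_display} {T : measurableType dT}.
Variables (P : probability T R) (theta : R) (theta_gt0 : 0 < theta).
Variables (X : T -> set Rd) (poisX : poisson_process P theta X).
Local Notation FW := (F_W_type X W).
Let mW := measurable_window cW.
Let finX := finite_window cW poisX.

Lemma X_W_Wpow w : Wpow W _ (X_W X W w).
Proof. exact: (@Xn_Wpow _ _ _ _ X W finX (count X W w) w erefl). Qed.

Lemma measurable_at_count (G : form) :
  (forall n, measurable_fun (Wpow W n) (G n)) ->
  (forall n (s : 'S_n) z, Wpow W n z -> G n (row_perm s z) = G n z) ->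
  measurable_fun setT (functional X W G : FW -> R).
Proof.
move=> mG symG.
have m := @measurable_symmetric _ _ _ _ X W mW finX _ unit setT
  (fun n z _ => G n z) measurableT.
have mf : measurable_fun (setT `*` setT)
    (fun p : FW * unit => G (count X W p.1) (X_W X W p.1)).
  apply: m => [n|n s z _ zW _]; last exact: symG.
  have mfst : measurable_fun (Wpow W n `*` [set: unit])
      (fst : 'M[R]_(n, d) * unit -> 'M[R]_(n, d)).
    by apply: measurable_funS measurable_fst => //; exact: measurableT.
  have sub : fst @` (Wpow W n `*` [set: unit]) `<=` Wpow W n by move=> _ [p [pW _] <-].
  have e := measurable_comp (measurable_WpowW cW (n:=n)) sub (mG n) mfst.
  by rewrite (_ : (fun _ => _) = G n \o fst).
rewrite setXTT in mf.
have mp : measurable_fun setT (fun w : FW => (w, tt)).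
  exact: measurable_fun_pair.
exact: measurableT_comp mf mp.
Qed.

Lemma measurable_functional (f : form) A C : tame W f A C ->
  measurable_fun setT (functional X W f : FW -> R).
Proof.
move=> tf; have [symf _ _ _] := tf; apply: measurable_at_count => // n.
exact: tame_measurable tf.
Qed.

Lemma integrable_at_count (G : form) A C : 0 <= C ->
  (forall n, measurable_fun (Wpow W n) (G n)) ->
  (forall n (s : 'S_n) z, Wpow W n z -> G n (row_perm s z) = G n z) ->
  (forall n z, Wpow W n z -> `|G n z| <= A * C ^+ n) ->
  P.-integrable setT (EFin \o functional X W G).
Proof.
move=> C0 mG symG GC; apply: (integrable_growth cW poisX (A := A) C0).
  by apply: (FW_measurable_fun cW poisX); exact: measurable_at_count.
by move=> w; apply: GC; exact: X_W_Wpow.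
Qed.

(** The number of terms satisfies [n <= 2 ^ n] and is absorbed by doubling the base of the
    growth. *)
Lemma sum_growth n (h : 'I_n -> R) A C : 0 <= A -> 0 <= C ->
  (forall i, `|h i| <= A * C ^+ n) -> `|\sum_i h i| <= A * (2 * C) ^+ n.
Proof.
move=> A0 C0 hb; apply: le_trans (ler_norm_sum _ _ _) _.
apply: (@le_trans _ _ (\sum_(i < n) A * C ^+ n)); first exact: ler_sum.
rewrite sumr_const card_ord -[leLHS]mulr_natl exprMn [leRHS]mulrCA.
apply: ler_wpM2r; first by rewrite mulr_ge0// exprn_ge0.
by rewrite -natrX ler_nat; apply/ltnW/ltn_expl.
Qed.

Lemma functional_bound (f : form) A C w : tame W f A C ->
  `|functional X W f w| <= A * C ^+ count X W w.
Proof. by move=> [_ _ h _]; apply: h; exact: X_W_Wpow. Qed.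

Lemma growth_in_L2 (F : T -> R) A C : 0 <= A -> 0 <= C ->
  measurable_fun setT (F : FW -> R) ->
  (forall w, `|F w| <= A * C ^+ count X W w) -> in_l2 (F : L2_Omega P X W).
Proof.
move=> A0 C0 mF FC; split => //.
have i : P.-integrable setT (EFin \o (fun w => F w * F w)).
  apply: (integrable_growth cW poisX (A := A * A) (C := C * C)).
  - exact: mulr_ge0.
  - by apply: (FW_measurable_fun cW poisX); exact: measurable_funM.
  - move=> w; rewrite normrM exprMn mulrACA; exact: ler_pM.
have := integrable_fin_num measurableT i; rewrite ge0_fin_numE//.
by apply: integral_ge0 => w _; rewrite lee_fin -expr2 sqr_ge0.
Qed.

Lemma growth_in_field (Y : T -> Rd -> Rd) A C : 0 <= A -> 0 <= C ->
  l2meas (Y : L2_field P X W) ->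
  (forall w x k, W x -> `|Y w x 0 k| <= A * C ^+ count X W w) ->
  in_l2 (Y : L2_field P X W).
Proof.
move=> A0 C0 mY YC; split => //.
have YY w x : W x -> dot (Y w x) (Y w x) <= d%:R * (A * A) * (C * C) ^+ count X W w.
  move=> Wx; apply: (@le_trans _ _ (\sum_(k < d) (A * C ^+ count X W w) ^+ 2)).
    apply: ler_sum => k _; rewrite -expr2 -real_normK ?num_real//.
    by rewrite lerXn2r ?nnegrE ?mulr_ge0 ?exprn_ge0//; exact: YC.
  by rewrite sumr_const card_ord -[leLHS]mulr_natl !exprMn !mulrA -mulrA -expr2 -!mulrA.
set K := d%:R * (A * A) in YY; set E := C * C in YY.
have K0 : 0 <= K by rewrite !mulr_ge0.
have E0 : 0 <= E by rewrite mulr_ge0.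
have KE0 w : 0 <= K * E ^+ count X W w by rewrite mulr_ge0// exprn_ge0.
have mKE : measurable_fun setT (fun w => K * E ^+ count X W w).
  exact: (measurable_count_fun cW poisX (fun n => K * E ^+ n)).
have mKE1 : measurable_fun setT (fun p : T * Rd => (K * E ^+ count X W p.1)%:E).
  by apply/measurable_EFinP; exact: (measurableT_comp mKE measurable_fst).
rewrite /= (L2_field_sq cW C2W poisX mY).
apply: (@le_lt_trans _ _ (\int[P \x wmeas cW]_p (K * E ^+ count X W p.1)%:E)%E).
  apply: ge0_le_integral => //.
  - by move=> p _; rewrite lee_fin /fdot; case: ifP => // _; exact: dot_ge0.
  - by apply/measurable_EFinP; exact: (measurable_fdot cW poisX mY mY).
  - move=> p _; rewrite lee_fin /fdot; case: ifPn => [/set_mem pW|_]; last exact: KE0.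
    exact: YY.
rewrite fubini_tonelli1//; last by move=> p; rewrite lee_fin.
have -> : (\int[P]_w fubini_F (wmeas cW) (fun p : T * Rd => (K * E ^+ count X W p.1)%:E) w =
    \int[P]_w ((fine (wmeas cW setT))%:E * (K * E ^+ count X W w)%:E))%E.
  apply: eq_integral => w _; rewrite muleC fineK; last exact: fin_num_measure.
  exact: (@integral_cst _ _ _ (wmeas cW) setT measurableT (K * E ^+ count X W w)%:E).
have i : P.-integrable setT (EFin \o (fun w => K * E ^+ count X W w)).
  apply: (integrable_growth cW poisX (A := K) E0) => // w.
  by rewrite ger0_norm.
rewrite integralZl// lte_mul_pinfty//; first by rewrite lee_fin fine_ge0.
by have := integrable_fin_num measurableT i; rewrite ge0_fin_numE//; apply: integral_ge0 => w _; rewrite lee_fin.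
Qed.

Definition pi_kernel (pi : Rd -> Rd -> R) (M : R) :=
  measurable_fun (W `*` W) (fun zx : Rd * Rd => pi zx.1 zx.2) /\
  forall z x, W z -> W x -> `|pi z x| <= M.

Lemma derivative_fieldE (pi : Rd -> Rd -> R) (f : form) (w : T) x k :
  derivative_field X W pi f w x 0 k =
  - \sum_(i < count X W w) pi (row i (X_W X W w)) x *
      partial (Wpow W (count X W w)) i k (f (count X W w)) (X_W X W w).
Proof.
rewrite /derivative_field !mxE summxE; congr (- _).
by apply: eq_bigr => j _; rewrite !mxE.
Qed.

(** Permuting the points permutes the terms of the sum, by [partial_perm]; the components are thus
    symmetric in the points although each term is not, and [measurable_symmetric] applies. *)
Lemma measurable_derivative_field (pi : Rd -> Rd -> R) (M : R) (f : form) A C :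
  pi_kernel pi M -> tame W f A C ->
  l2meas (derivative_field X W pi f : L2_field P X W).
Proof.
move=> [mpi _] tf; have [symf c1f _ _] := tf.
have mD : measurable ([set: FW] `*` W) by exact: measurableX.
apply/(measurable_mxP _ mD) => i k; rewrite ord1.
have mWW : measurable (W `*` W) by exact: measurableX.
have h := @measurable_symmetric _ _ _ _ X W mW finX _ Rd W
  (fun n z x => - \sum_(i < n) pi (row i z) x * partial (Wpow W n) i k (f n) z) mW.
rewrite (_ : (fun _ => _) = (fun p : FW * Rd =>
    - \sum_(i < count X W p.1) pi (row i (X_W X W p.1)) p.2 *
      partial (Wpow W (count X W p.1)) i k (f (count X W p.1)) (X_W X W p.1))); last first.
  by apply/funext => p; exact: derivative_fieldE.
apply: h => [n|n s z x zW xW].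
  have mWn : measurable (Wpow W n `*` W) by apply: measurableX => //; exact: measurable_WpowW.
  apply: measurableT_comp; first exact: oppr_measurable.
  apply: measurable_sum => j; apply: measurable_funM.
    apply: (measurable_comp mWW _ mpi (g := fun p : 'M[R]_(n, d) * Rd => (row j p.1, p.2))).
      by move=> _ [p [pW qW] <-]; split => //=; exact: pW.
    apply: measurable_funS measurableT (@subsetT _ _) _.
    apply: measurable_fun_pair; last exact: measurable_snd.
    exact: (measurableT_comp (@measurable_row R d n j) measurable_fst).
  apply: (measurable_comp (F := Wpow W n) _ _ (tame_measurable_partial cW j k tf)).
  - exact: measurable_WpowW.
  - by move=> _ [p [pW _] <-].
  - by apply: measurable_funS measurable_fst => //; exact: measurableT.
congr (- _); rewrite [RHS](reindex_inj (@perm_inj _ s)); apply: eq_bigr => j _.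
have e1 : row j (row_perm s z) = row (s j) z by apply/rowP => l; rewrite !mxE.
have n0 : (0 < n)%N by apply: leq_ltn_trans (ltn_ord j).
have e2 := partial_perm cW C2W s j k (symf n) (c1f n n0) zW.
exact: (congr2 (fun u b => pi u x * b) e1 e2).
Qed.

Lemma derivative_field_bound (pi : Rd -> Rd -> R) (M : R) (f : form) A C (w : T) x k :
  0 <= A -> 0 <= C -> pi_kernel pi M -> tame W f A C -> W x ->
  `|derivative_field X W pi f w x 0 k| <= `|M| * A * (2 * C) ^+ count X W w.
Proof.
move=> A0 C0 [_ bpi] [_ _ _ pf] xW; have XW : Wpow W _ (X_W X W w) := @X_W_Wpow w.
rewrite derivative_fieldE normrN; apply: sum_growth => // [|i].
  exact: mulr_ge0.
rewrite -mulrA normrM; apply: ler_pM => //; last exact: pf.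
by apply: le_trans (ler_norm M); apply: bpi => //; exact: XW.
Qed.

Variables (pi : Rd -> Rd -> R) (M : R) (piK : pi_kernel pi M).

Lemma D_op_tame F Y : @D_op _ _ _ _ P X W pi F Y -> exists f A C,
  [/\ 1 <= A, 1 <= C, tame W f A C, compatible W f &
      F = functional X W f /\ Y = derivative_field X W pi f].
Proof.
move=> [f [fS cf -> ->]]; have [A [C [A1 C1 tf]]] := in_S'_tame cW C2W fS.
by exists f, A, C.
Qed.

Lemma tame_D_op f A C : 1 <= A -> 1 <= C -> tame W f A C -> compatible W f ->
  @D_op _ _ _ _ P X W pi (functional X W f) (derivative_field X W pi f).
Proof.
by move=> A1 C1 tf cf; exists f; split => //; exact: (tame_in_S' cW A1 C1 tf).
Qed.

Lemma D_op_in_l2 F Y : @D_op _ _ _ _ P X W pi F Y -> in_l2 F /\ in_l2 Y.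
Proof.
move=> /D_op_tame[f [A [C [A1 C1 tf cf [-> ->]]]]].
have A0 : 0 <= A by apply: le_trans A1.
have C0 : 0 <= C by apply: le_trans C1.
split.
  apply: (@growth_in_L2 _ A C) => //; first exact: measurable_functional tf.
  by move=> w; exact: functional_bound.
apply: (@growth_in_field _ (`|M| * A) (2 * C)); rewrite ?mulr_ge0//.
  exact: measurable_derivative_field piK tf.
by move=> w x k xW; exact: derivative_field_bound.
Qed.

Lemma D_op_linear a F F' Y Y' : @D_op _ _ _ _ P X W pi F Y ->
  @D_op _ _ _ _ P X W pi F' Y' -> @D_op _ _ _ _ P X W pi (a *: F + F') (a *: Y + Y').
Proof.
move=> /D_op_tame[f [A [C [A1 C1 tf cf [-> ->]]]]].
move=> /D_op_tame[g [B [E [B1 E1 tg cg [-> ->]]]]].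
have A0 : 0 <= A by apply: le_trans A1.
have B0 : 0 <= B by apply: le_trans B1.
have C0 : 0 <= C by apply: le_trans C1.
have E0 : 0 <= E by apply: le_trans E1.
have tf' : tame W f A (Num.max C E) by apply: tame_le tf; rewrite ?le_max ?lexx.
have tg' : tame W g B (Num.max C E) by apply: tame_le tg; rewrite ?le_max ?lexx ?orbT.
have CE1 : 1 <= Num.max C E by rewrite le_max C1.
have [th ph] := tame_D cW C2W a A0 B0 (le_trans ler01 CE1) tf' tg'.
have B1' : 1 <= `|a| * A + B by rewrite -[1]add0r lerD// mulr_ge0.
have ch : compatible W (fun n => a *: f n + g n).
  by move=> n z y zW yF; rewrite /= !fctE cf// cg.
rewrite (_ : a *: _ + _ = functional X W (fun n => a *: f n + g n))//.
rewrite (_ : a *: _ + _ = derivative_field X W pi (fun n => a *: f n + g n)).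
  exact: (tame_D_op B1' CE1 th ch).
apply/funext => w; apply/funext => x; apply/rowP => k.
transitivity (a * derivative_field X W pi f w x 0 k +
    derivative_field X W pi g w x 0 k).
  by rewrite [LHS]mxE [X in X + _]mxE.
have ef := derivative_fieldE pi f w x k.
have eg := derivative_fieldE pi g w x k.
apply: etrans (congr2 (fun p q => a * p + q) ef eg) _.
apply: etrans _ (esym (derivative_fieldE pi _ w x k)).
rewrite mulrN mulr_sumr -opprD -big_split.
congr (- _); apply: eq_bigr => i _.
by rewrite (ph _ i k _ (@X_W_Wpow w)) mulrDr [X in X + _]mulrCA.
Qed.

End derivative_operator.

(** * Differentiation under the integral sign *)

Section sequences_in_sets.
Context {R : realType} {m n : nat}.
Local Notation M := 'M[R]_(m, n).
Variable K : set M.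

(** Continuity is put in sequential form because dominated convergence is a statement on
    sequences. *)
Lemma within_continuous_seqP (f : M -> R) : {within K, continuous f} <->
  forall (u : nat -> M) x, (forall l, K (u l)) -> K x -> u @ \oo --> x ->
    f (u l) @[l --> \oo] --> f x.
Proof.
split=> [/within_continuousP fc u x Ku Kx ux|h].
  apply/cvgrPdist_lt => e e0; have [r r0 rP] := fc x Kx e e0.
  exact: (filterS (fun l => rP _ (Ku l)) (cvg_ball ux r0)).
apply/within_continuousP => x Kx e e0; apply: contrapT => nr.
have ex l : exists y, [/\ K y, ball x l.+1%:R^-1 y & ~ `|f x - f y| < e].
  apply: contrapT => ny; apply: nr; exists l.+1%:R^-1; first by rewrite invr_gt0.
  by move=> y Ky xy; apply: contrapT => fxy; apply: ny; exists y.
pose u l := sval (cid (ex l)).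
have uP l : [/\ K (u l), ball x l.+1%:R^-1 (u l) & ~ `|f x - f (u l)| < e].
  by rewrite /u; case: cid.
have ux : u @ \oo --> x.
  apply/cvg_ballP => r r0.
  have := near_infty_natSinv_lt (PosNum r0); apply: filterS => l /= lr.
  by have [_ + _] := uP l; apply: le_ball; exact: ltW.
have Ku l : K (u l) by have [] := uP l.
have /cvgrPdist_lt/(_ e e0)[l0 _ /(_ l0 (leqnn _)) /=] := h u x Ku Kx ux.
by have [] := uP l0.
Qed.

Lemma closure_seq (A : set M) x : closure A x ->
  exists2 u : nat -> M, forall l, A (u l) & u @ \oo --> x.
Proof.
move=> Ax; have ex l : exists y, A y /\ ball x l.+1%:R^-1 y.
  have l0 : 0 < l.+1%:R^-1 :> R by rewrite invr_gt0.
  by have [y []] := Ax _ (nbhsx_ballx x _ l0); exists y.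
exists (fun l => sval (cid (ex l))) => [l|]; first by case: cid => y [].
apply/cvg_ballP => r r0.
have := near_infty_natSinv_lt (PosNum r0); apply: filterS => l /= lr.
by case: cid => y [_] /=; apply: le_ball; exact: ltW.
Qed.

End sequences_in_sets.

Section parameter_integral.
Context {R : realType} {d : nat}.
Local Notation Rd := 'rV[R]_d.
Variables (W : set Rd) (cW : compact W) (C2W : C2_boundary W).
Let mW := measurable_window cW.
Let regW : W `<=` closure W° := C2_regular cW C2W.

Lemma dominated_Rintegral (F_ : nat -> Rd -> R) (F b : Rd -> R) :
  (forall l, measurable_fun W (F_ l)) ->
  (forall x, W x -> F_ l x @[l --> \oo] --> F x) ->
  leb.-integrable W (EFin \o b) ->
  (forall l x, W x -> `|F_ l x| <= b x) ->
  \int[leb]_(x in W) F_ l x @[l --> \oo] --> \int[leb]_(x in W) F x.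
Proof.
move=> mF FF ib Fb.
have mF0 : measurable_fun W F by exact: measurable_fun_cvg FF.
have Fb0 x : W x -> `|F x| <= b x.
  move=> Wx; have /cvg_norm/cvgr_to_le := FF x Wx; apply.
  by apply: nearW => l; exact: Fb.
have iF : leb.-integrable W (EFin \o F).
  apply: le_integrable ib => //; first exact/measurable_EFinP.
  by move=> x Wx; rewrite lee_fin (le_trans (Fb0 x Wx))// ler_norm.
apply: fine_cvg; rewrite fineK; last exact: integrable_fin_num iF.
apply: (@dominated_cvg _ _ _ leb W mW (fun l x => (F_ l x)%:E) (EFin \o F) (EFin \o b)) => //.
- by move=> l; exact/measurable_EFinP.
- by move=> x Wx; apply: cvg_EFin; [exact: nearW|exact: FF].
Qed.

Variables (h : Rd -> Rd -> R) (B : R) (b : Rd -> R).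
Hypothesis mh : forall z, W z -> measurable_fun W (h z).
Hypothesis c1h : forall x, W x -> C1_on W (h ^~ x).
Hypothesis hB : forall z x, W z -> W x -> `|h z x| <= B.
Hypothesis ib : leb.-integrable W (EFin \o b).
Hypothesis phb : forall z x l, W z -> W x -> `|partial W 0 l (h ^~ x) z| <= b x.

Let q l u x := partial W 0 l (h ^~ x) u.

Let ball_step z r l t : 0 < r -> `|t| < r -> ball z r (z + t *: delta_mx 0 l : Rd).
Proof.
move=> r0 tr; rewrite -{1}(addr0 z) -(scale0r (delta_mx 0 l)); apply: ball_line => //.
by rewrite sub0r normrN.
Qed.

Let quotient_bound z r l t x : 0 < r -> ball z r `<=` W -> `|t| < r -> W x ->
  `|h (z + t *: delta_mx 0 l) x - h z x| <= b x * `|t|.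
Proof.
move=> r0 zrW tr Wx; have [_ c1o _] := c1h Wx.
have inW s : `|s| <= `|t| -> W° (z + s *: delta_mx 0 l).
  move=> st; apply: filterS zrW _; apply: open_nbhs_nbhs; split; first exact: ball_open.
  by apply: ball_step => //; exact: le_lt_trans st tr.
apply: (line_lipschitz0 (f := h ^~ x)) => s st.
have sW := inW s st; split; first by have [] := c1o 0 l _ sW.
rewrite -(partial_interior regW _ _ c1o sW).
exact: phb (interior_subset sW) Wx.
Qed.

Let quotient_cvg z l x (t_ : nat -> R) : W° z -> W x -> (forall m, t_ m != 0) ->
  t_ @ \oo --> 0 ->
  (t_ m)^-1 * (h (z + t_ m *: delta_mx 0 l) x - h z x) @[m --> \oo] --> q l z x.
Proof.
move=> zW Wx t0 tc; have [_ c1o _] := c1h Wx.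
rewrite /q (partial_interior regW)//.
have [dr _] := c1o 0 l z zW.
have := dr; rewrite /derivable => /cvg_ex[v vP].
have -> : 'D_(delta_mx 0 l) (h ^~ x) z = v by apply: cvg_lim => //; exact: norm_hausdorff.
have /cvgr_dnbhsP/(_ t_ (conj t0 tc)) := vP.
apply: cvg_trans; apply: near_eq_cvg; apply: nearW => m /=.
by rewrite [_ + z]addrC.
Qed.

Let interior_ball z : W° z -> exists2 r, 0 < r & ball z r `<=` W.
Proof. by move=> /nbhs_ballP[r /= r0 rP]; exists r. Qed.

Let inv_seq (r : R) : 0 < r -> exists N, forall m, `|(m + N).+1%:R^-1| < r :> R.
Proof.
move=> r0; have [N _ NP] := near_infty_natSinv_lt (PosNum r0).
by exists N => m; rewrite ger0_norm ?invr_ge0//; apply: NP; rewrite /= leq_addl.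
Qed.

(** In the interior the derivative is a limit of difference quotients of [h], measurable in x; at
    the other points of [W] it is a limit of interior values. *)
Let measurable_q l u : W u -> measurable_fun W (q l u).
Proof.
have int z : W° z -> measurable_fun W (q l z).
  move=> zW; have [r r0 rP] := interior_ball zW; have [N NP] := inv_seq r0.
  apply: (measurable_fun_cvg (h := fun m x => ((m + N).+1%:R^-1)^-1 *
    (h (z + (m + N).+1%:R^-1 *: delta_mx 0 l) x - h z x))) => [m|x Wx].
    apply: measurable_funM; first exact: measurable_cst.
    apply: measurable_funB; apply: mh; last exact: interior_subset zW.
    by apply: rP; exact: ball_step.
  apply: (quotient_cvg (t_ := fun m => (m + N).+1%:R^-1)) => //.
  have := @cvg_harmonic R; rewrite -(cvg_shiftn N); exact.
move=> Wu; have [v vW vu] := closure_seq (regW Wu).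
apply: (measurable_fun_cvg (h := fun m => q l (v m))) => [m|x Wx]; first exact: int.
have [_ _ /(_ 0 l)/within_continuous_seqP] := c1h Wx; apply => // m.
exact: interior_subset (vW m).
Qed.

(** By the mean value theorem the difference quotients are dominated by [b], as the derivatives are;
    dominated convergence gives both the derivative of the integral and its continuity up to the
    boundary. *)
Lemma C1_on_integral : C1_on W (fun u => \int[leb]_(x in W) h u x).
Proof.
have iB : leb.-integrable W (EFin \o cst B).
  apply: (bounded_integrable mW (window_fin cW) (M := `|B|)) => //.
have ih z : W z -> leb.-integrable W (EFin \o h z).
  by move=> Wz; apply: (bounded_integrable mW (window_fin cW) (mh Wz)) => x; exact: hB.
have qC z l : W° z -> t^-1 *: (((fun u => \int[leb]_(x in W) h u x) \o shift z)
      (t *: delta_mx 0 l) - \int[leb]_(x in W) h z x) @[t --> (0 : R)^'] -->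
    \int[leb]_(x in W) q l z x.
  move=> Wz; have [r r0 rP] := interior_ball Wz; have Wz' := interior_subset Wz.
  apply/cvgr_dnbhsP => t_ [t0 tc].
  (* The first N terms of the sequence of increments are dropped, so that all shifted points stay in
     the ball inside [W]. *)
  have /cvgrPdist_lt/(_ r r0)[N _ NP] := tc.
  have tN m : `|t_ (m + N)%N| < r.
    by have := NP (m + N)%N (leq_addl _ _); rewrite /= sub0r normrN.
  rewrite -(cvg_shiftn N).
  have zW m : W (z + t_ (m + N)%N *: delta_mx 0 l) by apply: rP; exact: ball_step.
  rewrite (_ : (fun m => _) = (fun m => \int[leb]_(x in W)
      ((t_ (m + N)%N)^-1 * (h (z + t_ (m + N)%N *: delta_mx 0 l) x - h z x)))); last first.
    apply/funext => m /=; rewrite [_ + z]addrC -RintegralB//; [|exact: ih..].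
    rewrite RintegralZl//.
    exact: (integrableB mW (ih _ (zW m)) (ih _ Wz')).
  apply: (dominated_Rintegral _ _ ib) => [m|x Wx|m x Wx].
  - apply: measurable_funM; first exact: measurable_cst.
    by apply: measurable_funB; apply: mh.
  - apply: (quotient_cvg (t_ := fun m => t_ (m + N)%N)) => //.
    by rewrite (cvg_shiftn N t_).
  - rewrite normrM normfV ler_pdivrMl ?normr_gt0// mulrC.
    exact: quotient_bound (tN m) Wx.
have [] // := C1_on_intro regW (f := fun u => \int[leb]_(x in W) h u x)
  (p := fun i l u => \int[leb]_(x in W) q l u x).
- apply/within_continuous_seqP => u z Wu Wz uz.
  apply: (dominated_Rintegral _ _ iB) => [m|x Wx|m x Wx]; first exact: mh.
    by have [/within_continuous_seqP + _ _] := c1h Wx; apply.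
  exact: hB.
- by move=> i l z Wz; apply/cvg_ex; eexists; rewrite [i]ord1; exact: qC.
- move=> i l z Wz; rewrite [i]ord1; apply: cvg_lim (qC z l Wz).
  exact: norm_hausdorff.
- move=> i l; apply/within_continuous_seqP => u z Wu Wz uz.
  apply: (dominated_Rintegral _ _ ib) => [m|x Wx|m x Wx]; first exact: measurable_q.
    by have [_ _ /(_ 0 l)/within_continuous_seqP] := c1h Wx; apply.
  exact: phb.
Qed.

End parameter_integral.

(** * Smoothness of [V_pi] *)

Section smeared_field.
Context {R : realType} {d : nat}.
Local Notation Rd := 'rV[R]_d.
Variables (W : set Rd) (cW : compact W) (C2W : C2_boundary W) (W_pos : (0 < leb W)%E).
Let mW := measurable_window cW.
Let regW : W `<=` closure W° := C2_regular cW C2W.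

Lemma C1_on_cst (c : R) : C1_on W (cst c) /\
  forall i j x, W x -> partial W i j (cst c) x = 0.
Proof.
have [] := C1_on_intro regW (f := cst c) (p := fun _ _ _ => 0) => //.
- by move=> x; exact: cst_continuous.
- by move=> i j x _; exact: derive_cst.
- by move=> i j x; exact: cst_continuous.
Qed.

Lemma C1_on_eq (f g : Rd -> R) : (forall x, W x -> f x = g x) -> C1_on W f ->
  C1_on W g /\ forall i j x, W x -> partial W i j g x = partial W i j f x.
Proof.
move=> fg c1f; have [fc fo pc] := c1f.
have ne x : W° x -> \near x, f x = g x.
  by move=> xW; apply: filterS xW => y; exact: fg.
have [] // := C1_on_intro regW (f := g) (p := fun i j => partial W i j f).
- apply/within_continuousP => x Wx e e0.
  have [r r0 rP] := (within_continuousP _ _).1 fc x Wx e e0.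
  by exists r => // y Wy xy; rewrite -!fg//; exact: rP.
- move=> i j x Wx; apply: near_eq_derivable (ne x Wx) _.
  by have [] := fo i j x Wx.
- move=> i j x Wx; rewrite (partial_interior regW _ _ fo Wx).
  by apply/esym/near_eq_derive; exact: ne.
Qed.

Lemma C1_on_Z (a : R) (f : Rd -> R) : C1_on W f -> C1_on W (fun x => a * f x) /\
  forall i j x, W x -> partial W i j (fun x => a * f x) x = a * partial W i j f x.
Proof.
move=> c1f; have [c10 p0] := C1_on_cst 0.
have [h1 h2] := C1_on_D regW a c1f c10.
have [h3 h4] := C1_on_eq (g := fun x => a * f x) (fun x _ => addr0 (a * f x)) h1.
by split; [exact: h3|move=> i j x Wx; rewrite (h4 i j x Wx) (h2 i j x Wx) (p0 i j x Wx) addr0].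
Qed.

Variables (pi : Rd -> Rd -> R) (M : R) (piK : pi_kernel W pi M).
Hypothesis pi_C1 : {ae leb, forall x, W x -> C1_on W (pi ^~ x)}.

Lemma measurable_pi z : W z -> measurable_fun W (pi z).
Proof.
move=> Wz; have [mpi _] := piK.
have mWW : measurable (W `*` W) by exact: measurableX.
apply: (measurable_comp mWW _ mpi (g := fun x : Rd => (z, x))).
  by move=> _ [x Wx <-].
by apply: measurable_funS (pair1_measurable z) => //; exact: measurableT.
Qed.

Variable V : Rd -> Rd.
Hypothesis mV : measurable_fun W V.
Hypothesis bV : (Linfty_norm W (fun x => enorm (V x)) < +oo)%E.

Lemma ae_bounded_field : exists2 c, 0 <= c &
  {ae leb, forall x, W x -> forall k, `|V x 0 k| <= c}.
Proof.
pose L := Linfty_norm W (fun x => enorm (V x)).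
have L0 : (0 <= L)%E by exact: Lnorm_ge0.
have Lf : L = (fine L)%:E by rewrite fineK// ge0_fin_numE.
exists (fine L); first exact: fine_ge0.
have := @Linfty_norm_ae _ _ _ W (fun x => enorm (V x)) (fine L) mW W_pos.
rewrite -Lf lexx => /(_ isT); apply: filterS => x h Wx k.
apply: le_trans (h Wx); rewrite [leRHS]ger0_norm ?sqrtr_ge0// /enorm -sqrtr_sqr.
apply: ler_wsqrtr; rewrite /dot (bigD1 k)//= -expr2 lerDl.
by apply: sumr_ge0 => j _; rewrite -expr2 sqr_ge0.
Qed.

Lemma V_pi_C1 : dominated_gradient W pi -> C1_on_vec W (V_pi W pi V).
Proof.
move=> [g ig gP] k; have [c c0 cP] := ae_bounded_field.
have [N [mN N0 NP]] : leb.-negligible (~` [set x | W x ->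
    [/\ C1_on W (pi ^~ x), forall k, `|V x 0 k| <= c &
      forall z k, W z -> `|partial W 0 k (pi ^~ x) z| <= g x]]).
  have h : {ae leb, forall x, W x -> [/\ C1_on W (pi ^~ x),
      forall k, `|V x 0 k| <= c &
      forall z k, W z -> `|partial W 0 k (pi ^~ x) z| <= g x]}.
    by move: pi_C1 cP gP; apply: filterS3 => x h1 h2 h3 Wx; split; auto.
  exact: h.
have Ngood x : W x -> ~ N x -> [/\ C1_on W (pi ^~ x), forall k, `|V x 0 k| <= c &
      forall z k, W z -> `|partial W 0 k (pi ^~ x) z| <= g x].
  by move=> Wx Nx; apply: contrapT => h; apply: Nx; apply: NP => /(_ Wx).
(* The assumptions on [pi] and [V] hold for almost every x. Putting 0 on an exceptional null set
   makes them hold for every x without changing the integral. *)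
pose h z x := \1_(~` N) x * V x 0 k * pi z x.
have hin x : ~ N x -> h ^~ x = (fun z => V x 0 k * pi z x).
  by move=> Nx; apply/funext => z; rewrite /h indicE mem_set// mul1r.
have hout x : N x -> h ^~ x = cst 0.
  by move=> Nx; apply/funext => z; rewrite /h indicE memNset ?mul0r//; exact.
have mVk : measurable_fun W (fun x => V x 0 k).
  exact: (measurableT_comp (measurable_coord_mx 0 k) mV).
have mh z : W z -> measurable_fun W (h z).
  move=> Wz; apply: measurable_funM; last exact: measurable_pi.
  apply: measurable_funM => //; apply: measurable_indic; exact: measurableC.
have c1 : C1_on W (fun u => \int[leb]_(x in W) h u x).
  apply: (C1_on_integral cW C2W (B := c * `|M|) (b := fun x => c * `|g x|) mh).
  - move=> x Wx; have [Nx|Nx] := pselect (N x).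
      by rewrite hout//; have [] := C1_on_cst 0.
    by rewrite hin//; have [+ _ _] := Ngood x Wx Nx; move=> /(C1_on_Z (V x 0 k))[].
  - move=> z x Wz Wx; have [Nx|Nx] := pselect (N x).
      by rewrite -[h z x]/((h ^~ x) z) hout// normr0 mulr_ge0.
    rewrite -[h z x]/((h ^~ x) z) hin//= normrM; have [_ hV _] := Ngood x Wx Nx.
    by apply: ler_pM => //; apply: le_trans (ler_norm M); have [_] := piK; apply.
  - rewrite (_ : EFin \o _ = (fun x => c%:E * (`|g x|)%:E)%E)//.
    by apply: integrableZl => //; exact: integrable_abse ig.
  - move=> z x l Wz Wx; have [Nx|Nx] := pselect (N x).
      by rewrite hout//; have [_ ->] := C1_on_cst 0; rewrite // normr0 mulr_ge0.
    rewrite hin//; have [h1 h2 h3] := Ngood x Wx Nx.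
    have [_ ->] := C1_on_Z (V x 0 k) h1; rewrite // normrM.
    by apply: ler_pM => //; apply: le_trans (ler_norm (g x)); exact: h3.
suff e x : W x -> \int[leb]_(y in W) h x y = V_pi W pi V x 0 k.
  by have [] := C1_on_eq e c1.
move=> Wx; rewrite /V_pi mxE; congr fine.
apply: ae_eq_integral => //.
- by apply/measurable_EFinP; exact: mh.
- by apply/measurable_EFinP; apply: measurable_funM => //; exact: measurable_pi.
- exists N; split => // y ny; apply: contrapT => Ny; apply: ny => Wy.
  by rewrite /h indicE mem_set// mul1r.
Qed.

End smeared_field.

(** * Duality for deterministic fields *)

Section bounded_measurable.
Context {R : realType} {dS : measure_display} {S : measurableType dS}.
Implicit Types (D : set S) (f g : S -> R).

Definition bm D f := measurable_fun D f /\ exists M, forall x, D x -> `|f x| <= M.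

Lemma bm_cst D c : bm D (fun=> c).
Proof. by split; [exact: measurable_cst|exists `|c|]. Qed.

Lemma bmD D f g : bm D f -> bm D g -> bm D (fun x => f x + g x).
Proof.
move=> [mf [M fM]] [mg [N gN]]; split; first exact: measurable_funD.
by exists (M + N) => x Dx; rewrite (le_trans (ler_normD _ _))// lerD ?fM ?gN.
Qed.

Lemma bmM D f g : bm D f -> bm D g -> bm D (fun x => f x * g x).
Proof.
move=> [mf [M fM]] [mg [N gN]]; split; first exact: measurable_funM.
by exists (M * N) => x Dx; rewrite normrM ler_pM ?fM ?gN.
Qed.

Lemma bmN D f : bm D f -> bm D (fun x => - f x).
Proof.
move=> [mf [M fM]]; split; last by exists M => x Dx; rewrite normrN fM.
by apply: measurableT_comp mf; exact: oppr_measurable.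
Qed.

Lemma bm_sum D (I : Type) (r : seq I) (F : I -> S -> R) : (forall i, bm D (F i)) ->
  bm D (fun x => \sum_(i <- r) F i x).
Proof.
move=> bF; elim: r => [|i r IH].
  by under eq_fun do rewrite big_nil; exact: bm_cst.
by under eq_fun do rewrite big_cons; exact: bmD.
Qed.

Lemma bmS D E f : measurable E -> D `<=` E -> bm E f -> bm D f.
Proof.
move=> mE DE [mf [M fM]]; split; first exact: measurable_funS mf.
by exists M => x /DE; exact: fM.
Qed.

Lemma bm_comp dU (U : measurableType dU) (E : set U) D (h : U -> S) f :
  measurable D -> measurable_fun setT h -> (forall u, E u -> D (h u)) ->
  bm D f -> measurable E -> @measurable_fun _ _ U R E (f \o h) /\
    exists M, forall x, E x -> `|(f \o h) x| <= M.
Proof.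
move=> mD mh hED [mf [M fM]] mE; split; last by exists M => u /hED; exact: fM.
apply: (measurable_comp mD _ mf); first by move=> _ [u /hED ? <-].
by apply: measurable_funS mh => //; exact: measurableT.
Qed.

Lemma bm_integrable (mu : {measure set S -> \bar R}) D f : measurable D ->
  (mu D < +oo)%E -> bm D f -> mu.-integrable D (EFin \o f).
Proof. by move=> mD D0 [mf [M fM]]; exact: bounded_integrable mD D0 mf fM. Qed.

End bounded_measurable.

(** * Permutation invariance of the product measure *)

Section permutation_invariance.
Context {R : realType} {d : nat}.
Local Notation Rd := 'rV[R]_d.
Variable mu : {finite_measure set Rd -> \bar R}.
Hypothesis mu1 : forall u, mu [set u] = 0%E.

(** Uniqueness off the diagonal applies once more: cells are products, and permuting the rows
    permutes the factors. *)
Lemma pm_row_perm n (s : 'S_n) (A : set 'M[R]_(n, d)) : measurable A ->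
  pm mu n (row_perm s @^-1` A) = pm mu n A.
Proof.
move=> mA; pose m1 := image_measure (pm mu n) (@measurable_row_perm R d n s).
have rectE k (q : 'M[int]_(n, d)) : dcell k q = rect (fun i => dcell k (row i q)) :> set 'M[R]_(n, d).
  apply/seteqP; split => z h i; [move=> a j|move=> j].
    by have := h i j; rewrite !mxE.
  by have := h i 0 j; rewrite !mxE.
have mq k (q : 'M[int]_(n, d)) i : measurable (dcell k (row i q) : set Rd).
  exact: measurable_dcell.
have diag0 : pm mu n (diagonal n) = 0%E by exact: pmeasure_diagonal.
apply: (@off_diagonal_unique _ _ _ m1 (pm mu n)) mA => //.
- by rewrite /m1 /= /pushforward preimage_setT ltey_eq fin_num_measure.
- rewrite /m1 /= /pushforward (_ : _ @^-1` _ = diagonal n)//.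
  have re (t : 'S_n) (z : 'M[R]_(n, d)) i : row i (row_perm t z) = row (t i) z.
    by apply/rowP => j; rewrite !mxE.
  apply/seteqP; split => z [i [j [ij zij]]].
    exists (s i), (s j); split; last by rewrite -!re.
    by rewrite (inj_eq perm_inj).
  exists ((s^-1)%g i), ((s^-1)%g j); split; first by rewrite (inj_eq perm_inj).
  by rewrite !re !permKV.
- move=> k q dq; transitivity (pm mu n (row_perm s @^-1` dcell k q)) => //.
  rewrite (_ : _ @^-1` _ = dcell k (row_perm (s^-1)%g q)); last first.
    apply/seteqP; split => z h i j.
      by have := h ((s^-1)%g i) j; rewrite !mxE permKV.
    by have := h (s i) j; rewrite !mxE permK.
  rewrite !rectE [LHS](@pmeasure_rect _ _ mu n)//.
  rewrite [RHS](@pmeasure_rect _ _ mu n)//.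
  rewrite [RHS](reindex_inj (@perm_inj _ (s^-1)%g)); apply: eq_bigr => i _.
  by congr (mu (dcell k _)); apply/rowP => j; rewrite !mxE.
Qed.

Lemma integral_pm_perm n (s : 'S_n) (B : set Rd) (G : 'M[R]_(n, d) -> R) :
  measurable B -> bm (Wpow B n) G ->
  (\int[pm mu n]_(z in Wpow B n) (G (row_perm s z))%:E =
   \int[pm mu n]_(z in Wpow B n) (G z)%:E)%E.
Proof.
move=> mB bG; have mBn := @measurable_Wpow R d B n mB.
have Bs z : (row_perm s @^-1` Wpow B n) z <-> Wpow B n z.
  have re (t : 'S_n) i : row i (row_perm t z) = row (t i) z.
    by apply/rowP => j; rewrite !mxE.
  split => h i; last by rewrite re.
  by have := h ((s^-1)%g i); rewrite re permKV.
have Bs' : row_perm s @^-1` Wpow B n = Wpow B n by apply/seteqP; split => z /Bs.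
have fin : (pm mu n (Wpow B n) < +oo)%E by rewrite ltey_eq fin_num_measure.
have bGs : bm (Wpow B n) (fun z => G (row_perm s z)).
  by apply: (bm_comp mBn (@measurable_row_perm R d n s) _ bG mBn) => z /Bs.
pose G0 := G \_ (Wpow B n).
have G0E z : Wpow B n z -> G0 z = G z by move=> zB; rewrite /G0 patchT// mem_set.
have mG0 : measurable_fun setT G0 by apply/(measurable_restrictT _ mBn); case: bG.
transitivity (\int[pm mu n]_(z in Wpow B n) ((EFin \o G0) \o row_perm s) z)%E.
  by apply: eq_integral => z; rewrite inE => zB /=; rewrite G0E//; exact/Bs.
transitivity (\int[pm mu n]_(z in Wpow B n) (EFin \o G0) z)%E; last first.
  by apply: eq_integral => z; rewrite inE => zB /=; rewrite G0E.
have := @integral_pushforward _ _ _ _ R (row_perm s)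
  (@measurable_row_perm R d n s) (pm mu n) (Wpow B n) (EFin \o G0).
rewrite Bs' => h; rewrite -h//.
- transitivity (\int[image_measure (pm mu n) (@measurable_row_perm R d n s)]_(z in Wpow B n)
      (EFin \o G0) z)%E; first by [].
  apply: eq_measure_integral => C mC _.
  exact: (pm_row_perm s mC).
- exact/measurable_EFinP.
- apply: bm_integrable => //; have [m [M GM]] := bGs; split.
    exact: measurable_funS measurableT (@subsetT _ _) (measurableT_comp mG0 (@measurable_row_perm R d n s)).
  by exists M => z zB /=; rewrite G0E; [exact: GM|exact/Bs].
Qed.

End permutation_invariance.

(** * Integration by parts under the Poisson law *)

Section poisson_duality.
Context {R : realType} {d : nat} (d_gt0 : (0 < d)%N).
Local Notation Rd := 'rV[R]_d.
Local Notation form := (forms (R := R) (d := d)).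
Variables (W : set Rd) (cW : compact W) (C2W : C2_boundary W).
Context {dT : measure_display} {T : measurableType dT}.
Variables (P : probability T R) (theta : R) (theta_gt0 : 0 < theta).
Variables (X : T -> set Rd) (poisX : poisson_process P theta X).
Let wm : {finite_measure set Rd -> \bar R} := wmeas cW.
Let mW := measurable_window cW.
Let regW : W `<=` closure W° := C2_regular cW C2W.
Let mWo : measurable W° := measurable_interior W.
Let Ev n : set T := [set w | count X W w = n].
Let mEv n : measurable (Ev n) := measurable_countW cW poisX n.
Let wt := poisson_weight W theta.
Let I n (G : 'M[R]_(n, d) -> R) : R := \int[pm wm n]_(z in Wpow W° n) G z.

Let WoW n : Wpow W° n `<=` Wpow W n.
Proof. by move=> z zW i; apply: interior_subset; exact: zW. Qed.

Let pm_fin_Wo n : (pm wm n (Wpow W° n) < +oo)%E.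
Proof.
rewrite ltey_eq fin_num_measure//; exact: (@measurable_Wpow R d _ n mWo).
Qed.

Let bm_I n (G : 'M[R]_(n, d) -> R) : bm (Wpow W n) G ->
  (pm wm n).-integrable (Wpow W° n) (EFin \o G).
Proof.
move=> bG; have [mG [M GM]] := bmS (measurable_WpowW cW (n:=n)) (@WoW n) bG.
exact: (@bounded_integrable _ _ _ (pm wm n) _ G M (@measurable_Wpow R d _ n mWo) (pm_fin_Wo n) mG GM).
Qed.

(** The origin of the factor theta in the compensator: summing over n + 1 exchangeable points turns
    the weight of n + 1 points into theta times the weight of n points. *)
Lemma poisson_weightS n : wt n.+1 * n.+1%:R = theta * wt n.
Proof.
rewrite /wt /poisson_weight factS natrM exprS; set r := expR _.
have n0 : n.+1%:R != 0 :> R by rewrite pnatr_eq0.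
have f0 : n`!%:R != 0 :> R by rewrite pnatr_eq0 -lt0n fact_gt0.
by move: (n.+1%:R) n0 (n`!%:R) f0 (theta ^+ n) => a a0 b b0 c; field; rewrite a0 b0.
Qed.

Lemma Rlaw n (G : 'M[R]_(n, d) -> R) : bm (Wpow W n) G ->
  (forall (s : 'S_n) z, Wpow W n z -> G (row_perm s z) = G z) ->
  \int[P]_(w in Ev n) G (Xn X W n w) = wt n * I G.
Proof.
move=> bG symG; have [mG [M GM]] := bG.
rewrite /Rintegral (law d_gt0 cW C2W theta_gt0 poisX mG GM symG) fineM//.
have h := integrable_fin_num (@measurable_Wpow R d _ n mWo) (bm_I bG).
exact: h.
Qed.

Lemma I_app n (G : 'M[R]_(n.+1, d) -> R) : bm (Wpow W n.+1) G ->
  I G = I (fun z => \int[leb]_(u in W°) G (app z u)).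
Proof.
move=> bG; have [mG [M GM]] := bmS (measurable_WpowW cW (n:=n.+1)) (@WoW n.+1) bG.
rewrite /I /Rintegral (integral_pm_app wm mWo mG GM); congr fine.
apply: eq_integral => z; rewrite inE => zW.
have bz : bm W° (fun u => G (app z u)).
  split; last by exists M => u Wu; apply: GM; exact/Wpow_app.
  have sub : app z @` W° `<=` Wpow W° n.+1 by move=> _ [u Wu <-]; exact/Wpow_app.
  have mz : measurable_fun W° (app z).
    have := measurableT_comp (@measurable_app R d n) (pair1_measurable z).
    by apply: measurable_funS => //; exact: measurableT.
  exact: (measurable_comp (@measurable_Wpow R d _ n.+1 mWo) sub mG mz).
have iz := @bm_integrable _ _ _ leb _ _ mWo (interior_fin cW) bz.
rewrite fineK; last exact: integrable_fin_num iz.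
pose G0 := (fun u => (G (app z u))%:E) \_ W°.
have mG0 : measurable_fun setT G0.
  by apply/(measurable_restrictT _ mWo)/measurable_EFinP; case: bz.
transitivity (\int[mrestr leb mWo]_u G0 u)%E; first by rewrite integral_mkcond.
rewrite (integral_mrestr leb mWo mG0).
by apply: eq_integral => u uW; rewrite /G0 patchT.
Qed.

Lemma I_perm n (s : 'S_n) (G : 'M[R]_(n, d) -> R) : bm (Wpow W n) G ->
  I (fun z => G (row_perm s z)) = I G.
Proof.
move=> bG; congr fine; apply: integral_pm_perm => //.
  move=> u; apply: (subset_measure0 _ _ _ (leb_set1 d_gt0 u)) => //.
    apply: measurableI => //; apply: compact_measurable_mx; exact: compact_set1.
  by apply: compact_measurable_mx; exact: compact_set1.
exact: bmS (measurable_WpowW cW (n:=n)) (@WoW n) bG.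
Qed.

Lemma ID n (F G : 'M[R]_(n, d) -> R) : bm (Wpow W n) F -> bm (Wpow W n) G ->
  I (fun z => F z + G z) = I F + I G.
Proof.
by move=> bF bG; apply: RintegralD; [exact: (@measurable_Wpow R d _ n mWo)|exact: bm_I|exact: bm_I].
Qed.

Lemma IZ n a (F : 'M[R]_(n, d) -> R) : bm (Wpow W n) F ->
  I (fun z => a * F z) = a * I F.
Proof.
by move=> bF; apply: RintegralZl; [exact: (@measurable_Wpow R d _ n mWo)|exact: bm_I].
Qed.

Lemma I_sum n (J : seq 'I_n) (F : 'I_n -> 'M[R]_(n, d) -> R) :
  (forall i, bm (Wpow W n) (F i)) ->
  I (fun z => \sum_(i <- J) F i z) = \sum_(i <- J) I (F i).
Proof.
move=> bF; elim: J => [|i J IH].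
  rewrite big_nil; transitivity (I (fun _ : 'M[R]_(n, d) => 0)).
    by apply: eq_Rintegral => z _; rewrite big_nil.
  by rewrite /I Rintegral_cst ?mul0r//; exact: (@measurable_Wpow R d _ n mWo).
rewrite big_cons -IH -ID//; last exact: bm_sum.
by apply: eq_Rintegral => z _; rewrite big_cons.
Qed.

(** By exchangeability each index contributes as much as the last one, to which it is carried by a
    transposition. *)
Lemma I_last n (F : 'I_n.+1 -> 'M[R]_(n.+1, d) -> R) :
  (forall i, bm (Wpow W n.+1) (F i)) ->
  (forall i (s : 'S_n.+1) z, Wpow W n.+1 z -> F i (row_perm s z) = F (s i) z) ->
  I (fun z => \sum_i F i z) = n.+1%:R * I (F ord_max).
Proof.
move=> bF symF; rewrite I_sum// (eq_bigr (fun=> I (F ord_max))).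
  by rewrite sumr_const card_ord mulr_natl.
move=> i _; rewrite -(I_perm (tperm i ord_max) (bF i)).
by apply: eq_Rintegral => z /set_mem/WoW zW; rewrite symF// tpermL.
Qed.

(** Dominated convergence on the increasing events of fewer than n points, [series u n] being the
    sum over indices below n. *)
Lemma cvg_count_series (F : T -> R) : P.-integrable setT (EFin \o F) ->
  series (fun n => \int[P]_(w in Ev n) F w) @ \oo --> \int[P]_w F w.
Proof.
move=> iF; pose S n : set T := [set w | (count X W w < n)%N].
have mS n : measurable (S n).
  rewrite (_ : S n = \bigcup_(i < n) Ev i).
    by apply: bigcup_measurable => i _; exact: mEv.
  apply/seteqP; split => [w wn|w [i i_n wi]].
    by exists (count X W w).
  by rewrite /S /= (wi : count X W w = i).
have iD (D : set T) : measurable D -> P.-integrable D (EFin \o F).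
  by move=> mD; apply: integrableS iF.
have e n : series (fun n => \int[P]_(w in Ev n) F w) n = \int[P]_(w in S n) F w.
  elim: n => [|n IH].
    rewrite /series/= big_geq// (_ : S 0 = set0) ?Rintegral_set0//.
    by apply/seteqP; split.
  rewrite seriesSr IH; rewrite (_ : S n.+1 = S n `|` Ev n); last first.
    apply/seteqP; split => [w|w [|wn]].
    - by rewrite /S /= ltnS leq_eqVlt => /orP[/eqP|]; [right|left].
    - exact: ltnW.
    - by rewrite /S /= (wn : count X W w = n).
  rewrite Rintegral_setU//; first exact: iD (measurableU _ _ (mS n) (mEv n)).
  by apply/disj_setPS => w [] /= + wn; rewrite /S /= (wn : count X W w = n) ltnn.
have -> : series (fun n => \int[P]_(w in Ev n) F w) =
  (fun n => \int[P]_(w in S n) F w) by exact/funext.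
apply: fine_cvg; rewrite fineK; last exact: integrable_fin_num iF.
pose f_ n := (EFin \o F) \_ (S n).
rewrite (_ : (fun n => _) = (fun n => \int[P]_w f_ n w)%E); last first.
  by apply/funext => n; rewrite integral_mkcond.
have [_ mF] := integrableP _ _ _ iF.
apply: (@dominated_cvg _ _ _ P setT measurableT f_ (EFin \o F) (abse \o (EFin \o F))) => //.
- by move=> n; apply/(measurable_restrictT _ (mS n)); have [] := integrableP _ _ _ (iD _ (mS n)).
- move=> w _; apply: cvg_near_cst; exists (count X W w).+1 => // n /= wn.
  by rewrite /f_ patchT// mem_set.
- exact: integrable_abse.
- by move=> n w _; rewrite /f_ /patch; case: ifPn => // _; rewrite abse0; exact: abse_ge0.
Qed.

(* Partial summation over the number of points. *)
Lemma count_telescope (A B F : T -> R) (c : R) :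
  P.-integrable setT (EFin \o A) -> P.-integrable setT (EFin \o B) ->
  P.-integrable setT (EFin \o F) ->
  \int[P]_(w in Ev 0) A w = 0 -> \int[P]_(w in Ev 0) B w = 0 ->
  (forall n, \int[P]_(w in Ev n.+1) A w =
     \int[P]_(w in Ev n.+1) B w - c * \int[P]_(w in Ev n) F w) ->
  \int[P]_w A w = \int[P]_w B w - c * \int[P]_w F w.
Proof.
move=> iA iB iF A0 B0 AB.
have sA := cvg_count_series iA; have sB := cvg_count_series iB.
have sF := cvg_count_series iF.
have e n : series (fun n => \int[P]_(w in Ev n) A w) n.+1 =
  series (fun n => \int[P]_(w in Ev n) B w) n.+1 -
  c * series (fun n => \int[P]_(w in Ev n) F w) n.
  elim: n => [|n IH].
    by rewrite !seriesSr /series/= !big_geq// A0 B0 mulr0 subr0.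
  have h (u : nat -> R) m : series u m.+1 = series u m + u m by exact: seriesSr.
  rewrite (h _ n.+1) IH AB [X in _ = X - _](h _ n.+1) [X in _ = _ - c * X](h _ n).
  by ring.
apply: (@cvgR_unique _ (fun n => series (fun n => \int[P]_(w in Ev n) A w) n.+1)).
  by have := sA; rewrite -cvg_shiftS.
under eq_fun do rewrite e.
apply: cvgB; first by have := sB; rewrite -cvg_shiftS.
by apply: cvgM => //; exact: cvg_cst.
Qed.

Section one_field.
Variables (f : form) (A C : R) (tf : tame W f A C) (cf : compatible W f).
Arguments f : clear implicits.
Variables (v : Rd -> Rd) (c1v : C1_on_vec W v).

Let bW (g : Rd -> R) : {within W, continuous g} -> bm W g.
Proof.
move=> cg; split; first exact: within_continuous_measurable cg.
by have [c _ hc] := within_continuous_bounded cW cg; exists c.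
Qed.

Let bv k : bm W (fun u => v u 0 k).
Proof. by apply: bW; have [] := c1v k. Qed.

Let bpv k : bm W (partial W 0 k (fun u => v u 0 k)).
Proof. by apply: bW; have [_ _ h] := c1v k; exact: h. Qed.

Lemma bm_divergence : bm W (divergence W v).
Proof. exact: bm_sum. Qed.

Lemma bm_form n : bm (Wpow W n) (f n).
Proof.
split; first exact: tame_measurable tf.
by exists (A * C ^+ n) => z zW; have [_ _ h _] := tf; exact: h.
Qed.

Lemma bm_partial n i k : bm (Wpow W n) (partial (Wpow W n) i k (f n)).
Proof.
split; first exact: tame_measurable_partial tf.
by exists (A * C ^+ n) => z zW; have [_ _ _ h] := tf; exact: h.
Qed.

Lemma bm_row n (i : 'I_n) (g : Rd -> R) : bm W g ->
  bm (Wpow W n) (fun z => g (row i z)).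
Proof.
move=> bg; apply: (bm_comp mW (@measurable_row R d n i) _ bg) => [z zW|].
  exact: zW.
exact: (measurable_WpowW cW (n:=n)).
Qed.

(** The contribution of the i-th point to the pairing of the derivative with V, up to sign, once V
    has been integrated against [pi]: [v] stands for [V_pi]. *)
Definition flux n (i : 'I_n) (z : 'M[R]_(n, d)) : R :=
  \sum_k v (row i z) 0 k * partial (Wpow W n) i k (f n) z.

Lemma bm_flux n i : bm (Wpow W n) (@flux n i).
Proof.
apply: bm_sum => k; apply: bmM; last exact: bm_partial.
exact: (bm_row i (bv k)).
Qed.

Let row_perm_row n (s : 'S_n) (z : 'M[R]_(n, d)) i :
  row i (row_perm s z) = row (s i) z.
Proof. by apply/rowP => j; rewrite !mxE. Qed.

Lemma flux_perm n i (s : 'S_n) z : Wpow W n z ->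
  flux i (row_perm s z) = flux (s i) z.
Proof.
move=> zW; apply: eq_bigr => k _; have [symf c1f _ _] := tf.
have n0 : (0 < n)%N by apply: leq_ltn_trans (ltn_ord i).
have e := partial_perm cW C2W s i k (symf n) (c1f n n0) zW.
exact: (congr2 (fun u b => v u 0 k * b) (row_perm_row s z i) e).
Qed.

(** The term with [f n z] is the price of subtracting a quantity independent of the last point to
    reach zero boundary values. It involves one point less and becomes the compensator. *)
Lemma flux_slice n (z : 'M[R]_(n, d)) : Wpow W° n z ->
  \int[leb]_(u in W°) flux ord_max (app z u) =
  f n z * \int[leb]_(u in W°) divergence W v u -
  \int[leb]_(u in W°) (f n.+1 (app z u) * divergence W v u).
Proof.
move=> zW; have [_ c1f _ _] := tf.
have zW' := WoW zW.
have [c1s ps] := C1_on_slice regW (c1f n.+1 isT) zW.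
have [c1c pc] := C1_on_cst cW C2W (- f n z).
pose g u := f n.+1 (app z u) - f n z.
have [c1g0 pg0] := C1_on_D regW 1 c1s c1c.
have [c1g pg] := C1_on_eq cW C2W (g := g) (fun u _ => congr1 (fun a => a + _) (mul1r _)) c1g0.
have pgE k u : W u -> partial W 0 k g u =
    partial (Wpow W n.+1) ord_max k (f n.+1) (app z u).
  move=> Wu; rewrite (pg 0 k u Wu) (pg0 0 k u Wu) (pc 0 k u Wu) (ps 0 k u Wu).
  by rewrite mul1r addr0.
have bsl : bm W (fun u => f n.+1 (app z u)) by apply: bW; have [] := c1s.
have bg : bm W g by apply: bW; have [] := c1g.
have bpg k : bm W (partial W 0 k g) by apply: bW; have [_ _ h] := c1g; exact: h.
have bWo (h : Rd -> R) : bm W h -> leb.-integrable W° (EFin \o h).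
  move=> bh; apply: (@bm_integrable _ _ _ leb _ _ mWo (interior_fin cW)).
  by apply: bmS bh => //; exact: interior_subset.
have ibp k : \int[leb]_(u in W°) (g u * partial W 0 k (fun y => v y 0 k) u +
    v u 0 k * partial W 0 k g u) = 0.
  have [c1h ph] := C1_on_M regW c1g (c1v k).
  have h0 x : frontier W x -> (g * (fun y => v y 0 k)) x = 0.
    move=> Fx; rewrite [LHS](_ : _ = g x * v x 0 k)// /g.
    by rewrite -forms_app (cf zW' Fx) subrr mul0r.
  have := integral_partial0 cW k c1h regW h0.
  move=> /(congr1 fine); rewrite -[fine (\int[_]_(_ in _) _)]/(\int[leb]_(x in W°) _) /= => <-.
  by apply: eq_Rintegral => u /set_mem/interior_subset Wu; rewrite (ph 0 k u Wu).
have bdv := bm_divergence; have Wo_W : W° `<=` W by exact: interior_subset.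
have bfl : bm W (fun u => flux ord_max (app z u)).
  have e u : flux ord_max (app z u) = \sum_k v u 0 k *
      partial (Wpow W n.+1) ord_max k (f n.+1) (app z u).
    by apply: eq_bigr => k _; rewrite row_app_max.
  have h : bm W (fun u => \sum_k v u 0 k * partial W 0 k g u).
    by apply: bm_sum => k; apply: bmM.
  have [mh [M hM]] := h; split.
    apply: eq_measurable_fun mh => u /set_mem Wu; rewrite e.
    by apply: eq_bigr => k _; rewrite pgE.
  exists M => u Wu; rewrite e.
  by under eq_bigr do rewrite -pgE//; exact: hM.
have sum0 : \int[leb]_(u in W°) (g u * divergence W v u + flux ord_max (app z u)) = 0.
  have -> : \int[leb]_(u in W°) (g u * divergence W v u + flux ord_max (app z u)) =
      \int[leb]_(u in W°) \sum_(k <- index_enum 'I_d)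
        (g u * partial W 0 k (fun y => v y 0 k) u + v u 0 k * partial W 0 k g u).
    apply: eq_Rintegral => u /set_mem/Wo_W Wu; rewrite big_split /= -mulr_sumr.
    congr (_ + _); apply: eq_bigr => k _; rewrite row_app_max pgE//.
  elim: (index_enum 'I_d) => [|k r IH].
    under eq_Rintegral do rewrite big_nil.
    by rewrite Rintegral_cst// mul0r.
  under eq_Rintegral do rewrite big_cons.
  rewrite RintegralD//; first by rewrite IH addr0; exact: ibp.
  - by apply: bWo; apply: bmD; apply: bmM.
  - by apply: bWo; apply: bm_sum => l; apply: bmD; apply: bmM.
have bfd : bm W (fun u => f n.+1 (app z u) * divergence W v u) by exact: bmM.
have : \int[leb]_(u in W°) (g u * divergence W v u + flux ord_max (app z u)) =
   \int[leb]_(u in W°) (f n.+1 (app z u) * divergence W v u) -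
   f n z * \int[leb]_(u in W°) divergence W v u +
   \int[leb]_(u in W°) flux ord_max (app z u).
  rewrite -RintegralZl//; last exact: bWo.
  rewrite -RintegralB//; [|exact: bWo|by apply: bWo; apply: bmM => //; exact: bm_cst].
  rewrite -RintegralD//; [|apply: bWo|exact: bWo].
    by apply: eq_Rintegral => u _; rewrite /g mulrBl.
  by apply: bmD => //; apply: bmN; apply: bmM => //; exact: bm_cst.
by rewrite sum0; lra.
Qed.


Let D := \int[leb]_(u in W) divergence W v u.

Let D_interior : \int[leb]_(u in W°) divergence W v u = D.
Proof.
congr fine; apply: (integral_interior cW C2W).
by apply/measurable_EFinP; case: bm_divergence.
Qed.

Definition total_flux n (z : 'M[R]_(n, d)) : R := - \sum_i flux i z.

Definition total_divergence n (z : 'M[R]_(n, d)) : R :=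
  f n z * \sum_i divergence W v (row i z).

Lemma bm_total_flux n : bm (Wpow W n) (@total_flux n).
Proof. by apply/bmN/bm_sum => i; exact: bm_flux. Qed.

Lemma bm_total_divergence n : bm (Wpow W n) (@total_divergence n).
Proof.
apply: bmM; first exact: bm_form.
by apply: bm_sum => i; apply: bm_row; exact: bm_divergence.
Qed.

Lemma total_flux_perm n (s : 'S_n) z : Wpow W n z ->
  total_flux (row_perm s z) = total_flux z.
Proof.
move=> zW; congr (- _); rewrite [RHS](reindex_inj (@perm_inj _ s)).
by apply: eq_bigr => i _; exact: flux_perm.
Qed.

Lemma total_divergence_perm n (s : 'S_n) z : Wpow W n z ->
  total_divergence (row_perm s z) = total_divergence z.
Proof.
move=> zW; have [symf _ _ _] := tf.
have e : \sum_i divergence W v (row i (row_perm s z)) = \sum_i divergence W v (row i z).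
  rewrite [RHS](reindex_inj (@perm_inj _ s)); apply: eq_bigr => i _.
  exact: congr1 (row_perm_row s z i).
exact: congr2 (symf n s z zW) e.
Qed.

(** Exchangeability reduces the sums to the last point, where [flux_slice] applies, and
    [poisson_weightS] converts the term with one point less. *)
Lemma flux_step n : wt n.+1 * I (@total_flux n.+1) =
  wt n.+1 * I (@total_divergence n.+1) - theta * D * (wt n * I (f n)).
Proof.
have bfl i : bm (Wpow W n.+1) (@flux n.+1 i) by exact: bm_flux.
pose G (i : 'I_n.+1) z := f n.+1 z * divergence W v (row i z).
have bG i : bm (Wpow W n.+1) (G i).
  by apply: bmM; [exact: bm_form|apply: bm_row; exact: bm_divergence].
have eF : I (@total_flux n.+1) = - (n.+1%:R * I (@flux n.+1 ord_max)).
  rewrite -(I_last bfl); last by move=> i s z zW; exact: flux_perm.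
  rewrite -mulN1r -IZ; last exact: bm_sum.
  by apply: eq_Rintegral => z _; rewrite mulN1r.
have eG : I (@total_divergence n.+1) = n.+1%:R * I (G ord_max).
  rewrite -(I_last bG); first by apply: eq_Rintegral => z _; rewrite /total_divergence mulr_sumr.
  move=> i s z zW; have [symf _ _ _] := tf.
  exact: congr2 (symf _ s z zW) (congr1 (divergence W v) (row_perm_row s z i)).
have mtop : measurable_fun setT (row' ord_max : 'M[R]_(n.+1, d) -> 'M[R]_(n, d)).
  apply: measurable_fun_mx => i k; rewrite (_ : (fun _ => _) =
    (fun M : 'M[R]_(n.+1, d) => M (lift ord_max i) k)).
    exact: measurable_coord_mx.
  by apply/funext => z; rewrite mxE.
(* The term with one point less, rewritten as a function of n + 1 points whose integral factorizes;
   all terms can then be compared slice by slice. *)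
pose H z := f n (row' ord_max z) * divergence W v (row ord_max z).
have bH : bm (Wpow W n.+1) H.
  apply: bmM; last by apply: bm_row; exact: bm_divergence.
  apply: (bm_comp (measurable_WpowW cW (n:=n)) mtop _ (bm_form n)).
    move=> z zW i; have := zW (lift ord_max i); congr W.
    by apply/rowP => k; rewrite !mxE.
  exact: (measurable_WpowW cW (n:=n.+1)).
have topE z u : row' ord_max (app z u) = z :> 'M[R]_(n, d).
  by apply/matrixP => i k; rewrite !mxE liftK.
have HE z : \int[leb]_(u in W°) H (app z u) =
    f n z * \int[leb]_(u in W°) divergence W v u.
  have idv : leb.-integrable W° (EFin \o divergence W v).
    apply: (@bm_integrable _ _ _ leb _ _ mWo (interior_fin cW)).
    by apply: bmS bm_divergence => //; exact: interior_subset.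
  apply: etrans _ (RintegralZl (f n z) mWo idv).
  apply: eq_Rintegral => u _; rewrite /H.
  exact: (congr2 (fun a b => f n a * divergence W v b) (topE z u) (row_app_max z u)).
have IH : I H = D * I (f n).
  rewrite (I_app bH) -IZ; last exact: bm_form.
  apply: eq_Rintegral => z /set_mem zW; apply: etrans (HE z) _.
  by rewrite D_interior; exact: mulrC.
have slice : I (@flux n.+1 ord_max) = D * I (f n) - I (G ord_max).
  have bFG : bm (Wpow W n.+1) (fun z => flux ord_max z + G ord_max z) by exact: bmD.
  have : I (fun z => flux ord_max z + G ord_max z) = I H.
    rewrite (I_app bH) (I_app bFG); apply: eq_Rintegral => z /set_mem zW.
    have bo (h : 'M[R]_(n.+1, d) -> R) : bm (Wpow W n.+1) h ->
        leb.-integrable W° (EFin \o (fun u => h (app z u))).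
      move=> bh; have mz : measurable_fun setT (app z).
        exact: (measurableT_comp (@measurable_app R d n) (pair1_measurable z)).
      apply: (@bm_integrable _ _ _ leb _ _ mWo (interior_fin cW)).
      apply: (bm_comp (measurable_WpowW cW (n:=n.+1)) mz _ bh mWo) => u Wu.
      by apply/Wpow_app; split; [exact: WoW|exact: interior_subset].
    rewrite RintegralD//; [|exact: bo|exact: bo].
    rewrite (flux_slice zW).
    have -> : \int[leb]_(u in W°) G ord_max (app z u) =
        \int[leb]_(u in W°) (f n.+1 (app z u) * divergence W v u).
      apply: eq_Rintegral => u _.
      exact: (congr1 (fun b => f n.+1 (app z u) * divergence W v b) (row_app_max z u)).
    by rewrite subrK; apply: esym; exact: HE.
  by rewrite ID// IH => <-; rewrite addrK.
rewrite eF eG slice -[theta * D * _]mulrA.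
have -> : theta * (D * (wt n * I (f n))) = wt n.+1 * n.+1%:R * (D * I (f n)).
  by rewrite poisson_weightS; ring.
by ring.
Qed.

Let v_bound : exists2 c, 0 <= c & forall u k, W u -> `|v u 0 k| <= c.
Proof.
have /choice[M hM] : forall k, exists M, forall u, W u -> `|v u 0 k| <= M.
  by move=> k; have [_] := bv k.
exists (\sum_k `|M k|); first exact: sumr_ge0.
move=> u k Wu; apply: le_trans (hM k u Wu) _; apply: le_trans (ler_norm _) _.
by rewrite (bigD1 k)//= lerDl; exact: sumr_ge0.
Qed.

Hypothesis (A0 : 0 <= A) (C0 : 0 <= C).

Lemma total_flux_bound : exists2 K, 0 <= K &
  forall n z, Wpow W n z -> `|total_flux z| <= K * (2 * C) ^+ n.
Proof.
have [c c0 hc] := v_bound; have [_ _ _ pC] := tf.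
exists (d%:R * (c * A)); first by rewrite !mulr_ge0.
move=> n z zW; rewrite /total_flux normrN; apply: sum_growth => // [|i].
  by rewrite !mulr_ge0.
apply: le_trans (ler_norm_sum _ _ _) _.
apply: (@le_trans _ _ (\sum_(k < d) c * (A * C ^+ n))).
  apply: ler_sum => k _; rewrite normrM; apply: ler_pM => //; last exact: pC.
  by apply: hc; exact: zW.
by rewrite sumr_const card_ord -[leLHS]mulr_natl !mulrA.
Qed.

Lemma integrable_total_flux : P.-integrable setT (EFin \o functional X W total_flux).
Proof.
have [K K0 hK] := total_flux_bound.
apply: (integrable_at_count cW poisX (A := K) (C := 2 * C)) => //.
- exact: mulr_ge0.
- by move=> n; have [] := bm_total_flux n.
- by move=> n s z zW; exact: total_flux_perm.
Qed.

Lemma integrable_total_divergence :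
  P.-integrable setT (EFin \o functional X W total_divergence).
Proof.
have [_ [c hc]] := bm_divergence; have [_ _ fC _] := tf.
apply: (integrable_at_count cW poisX (A := A * `|c|) (C := C * (2 * 1))).
- by rewrite !mulr_ge0.
- by move=> n; have [] := bm_total_divergence n.
- by move=> n s z zW; exact: total_divergence_perm.
move=> n z zW; rewrite normrM exprMn mulrACA; apply: ler_pM => //; first exact: fC.
apply: sum_growth => // i; rewrite expr1n mulr1; apply: le_trans (ler_norm c).
by apply: hc; exact: zW.
Qed.

Lemma count_duality : \int[P]_w functional X W total_flux w =
  \int[P]_w functional X W total_divergence w - theta * D * \int[P]_w functional X W f w.
Proof.
have law_of (G : form) n : bm (Wpow W n) (G n) ->
    (forall (s : 'S_n) z, Wpow W n z -> G n (row_perm s z) = G n z) ->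
    \int[P]_(w in Ev n) functional X W G w = wt n * I (G n).
  move=> bG symG; rewrite -Rlaw//; apply: eq_Rintegral => w /set_mem wn.
  exact: at_count.
have [symf _ fC _] := tf.
have lF n := law_of total_flux n (bm_total_flux n) (@total_flux_perm n).
have lB n := law_of total_divergence n (bm_total_divergence n) (@total_divergence_perm n).
have lf n := law_of f n (bm_form n) (symf n).
apply: count_telescope.
- exact: integrable_total_flux.
- exact: integrable_total_divergence.
- apply: (integrable_at_count cW poisX C0) fC => // n.
  exact: tame_measurable tf.
- apply: etrans (lF 0) _; rewrite (_ : @total_flux 0 = fun=> 0).
    by rewrite /I Rintegral_cst ?mul0r ?mulr0//; exact: (@measurable_Wpow R d _ 0 mWo).
  by apply/funext => z; rewrite /total_flux big_ord0 oppr0.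
- apply: etrans (lB 0) _; rewrite (_ : @total_divergence 0 = fun=> 0).
    by rewrite /I Rintegral_cst ?mul0r ?mulr0//; exact: (@measurable_Wpow R d _ 0 mWo).
  by apply/funext => z; rewrite /total_divergence big_ord0 mulr0.
- move=> n; apply: etrans (lF n.+1) (etrans (flux_step n) _).
  have eB := lB n.+1; have ef := lf n.
  by move: eB ef => -> ->.
Qed.

End one_field.

End poisson_duality.

Lemma Rintegral_lincomb (R : realType) dS (S : measurableType dS)
    (mu : {measure set S -> \bar R}) (D : set S) (I : Type) (r : seq I)
    (a : I -> R) (h : I -> S -> R) : measurable D ->
  (forall i, mu.-integrable D (EFin \o h i)) ->
  mu.-integrable D (EFin \o (fun x => \sum_(i <- r) a i * h i x)) /\
  \int[mu]_(x in D) (\sum_(i <- r) a i * h i x) =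
  \sum_(i <- r) a i * \int[mu]_(x in D) h i x.
Proof.
move=> mD ih; elim: r => [|i r [IH1 IH2]].
  have e : (fun x => \sum_(i <- [::]) a i * h i x) = cst 0 :> (S -> R).
    by apply/funext => x; rewrite big_nil.
  by rewrite e big_nil Rintegral_cst// mul0r; split => //; exact: integrable0.
have e : (fun x => \sum_(j <- i :: r) a j * h j x) =
    (fun x => a i * h i x + \sum_(j <- r) a j * h j x).
  by apply/funext => x; rewrite big_cons.
have i1 : mu.-integrable D (EFin \o (fun x => a i * h i x)).
  exact: (integrableZl mD (a i) (ih i)).
rewrite e big_cons RintegralD// RintegralZl// IH2; split => //.
exact: (integrableD mD i1 IH1).
Qed.

Lemma ae_bounded_integrable dS (S : measurableType dS) (R : realType)
    (mu : {measure set S -> \bar R}) (D : set S) (f : S -> R) (c : R) :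
  measurable D -> (mu D < +oo)%E -> measurable_fun D f -> 0 <= c ->
  {ae mu, forall x, D x -> `|f x| <= c} -> mu.-integrable D (EFin \o f).
Proof.
move=> mD D0 mf c0 fc; apply/integrableP; split; first exact/measurable_EFinP.
apply: (@le_lt_trans _ _ (\int[mu]_(x in D) c%:E)%E).
  apply: ae_ge0_le_integral => //.
  by apply: measurableT_comp => //; exact/measurable_EFinP.
rewrite (_ : (fun=> _) = cst c%:E)// integral_cst// lte_mul_pinfty//.
Qed.

(** * The adjoint on deterministic fields *)

Section deterministic_field.
Context {R : realType} {d : nat} (d_gt0 : (0 < d)%N).
Local Notation Rd := 'rV[R]_d.
Local Notation form := (forms (R := R) (d := d)).
Variables (W : set Rd) (cW : compact W) (C2W : C2_boundary W) (W_pos : (0 < leb W)%E).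
Context {dT : measure_display} {T : measurableType dT}.
Variables (P : probability T R) (theta : R) (theta_gt0 : 0 < theta).
Variables (X : T -> set Rd) (poisX : poisson_process P theta X).
Local Notation FW := (F_W_type X W).
Variables (pi : Rd -> Rd -> R) (M : R) (piK : pi_kernel W pi M).
Variable V : Rd -> Rd.
Hypothesis mV : measurable_fun W V.
Hypothesis bV : (Linfty_norm W (fun x => enorm (V x)) < +oo)%E.
Let mW := measurable_window cW.
Let v := V_pi W pi V.

Let mVk k : measurable_fun W (fun x => V x 0 k).
Proof. exact: (measurableT_comp (measurable_coord_mx 0 k) mV). Qed.

Let integrable_Vpi u k : W u -> leb.-integrable W (EFin \o (fun x => V x 0 k * pi u x)).
Proof.
move=> Wu; have [c c0 hc] := ae_bounded_field cW W_pos bV.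
apply: (@ae_bounded_integrable _ _ _ leb W _ (c * `|M|) mW (window_fin cW)).
- by apply: measurable_funM => //; exact: (measurable_pi cW piK Wu).
- exact: mulr_ge0.
- apply: filterS hc => x h Wx; rewrite normrM; apply: ler_pM => //; first exact: h.
  by apply: le_trans (ler_norm M); have [_] := piK; apply.
Qed.

(** For a fixed outcome the derivative is a finite combination of the functions [pi(X_i, .)];
    integrating V against each of them gives [V_pi] at the point X_i, and the field variable
    disappears. *)
Lemma smear_pairing (f : form) (w : T) :
  leb.-integrable W (EFin \o (fun x => dot (derivative_field X W pi f w x) (V x))) /\
  \int[leb]_(x in W) dot (derivative_field X W pi f w x) (V x) =
  functional X W (total_flux W f v) w.
Proof.
set n := count X W w; pose z : 'M[R]_(n, d) := X_W X W w.
have zW i : W (row i z) by exact: (X_W_Wpow cW poisX).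
pose a (p : 'I_n * 'I_d) := - partial (Wpow W n) p.1 p.2 (f n) z.
pose h (p : 'I_n * 'I_d) x := V x 0 p.2 * pi (row p.1 z) x.
have e : (fun x => dot (derivative_field X W pi f w x) (V x)) =
    (fun x => \sum_p a p * h p x).
  apply/funext => x; rewrite -(pair_bigA _ (fun i k => a (i, k) * h (i, k) x)) /=.
  rewrite exchange_big /=; apply: eq_bigr => k _.
  apply: etrans (f_equal (fun b => b * V x 0 k) (derivative_fieldE W X pi f w x k)) _.
  rewrite mulNr mulr_suml -sumrN; apply: eq_bigr => i _.
  by rewrite /a /h /= mulNr; congr (- _); rewrite mulrC mulrA mulrC.
have [i1 i2] := @Rintegral_lincomb _ _ _ leb W _ (index_enum ('I_n * 'I_d)%type) a h mW
  (fun p => integrable_Vpi p.2 (zW p.1)).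
rewrite e; split => //; apply: etrans i2 _.
rewrite -(pair_bigA _ (fun i k => a (i, k) * \int[leb]_(x in W) h (i, k) x)) /=.
rewrite /functional /total_flux -sumrN; apply: eq_bigr => i _.
rewrite /flux -sumrN; apply: eq_bigr => k _.
rewrite mulNr; congr (- _); rewrite mulrC; congr (_ * _).
by rewrite /v /V_pi mxE.
Qed.

Hypothesis c1v : C1_on_vec W v.

Definition flux_divergence (w : T) : R :=
  \sum_(u \in X w `&` W) divergence W v u -
  theta * \int[leb]_(u in W) divergence W v u.

Lemma sum_points (g : Rd -> R) w :
  \sum_(u \in X w `&` W) g u = \sum_(i < count X W w) g (row i (X_W X W w)).
Proof.
rewrite fsbig_finite; last exact: (finite_window cW poisX).
rewrite -/(points X W w) (big_nth 0) big_mkord; apply: eq_bigr => i _.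
by congr g; apply/rowP => j; rewrite !mxE.
Qed.

Let div_form n (z : 'M[R]_(n, d)) : R := \sum_i divergence W v (row i z) -
  theta * \int[leb]_(u in W) divergence W v u.

Let flux_divergenceE : flux_divergence = functional X W div_form.
Proof. by apply/funext => w; rewrite /flux_divergence sum_points. Qed.

Lemma flux_divergence_growth :
  measurable_fun setT (flux_divergence : FW -> R) /\
  exists2 K, 0 <= K & forall w, `|flux_divergence w| <= K * 2 ^+ count X W w.
Proof.
have [mdv [c hc]] := bm_divergence cW c1v.
set K := `|theta * \int[leb]_(u in W) divergence W v u|.
rewrite flux_divergenceE; split; last exists (`|c| + K).
- apply: (measurable_at_count cW poisX) => [n|n s z zW].
    apply: measurable_funB; last exact: measurable_cst.
    have bs : bm (Wpow W n) (fun z => \sum_i divergence W v (row i z)).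
      by apply: bm_sum => i; apply: (bm_row cW i); exact: bm_divergence.
    exact: bs.1.
  have e : \sum_i divergence W v (row i (row_perm s z)) = \sum_i divergence W v (row i z).
    rewrite [RHS](reindex_inj (@perm_inj _ s)); apply: eq_bigr => i _.
    have r : row i (row_perm s z) = row (s i) z by apply/rowP => j; rewrite !mxE.
    by rewrite r.
  by have e' := f_equal (fun b => b - theta * \int[leb]_(u in W) divergence W v u) e; exact: e'.
- by rewrite addr_ge0// normr_ge0.
move=> w; apply: le_trans (ler_normB _ _) _; rewrite mulrDl; apply: lerD.
  rewrite -[2]mulr1; apply: sum_growth => // i; rewrite expr1n mulr1.
  by apply: le_trans (ler_norm c); apply: hc; exact: (X_W_Wpow cW poisX).
by rewrite ler_peMr// exprn_ege1// ler1n.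
Qed.

Lemma flux_divergence_in_L2 : in_l2 (flux_divergence : L2_Omega P X W).
Proof.
have [mf [K K0 hK]] := flux_divergence_growth.
exact: (growth_in_L2 cW poisX (A := K) (C := 2)).
Qed.

Lemma deterministic_in_L2 : in_l2 ((fun=> V) : L2_field P X W).
Proof.
split.
  apply: (measurable_comp (F := W) mW _ mV (g := snd)).
    by move=> _ [p [_ pW] <-].
  by apply: measurable_funS measurable_snd => //; exact: measurableT.
have [c c0 hc] := ae_bounded_field cW W_pos bV.
have i : leb.-integrable W (EFin \o (fun x => dot (V x) (V x))).
  apply: (@ae_bounded_integrable _ _ _ leb W _ (d%:R * (c * c)) mW (window_fin cW)).
  - by apply: measurable_sum => k; exact: measurable_funM.
  - by rewrite !mulr_ge0.
  - apply: filterS hc => x h Wx; apply: le_trans (ler_norm_sum _ _ _) _.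
    apply: (@le_trans _ _ (\sum_(k < d) c * c)).
      by apply: ler_sum => k _; rewrite normrM; apply: ler_pM => //; exact: h.
    by rewrite sumr_const card_ord mulr_natl.
have := integrable_fin_num mW i; set r := (\int[leb]_(x in W) _)%E => rf.
apply: (@le_lt_trans _ _ r); last by rewrite ltey_eq rf.
rewrite le_eqVlt; apply/orP; left; apply/eqP.
apply: etrans (@integral_cst _ _ _ P setT measurableT r) _.
by rewrite [X in (_ * X)%E](_ : _ = 1%E) ?mule1//; exact: probability_setT.
Qed.

(** In [count_duality] the functional multiplies the sum of divergences minus theta times their
    integral; comparison with the definition of the adjoint reads off the formula. *)
Lemma delta_deterministic :
  delta_op (P := P) (X := X) (W := W) pi (fun=> V) flux_divergence.
Proof.
split; [exact: deterministic_in_L2|exact: flux_divergence_in_L2|].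
move=> F DF /(D_op_tame cW C2W)[f [A [C [A1 C1 tf cf [-> ->]]]]].
have A0 : 0 <= A by apply: le_trans A1.
have C0 : 0 <= C by apply: le_trans C1.
have iF := integrable_total_flux cW C2W poisX tf c1v A0 C0.
have iB := integrable_total_divergence cW poisX tf c1v C0.
have iT : P.-integrable setT (EFin \o functional X W f).
  have [symf _ fC _] := tf.
  by apply: (integrable_at_count cW poisX C0) fC => // n; exact: tame_measurable tf.
apply: (etrans (y := (\int[P]_w functional X W (total_flux W f v) w)%:E)).
  apply: etrans _ (esym (fineK (integrable_fin_num measurableT iF))).
  apply: eq_integral => w _; have [i1 i2] := smear_pairing f w.
  apply: etrans (esym (fineK (integrable_fin_num mW i1))) _.
  by have e := f_equal (@EFin R) i2; exact: e.
rewrite (count_duality d_gt0 cW C2W theta_gt0 poisX tf cf c1v A0 C0).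
set c := theta * _; have iT' := integrableZl measurableT c iT.
rewrite -(RintegralZl c measurableT iT) -(RintegralB measurableT iB iT').
apply: etrans (fineK (integrable_fin_num measurableT (integrableB measurableT iB iT'))) _.
apply: eq_integral => w _; rewrite -EFinM -EFinB; apply: (f_equal (@EFin R)).
rewrite flux_divergenceE /functional /total_divergence /div_form mulrBr.
by congr (_ - _); rewrite mulrC.
Qed.

End deterministic_field.

(** * Density of the domain *)

Section l2_closure.
Context {R : realType} (H : l2space R) (HH : l2_laws H) (dom : set H).
Hypothesis dom_l2 : forall f, dom f -> in_l2 f.
Hypothesis dom_lin : forall a f g, dom f -> dom g -> dom (a *: f + g).
Hypothesis dom0 : dom 0.
Implicit Types f g h : H.

(** The closure of the domain, with tolerances instead of sequences, so that limits of limits need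
    no diagonal extraction. *)
Definition approximable f :=
  in_l2 f /\ forall e, 0 < e -> exists2 g, dom g & ip (f - g) (f - g) < e.

Lemma ip_parallelogram_le f g : in_l2 f -> in_l2 g ->
  ip (f + g) (f + g) <= 2 * ip f f + 2 * ip g g.
Proof.
move=> fL gL; have fgL := in_l2D HH fL gL; have fgL' := in_l2B HH fL gL.
have := ip_ge0 HH (f - g).
rewrite (ipBl HH) // !(ipBr HH) // (ipDl HH) // (ip_sym HH f (f + g)).
rewrite (ip_sym HH g (f + g)) !(ipDl HH) // (ip_sym HH g f).
by lra.
Qed.

Lemma approximable_dom f : dom f -> approximable f.
Proof.
move=> fD; split=> [|e e0]; first exact: dom_l2.
exists f => //; rewrite subrr; have := ipZl HH 0 (dom_l2 fD) (in_l2_0 HH (dom_l2 fD)).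
by rewrite scale0r mul0r => ->.
Qed.

Lemma approximable_seq f : approximable f ->
  exists f_ : nat -> H, (forall l, dom (f_ l)) /\ l2cvg f_ f.
Proof.
move=> [fL fA].
have /choice[f_ f_P] : forall l : nat, exists g,
    dom g /\ ip (f - g) (f - g) < l.+1%:R^-1.
  by move=> l; have [|g Dg ge] := fA l.+1%:R^-1; [rewrite invr_gt0 ltr0n|exists g].
exists f_; split=> [l|]; first by have [] := f_P l.
apply/(l2cvgE HH) => [l|//|]; first by apply: dom_l2; have [] := f_P l.
apply/cvgrPdist_lt => e e0.
have [k _ ke] := near_infty_natSinv_lt (PosNum e0).
exists k => // l /= kl; rewrite sub0r normrN ger0_norm ?ip_ge0//.
apply: lt_trans (ke l kl); apply: le_lt_trans (proj2 (f_P l)).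
have gL : in_l2 (f_ l) by apply: dom_l2; have [] := f_P l.
rewrite le_eqVlt; apply/orP; left; apply/eqP.
rewrite !(ipBl HH)// ?(ipBr HH)//; [|exact: in_l2B..].
by ring.
Qed.

Lemma approximable_lin a f g : approximable f -> approximable g ->
  approximable (a *: f + g).
Proof.
move=> [fL fA] [gL gA]; split=> [|e e0]; first exact: l2_closed.
(* Chosen so that [2 * a ^+ 2] times this is below [e / 2]; the other half of [e] is spent on
   [g]. *)
have e1 : 0 < e / (4 * (a ^+ 2 + 1)).
  by rewrite divr_gt0// mulr_gt0// ltr_wpDl// sqr_ge0.
have e2 : 0 < e / 4 by rewrite divr_gt0.
have [f' Df' ff'] := fA _ e1; have [g' Dg' gg'] := gA _ e2.
exists (a *: f' + g'); first exact: dom_lin.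
have f'L := dom_l2 Df'; have g'L := dom_l2 Dg'.
have -> : a *: f + g - (a *: f' + g') = a *: (f - f') + (g - g').
  by rewrite scalerBr opprD addrACA.
have L1 := in_l2B HH fL f'L; have L2 := in_l2B HH gL g'L.
have L3 := in_l2Z HH a L1.
apply: le_lt_trans (ip_parallelogram_le L3 L2) _.
rewrite ipZl// ip_sym// ipZl//.
have : ip (f - f') (f - f') * (4 * (a ^+ 2 + 1)) < e.
  by rewrite -ltr_pdivlMr// mulr_gt0// ltr_wpDl// sqr_ge0.
have := ip_ge0 HH (f - f'); have := sqr_ge0 a.
rewrite ltr_pdivlMr// in gg'.
rewrite expr2.
by nra.
Qed.

Lemma approximable0 : approximable 0.
Proof. exact: approximable_dom. Qed.

Lemma approximable_sum (I : eqType) (r : seq I) (a : I -> R) (F : I -> H) :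
  (forall i, i \in r -> approximable (F i)) ->
  approximable (\sum_(i <- r) a i *: F i).
Proof.
elim: r => [|i r IH] Fi; first by rewrite big_nil; exact: approximable0.
rewrite big_cons; apply: approximable_lin; first by apply: Fi; rewrite mem_head.
by apply: IH => j jr; apply: Fi; rewrite in_cons jr orbT.
Qed.

Lemma approximable_lim (f_ : nat -> H) f :
  (forall l, approximable (f_ l)) -> in_l2 f -> l2cvg f_ f -> approximable f.
Proof.
move=> fA fL; have f_L l : in_l2 (f_ l) by have [] := fA l.
move=> /(l2cvgE HH f_L fL) cv; split=> // e e0.
have e4 : 0 < e / 4 by rewrite divr_gt0.
have /cvgrPdist_lt /(_ _ e4)[l _ /(_ _ (leqnn l))] := cv.
rewrite sub0r normrN ger0_norm ?ip_ge0// => le4.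
have [g Dg ge] := (proj2 (fA l)) _ e4; exists g => //.
have gL := dom_l2 Dg.
have -> : f - g = (-1) *: (f_ l - f) + (f_ l - g).
  by rewrite scaleN1r opprB addrA subrK.
have L1 := in_l2B HH (f_L l) fL; have L2 := in_l2B HH (f_L l) gL.
have L3 := in_l2Z HH (-1) L1.
apply: le_lt_trans (ip_parallelogram_le L3 L2) _.
rewrite ipZl// ip_sym// ipZl//.
by lra.
Qed.

End l2_closure.

Import HBNNSimple.

(** * From indicators to all square-integrable variables *)

Section L2_Omega_closure.
Context {R : realType} {d : nat} (W : set 'rV[R]_d) (cW : compact W).
Context {dT : measure_display} {T : measurableType dT} (P : probability T R).
Context (theta : R) (X : T -> set 'rV[R]_d).
Hypothesis poisX : poisson_process P theta X.
Let L2 := L2_Omega P X W.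

Lemma in_L2_OmegaE (F : T -> R) : in_l2 (F : L2) <->
  measurable_fun setT (F : F_W_type X W -> R) /\
  P.-integrable setT (fun w => (F w ^+ 2)%:E).
Proof.
split=> -[mF iF]; split=> //.
  have mF' := FW_measurable_fun cW poisX mF.
  apply/integrableP; split.
    by apply/measurable_EFinP; exact: measurable_funX.
  rewrite (eq_integral (fun w => (F w * F w)%:E))// => w _.
  by rewrite abse_EFin ger0_norm ?sqr_ge0 ?expr2.
have -> : l2ip (F : L2) F = (\int[P]_w (F w ^+ 2)%:E)%E.
  by apply: eq_integral => w _; rewrite expr2.
by rewrite ltey_eq (integrable_fin_num measurableT iF).
Qed.

Lemma L2_Omega_integrableM (F G : T -> R) : in_l2 (F : L2) -> in_l2 (G : L2) ->
  P.-integrable setT (EFin \o (fun w => F w * G w)).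
Proof.
move=> /in_L2_OmegaE[mF iF] /in_L2_OmegaE[mG iG].
have iFG := integrableD measurableT iF iG.
apply: le_integrable iFG => //.
  apply/measurable_EFinP; apply: measurable_funM; exact: (FW_measurable_fun cW poisX).
move=> w _; rewrite /comp -EFinD !abse_EFin lee_fin normrM.
rewrite [leRHS]ger0_norm ?addr_ge0 ?sqr_ge0//.
rewrite -[F w ^+ 2]real_normK ?num_real// -[G w ^+ 2]real_normK ?num_real//.
have := normr_ge0 (F w); have := normr_ge0 (G w).
move: (`|F w|) (`|G w|) => a b a0 b0; have := sqr_ge0 (a - b); nra.
Qed.

Lemma L2_Omega_dominated (F_ : nat -> T -> R) (F : T -> R) (K : T -> R) :
  (forall l, in_l2 (F_ l : L2)) -> in_l2 (F : L2) ->
  P.-integrable setT (EFin \o K) ->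
  (forall l w, (F_ l w - F w) ^+ 2 <= K w) ->
  {ae P, forall w, F_ l w @[l --> \oo] --> F w} ->
  l2cvg (F_ : nat -> L2) (F : L2).
Proof.
move=> F_L FL iK bK cF; have laws := L2_Omega_laws cW poisX.
have m1 l : measurable_fun setT (fun w => ((F_ l w - F w) * (F_ l w - F w))%:E).
  have mB : measurable_fun setT (fun w => F_ l w - F w).
    apply: measurable_funB; apply: (FW_measurable_fun cW poisX).
      by have [] := F_L l.
    by have [] := FL.
  by apply/measurable_EFinP; exact: measurable_funM.
have [] := @dominated_convergence _ _ _ P setT measurableT
  (fun l w => ((F_ l w - F w) * (F_ l w - F w))%:E) (fun=> 0%E) (EFin \o K) m1.
- exact: measurable_cst.
- apply: filterS cF => w cw _.
  apply: cvg_EFin; first by near=> n.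
  rewrite [X in _ --> X](_ : _ = (F w - F w) * (F w - F w)); last by rewrite subrr mul0r.
  by apply: cvgM; apply: cvgB => //; exact: cvg_cst.
- exact: iK.
- apply: aeW => w l _ /=.
  by rewrite lee_fin ger0_norm -expr2 ?sqr_ge0.
move=> _ _; rewrite integral_cst// mul0e => c.
exact: c.
Unshelve. all: by end_near. Qed.

Context (dom : set L2).
Hypothesis dom_l2 : forall f, dom f -> in_l2 f.
Hypothesis dom_lin : forall a f g, dom f -> dom g -> dom (a *: f + g).
Hypothesis dom0 : dom 0.
Hypothesis dom_indic : forall A : set T,
  measurable (A : set (F_W_type X W)) -> approximable dom (\1_A : L2).

(** Simple functions increase to [F], and the squared errors are dominated by the integrable
    [F ^+ 2]. *)
Lemma approximable_nonneg (F : T -> R) : in_l2 (F : L2) ->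
  (forall w, 0 <= F w) -> approximable dom (F : L2).
Proof.
move=> FL F0; have laws := L2_Omega_laws cW poisX.
have /in_L2_OmegaE[mF iF] := FL.
have mF' : measurable_fun [set: F_W_type X W] (EFin \o (F : F_W_type X W -> R)).
  exact/measurable_EFinP.
have F0' : forall w : F_W_type X W, setT w -> (0 <= (EFin \o F) w)%E.
  by move=> w _; rewrite lee_fin.
pose s := nnsfun_approx measurableT mF'.
have sF l w : s l w <= F w.
  have nds : {homo (fun n => s n w) : n m / (n <= m)%N >-> n <= m}.
    by move=> n m nm; have /lefP := nd_nnsfun_approx measurableT mF' nm; exact.
  have c : s n w @[n --> \oo] --> F w.
    by have /fine_cvgP[_] := cvg_nnsfun_approx measurableT mF' F0' (I : setT w).
  by rewrite -(cvg_lim _ c)//; apply: nondecreasing_cvgn_le => //; apply/cvg_ex; exists (F w).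
have s0 l w : 0 <= s l w by [].
have sA l : approximable dom (s l : L2).
  have -> : (s l : L2) =
      \sum_(y <- finmap.enum_fset (fset_set (range (s l))))
        y *: (\1_(s l @^-1` [set y]) : L2).
    apply: funext => w; rewrite [LHS](fimfunE (s l)) fsbig_finite//=.
    elim: (finmap.enum_fset _) => [|y r IH]; first by rewrite !big_nil.
    by rewrite !big_cons IH.
  apply: (approximable_sum laws dom_l2 dom_lin dom0) => y _.
  by apply: dom_indic; rewrite -[X in measurable X]setTI; exact: measurable_funPT.
apply: (approximable_lim laws dom_l2 sA FL).
apply: (L2_Omega_dominated (K := fun w => F w ^+ 2)) => //.
- by move=> l; have [] := sA l.
- move=> l w; rewrite -sqrrN opprB lerXn2r// ?nnegrE ?subr_ge0//.
  by rewrite gerBl.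
- apply: aeW => w.
  by have /fine_cvgP[_] := cvg_nnsfun_approx measurableT mF' F0' (I : setT w).
Qed.

Lemma approximable_all (F : L2) : in_l2 F -> approximable dom F.
Proof.
move=> FL; have laws := L2_Omega_laws cW poisX.
have /in_L2_OmegaE[mF iF] := FL.
pose Fp : T -> R := fun w => Num.max (F w) 0.
pose Fn : T -> R := fun w => Num.max (- F w) 0.
have mFp : measurable_fun setT (Fp : F_W_type X W -> R).
  by apply: measurable_maxr => //; exact: measurable_cst.
have mFn : measurable_fun setT (Fn : F_W_type X W -> R).
  by apply: measurable_maxr; [exact: measurableT_comp|exact: measurable_cst].
have dominated G : measurable_fun setT (G : F_W_type X W -> R) ->
    (forall w, G w ^+ 2 <= F w ^+ 2) -> in_l2 (G : L2).
  move=> mG GF; apply/in_L2_OmegaE; split=> //.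
  apply: le_integrable iF => //.
    by apply/measurable_EFinP; apply: measurable_funX; exact: (FW_measurable_fun cW poisX mG).
  by move=> w _; rewrite !abse_EFin lee_fin !ger0_norm ?sqr_ge0.
have -> : F = (-1) *: (Fn : L2) + (Fp : L2).
  apply: funext => w; change (F w = (-1) * Fn w + Fp w).
  by rewrite /Fn /Fp !maxEle; case: ifP; case: ifP; lra.
apply: (approximable_lin laws dom_l2 dom_lin); apply: approximable_nonneg.
- apply: dominated => // w; rewrite /Fn maxEle; case: ifP => _; rewrite ?sqrrN//.
  by rewrite expr0n sqr_ge0.
- by move=> w; rewrite /Fn le_max lexx orbT.
- apply: dominated => // w; rewrite /Fp maxEle; case: ifP => _ //.
  by rewrite expr0n sqr_ge0.
- by move=> w; rewrite /Fp le_max lexx orbT.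
Qed.

End L2_Omega_closure.

(** * Bump functions of class C^1 *)

Section square_of_positive_part.
Context {R : realType}.
Implicit Types s h c r t : R.

(** Squaring smooths the corner of the positive part just enough to reach class C^1, which is all
    the domain of D asks. *)
Definition sqpos s : R := (Num.max s 0) ^+ 2.

Lemma sqpos_ge0 s : 0 <= sqpos s. Proof. exact: sqr_ge0. Qed.

Lemma sqpos_increment s h :
  `|2 * Num.max s 0 * h - (sqpos (s + h) - sqpos s)| <= h ^+ 2.
Proof.
rewrite /sqpos ler_norml.
have [s0|s0] := leP s 0; have [t0|t0] := leP (s + h) 0; apply/andP; split; nra.
Qed.

Lemma is_derive_sqpos s : is_derive s (1 : R) sqpos (2 * Num.max s 0).
Proof.
have c : (fun h : R => h^-1 *: (sqpos (h *: 1 + s) - sqpos s)) h @[h --> 0^'] -->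
    2 * Num.max s 0.
  apply/cvgrPdist_le => e e0; near=> h.
  have h0 : h != 0 by near: h; exact: nbhs_dnbhs_neq.
  have he : `|h| <= e.
    near: h; apply: nbhs_dnbhs; apply/nbhs_ballP; exists e => //= h.
    by rewrite /ball/= sub0r normrN => /ltW.
  apply: le_trans he.
  have hp : 0 < `|h| by rewrite normr_gt0.
  rewrite -(ler_pM2r hp) -normrM mulrBl.
  have -> : h^-1 *: (sqpos (h *: 1 + s) - sqpos s) * h = sqpos (s + h) - sqpos s.
    by rewrite /GRing.scale/= mulr1 addrC [s + h]addrC mulrAC mulVf// mul1r addrC.
  by rewrite -normrM -expr2 [leRHS]ger0_norm ?sqr_ge0//; exact: sqpos_increment.
apply: DeriveDef; first by apply/cvg_ex; exists (2 * Num.max s 0).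
exact: cvg_lim c.
Unshelve. all: by end_near. Qed.

Definition bump1 c r t : R := sqpos (r ^+ 2 - (t - c) ^+ 2).

Lemma is_derive_bump1 c r t : is_derive t (1 : R) (bump1 c r)
  (2 * Num.max (r ^+ 2 - (t - c) ^+ 2) 0 * (- (2 * (t - c)))).
Proof.
have h1 := is_derive_sqpos (r ^+ 2 - (t - c) ^+ 2).
have h2 : is_derive t (1 : R) (fun t => r ^+ 2 - (t - c) ^+ 2) (- (2 * (t - c))).
  have h3 : is_derive t (1 : R) (fun t : R => t - c) 1.
    by apply: is_derive_eq; rewrite subr0.
  change (is_derive t (1 : R) (cst (r ^+ 2) - (fun t : R => t - c) ^+ 2)
    (- (2 * (t - c)))).
  apply: is_derive_eq; rewrite sub0r /GRing.scale/= expr1.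
  by rewrite mulr1 ?mulr_natl.
have := @is_derive1_comp R sqpos (fun t => r ^+ 2 - (t - c) ^+ 2) t _ _ h1 h2.
exact.
Qed.

Lemma bump1_ge0 c r t : 0 <= bump1 c r t. Proof. exact: sqpos_ge0. Qed.

Lemma bump1_le1 c r t : 0 < r -> r <= 1 -> bump1 c r t <= 1.
Proof.
move=> r0 r1; rewrite /bump1 /sqpos expr_le1// ?le_max ?lexx ?orbT// ge_max ler01 andbT.
have := sqr_ge0 (t - c); nra.
Qed.

Lemma bump1_gt0 c r t : 0 < r -> (0 < bump1 c r t) = (`|c - t| < r).
Proof.
move=> r0; rewrite /bump1 /sqpos lt0r sqr_ge0 andbT sqrf_eq0.
have -> : (t - c) ^+ 2 = `|c - t| ^+ 2 by rewrite distrC real_normK ?num_real.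
rewrite -(ltr_pXn2r (n := 2) _ (normr_ge0 _) (ltW r0))// -[RHS]subr_gt0.
by have [h|h] := leP _ 0; rewrite ?eqxx ?gt_eqF.
Qed.

End square_of_positive_part.

Section C1_open_closure.
Context {R : realType} {d : nat}.
Local Notation V := 'rV[R]_d.
Implicit Types f g : V -> R.

Lemma C1_open_cst (c : R) : C1_open setT (fun _ : V => c).
Proof.
move=> i j x _; split; first exact: derivable_cst.
have -> : 'D_(delta_mx i j) (fun _ : V => c) = fun=> 0.
  by apply: funext => y; exact: derive_cst.
exact: cst_continuous.
Qed.

Lemma C1_openB f g : C1_open setT f -> C1_open setT g ->
  C1_open setT (fun x => f x - g x).
Proof.
move=> cf cg i j x _; split.
  by apply: derivableB; [have [] := cf i j x I|have [] := cg i j x I].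
have -> : 'D_(delta_mx i j) (fun x : V => f x - g x) =
    fun y => 'D_(delta_mx i j) f y - 'D_(delta_mx i j) g y.
  apply: funext => y.
  by apply: deriveB; [have [] := cf i j y I|have [] := cg i j y I].
have [_ Df] := cf i j x I; have [_ Dg] := cg i j x I.
exact: (cvgB Df Dg).
Qed.

Lemma C1_openM f g : C1_open setT f -> C1_open setT g ->
  C1_open setT (fun x => f x * g x).
Proof.
move=> cf cg i j x _; split.
  by apply: derivableM; [have [] := cf i j x I|have [] := cg i j x I].
have -> : 'D_(delta_mx i j) (fun x : V => f x * g x) =
    fun y => f y * 'D_(delta_mx i j) g y + g y * 'D_(delta_mx i j) f y.
  apply: funext => y.
  by apply: deriveM; [have [] := cf i j y I|have [] := cg i j y I].
have cf' := C1_open_continuous openT cf (I : setT x).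
have cg' := C1_open_continuous openT cg (I : setT x).
have [_ Df] := cf i j x I; have [_ Dg] := cg i j x I.
exact: (cvgD (cvgM cf' Dg) (cvgM cg' Df)).
Qed.

Lemma C1_openX f k : C1_open setT f -> C1_open setT (fun x => f x ^+ k).
Proof.
move=> cf; elim: k => [|k IH].
  by rewrite (_ : (fun x => _) = fun=> 1); [exact: C1_open_cst|exact: funext].
rewrite (_ : (fun x => _) = fun x => f x * f x ^+ k); first exact: C1_openM.
by apply: funext => x; exact: exprS.
Qed.

Lemma C1_open_prod (I : Type) (r : seq I) (F : I -> V -> R) :
  (forall i, C1_open setT (F i)) -> C1_open setT (fun x => \prod_(i <- r) F i x).
Proof.
move=> cF; elim: r => [|i r IH].
  rewrite (_ : (fun x => _) = fun=> 1); first exact: C1_open_cst.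
  by apply: funext => x; rewrite big_nil.
rewrite (_ : (fun x => _) = fun x => F i x * \prod_(i <- r) F i x).
  exact: C1_openM.
by apply: funext => x; rewrite big_cons.
Qed.

Lemma C1_open_coord (phi dphi : R -> R) (k : 'I_d) :
  (forall t, is_derive t (1 : R) phi (dphi t)) -> continuous dphi ->
  C1_open setT (fun x : V => phi (x 0 k)).
Proof.
move=> Dphi cdphi i j.
have c (x : V) : (fun h : R => h^-1 *: (phi ((h *: delta_mx i j + x) 0 k) - phi (x 0 k))) h
    @[h --> 0^'] --> if k == j then dphi (x 0 k) else 0.
  have [kj|kj] := eqVneq k j.
    have [cv <-] := Dphi (x 0 k).
    rewrite (_ : (fun h => _) =
      (fun h => h^-1 *: (phi (h *: 1 + x 0 k) - phi (x 0 k)))); last first.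
      by apply: funext => h; rewrite !mxE -kj ord1 !eqxx.
    exact: cv.
  rewrite (_ : (fun h => _) = fun=> 0); first exact: cvg_cst.
  apply: funext => h; rewrite !mxE ord1 (negbTE kj) andbF mulr0 add0r subrr.
  exact: scaler0.
move=> x _; split; first by apply/cvg_ex; eexists; exact: c.
have -> : 'D_(delta_mx i j) (fun x : V => phi (x 0 k)) =
    fun y : V => if k == j then dphi (y 0 k) else 0.
  by apply: funext => y; exact: cvg_lim (c y).
case: (k == j); last exact: cst_continuous.
apply: (continuous_comp (f := fun y : V => y 0 k)); last exact: cdphi.
exact: coord_continuous.
Qed.

(** A product over coordinates, because balls for the norm on matrices are boxes: the bump is
    positive exactly on the ball. *)
Definition bump (c : V) (r : R) (u : V) : R := \prod_j bump1 (c 0 j) r (u 0 j).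

Lemma C1_open_bump c r : C1_open setT (bump c r).
Proof.
apply: C1_open_prod => j.
apply: (@C1_open_coord (bump1 (c 0 j) r)); first exact: is_derive_bump1.
move=> t; apply: cvgM.
  apply: cvgM; first exact: cvg_cst.
  apply: (continuous_comp (f := fun t => r ^+ 2 - (t - c 0 j) ^+ 2)
    (g := fun s => Num.max s 0)); last first.
    by apply: continuous_max; [exact: cvg_id|exact: cvg_cst].
  apply: cvgB; first exact: cvg_cst.
  apply: (continuous_comp (f := fun t => t - c 0 j) (g := fun s => s ^+ 2)).
    by apply: cvgB; [exact: cvg_id|exact: cvg_cst].
  exact: exprn_continuous.
apply: cvgN; apply: cvgM; first exact: cvg_cst.
by apply: cvgB; [exact: cvg_id|exact: cvg_cst].
Qed.

Lemma bump_ge0 c r u : 0 <= bump c r u.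
Proof. by apply: prodr_ge0 => j _; exact: bump1_ge0. Qed.

Lemma bump_le1 c r u : 0 < r -> r <= 1 -> bump c r u <= 1.
Proof.
by move=> r0 r1; apply: prodr_ile1 => j _; rewrite bump1_ge0 bump1_le1.
Qed.

Lemma bump_gt0 c r u : 0 < r -> 0 < bump c r u <-> ball c r u.
Proof.
move=> r0; rewrite lt0r bump_ge0 andbT; split => [h|[_ h]].
  apply: ball_coord => // j; rewrite -bump1_gt0// lt0r bump1_ge0 andbT.
  by apply: contraNneq h => h; apply/eqP; rewrite /bump (bigD1 j)//= h mul0r.
by apply/prodf_neq0 => j _; rewrite gt_eqF// bump1_gt0//; exact: h.
Qed.

End C1_open_closure.

(** * Products over the points *)

Section product_forms.
Context {R : realType} {d : nat}.
Local Notation V := 'rV[R]_d.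
Variables (W : set V) (cW : compact W) (C2W : C2_boundary W).
Variables (g : V -> R) (c1g : C1_open setT g).
Hypothesis g01 : forall u, 0 <= g u <= 1.

Definition prod_form : forms (R := R) (d := d) :=
  fun n z => \prod_(i < n) g (row i z).

Lemma row_continuous n (i : 'I_n) (z : 'M[R]_(n, d)) :
  {for z, continuous (row i)}.
Proof.
move=> A /nbhs_ballP[e /= e0 eA]; apply/nbhs_ballP; exists e => // y [_ zy].
by apply: eA; split => // k l; rewrite !mxE; exact: zy.
Qed.

Lemma continuous_form n : continuous (@prod_form n).
Proof.
apply: continuous_big => [|i _ z].
  by move=> [x y]; apply: cvgM; [exact: cvg_fst|exact: cvg_snd].
apply: continuous_comp; first exact: row_continuous.
exact: C1_open_continuous openT c1g I.
Qed.

Let others n (i : 'I_n) (z : 'M[R]_(n, d)) := \prod_(l < n | l != i) g (row l z).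

Let others_continuous n (i : 'I_n) : continuous (others i).
Proof.
apply: continuous_big => [|l _ z].
  by move=> [x y]; apply: cvgM; [exact: cvg_fst|exact: cvg_snd].
apply: continuous_comp; first exact: row_continuous.
exact: C1_open_continuous openT c1g I.
Qed.

Let others01 n (i : 'I_n) z : 0 <= others i z <= 1.
Proof.
by rewrite prodr_ge0 ?prodr_ile1// => l _; have /andP[] := g01 (row l z).
Qed.

Lemma prod_form_quotient n (i : 'I_n) k (z : 'M[R]_(n, d)) :
  (fun h : R => h^-1 *: (prod_form (h *: delta_mx i k + z) - prod_form z)) h
    @[h --> 0^'] --> others i z * 'D_(delta_mx 0 k) g (row i z).
Proof.
rewrite (_ : (fun h => _) = fun h : R => others i z *
    (h^-1 *: (g (h *: delta_mx 0 k + row i z) - g (row i z)))); last first.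
  apply: funext => h; rewrite /prod_form [X in X - _](bigD1 i)// [X in _ - X](bigD1 i)//=.
  have -> : row i (h *: delta_mx i k + z) = h *: delta_mx 0 k + row i z.
    by apply/rowP => j; rewrite !mxE !eqxx.
  rewrite (_ : \prod_(l < n | l != i) g (row l (h *: delta_mx i k + z)) = others i z).
    by rewrite -mulrBl /GRing.scale/=; ring.
  apply: eq_bigr => l li; congr g; apply/rowP => j.
  by rewrite !mxE (negbTE li)/= mulr0 add0r.
have [dg _] := c1g 0 k (I : setT (row i z)).
by apply: cvgM; [exact: cvg_cst|exact: dg].
Qed.

Lemma derive_prod_form n (i : 'I_n) k (z : 'M[R]_(n, d)) :
  'D_(delta_mx i k) (prod_form (n := n)) z =
  others i z * 'D_(delta_mx 0 k) g (row i z).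
Proof. exact: cvg_lim (@prod_form_quotient n i k z). Qed.

Lemma C1_prod_form n : C1_open setT (@prod_form n).
Proof.
move=> i k z _; split.
  by apply/cvg_ex; eexists; exact: prod_form_quotient.
have -> : (fun y => 'D_(delta_mx i k) (prod_form (n := n)) y) =
    fun z => others i z * 'D_(delta_mx 0 k) g (row i z).
  by apply: funext => y; exact: derive_prod_form.
have [_ cg] := c1g 0 k (I : setT (row i z)).
have c := continuous_comp (row_continuous (i := i) (z := z)) cg.
exact: (cvgM (@others_continuous n i z) c).
Qed.

Lemma prod_form01 n z : 0 <= @prod_form n z <= 1.
Proof.
by rewrite prodr_ge0 ?prodr_ile1// => l _; have /andP[] := g01 (row l z).
Qed.

(** All factors lie in [0, 1], and a partial derivative touches one factor only, so neither the
    products nor their gradients grow with n: the base is 1. *)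
Lemma tame_prod_form : exists2 A, 1 <= A & tame W prod_form A 1.
Proof.
have bD (k : 'I_d) : exists c, 0 <= c /\
    forall x, W x -> `|'D_(delta_mx 0 k) g x| <= c.
  have cD : {within W, continuous ('D_(delta_mx 0 k) g)}.
    apply: continuous_subspaceT => x.
    by have [_] := c1g 0 k (I : setT x).
  by have [c c0 h] := within_continuous_bounded cW cD; exists c.
have {bD}/choice[c cP] := bD.
have le_c k : c k <= 1 + \sum_k c k.
  rewrite (bigD1 k)//= addrCA lerDl addr_ge0// sumr_ge0// => l _.
  by have [] := cP l.
exists (1 + \sum_k c k).
  by rewrite lerDl sumr_ge0// => k _; have [] := cP k.
have C1 n := C1_on_global (regular_Wpow cW C2W (n := n)) (C1_prod_form (n := n))
  (continuous_subspaceT (@continuous_form n)).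
split.
- move=> n s z _; rewrite /prod_form [RHS](reindex_perm s)/=.
  by apply: eq_bigr => i _; congr g; apply/rowP => j; rewrite !mxE.
- by move=> n _; have [] := C1 n.
- move=> n z _; rewrite expr1n mulr1; have /andP[p0 p1] := prod_form01 z.
  rewrite ger0_norm//; apply: le_trans p1 _.
  by rewrite lerDl sumr_ge0// => k _; have [] := cP k.
- move=> n i k z zW; rewrite expr1n mulr1; have [_ e] := C1 n.
  rewrite (e i k z zW) derive_prod_form; apply: le_trans (le_c k).
  have /andP[oth0 oth1] := others01 i z; rewrite normrM ger0_norm//.
  apply: le_trans (proj2 (cP k) _ (zW i)).
  by rewrite ler_piMl.
Qed.

Lemma compatible_prod_form : (forall u, frontier W u -> g u = 1) ->
  compatible W prod_form.
Proof.
move=> g1 n z y zW fy; rewrite /prod_form big_split_ord/= big_ord1.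
have -> : row (rshift n ord0) (col_mx z y) = y.
  by apply/rowP => j; rewrite mxE col_mxEd.
rewrite g1// mulr1; apply: eq_bigr => i _; congr g.
by apply/rowP => j; rewrite [LHS]mxE col_mxEu mxE.
Qed.

End product_forms.

(** * Smooth approximation of the indicator of the complement of an open set *)

Section void_forms.
Context {R : realType} {d : nat}.
Local Notation V := 'rV[R]_d.
Variables (O : set V) (oO : open O).

Let center (q : 'rV[rat]_d) : V := map_mx ratr q.

(** An enumeration of bumps on the rational balls contained in [O], completed by 0 at the remaining
    indices. *)
Let b m (u : V) : R := if (unpickle m : option ('rV[rat]_d * nat)) is Some qk then
  (if `[< ball (center qk.1) (qk.2.+1%:R^-1 : R) `<=` O >] then
    bump (center qk.1) qk.2.+1%:R^-1 u else 0) else 0.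

Let radius k : 0 < (k.+1%:R^-1 : R) /\ (k.+1%:R^-1 : R) <= 1.
Proof. by rewrite invr_gt0 ltr0n invf_le1 ?ler1n// ltr0n. Qed.

Let b01 m u : 0 <= b m u <= 1.
Proof.
rewrite /b; case: (unpickle m) => [[q k]|]; last by rewrite lexx ler01.
case: asboolP => _; last by rewrite lexx ler01.
by have [r0 r1] := radius k; rewrite bump_ge0 bump_le1.
Qed.

Let b_out m u : ~ O u -> b m u = 0.
Proof.
move=> Ou; rewrite /b; case: (unpickle m) => [[q k]|//].
case: asboolP => // sub; have [r0 r1] := radius k.
apply/eqP; rewrite eq_le bump_ge0 andbT leNgt; apply: contra_notN Ou.
by move=> h; apply: sub; apply/bump_gt0.
Qed.

Let b_in u : O u -> exists m, 0 < b m u.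
Proof.
move=> Ou; have /nbhs_ballP[e /= e0 eO] : nbhs u O by exact: open_nbhs_nbhs.
have e20 : 0 < e / 2 by rewrite divr_gt0.
have [k _ /(_ _ (leqnn k)) /= ke] := near_infty_natSinv_lt (PosNum e20).
have [r0 r1] := radius k.
have qP j : exists q : rat, `|ratr q - u 0 j| < k.+1%:R^-1.
  have [q] : exists q : rat, ratr q \in
      `](u 0 j - k.+1%:R^-1), (u 0 j + k.+1%:R^-1)[.
    by apply: rat_in_itvoo; rewrite ltrBlDr -addrA ltrDl addr_gt0.
  by rewrite in_itv/= => /andP[h1 h2]; exists q; rewrite ltr_distl h1 h2.
pose q : 'rV[rat]_d := \row_j sval (cid (qP j)).
have Bu : ball (center q) k.+1%:R^-1 u.
  by apply: ball_coord => // j; rewrite !mxE; case: cid.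
exists (pickle (q, k)); rewrite /b pickleK asboolT ?bump_gt0// => y By.
apply: eO; rewrite (splitr e); apply: (@ball_triangle _ _ (center q)).
  by apply: ball_sym; apply: le_ball Bu; exact: ltW.
by apply: le_ball By; exact: ltW.
Qed.

(** Equal to 1 off [O]. At a point of [O] some bump is positive but perhaps not equal to 1, which is
    why the factors are raised to a growing power: [(1 - b) ^+ l] tends to 0. *)
Definition void_factor l (u : V) : R := \prod_(m < l) (1 - b m u) ^+ l.

Lemma C1_void_factor l : C1_open setT (void_factor l).
Proof.
apply: C1_open_prod => m; apply: C1_openX; apply: C1_openB.
  exact: C1_open_cst.
rewrite /b; case: (unpickle _) => [[q k]|]; last exact: C1_open_cst.
case: asboolP => _; last exact: C1_open_cst.
exact: C1_open_bump.
Qed.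

Let f01 m l u : 0 <= (1 - b m u) ^+ l <= 1.
Proof.
have /andP[h1 h2] := b01 m u.
by rewrite exprn_ge0 ?subr_ge0//= exprn_ile1 ?subr_ge0// gerBl.
Qed.

Lemma void_factor01 l u : 0 <= void_factor l u <= 1.
Proof.
by rewrite prodr_ge0 ?prodr_ile1// => m _; have /andP[] := f01 m l u.
Qed.

Lemma void_factor_out l u : ~ O u -> void_factor l u = 1.
Proof. by move=> Ou; apply: big1 => m _; rewrite b_out// subr0 expr1n. Qed.

Lemma void_factor_cvg u :
  void_factor l u @[l --> \oo] --> ((u \notin O)%:R : R).
Proof.
have [/set_mem Ou|/negP Ou] := boolP (u \in O); last first.
  rewrite (_ : (fun l => _) = fun=> 1); first exact: cvg_cst.
  by apply: funext => l; apply: void_factor_out => /mem_set.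
have [m bm] := b_in Ou; have /andP[_ b1] := b01 m u.
have q1 : `|1 - b m u| < 1 by rewrite ger0_norm ?subr_ge0// gtrBl.
have := cvg_expr q1; apply: squeeze_cvgr; last exact: cvg_cst.
exists m.+1 => // l /= ml; have /andP[-> _] /= := void_factor01 l u.
rewrite /void_factor (bigD1 (Ordinal ml))//= ler_piMr//.
  by have /andP[] := f01 m l u.
by apply: prodr_ile1 => k _; exact: f01.
Qed.

End void_forms.

Section cvg_finite.
Context {R : realType} (I : Type) (r : seq I) (F : I -> nat -> R) (a : I -> R).
Hypothesis cF : forall i, F i l @[l --> \oo] --> a i.

Lemma cvg_prodr : \prod_(i <- r) F i l @[l --> \oo] --> \prod_(i <- r) a i.
Proof.
elim: r => [|i s IH]; first by under eq_fun do rewrite big_nil; rewrite big_nil; exact: cvg_cst.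
by under eq_fun do rewrite big_cons; rewrite big_cons; exact: cvgM.
Qed.

Lemma cvg_sumr : \sum_(i <- r) F i l @[l --> \oo] --> \sum_(i <- r) a i.
Proof.
elim: r => [|i s IH]; first by under eq_fun do rewrite big_nil; rewrite big_nil; exact: cvg_cst.
by under eq_fun do rewrite big_cons; rewrite big_cons; exact: cvgD.
Qed.

End cvg_finite.

(** * Void events in the closure of the domain *)

Section void_events.
Context {R : realType} {d : nat}.
Local Notation V := 'rV[R]_d.
Variables (W : set V) (cW : compact W) (C2W : C2_boundary W).
Context {dT : measure_display} {T : measurableType dT} (P : probability T R).
Context (theta : R) (X : T -> set V).
Hypothesis poisX : poisson_process P theta X.
Variables (pi : V -> V -> R) (M : R) (piK : pi_kernel W pi M).
Let mW := measurable_window cW.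
Let finX := finite_window cW poisX.

Definition D_dom : set (L2_Omega P X W) := [set F | exists Y, D_op pi F Y].

Lemma D_dom_l2 F : D_dom F -> in_l2 F.
Proof. by move=> [Y /(D_op_in_l2 cW C2W poisX piK)[]]. Qed.

Lemma D_dom_lin a F G : D_dom F -> D_dom G -> D_dom (a *: F + G).
Proof.
move=> [Y FY] [Z GZ]; exists (a *: Y + Z).
exact: (D_op_linear cW C2W poisX).
Qed.

Lemma D_dom_prod_form (g : V -> R) : C1_open setT g ->
  (forall u, 0 <= g u <= 1) -> (forall u, frontier W u -> g u = 1) ->
  D_dom (functional X W (prod_form g)).
Proof.
move=> c1g g01 g1; have [A A1 tg] := tame_prod_form cW C2W c1g g01.
exists (derivative_field X W pi (prod_form g)).
exact: (tame_D_op cW P X pi A1 (lexx 1) tg (compatible_prod_form g1)).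
Qed.

Lemma D_dom0 : D_dom 0.
Proof.
have h : D_dom (functional X W (prod_form (fun=> 1))).
  apply: D_dom_prod_form => [|u|//]; first exact: C1_open_cst.
  by rewrite ler01 lexx.
by rewrite -(addNr (functional X W (prod_form (fun=> 1)) : L2_Omega P X W)) -scaleN1r;
  exact: D_dom_lin.
Qed.

(** The frontier is null, so the number of points on it is Poisson with parameter 0. *)
Lemma boundary_avoided : {ae P, forall w, count X (frontier W) w = 0%N}.
Proof.
have [bW mc pX _] := poisX.
have mf : measurable (frontier W).
  by apply: compact_measurable_mx; exact: compact_frontier.
have bf : bounded_set (frontier W).
  by exact: compact_bounded (compact_frontier cW).
have /= := pX _ 0%N mf bf.
rewrite frontier_null//= mulr0 expr0 fact0 invr1 mul1r oppr0 expR0 => P1.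
exists (~` [set w | count X (frontier W) w = 0%N]); split => //.
  by apply: measurableC; exact: mc.
rewrite probability_setC ?P1 ?mulr1 ?subee//; exact: mc.
Qed.

(* Multiply over the points factors tending to the indicator of the complement
   of O `&` W°; almost surely no point lies on the boundary of W. *)
Lemma approximable_void O : open O ->
  approximable D_dom (\1_[set w | count X (O `&` W) w = 0%N] : L2_Omega P X W).
Proof.
move=> oO; pose O' := O `&` W°.
have oO' : open O' by apply: openI => //; exact: open_interior.
pose F l := functional X W (prod_form (void_factor O' l)).
have v01 := void_factor01 O'.
have FD l : D_dom (F l).
  apply: D_dom_prod_form => [|u|u [_ fu]]; first exact: C1_void_factor.
    exact: void_factor01.
  by apply: void_factor_out => -[].
have mO : measurable (O `&` W) by apply: measurableI => //; exact: open_measurable_mx.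
have mV : measurable ([set w | count X (O `&` W) w = 0%N] : set (F_W_type X W)).
  by apply: measurable_count => // u [].
have IL : in_l2 (\1_[set w | count X (O `&` W) w = 0%N] : L2_Omega P X W).
  apply: (growth_in_L2 cW poisX (A := 1) (C := 1)) => //.
  by move=> w; rewrite expr1n mulr1 ger0_norm// indicE; case: (_ \in _).
have laws := L2_Omega_laws cW poisX.
apply: (approximable_lim laws D_dom_l2 (f_ := F) _ IL) => [l|].
  by apply: approximable_dom => //; exact: D_dom_l2.
have i1 : P.-integrable setT (EFin \o (fun _ : T => 1 : R)).
  exact: finite_measure_integrable_cst.
apply: (L2_Omega_dominated cW poisX _ IL i1) => [l|l w|].
- exact: D_dom_l2.
- have /andP[p0 p1] := prod_form01 (v01 l) (X_W X W w).
  rewrite -[leRHS](expr1n _ 2) -[leLHS]real_normK ?num_real//.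
  rewrite lerXn2r// ?nnegrE//; rewrite /F /functional indicE.
  by rewrite ler_norml; case: (_ \in _) => /=; apply/andP; split; lra.
apply: filterS boundary_avoided => w fw.
have -> : \1_[set w | count X (O `&` W) w = 0%N] w =
    \prod_(i < count X W w) ((row i (X_W X W w) \notin O')%:R : R).
  rewrite indicE; have [h|h] := eqVneq (count X (O `&` W) w) 0%N.
    rewrite mem_set// big1// => i _; rewrite (_ : _ \notin _)//.
    apply/negP => /set_mem[Oi _].
    have : row i (X_W X W w) \in points X (O `&` W) w.
      have im : row i (X_W X W w) \in points X W w.
        rewrite (_ : row _ _ = nth 0 (points X W w) i) ?mem_nth//.
        by apply/rowP => j; rewrite !mxE.
      move: im; rewrite (mem_points finX)// inE => -[Xi Wi].
      by rewrite (mem_points finX) ?inE//; move=> ? [].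
    by move: h; rewrite /Defs.count => /size0nil ->.
  rewrite memNset; last by apply/eqP.
  have /(nthP 0) : nth 0 (points X (O `&` W) w) 0 \in points X W w.
    have : nth 0 (points X (O `&` W) w) 0 \in points X (O `&` W) w.
      by apply: mem_nth; rewrite lt0n.
    by rewrite (mem_points finX)// inE => -[Xu [Ou Wu]]; rewrite (mem_points finX)// inE.
  move=> [i iN iu]; rewrite (bigD1 (Ordinal iN))//=.
  set u := row (Ordinal iN) _.
  have uE : u = nth 0 (points X (O `&` W) w) 0.
    by rewrite -iu; apply/rowP => j; rewrite !mxE.
  have : nth 0 (points X (O `&` W) w) 0 \in points X (O `&` W) w.
    by apply: mem_nth; rewrite lt0n.
  rewrite -uE (mem_points finX) ?inE; last by move=> ? [].
  move=> [Xu [Ou Wu]].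
  suff uO : u \in O' by rewrite uO mul0r.
  apply/mem_set; split => //; apply: contrapT => nWu.
  have : u \in points X (frontier W) w.
    rewrite (mem_points finX) ?inE.
      by split => //; split => //; exact: subset_closure.
    by move=> y [cy _]; rewrite (closure_id W).1//; exact: compact_closed.
  by move: fw; rewrite /Defs.count => /size0nil ->.
rewrite /F /functional /prod_form.
apply: cvg_prodr => i.
exact: void_factor_cvg.
Qed.

End void_events.

(** * Void events of open sets generate F_W *)

Section void_sigma_algebra.
Context {R : realType} {d : nat}.
Local Notation V := 'rV[R]_d.
Variables (W : set V) (mW : measurable W).
Context {dT : measure_display} {T : measurableType dT} (X : T -> set V).
Hypothesis finX : forall w, finite_set (X w `&` W).

Definition void (B : set V) : set T := [set w | count X (B `&` W) w = 0%N].

Definition open_voids : set (set T) :=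
  [set A | exists2 O, open O & A = void O].

Local Notation VT := (g_sigma_algebraType open_voids).

Lemma voidE B w : void B w <-> forall u, X w u -> W u -> ~ B u.
Proof.
have BW : B `&` W `<=` W by move=> ? [].
split => [|h].
  rewrite /void/= /Defs.count => /size0nil e u Xu Wu Bu.
  have : u \in points X (B `&` W) w by rewrite (mem_points finX)// inE.
  by rewrite e.
rewrite /void/= /Defs.count; case E : (points _ _ _) => [//|u s].
have : u \in points X (B `&` W) w by rewrite E mem_head.
by rewrite (mem_points finX)// inE => -[Xu [Bu Wu]]; case: (h u).
Qed.

Lemma setI_closed_voids : setI_closed open_voids.
Proof.
move=> _ _ [U oU ->] [U' oU' ->]; exists (U `|` U'); first exact: openU.
apply/seteqP; split => w.
  move=> [/voidE h /voidE h']; apply/voidE => u Xu Wu [Ou|O'u].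
    exact: (h u).
  exact: (h' u).
by move=> /voidE h; split; apply/voidE => u Xu Wu Ou; apply: (h u) => //; [left|right].
Qed.

Let mvoid O : open O -> measurable (void O : set VT).
Proof. by move=> oO; apply: sub_sigma_algebra; exists O. Qed.

Section open_counts.
Variables (O : set V) (oO : open O).

(* hits n: at least n disjoint rational balls meet the points in O; this is
   the event that O contains at least n points of the window. *)
Let hits n : set T := \bigcup_(q in [set q : 'M[rat]_(n, d) * nat | sep (R := R) q])
  \bigcap_(i in [set: 'I_n]) ~` void (O `&` cell q i).

Let mhits n : measurable (hits n : set VT).
Proof.
rewrite /hits bigcup_mkcond; apply: countable_bigcupT_measurable => // q.
case: (q \in _) => //; apply: fin_bigcap_measurable => // i _.
apply: measurableC; apply: mvoid; apply: openI => //.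
exact: ball_open.
Qed.

Let hits_count w : hits (count X (O `&` W) w) w.
Proof.
have OWW : O `&` W `<=` W by move=> ? [].
have fOW w' : finite_set (X w' `&` (O `&` W)).
  by apply: sub_finite_set (finX w'); exact: setIS.
have [q [sq _ cq]] := exists_isolating fOW (erefl (count X (O `&` W) w)).
exists q => // i _; rewrite /void/= setIAC => h.
by have := cq i; rewrite h.
Qed.

Let hits_le n w : hits n w -> (n <= count X (O `&` W) w)%N.
Proof.
move=> [q sq h].
have uP i : exists u, [/\ X w u, W u, O u & cell q i u].
  apply: contrapT => no; apply: (h i I); apply/voidE => u Xu Wu [Ou cu].
  by apply: no; exists u.
have [u {}uP] := choice uP.
rewrite -[leqLHS](card_ord n) cardT -(size_map u).
apply: uniq_leq_size => [|_ /mapP[i _ ->]].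
  rewrite map_inj_uniq ?enum_uniq// => i j ij.
  apply/eqP; apply: contrapT => /negP /sq; rewrite -subset0 => /(_ (u i)); apply.
  by split; [have [] := uP i|rewrite ij; have [] := uP j].
rewrite (mem_points finX) ?inE; last by move=> ? [].
by have [] := uP i.
Qed.

Lemma measurable_open_count k :
  measurable ([set w | count X (O `&` W) w = k] : set VT).
Proof.
rewrite (_ : [set w | _] = hits k `\` \bigcup_(n in [set n | (k < n)%N]) hits n).
  apply: measurableD; first exact: mhits.
  by apply: bigcup_measurable => n _; exact: mhits.
apply/seteqP; split => [w /= <-|w [hk no]] /=.
  split; first exact: hits_count.
  by move=> [n /= kn /hits_le]; rewrite leqNgt kn.
apply/eqP; rewrite eqn_leq (hits_le hk) andbT leqNgt; apply/negP => kc.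
by apply: no; exists (count X (O `&` W) w) => //; exact: hits_count.
Qed.

End open_counts.

(** Real-valued counts, written as sums over the points, so that they can be subtracted and passed
    to the limit. *)
Let rcount (B : set V) (w : T) : R := \sum_(u <- points X W w) (u \in B)%:R.

Hypothesis countE : forall B w, B `<=` W ->
  count X B w = (\sum_(u <- points X W w) (u \in B))%N.

Let rcountE B w : (count X (B `&` W) w)%:R = rcount B w.
Proof.
rewrite countE; last by move=> ? [].
rewrite natr_sum /rcount big_seq [RHS]big_seq; apply: eq_bigr => u.
rewrite (mem_points finX)// !in_setI => /andP[_ ->].
by rewrite andbT.
Qed.

(** Open sets form a pi-system generating the Borel sets. A complement corresponds to a difference
    of counts, and a disjoint union to a limit of sums. *)
Lemma measurable_rcount B : measurable B ->
  measurable_fun [set: VT] (rcount B : VT -> R).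
Proof.
have meas_open O : open O -> measurable_fun [set: VT] (rcount O : VT -> R).
  move=> oO; rewrite (_ : setT = \bigcup_n [set w | count X (O `&` W) w = n]).
    apply/measurable_fun_bigcup => n; first exact: measurable_open_count.
    apply: (@eq_measurable_fun _ _ VT R _ (cst n%:R)) => // w.
    by rewrite inE => /= wn; rewrite -rcountE wn.
  by apply/seteqP; split => // w _; exists (count X (O `&` W) w).
move: B; apply: (@dynkin_induction _ V [set A | open A]
  (fun B => measurable_fun [set: VT] (rcount B : VT -> R))) => //.
- exact: openI.
- exact: meas_open openT.
- move=> S mS mrS.
  rewrite (_ : rcount (~` S) = fun w => rcount setT w - rcount S w).
    by apply: measurable_funB => //; exact: meas_open openT.
  apply: funext => w; rewrite /rcount -sumrB; apply: eq_bigr => u _.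
  by rewrite in_setC in_setT; case: (u \in S); rewrite ?subrr ?subr0.
- move=> F mF tF mrF.
  apply: (measurable_fun_cvg (T := VT) (h := fun n w => \sum_(k < n) rcount (F k) w)).
    by move=> n; apply: measurable_sum.
  move=> w _.
  rewrite (_ : (fun n => _) = fun n =>
      \sum_(u <- points X W w) \sum_(k < n) ((u \in F k)%:R : R)); last first.
    by apply: funext => n; rewrite exchange_big.
  apply: cvg_sumr => u.
  have [/set_mem[k0 _ Fk0]|nF] := boolP (u \in \bigcup_k F k); last first.
    rewrite (_ : (fun n => _) = fun=> 0); first exact: cvg_cst.
    apply: funext => n; apply: big1 => k _; rewrite [_ \in _](_ : _ = false)//.
    by apply: contraNF nF => /set_mem Fk; apply/mem_set; exists k.
  apply: cvg_near_cst; exists k0.+1 => // n /= kn.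
  rewrite (bigD1 (Ordinal kn))//= mem_set// big1 ?addr0// => k kk0.
  rewrite memNset// => Fk; move/eqP: kk0; apply; apply: val_inj => /=.
  by apply: (tF k k0) => //; exists u.
Qed.

Lemma sigma_voids : <<s open_voids >> = <<s F_W_gen X W >>.
Proof.
apply/seteqP; split; apply: smallest_sub.
- exact: smallest_sigma_algebra.
- move=> _ [U oU ->]; apply: sub_sigma_algebra; exists (U `&` W), 0%N.
  by split => //; apply: measurableI => //; exact: open_measurable_mx.
- exact: smallest_sigma_algebra.
- move=> _ [B [k [mB BW ->]]].
  have := measurable_rcount mB measurableT (measurable_set1 (k%:R : R)).
  rewrite setTI (_ : _ @^-1` _ = [set w | count X B w = k])//.
  apply/seteqP; split => w /=; rewrite -rcountE (setIidl BW).
    by move/eqP; rewrite eqr_nat => /eqP.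
  by move=> ->.
Qed.

End void_sigma_algebra.

Section domain_dense.
Context {R : realType} {d : nat}.
Local Notation V := 'rV[R]_d.
Variables (W : set V) (cW : compact W) (C2W : C2_boundary W).
Context {dT : measure_display} {T : measurableType dT} (P : probability T R).
Context (theta : R) (X : T -> set V).
Hypothesis poisX : poisson_process P theta X.
Variables (pi : V -> V -> R) (M : R) (piK : pi_kernel W pi M).
Let mW := measurable_window cW.
Let finX := finite_window cW poisX.
Local Notation Ddom := (D_dom (P := P) (X := X) (W := W) pi).
Local Notation FW := (F_W_type X W).

Lemma indicator_in_L2 (A : set T) : measurable (A : set FW) ->
  in_l2 (\1_A : L2_Omega P X W).
Proof.
move=> mA; apply: (growth_in_L2 cW poisX (A := 1) (C := 1)) => //.
by move=> w; rewrite expr1n mulr1 ger0_norm// indicE; case: (_ \in _).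
Qed.

(** Dynkin induction from the void events. Complements use linearity and the constant 1, which is
    the indicator of the void event of the empty set; disjoint unions are limits in L^2 of finite
    sums. *)
Lemma approximable_indicator (A : set T) : measurable (A : set FW) ->
  approximable Ddom (\1_A : L2_Omega P X W).
Proof.
have laws := L2_Omega_laws cW poisX.
have lin := D_dom_lin cW C2W poisX (pi := pi).
have dl2 := D_dom_l2 cW C2W poisX piK.
have AT : approximable Ddom (\1_setT : L2_Omega P X W).
  rewrite (_ : setT = [set w | count X (set0 `&` W) w = 0%N]).
    by apply: (approximable_void cW C2W poisX piK); exact: open0.
  apply/seteqP; split => // w _; apply/(voidE finX) => u _ _.
  exact.
have sv := sigma_voids mW finX (countE cW poisX).
move=> mA; have mA' : <<s open_voids W X >> A by rewrite sv.
apply: (dynkin_induction (T := FW) (G := open_voids W X)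
  (P := fun A => approximable Ddom (\1_A : L2_Omega P X W)) _ _ _ _ _ _ mA') => //.
- exact: setI_closed_voids.
- by move=> _ [U oU ->]; exact: (approximable_void cW C2W poisX piK).
- move=> S mS AS.
  rewrite (_ : (\1_(~` S) : L2_Omega P X W) =
    (-1) *: (\1_S : L2_Omega P X W) + (\1_setT : L2_Omega P X W)).
    exact: approximable_lin.
  apply: funext => w; change (\1_(~` S) w = (-1) * \1_S w + \1_setT w :> R).
  by rewrite !indicE in_setC in_setT; case: (w \in S) => /=; lra.
- move=> F mF tF AF.
  pose G n : set T := \big[setU/set0]_(k < n) F k.
  have mG n : measurable (G n : set FW) by apply: bigsetU_measurable.
  have AG n : approximable Ddom (\1_(G n) : L2_Omega P X W).
    elim: n => [|n IH].
      rewrite /G big_ord0 (_ : (\1_set0 : L2_Omega P X W) = 0).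
        exact: (approximable0 laws dl2 (D_dom0 cW C2W poisX pi)).
      by apply: funext => w; rewrite indicE in_set0.
    rewrite (_ : (\1_(G n.+1) : L2_Omega P X W) =
      1 *: (\1_(G n) : L2_Omega P X W) + (\1_(F n) : L2_Omega P X W)).
      exact: approximable_lin.
    apply: funext => w; change (\1_(G n.+1) w = 1 * \1_(G n) w + \1_(F n) w :> R).
    rewrite /G big_ord_recr/= !indicE in_setU mul1r.
    case: (boolP (w \in F n)) => [/set_mem Fn|_]; last by rewrite orbF addr0.
    rewrite orbT memNset ?add0r// -bigcup_mkord => -[k /= kn Fk].
    have e : k = n by apply: (tF k n) => //; exists w.
    by rewrite e ltnn in kn.
  have mU : measurable (\bigcup_k F k : set FW) by exact: bigcup_measurable.
  have UL := indicator_in_L2 mU.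
  apply: (approximable_lim laws dl2 AG UL).
  have i1 : P.-integrable setT (EFin \o (fun _ : T => 1 : R)).
    exact: finite_measure_integrable_cst.
  apply: (L2_Omega_dominated cW poisX _ UL i1) => [l|l w|].
  + exact: indicator_in_L2.
  + by rewrite !indicE; do 2 case: (_ \in _); rewrite ?subrr ?subr0 ?sub0r ?sqrrN ?expr1n ?expr0n/=.
  apply: aeW => w.
  have [/set_mem[k _ Fk]|nF] := boolP (w \in \bigcup_k F k); last first.
    rewrite (_ : (fun l => _) = fun=> \1_(\bigcup_k F k) w); first exact: cvg_cst.
    apply: funext => l; rewrite !indicE (negbTE nF) memNset//.
    rewrite /G -bigcup_mkord => -[k _ Fk].
    by move/negP: nF; apply; apply/mem_set; exists k.
  apply: cvg_near_cst; exists k.+1 => // n /= kn.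
  rewrite !indicE !mem_set//; first by exists k.
  by rewrite /G -bigcup_mkord; exists k.
Qed.

Lemma D_dom_approximates (F : L2_Omega P X W) : in_l2 F -> approximable Ddom F.
Proof.
apply: (approximable_all cW poisX (D_dom_l2 cW C2W poisX piK)
  (D_dom_lin cW C2W poisX (pi := pi)) (D_dom0 cW C2W poisX pi)).
exact: approximable_indicator.
Qed.

Lemma D_densely_defined : densely_defined (D_op (P := P) (X := X) (W := W) pi).
Proof.
move=> F /D_dom_approximates; apply: approximable_seq.
  exact: (L2_Omega_laws cW poisX).
exact: (D_dom_l2 cW C2W poisX piK).
Qed.

End domain_dense.

(** * Closability of the derivative *)

(** To be read with [a], [b], [c] the total fluxes of F G, of G and of F, and with [D] the adjoint
    applied to V: the duality for V tested on F G becomes a duality for G V tested on F. *)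
Lemma product_rule_pairing {R : realType} dT (T : measurableType dT)
    (P : {measure set T -> \bar R}) (F G D a b c : T -> R) :
  P.-integrable setT (EFin \o a) ->
  P.-integrable setT (EFin \o (fun w => F w * (G w * D w))) ->
  P.-integrable setT (EFin \o (fun w => F w * b w)) ->
  (forall w, a w = F w * b w + G w * c w) ->
  (\int[P]_w (a w)%:E = \int[P]_w (F w * (G w * D w))%:E)%E ->
  (\int[P]_w (G w * c w)%:E = \int[P]_w (F w * (G w * D w - b w))%:E)%E.
Proof.
move=> ia i1 i2 aE e.
have -> : (\int[P]_w (G w * c w)%:E = \int[P]_w ((a w)%:E - (F w * b w)%:E))%E.
  by apply: eq_integral => w _; rewrite aE -EFinB addrAC subrr add0r.
rewrite (integralB measurableT ia i2) e -(integralB measurableT i1 i2).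
by apply: eq_integral => w _; rewrite -EFinB mulrBr.
Qed.

(** * Deterministic fields multiplied by elements of the domain *)

Section modulated_field.
Context {R : realType} {d : nat} (d_gt0 : (0 < d)%N).
Local Notation Rd := 'rV[R]_d.
Local Notation form := (forms (R := R) (d := d)).
Variables (W : set Rd) (cW : compact W) (C2W : C2_boundary W) (W_pos : (0 < leb W)%E).
Context {dT : measure_display} {T : measurableType dT}.
Variables (P : probability T R) (theta : R) (theta_gt0 : 0 < theta).
Variables (X : T -> set Rd) (poisX : poisson_process P theta X).
Local Notation FW := (F_W_type X W).
Variables (pi : Rd -> Rd -> R) (M : R) (piK : pi_kernel W pi M).
Variable V : Rd -> Rd.
Hypothesis mV : measurable_fun W V.
Hypothesis bV : (Linfty_norm W (fun x => enorm (V x)) < +oo)%E.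
Let mW := measurable_window cW.
Let v := V_pi W pi V.
Hypothesis c1v : C1_on_vec W v.

Definition modulated (G : T -> R) : T -> Rd -> Rd := fun w x => G w *: V x.

Lemma modulated_measurable (G : T -> R) : measurable_fun setT (G : FW -> R) ->
  l2meas (modulated G : L2_field P X W).
Proof.
move=> mG.
have mD : measurable ([set: FW] `*` W) by exact: measurableX.
apply/(measurable_mxP _ mD) => i k.
rewrite (_ : (fun _ => _) = fun p : FW * Rd => G p.1 * V p.2 i k); last first.
  by apply: funext => p; rewrite mxE.
apply: measurable_funM.
  apply: (measurable_comp (F := setT) measurableT _ mG (g := fst)) => //.
  by apply: measurable_funS measurable_fst => //; exact: measurableT.
have mVk := proj1 (measurable_mxP _ mW) mV i k.
apply: (measurable_comp (F := W) mW _ mVk (g := snd)).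
  by move=> _ [p [_ pW] <-].
by apply: measurable_funS measurable_snd => //; exact: measurableT.
Qed.

(** Multiplication by a bounded V is a bounded operator from variables to fields, the constant being
    uniform in G; hence approximation of G gives approximation of G V. *)
Lemma modulated_sq : exists2 c, 0 <= c &
  forall G : T -> R, in_l2 (G : L2_Omega P X W) ->
  (l2ip (modulated G : L2_field P X W) (modulated G) <=
   c%:E * l2ip (G : L2_Omega P X W) G)%E.
Proof.
have [c c0 hc] := ae_bounded_field cW W_pos bV.
pose L := fine (leb W).
have LW : leb W = L%:E by rewrite /L fineK// ge0_fin_numE// (window_fin cW).
have L0 : 0 <= L by exact: fine_ge0.
exists (d%:R * c ^+ 2 * L); first by rewrite !mulr_ge0// sqr_ge0.
move=> G [mG _]; rewrite -ge0_integralZl//; last 3 first.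
- by apply/measurable_EFinP; apply: measurable_funM; exact: (FW_measurable_fun cW poisX).
- by move=> w _; rewrite lee_fin -expr2 sqr_ge0.
- by rewrite lee_fin !mulr_ge0// sqr_ge0.
have mGV := modulated_measurable mG.
apply: ge0_le_integral => //.
- by move=> w _; apply: integral_ge0 => x _; rewrite lee_fin dot_ge0.
- apply: (eq_measurable_fun (fun w => \int[wmeas cW]_x (fdot W (modulated G) (modulated G) (w, x))%:E)%E).
    by move=> w _; rewrite (fdot_slice cW C2W poisX w mGV mGV).
  apply: (measurable_fun_fubini_tonelli_F (m2 := wmeas cW)
    (fun p => (fdot W (modulated G) (modulated G) p)%:E)).
    by apply/measurable_EFinP; exact: (measurable_fdot cW poisX).
  by move=> p; rewrite lee_fin /fdot; case: ifP => // _; exact: dot_ge0.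
- apply: measurable_funeM; apply/measurable_EFinP; apply: measurable_funM;
    exact: (FW_measurable_fun cW poisX).
move=> w _; apply: (@le_trans _ _ (\int[leb]_(x in W) (d%:R * c ^+ 2 * (G w * G w))%:E)%E).
  apply: ae_ge0_le_integral => //.
  + by move=> x _; rewrite lee_fin dot_ge0.
  + apply/measurable_EFinP; apply: measurable_sum => k.
    have mVk := proj1 (measurable_mxP _ mW) mV 0 k.
    rewrite (_ : (fun x => _) = fun x => (G w * V x 0 k) * (G w * V x 0 k)).
      by apply: measurable_funM; apply: measurable_funM => //; exact: measurable_cst.
    by apply: funext => x; rewrite !mxE.
  + move=> x _; rewrite lee_fin; apply: mulr_ge0; last by rewrite -expr2 sqr_ge0.
    by rewrite mulr_ge0// sqr_ge0.
  + apply: filterS hc => x h Wx; rewrite lee_fin /dot.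
    apply: (@le_trans _ _ (\sum_(k < d) c ^+ 2 * (G w * G w))).
      apply: ler_sum => k _; rewrite !mxE mulrACA mulrC.
      apply: ler_wpM2r; first by rewrite -expr2 sqr_ge0.
      by rewrite -expr2 -real_normK ?num_real// lerXn2r ?nnegrE//; exact: h.
    by rewrite sumr_const card_ord -[leLHS]mulr_natl mulrA.
rewrite integral_cst// LW -EFinM lee_fin.
by rewrite le_eqVlt; apply/orP; left; apply/eqP; ring.
Qed.

Lemma modulated_in_L2 (G : T -> R) : in_l2 (G : L2_Omega P X W) ->
  in_l2 (modulated G : L2_field P X W).
Proof.
move=> GL; have laws := L2_Omega_laws cW poisX.
split; first by apply: modulated_measurable; have [] := GL.
have [c c0 hc] := modulated_sq.
apply: le_lt_trans (hc G GL) _.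
by rewrite (ipE laws GL GL) -EFinM ltry.
Qed.

Lemma modulated_cvg (G_ : nat -> T -> R) (G : T -> R) :
  (forall l, in_l2 (G_ l : L2_Omega P X W)) -> in_l2 (G : L2_Omega P X W) ->
  l2cvg (G_ : nat -> L2_Omega P X W) (G : L2_Omega P X W) ->
  l2cvg (fun l => modulated (G_ l) : L2_field P X W) (modulated G : L2_field P X W).
Proof.
move=> G_L GL cG; have [c c0 hc] := modulated_sq.
have laws := L2_Omega_laws cW poisX; have lawsF := L2_field_laws cW C2W poisX.
have e l : (modulated (G_ l) : L2_field P X W) - modulated G =
    modulated ((G_ l : L2_Omega P X W) - G).
  apply: funext => w; apply: funext => x.
  change (G_ l w *: V x - G w *: V x = (G_ l w - G w) *: V x).
  by rewrite scalerBl.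
have BL l : in_l2 ((G_ l : L2_Omega P X W) - G) by exact: in_l2B.
rewrite /l2cvg; apply: (@squeeze_cvge _ _ _ _ (fun=> 0%E) _
    (fun l => (c%:E * l2ip ((G_ l : L2_Omega P X W) - G) ((G_ l : L2_Omega P X W) - G))%E)).
- apply: nearW => l; rewrite l2_ge0//= e; exact: hc.
- exact: cvg_cst.
- by rewrite -(mule0 c%:E); apply: cvgeZl.
Qed.

Lemma functional_total_flux_M (f g : form) (A C B E : R) w :
  0 <= A -> 0 <= B -> 0 <= C -> 0 <= E -> tame W f A C -> tame W g B E ->
  functional X W (total_flux W (fun n => f n * g n) v) w =
  functional X W f w * functional X W (total_flux W g v) w +
  functional X W g w * functional X W (total_flux W f v) w.
Proof.
move=> A0 B0 C0 E0 tf tg; have [_ pM] := tame_M cW C2W A0 B0 C0 E0 tf tg.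
have zW : Wpow W _ (X_W X W w) by exact: (X_W_Wpow cW poisX).
rewrite /functional /total_flux !mulrN -opprD !mulr_sumr -big_split.
apply: (f_equal (fun a => - a)); apply: eq_bigr => i _.
rewrite /= /flux !mulr_sumr -big_split; apply: eq_bigr => k _.
apply: etrans (f_equal (fun a => _ * a) (pM _ i k _ zW)) _.
move: (partial _ _ _ (f _) _) (partial _ _ _ (g _) _) => p q.
by rewrite /=; ring.
Qed.

Lemma compatible_M (f g : form) : compatible W f -> compatible W g ->
  compatible W (fun n => f n * g n).
Proof.
move=> cf cg n z y zW fy.
by have e := congr2 *%R (cf n z y zW fy) (cg n z y zW fy); exact: e.
Qed.

Variables (g : form) (B E : R).
Arguments g : clear implicits.
Hypotheses (B1 : 1 <= B) (E1 : 1 <= E) (tg : tame W g B E) (cg : compatible W g).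
Let B0 : 0 <= B. Proof. exact: le_trans B1. Qed.
Let E0 : 0 <= E. Proof. exact: le_trans E1. Qed.
Let G := functional X W g.

(** The classical formula [delta(G V) = G delta(V) - <DG, V>], where the pairing of DG with V is the
    total flux of [g]. *)
Definition modulated_delta (w : T) : R :=
  G w * flux_divergence W theta X pi V w - functional X W (total_flux W g v) w.

Let total_flux_in_L2 : in_l2 (functional X W (total_flux W g v) : L2_Omega P X W).
Proof.
have [K K0 hK] := total_flux_bound cW tg c1v B0 E0.
apply: (growth_in_L2 cW poisX (A := K) (C := 2 * E)) => //.
- exact: mulr_ge0.
- apply: (measurable_at_count cW poisX) => [n|n s z zW].
    by have [] := bm_total_flux cW tg c1v n.
  exact: (total_flux_perm cW C2W tg).
- by move=> w; apply: hK; exact: (X_W_Wpow cW poisX).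
Qed.

Let G_measurable : measurable_fun setT (G : FW -> R).
Proof. exact: (measurable_functional cW poisX tg). Qed.

Let G_in_L2 : in_l2 (G : L2_Omega P X W).
Proof.
apply: (growth_in_L2 cW poisX B0 E0) => // w.
exact: (functional_bound cW poisX w tg).
Qed.

Let G_flux_divergence_in_L2 :
  in_l2 ((fun w => G w * flux_divergence W theta X pi V w) : L2_Omega P X W).
Proof.
have [mf [K K0 hK]] := flux_divergence_growth cW poisX c1v.
apply: (growth_in_L2 cW poisX (A := B * K) (C := E * 2)).
- exact: mulr_ge0.
- exact: mulr_ge0.
- exact: measurable_funM.
- move=> w; rewrite normrM exprMn mulrACA; apply: ler_pM => //.
  exact: (functional_bound cW poisX w tg).
Qed.

(* D(FG) = F DG + G DF turns the duality for V into one for G V. *)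
Lemma modulated_adjoint :
  delta_op (P := P) (X := X) (W := W) pi (modulated G) modulated_delta.
Proof.
have laws := L2_Omega_laws cW poisX.
have hL : in_l2 (modulated_delta : L2_Omega P X W).
  exact: (in_l2B laws G_flux_divergence_in_L2 total_flux_in_L2).
split=> //; first exact: modulated_in_L2.
move=> F DF FDF; have [FL _] := D_op_in_l2 cW C2W poisX piK FDF.
have [f [A [C [A1 C1 tf cf [FE DFE]]]]] := D_op_tame cW C2W FDF.
have A0 : 0 <= A by apply: le_trans A1.
have C0 : 0 <= C by apply: le_trans C1.
have [tfg _] := tame_M cW C2W A0 B0 C0 E0 tf tg.
have [_ _ adj] := delta_deterministic d_gt0 cW C2W W_pos theta_gt0 poisX piK mV bV c1v.
have AB1 : 1 <= 2 * (A * B).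
  by rewrite mulr_ege1 ?ler1n// mulr_ege1.
have CE1 : 1 <= C * E by rewrite mulr_ege1.
have := adj _ _ (tame_D_op cW P X pi AB1 CE1 tfg (compatible_M cf cg)).
have pair (h : form) (K : T -> R) :
    (\int[P]_w \int[leb]_(x in W) (K w * dot (derivative_field X W pi h w x) (V x))%:E =
     \int[P]_w (K w * functional X W (total_flux W h v) w)%:E)%E.
  apply: eq_integral => w _; have [i1 i2] := smear_pairing cW W_pos poisX piK mV bV h w.
  have i3 := integrableZl mW (K w) i1.
  apply: etrans (esym (fineK (integrable_fin_num mW i3))) _.
  have e := f_equal (fun b => (K w * b)%:E) i2; apply: etrans e.
  apply: (f_equal (@EFin R)).
  exact: (RintegralZl (K w) mW i1).
have -> : l2ip (derivative_field X W pi (fun n => f n * g n) : L2_field P X W) (fun=> V) =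
    (\int[P]_w (functional X W (total_flux W (fun n => f n * g n) v) w)%:E)%E.
  apply: etrans (etrans (pair _ (fun=> 1)) _).
    by apply: eq_integral => w _; apply: eq_integral => x _; rewrite mul1r.
  by apply: eq_integral => w _; rewrite mul1r.
have -> : l2ip DF (modulated G : L2_field P X W) =
    (\int[P]_w (G w * functional X W (total_flux W f v) w)%:E)%E.
  apply: etrans (pair f G); apply: eq_integral => w _.
  apply: eq_integral => x _; apply: (f_equal (@EFin R)); rewrite DFE /dot mulr_sumr.
  apply: eq_bigr => k _; have mE : modulated G w x 0 k = G w * V x 0 k by rewrite mxE.
  exact: (etrans (f_equal (fun b => _ * b) mE) (mulrCA _ _ _)).
have i1 : P.-integrable setT (EFin \o (fun w =>
    F w * (G w * flux_divergence W theta X pi V w))).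
  exact: (L2_Omega_integrableM cW poisX FL G_flux_divergence_in_L2).
have i2 : P.-integrable setT (EFin \o (fun w =>
    F w * functional X W (total_flux W g v) w)).
  exact: (L2_Omega_integrableM cW poisX FL total_flux_in_L2).
have i0 : P.-integrable setT
    (EFin \o functional X W (total_flux W (fun n => f n * g n) v)).
  have AB0 : 0 <= 2 * (A * B) by apply: le_trans AB1.
  have CE0 : 0 <= C * E by apply: le_trans CE1.
  exact: (integrable_total_flux cW C2W poisX tfg c1v AB0 CE0).
have fM w : functional X W (total_flux W (fun n => f n * g n) v) w =
    F w * functional X W (total_flux W g v) w +
    G w * functional X W (total_flux W f v) w.
  by rewrite FE; exact: (functional_total_flux_M w A0 B0 C0 E0 tf tg).
move=> e; apply: (product_rule_pairing i0 i1 i2 fM).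
by apply: etrans e _; apply: eq_integral => w _; rewrite FE -mulrA.
Qed.

End modulated_field.

Lemma rational_point {R : realType} {d : nat} (U : set 'rV[R]_d) u :
  open U -> U u -> exists q : 'rV[rat]_d, U (map_mx ratr q).
Proof.
move=> oU Uu; have /nbhs_ballP[e /= e0 eU] : nbhs u U by exact: open_nbhs_nbhs.
have qP j : exists q : rat, `|u 0 j - ratr q| < e.
  have [q] : exists q : rat, ratr q \in `](u 0 j - e), (u 0 j + e)[.
    by apply: rat_in_itvoo; rewrite ltrBlDr -addrA ltrDl addr_gt0.
  by rewrite in_itv/= => /andP[h1 h2]; exists q; rewrite distrC ltr_distl h1 h2.
exists (\row_j sval (cid (qP j))); apply: eU; apply: ball_coord => // j.
by rewrite !mxE; case: cid.
Qed.

(** * Truncation of the kernel to a Lipschitz part *)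

Section gentle_points.
Context {R : realType} {d : nat}.
Local Notation Rd := 'rV[R]_d.
Variables (W : set Rd) (cW : compact W) (C2W : C2_boundary W) (W_pos : (0 < leb W)%E).
Variables (pi : Rd -> Rd -> R) (M : R) (piK : pi_kernel W pi M).
Hypothesis pi_C1 : {ae leb, forall x, W x -> C1_on W (pi ^~ x)}.
Let mW := measurable_window cW.
Let regW : W `<=` closure W° := C2_regular cW C2W.

Let step l : R := l.+1%:R^-1.
Let step_gt0 l : 0 < step l. Proof. by rewrite invr_gt0. Qed.

(** Segments start at rational points, follow a coordinate and have length 1 / (l + 1). There are
    countably many of them, so a condition on all of them remains measurable in x; lying in the
    interior lets the mean value theorem apply. *)
Definition inner_segment (p : 'rV[rat]_d * 'I_d * nat) :=
  forall t : R, 0 <= t <= step p.2 ->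
    W° (map_mx ratr p.1.1 + t *: delta_mx 0 p.1.2).

(* The points x at which pi(., x) is m-Lipschitz along countably many segments:
   a measurable description of a bound on the gradient of pi(., x). *)
Definition gentle (m : nat) : set Rd :=
  [set x | W x /\ forall p, inner_segment p ->
    `|pi (map_mx ratr p.1.1 + step p.2 *: delta_mx 0 p.1.2) x -
      pi (map_mx ratr p.1.1) x| <= m%:R * step p.2].

Lemma inner_segment_ends p : inner_segment p ->
  W (map_mx ratr p.1.1) /\ W (map_mx ratr p.1.1 + step p.2 *: delta_mx 0 p.1.2).
Proof.
move=> sp; split; apply: interior_subset.
  by have := sp 0; rewrite lexx ltW// scale0r addr0; exact.
by apply: sp; rewrite lexx ltW.
Qed.

Lemma measurable_gentle m : measurable (gentle m).
Proof.
pose S p : set Rd := if `[< inner_segment p >] then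
  W `&` [set x | m%:R * step p.2 < `|pi (map_mx ratr p.1.1 + step p.2 *: delta_mx 0 p.1.2) x -
      pi (map_mx ratr p.1.1) x| ] else set0.
rewrite (_ : gentle m = W `\` \bigcup_p S p).
  apply: measurableD => //; apply: countable_bigcupT_measurable => // p.
  rewrite /S; case: asboolP => // sp; have [W1 W2] := inner_segment_ends sp.
  have mf : measurable_fun W (fun x => `|pi (map_mx ratr p.1.1 + step p.2 *: delta_mx 0 p.1.2) x -
      pi (map_mx ratr p.1.1) x|).
    apply: measurableT_comp => //.
    by apply: measurable_funB; exact: (measurable_pi cW piK).
  have := mf mW _ (measurable_itv `]m%:R * step p.2, +oo[).
  congr measurable; apply/seteqP; split => x [Wx] /=; rewrite in_itv/= andbT//.
apply/seteqP; split => [x [Wx h]|x [Wx no]]; split => //.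
  move=> [p _]; rewrite /S; case: asboolP => // sp [_ /=].
  by rewrite ltNge h.
move=> p sp; rewrite leNgt; apply/negP => lt; apply: no; exists p => //.
by rewrite /S asboolT.
Qed.

(** The partial derivatives of a C^1 function on the compact window are bounded; any integer above
    the sum of these bounds will do. *)
Lemma ae_gentle : {ae leb, forall x, W x -> exists m, gentle m x}.
Proof.
apply: filterS pi_C1 => x h Wx; have [_ C1o cp] := h Wx.
have bD (k : 'I_d) : exists c, 0 <= c /\
    forall z, W z -> `|partial W 0 k (pi ^~ x) z| <= c.
  by have [c c0 hc] := within_continuous_bounded cW (cp 0 k); exists c.
have {bD}/choice[c cP] := bD.
have [m mP] : exists m : nat, \sum_k c k <= m%:R.
  exists (Num.bound (\sum_k c k)); apply/ltW/archi_boundP.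
  by apply: sumr_ge0 => k _; have [] := cP k.
exists m; split => // p sp.
have := line_lipschitz (f := pi ^~ x) (z := map_mx ratr p.1.1)
  (e := delta_mx 0 p.1.2) (c := m%:R) (ltW (step_gt0 p.2)).
rewrite scale0r addr0 subr0; apply => t /sp Wt.
have [dt _] := C1o 0 p.1.2 _ Wt; split => //.
rewrite -(partial_interior regW 0 p.1.2 C1o Wt); apply: le_trans mP.
apply: (@le_trans _ _ (c p.1.2)).
  by have [_] := cP p.1.2; apply; exact: interior_subset.
by rewrite (bigD1 p.1.2)//= lerDl sumr_ge0// => k _; have [] := cP k.
Qed.

(** The lengths of the segments tend to 0, so at a rational point of the interior the derivative is
    a limit of controlled difference quotients. *)
Lemma gentle_derivative m x (q : 'rV[rat]_d) k : gentle m x -> C1_on W (pi ^~ x) ->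
  W° (map_mx ratr q) -> `|'D_(delta_mx 0 k) (pi ^~ x) (map_mx ratr q)| <= m%:R.
Proof.
move=> [Wx gx] [_ C1o _] Wq; set z : Rd := map_mx ratr q.
have [dz _] := C1o 0 k z Wq; set D := 'D_ _ _ _.
rewrite leNgt; apply/negP => mD.
have e0 : 0 < `|D| - m%:R by rewrite subr_gt0.
have : (fun h : R => h^-1 *: (pi (h *: delta_mx 0 k + z) x - pi z x)) h @[h --> 0^'] --> D.
  exact: dz.
move=> /cvgrPdist_lt /(_ _ e0); rewrite near_withinE => /nbhs_ballP[r /= r0 hr].
have /nbhs_ballP[r' /= r'0 hr'] : nbhs z W°.
  by apply: open_nbhs_nbhs; split => //; exact: open_interior.
have rr0 : 0 < Num.min r r' by rewrite lt_min r0.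
have [l _ /(_ _ (leqnn l)) /= ls] := near_infty_natSinv_lt (PosNum rr0).
move: ls; rewrite lt_min => /andP[lr lr'].
have sp : inner_segment (q, k, l).
  move=> t /= /andP[t0 tl]; apply: hr'; apply: ball_coord => // j.
  rewrite !mxE eqxx/= opprD addrA subrr sub0r normrN normrM.
  apply: le_lt_trans lr'; apply: le_trans tl; rewrite ger0_norm//.
  by case: (j == k) => /=; rewrite ?normr1 ?normr0 ?mulr1 ?mulr0.
have g1 := gx _ sp.
have ez : z + step l *: delta_mx 0 k = step l *: delta_mx 0 k + z := addrC _ _.
rewrite /= -/z ez in g1.
have hb : ball 0 r (step l) by rewrite /ball/= sub0r normrN ger0_norm ?ltW.
have h1 := hr _ hb (lt0r_neq0 (step_gt0 l)).
set y := pi (_ + z) x - pi z x in g1 h1.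
have : `|(step l)^-1 *: y| <= m%:R.
  have s0 : 0 < (step l)^-1 by rewrite invr_gt0.
  by rewrite normrZ (gtr0_norm s0) (ler_pdivrMl _ _ (step_gt0 l)) mulrC.
have := ler_norm (`|D| - `|(step l)^-1 *: y|).
have := ler_dist_dist D ((step l)^-1 *: y); lra.
Qed.

(** Rational points are dense in the interior and the interior is dense in [W], so the bound extends
    to all of [W] by continuity. *)
Lemma gentle_partial m x z k : gentle m x -> C1_on W (pi ^~ x) -> W z ->
  `|partial W 0 k (pi ^~ x) z| <= m%:R.
Proof.
move=> gx C1x Wz; have [_ C1o cp] := C1x.
have Dm (q : 'rV[rat]_d) : W° (map_mx ratr q) ->
    `|'D_(delta_mx 0 k) (pi ^~ x) (map_mx ratr q)| <= m%:R.
  exact: gentle_derivative.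
have Dp y : W° y -> partial W 0 k (pi ^~ x) y = 'D_(delta_mx 0 k) (pi ^~ x) y.
  exact: partial_interior.
have /subspace_continuousP/(_ z Wz) := cp 0 k.
move: (partial W 0 k (pi ^~ x)) Dp => g Dp cg.
rewrite leNgt; apply/negP => cgx.
have /cvgrPdist_lt : g y @[y --> within W (nbhs z)] --> g z by exact: cg.
move=> /(_ (`|g z| - m%:R)); rewrite subr_gt0 => /(_ cgx).
rewrite near_withinE nbhsE => -[U [oU Uz] UP].
have [y [Wy Uy]] : W° `&` U !=set0.
  by apply: (regW Wz); exact: open_nbhs_nbhs.
have oWU : open (W° `&` U) by apply: openI => //; exact: open_interior.
have [q [Wq Uq]] := rational_point oWU (conj Wy Uy).
have h1 := Dm q Wq; rewrite -(Dp _ Wq) in h1.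
have h2 := UP _ Uq (interior_subset Wq).
have := ler_dist_dist (g z) (g (map_mx ratr q)).
have := ler_norm (`|g z| - `|g (map_mx ratr q)|); move: h2 => /=; lra.
Qed.

(** Cutting the kernel at gentle points gives a gradient bounded by the constant m, hence
    [dominated_gradient]; in [V_pi] the cut can equally be charged to V. *)
Definition truncated_pi m (z x : Rd) : R := if x \in gentle m then pi z x else 0.

Lemma truncated_kernel m : pi_kernel W (truncated_pi m) `|M|.
Proof.
have [mpi bpi] := piK; split; last first.
  move=> z x Wz Wx; rewrite /truncated_pi; case: ifP => _; last by rewrite normr0.
  by apply: le_trans (ler_norm M); exact: bpi.
have mWW : measurable (W `*` W) by exact: measurableX.
apply: (eq_measurable_fun (fun zx => pi zx.1 zx.2 * \1_(gentle m) zx.2)).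
  by move=> [z x] _; rewrite /truncated_pi/= indicE; case: (x \in _); rewrite ?mulr1 ?mulr0.
apply: measurable_funM => //.
apply: measurable_funS (measurableT) (@subsetT _ _) _.
by apply: (measurableT_comp _ measurable_snd); apply: measurable_indic; exact: measurable_gentle.
Qed.

Lemma truncated_C1 m : {ae leb, forall x, W x -> C1_on W (truncated_pi m ^~ x)}.
Proof.
apply: filterS pi_C1 => x h Wx; rewrite /truncated_pi.
case: (x \in gentle m); first exact: h.
by have [] := C1_on_cst cW C2W 0.
Qed.

Lemma truncated_dominated m : dominated_gradient W (truncated_pi m).
Proof.
exists (fun=> m%:R).
  apply: (@ae_bounded_integrable _ _ _ leb W _ m%:R mW (window_fin cW)) => //.
  by apply: aeW => x _; rewrite ger0_norm.
apply: filterS pi_C1 => x h Wx z k Wz; rewrite /truncated_pi.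
case: (boolP (x \in gentle m)) => [/set_mem gx|_].
  exact: (gentle_partial k gx (h Wx) Wz).
have [_ p0] := C1_on_cst cW C2W 0.
by have e := p0 0 k z Wz; apply: (le_trans (y := 0)) => //; rewrite normr_le0; apply/eqP; exact: e.
Qed.

End gentle_points.

(** * Fields orthogonal to the domain of the adjoint *)

Section derivative_closable.
Context {R : realType} {d : nat} (d_gt0 : (0 < d)%N).
Local Notation Rd := 'rV[R]_d.
Variables (W : set Rd) (cW : compact W) (C2W : C2_boundary W) (W_pos : (0 < leb W)%E).
Context {dT : measure_display} {T : measurableType dT}.
Variables (P : probability T R) (theta : R) (theta_gt0 : 0 < theta).
Variables (X : T -> set Rd) (poisX : poisson_process P theta X).
Local Notation FW := (F_W_type X W).
Local Notation L2F := (L2_field P X W).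
Variables (pi : Rd -> Rd -> R) (M : R) (piK : pi_kernel W pi M).
Hypothesis pi_C1 : {ae leb, forall x, W x -> C1_on W (pi ^~ x)}.
Let mW := measurable_window cW.
Let lawsO := L2_Omega_laws cW poisX.
Let lawsF := L2_field_laws cW C2W poisX.
Local Notation nu := (P \x wmeas cW)%E.

Lemma nu_strip (B : set Rd) : measurable B -> nu (setT `*` B) = wmeas cW B.
Proof.
move=> mB; apply: etrans (product_measure1E P (wmeas cW) measurableT mB) _.
have e : P setT = 1%E by exact: probability_setT.
by rewrite [X in (X * _)%E]e mul1e.
Qed.

Lemma fdot_integrable (Y Z : T -> Rd -> Rd) : in_l2 (Y : L2F) -> in_l2 (Z : L2F) ->
  nu.-integrable setT (EFin \o fdot W Y Z).
Proof.
have sq U : in_l2 (U : L2F) -> nu.-integrable setT (EFin \o fdot W U U).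
  move=> [mU fU]; apply/integrableP; split.
    by apply/measurable_EFinP; exact: (measurable_fdot cW poisX).
  rewrite [ltLHS](_ : _ = l2ip (U : L2F) U)//.
  rewrite [RHS](L2_field_sq cW C2W poisX mU); apply: eq_integral => p _.
  by rewrite /= ger0_norm// /fdot; case: ifP => // _; exact: dot_ge0.
move=> YL ZL; apply: le_integrable (integrableD measurableT (sq Y YL) (sq Z ZL)) => //.
  apply/measurable_EFinP; apply: (measurable_fdot cW poisX); first by have [] := YL.
  by have [] := ZL.
move=> p _; rewrite /comp -EFinD !abse_EFin lee_fin /fdot; case: ifP => _; last first.
  by rewrite normr0.
rewrite [leRHS]ger0_norm ?addr_ge0 ?dot_ge0// /dot -big_split.
apply: le_trans (ler_norm_sum _ _ _) _; apply: ler_sum => k _ /=.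
move: (Y _ _ _ _) (Z _ _ _ _) => a b; rewrite ler_norml.
have := sqr_ge0 (a - b); have := sqr_ge0 (a + b); have := sqr_ge0 a; have := sqr_ge0 b.
by rewrite !expr2 => *; apply/andP; split; nra.
Qed.

Definition direction (B : set Rd) (k : 'I_d) (x : Rd) : Rd := \1_B x *: delta_mx 0 k.

Lemma measurable_direction B k : measurable B -> measurable_fun W (direction B k).
Proof.
move=> mB; apply/(measurable_mxP _ mW) => i j.
rewrite (_ : (fun _ => _) = fun x => \1_B x * (delta_mx 0 k : Rd) i j); last first.
  by apply: funext => x; rewrite /direction !mxE.
exact: measurable_funM.
Qed.

Lemma bounded_direction B k :
  (Linfty_norm W (fun x => enorm (direction B k x)) < +oo)%E.
Proof.
apply: (@le_lt_trans _ _ (1 : R)%:E); last exact: ltry.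
apply: Linfty_norm_le => // x _; rewrite ger0_norm ?sqrtr_ge0//.
rewrite -[leRHS]sqrtr1 ler_wsqrtr// /dot (bigD1 k)//= big1.
  by rewrite !mxE !eqxx mulr1 addr0 indicE; case: (x \in B); rewrite ?mulr1 ?mulr0.
by move=> j jk; rewrite !mxE (negbTE jk) andbF !mulr0.
Qed.

(** The indicator of the gentle points is moved from V to the kernel, where the truncated [pi]
    satisfies the domination condition. *)
Lemma V_pi_gentle_C1 B k m : measurable B ->
  C1_on_vec W (V_pi W pi (direction (B `&` gentle W pi m) k)).
Proof.
move=> mB.
have -> : V_pi W pi (direction (B `&` gentle W pi m) k) =
    V_pi W (truncated_pi W pi m) (direction B k).
  apply: funext => u; apply/rowP => j; rewrite [LHS]mxE [RHS]mxE.
  apply: eq_Rintegral => x _; rewrite !mxE !indicE in_setI /truncated_pi.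
  by case: (x \in gentle W pi m); rewrite ?andbT ?andbF//= ?mul0r ?mulr0 ?mul0r.
exact: (V_pi_C1 cW C2W W_pos (truncated_kernel cW piK m) (truncated_C1 cW C2W pi_C1 m)
  (measurable_direction k mB) (bounded_direction B k)
  (truncated_dominated cW C2W pi_C1 m)).
Qed.

Variable Y : T -> Rd -> Rd.
Hypothesis YL : in_l2 (Y : L2F).
Hypothesis Y_orth : forall (v : L2F) h, delta_op (P := P) (X := X) (W := W) pi v h ->
  l2ip (Y : L2F) v = 0%E.

(** [modulated_adjoint] requires a variable in the domain of D, and an arbitrary F in L^2 is reached
    only in the limit: density supplies the approximation and [modulated_cvg] transfers it to
    fields. *)
Lemma orthogonal_modulated V (F : T -> R) : measurable_fun W V ->
  (Linfty_norm W (fun x => enorm (V x)) < +oo)%E -> C1_on_vec W (V_pi W pi V) ->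
  in_l2 (F : L2_Omega P X W) -> ip (Y : L2F) (modulated V F) = 0.
Proof.
move=> mV bV c1v FL.
have [F_ [DF_ cF]] := approximable_seq lawsO (D_dom_l2 cW C2W poisX piK)
  (D_dom_approximates cW C2W poisX piK FL).
have F_L l : in_l2 (F_ l) by apply: (D_dom_l2 cW C2W poisX piK); exact: DF_.
have c := ip_cvg lawsF (fun=> YL)
  (fun l => modulated_in_L2 cW C2W W_pos poisX mV bV (F_L l)) YL
  (modulated_in_L2 cW C2W W_pos poisX mV bV FL) (l2cvg_cst lawsF YL)
  (modulated_cvg cW C2W W_pos poisX mV bV F_L FL cF).
apply: cvgR_unique c _; rewrite (_ : (fun l => _) = fun=> 0); first exact: cvg_cst.
apply: funext => l; have [Z FZ] := DF_ l.
have [f [A [C [A1 C1 tf cf [FE _]]]]] := D_op_tame cW C2W FZ.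
rewrite /ip FE.
by rewrite (Y_orth (modulated_adjoint d_gt0 cW C2W W_pos theta_gt0 poisX piK mV bV c1v A1 C1 tf cf)).
Qed.

Section one_direction.
Variables (m : nat) (k : 'I_d).
Let E := gentle W pi m.
Let mE : measurable E. Proof. exact: (measurable_gentle cW piK). Qed.

(** Indexed by joint sets of outcomes and positions, so that the class of admissible S can be
    extended from rectangles to the product of F_W with the Borel sets; the cut at gentle points is
    kept throughout. *)
Definition test_field (S : set (T * Rd)) : T -> Rd -> Rd :=
  fun w x => (\1_S (w, x) * \1_E x) *: delta_mx 0 k.

Lemma test_field_in_L2 S : measurable (S : set (FW * Rd)) ->
  in_l2 (test_field S : L2F).
Proof.
move=> mS; apply: (growth_in_field cW C2W poisX (A := 1) (C := 1)) => //.
  have mD : measurable ([set: FW] `*` W) by exact: measurableX.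
  apply/(measurable_mxP _ mD) => i j.
  rewrite (_ : (fun _ => _) =
      fun p : FW * Rd => \1_S p * \1_E p.2 * (delta_mx 0 k : Rd) i j); last first.
    by apply: funext => -[w x]; rewrite !mxE.
  apply: measurable_funM => //; apply: measurable_funM.
    exact: (measurable_indic mS).
  apply: measurable_funS (measurableT) (@subsetT _ _) _.
  exact: (measurableT_comp (measurable_indic mE) measurable_snd).
move=> w x j Wx; rewrite expr1n mulr1 !mxE eqxx /= !indicE.
by do 2 case: (_ \in _); case: (_ == _); rewrite ?mulr1 ?mulr0 ?mul0r ?normr0 ?normr1.
Qed.

Lemma orthogonal_rectangle (A : set T) (B : set Rd) :
  measurable (A : set FW) -> measurable B ->
  ip (Y : L2F) (test_field (A `*` B)) = 0.
Proof.
move=> mA mB; pose V := direction (B `&` E) k.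
have -> : test_field (A `*` B) = modulated V (\1_A : T -> R).
  apply: funext => w; apply: funext => x.
  rewrite /test_field /modulated /V /direction scalerA !indicE in_setI in_setX/=.
  by congr (_ *: _); case: (w \in A); case: (x \in B); case: (x \in E);
    rewrite /= ?mulr1 ?mulr0.
apply: orthogonal_modulated.
- by apply: measurable_direction; exact: measurableI.
- exact: bounded_direction.
- exact: V_pi_gentle_C1.
- exact: (indicator_in_L2 cW poisX).
Qed.

Lemma orthogonal_test S : measurable (S : set (FW * Rd)) ->
  ip (Y : L2F) (test_field S) = 0.
Proof.
move=> mS; have mS' := mS; rewrite measurable_prod_measurableType in mS'.
apply: (dynkin_induction (T := (FW * Rd)%type)
  (G := [set A `*` B | A in measurable & B in measurable])
  (P := fun S => ip (Y : L2F) (test_field S) = 0) _ _ _ _ _ _ mS').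
- exact: measurable_prod_measurableType.
- move=> _ _ [A mA [B mB <-]] [A' mA' [B' mB' <-]].
  exists (A `&` A'); first exact: measurableI.
  by exists (B `&` B'); [exact: measurableI|rewrite setXI].
- by rewrite -setXTT; exact: orthogonal_rectangle.
- by move=> _ [A mA [B mB <-]]; exact: orthogonal_rectangle.
- move=> Q mQ hQ; have hT : ip (Y : L2F) (test_field setT) = 0.
    by rewrite -setXTT; exact: orthogonal_rectangle.
  have -> : (test_field (~` Q) : L2F) =
      (-1) *: (test_field Q : L2F) + (test_field setT : L2F).
    apply: funext => w; apply: funext => x.
    change (test_field (~` Q) w x = (-1) *: test_field Q w x + test_field setT w x).
    rewrite /test_field scalerA -scalerDl !indicE in_setC in_setT.
    by congr (_ *: _); case: (_ \in Q) => /=; ring.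
  have QL := test_field_in_L2 mQ; have TL := test_field_in_L2 measurableT.
  rewrite (ip_sym lawsF) (ip_linl lawsF)// (ip_sym lawsF (test_field Q)) hQ.
  by rewrite (ip_sym lawsF (test_field setT)) hT mulr0 addr0.
- move=> F mF tF hF.
  pose G n := \big[setU/set0]_(i < n) F i.
  have mG n : measurable (G n : set (FW * Rd)) by exact: bigsetU_measurable.
  have mU : measurable (\bigcup_i F i : set (FW * Rd)) by exact: bigcup_measurable.
  have hG n : ip (Y : L2F) (test_field (G n)) = 0.
    elim: n => [|n IH].
      rewrite /G big_ord0 -(set0X (setT : set Rd)).
      exact: orthogonal_rectangle.
    have -> : (test_field (G n.+1) : L2F) =
        1 *: (test_field (G n) : L2F) + (test_field (F n) : L2F).
      apply: funext => w; apply: funext => x.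
      change (test_field (G n.+1) w x = 1 *: test_field (G n) w x + test_field (F n) w x).
      rewrite /test_field scale1r -scalerDl -mulrDl; congr ((_ * _) *: _).
      rewrite /G big_ord_recr/= !indicE in_setU.
      case: (boolP ((w, x) \in F n)) => [/set_mem Fn|_]; last by rewrite orbF addr0.
      rewrite orbT memNset ?add0r// -bigcup_mkord => -[i /= ni Fi].
      have e : i = n by apply: (tF i n) => //; exists (w, x).
      by rewrite e ltnn in ni.
    have GL := test_field_in_L2 (mG n); have nL := test_field_in_L2 (mF n).
    rewrite (ip_sym lawsF) (ip_linl lawsF)// (ip_sym lawsF (test_field (G n))) IH.
    by rewrite (ip_sym lawsF (test_field (F n))) hF mulr0 addr0.
  have UL := test_field_in_L2 mU.
  have cG : l2cvg (fun n => test_field (G n) : L2F) (test_field (\bigcup_i F i) : L2F).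
    pose D n : L2F := (test_field (G n) : L2F) - test_field (\bigcup_i F i).
    have DL n : in_l2 (D n) by exact: (in_l2B lawsF (test_field_in_L2 (mG n)) UL).
    have e n : l2ip (D n) (D n) = (\int[nu]_p (fdot W (D n) (D n) p)%:E)%E.
      by apply: (L2_field_sq cW C2W poisX); have [] := DL n.
    have DE n p : fdot W (D n) (D n) p = if p.2 \in W then
        ((\1_(G n) p - \1_(\bigcup_i F i) p) * \1_E p.2) ^+ 2 else 0.
      rewrite /fdot; case: ifP => // _; rewrite /dot (bigD1 k)//= big1 ?addr0.
        by case: p => w x; rewrite !mxE !eqxx /= !mulr1 -mulrBl expr2.
      by move=> j jk; rewrite !mxE (negbTE jk) andbF !mulr0 subrr mulr0.
    rewrite /l2cvg (_ : (fun l => _) = fun n => (\int[nu]_p (fdot W (D n) (D n) p)%:E)%E); last first.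
      by apply: funext => n; exact: e.
    have i1 : nu.-integrable setT (cst (1 : R)%:E).
      apply/integrableP; split; first exact: measurable_cst.
      rewrite (_ : (fun x => _) = cst (1 : R)%:E); last first.
        by apply: funext => p; rewrite /= normr1.
      rewrite (@integral_cst _ _ _ nu setT measurableT 1%E) mul1e -setXTT.
      apply: (@le_lt_trans _ _ (wmeas cW setT)); last by rewrite ltey_eq fin_num_measure.
      by rewrite le_eqVlt; apply/orP; left; apply/eqP; exact: (nu_strip measurableT).
    have := @dominated_cvg _ _ _ nu setT measurableT
      (fun n p => (fdot W (D n) (D n) p)%:E) (fun=> 0%E) (cst (1 : R)%:E).
    rewrite integral_cst// mul0e; apply => //.
    + by move=> n; apply/measurable_EFinP; apply: (measurable_fdot cW poisX);
        have [] := DL n.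
    + move=> p _; have [/set_mem[i _ Fi]|nF] := boolP (p \in \bigcup_i F i).
        apply: cvg_near_cst; exists i.+1 => // n /= ni; rewrite DE !indicE.
        have Gp : p \in G n by apply/mem_set; rewrite /G -bigcup_mkord; exists i.
        have Up : p \in \bigcup_i F i by apply/mem_set; exists i.
        by rewrite Gp Up subrr mul0r expr0n /=; case: (_ \in W).
      rewrite (_ : (fun n => _) = fun=> 0%E); first exact: cvg_cst.
      apply: funext => n; rewrite DE !indicE (negbTE nF).
      have Gp : (p \in G n) = false.
        apply/negbTE; apply: contraNN nF => /set_mem.
        by rewrite /G -bigcup_mkord => -[i _ Fi]; apply/mem_set; exists i.
      by rewrite Gp subrr mul0r expr0n /=; case: (_ \in W).
    + move=> n p _; rewrite abse_EFin lee_fin DE; case: ifP => _; last by rewrite normr0.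
      rewrite !indicE; do 3 case: (_ \in _);
        by rewrite /= ?subrr ?subr0 ?sub0r ?mul0r ?mulr1 ?mulr0 ?sqrrN ?expr0n ?expr1n ?normr0 ?normr1.
  have c := ip_cvg lawsF (fun=> YL) (fun n => test_field_in_L2 (mG n)) YL UL
    (l2cvg_cst lawsF YL) cG.
  apply: cvgR_unique c _; rewrite (_ : (fun l => _) = fun=> 0); first exact: cvg_cst.
  by apply: funext => n; exact: hG.
Qed.

(** The field is measurable for the product of F_W with the Borel sets, so the sets where its k-th
    component is nonnegative or nonpositive are themselves admissible test sets. On each of them the
    product with the test field has constant sign and integral 0. *)
Lemma component_zero :
  {ae nu, forall p, W p.2 -> E p.2 -> Y p.1 p.2 0 k = 0}.
Proof.
have mD : measurable ([set: FW] `*` W) by exact: measurableX.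
have mY : measurable_fun ([set: FW] `*` W) (fun p : FW * Rd => Y p.1 p.2 0 k).
  by have [mY _] := YL; exact: (proj1 (measurable_mxP _ mD) mY 0 k).
(* The scalar [s] will be 1 or -1, treating both signs at once. *)
have half (s : R) (S : set (T * Rd)) : measurable (S : set (FW * Rd)) ->
    (forall p, S p -> 0 <= s * Y p.1 p.2 0 k) -> S `<=` setT `*` W -> s != 0 ->
    {ae nu, forall p, W p.2 -> E p.2 -> S p -> Y p.1 p.2 0 k = 0}.
  move=> mS S0 SW s0; have SL := test_field_in_L2 mS; have [mSf _] := SL.
  have [mY' _] := YL; have mf := measurable_fdot cW poisX mY' mSf.
  have fE p : fdot W Y (test_field S) p =
      if p.2 \in W then \1_S p * \1_E p.2 * Y p.1 p.2 0 k else 0.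
    rewrite /fdot; case: ifP => // _; rewrite /dot (bigD1 k)//= big1 ?addr0.
      by case: p => w x; rewrite !mxE !eqxx mulr1 mulrC.
    by move=> j jk; rewrite !mxE (negbTE jk) andbF !mulr0.
  have f0 p : 0 <= s * fdot W Y (test_field S) p.
    rewrite fE; case: ifP => _; last by rewrite mulr0.
    rewrite mulrCA !indicE; case: (boolP (p \in S)) => [/set_mem Sp|_].
      by rewrite mul1r; apply: mulr_ge0 => //; exact: S0.
    by rewrite !mul0r.
  have ifd := fdot_integrable YL SL.
  have i0 : (\int[nu]_p (fdot W Y (test_field S) p)%:E = 0)%E.
    rewrite -(L2_field_ip C2W poisX mY' mSf ifd).
    have := ipE lawsF YL SL; rewrite orthogonal_test// => e; exact: e.
  have z : ae_eq nu setT (fun p => (s * fdot W Y (test_field S) p)%:E) (cst 0%E).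
    apply/(ae_eq_integral_abs nu measurableT).
      by apply/measurable_EFinP; exact: measurable_funM.
    under eq_integral => p _ do rewrite abse_EFin (ger0_norm (f0 p)) EFinM.
    by rewrite integralZl// i0 mule0.
  apply: filterS z => p /(_ I) [h] Wp Ep Sp; move: h; rewrite fE mem_set//.
  rewrite !indicE !mem_set// !mul1r => /eqP; rewrite mulf_eq0 (negbTE s0)/=.
  by move/eqP.
have mS (i : interval R) : measurable (([set: FW] `*` W) `&`
    (fun p : FW * Rd => Y p.1 p.2 0 k) @^-1` [set` i]).
  by apply: mY => //; exact: measurable_itv.
have h1 := half 1 _ (mS `[0, +oo[); have h2 := half (-1) _ (mS `]-oo, 0]).
have h1' : {ae nu, forall p, W p.2 -> E p.2 -> 0 <= Y p.1 p.2 0 k -> Y p.1 p.2 0 k = 0}.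
  apply: filterS (h1 _ _ _) => [p h Wp Ep Y0|p [_]||]; last 3 first.
  - by rewrite /= in_itv/= andbT mul1r.
  - by move=> p [].
  - exact: oner_neq0.
  by apply: h => //; split => //; rewrite /= in_itv/= Y0.
have h2' : {ae nu, forall p, W p.2 -> E p.2 -> Y p.1 p.2 0 k <= 0 -> Y p.1 p.2 0 k = 0}.
  apply: filterS (h2 _ _ _) => [p h Wp Ep Y0|p [_]||]; last 3 first.
  - by rewrite /= in_itv/= mulN1r oppr_ge0.
  - by move=> p [].
  - by rewrite oppr_eq0 oner_neq0.
  by apply: h => //; split => //; rewrite /= in_itv/= Y0.
apply: filterS2 h1' h2' => p a1 a2 Wp Ep.
by have [h|h] := leP 0 (Y p.1 p.2 0 k); [exact: a1|apply: a2 => //; exact: ltW].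
Qed.

End one_direction.

Lemma ae_gentle_product :
  {ae nu, forall p, W p.2 -> exists m, gentle W pi m p.2}.
Proof.
have [N [mN N0 NP]] := ae_gentle cW C2W pi_C1.
exists (setT `*` N); split; first exact: measurableX.
  rewrite nu_strip// wmeasE.
  apply/eqP; rewrite eq_le measure_ge0 andbT -N0.
  by apply: le_measure; rewrite ?inE//; apply: measurableI => //; exact: measurable_interior.
by move=> p np; split => //; apply: NP.
Qed.

(** Finitely many components and countably many levels m leave one null set, and almost every
    position in [W] is gentle for some m. *)
Lemma orthogonal_to_adjoint_eq0 : l2ip (Y : L2F) Y = 0%E.
Proof.
have [mY _] := YL; rewrite [LHS](L2_field_sq cW C2W poisX mY).
have comp : {ae nu, forall p, forall k m, W p.2 -> gentle W pi m p.2 -> Y p.1 p.2 0 k = 0}.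
  apply: (@filter_forall _ 'I_d (fun k p => forall m,
    W p.2 -> gentle W pi m p.2 -> Y p.1 p.2 0 k = 0)) => k.
  by apply: ae_foralln => m; exact: component_zero.
rewrite (_ : 0%E = (\int[nu]_p (cst 0%E p))%E); last by rewrite integral0.
apply: ae_eq_integral => //.
  by apply/measurable_EFinP; exact: (measurable_fdot cW poisX).
apply: filterS2 comp ae_gentle_product => p hc hg _.
rewrite /fdot; case: ifP => // /set_mem Wp; have [m gm] := hg Wp.
by rewrite /dot big1// => k _; rewrite (hc k m Wp gm) mul0r.
Qed.

End derivative_closable.

Theorem theorem3p2 (R : realType) (d : nat) (d_gt0 : (0 < d)%N)
    (W : set 'rV[R]_d) (W_compact : compact W) (W_pos : (0 < leb W)%E)
    (W_C2 : C2_boundary W)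
    (dT : measure_display) (T : measurableType dT) (P : probability T R)
    (theta : R) (theta_gt0 : 0 < theta)
    (X : T -> set 'rV[R]_d) (X_poisson : poisson_process P theta X)
    (pi : 'rV[R]_d -> 'rV[R]_d -> R)
    (pi_meas : measurable_fun (W `*` W)
       (fun zx : 'rV[R]_d * 'rV[R]_d => pi zx.1 zx.2))
    (pi_bounded : exists M : R, forall z x, W z -> W x -> `|pi z x| <= M)
    (pi_C1 : {ae leb, forall x, W x -> C1_on W (pi ^~ x)}) :
  let D := @D_op R d dT T P X W pi in
  let delta := @delta_op R d dT T P X W pi in
  [/\ linear_operator D /\ densely_defined D,
      closable D,
      closable delta
    & [/\ forall F DF V deltaV, D F DF -> delta V deltaV ->
            (\int[P]_w \int[leb]_(x in W) (dot (DF w x) (V w x))%:E =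
             \int[P]_w (F w * deltaV w)%:E)%E,
          forall F DF V deltaV,
            closure_op D F DF -> closure_op delta V deltaV ->
            (\int[P]_w \int[leb]_(x in W) (dot (DF w x) (V w x))%:E =
             \int[P]_w (F w * deltaV w)%:E)%E
        & forall V : 'rV[R]_d -> 'rV[R]_d,
            measurable_fun W V ->
            (Linfty_norm W (fun x => enorm (V x)) < +oo)%E ->
            (dominated_gradient W pi -> C1_on_vec W (V_pi W pi V)) /\
            (C1_on_vec W (V_pi W pi V) ->
             delta (fun _ => V)
               (fun w =>
                  \sum_(u \in X w `&` W) divergence W (V_pi W pi V) u -
                  theta *
                  \int[leb]_(u in W) divergence W (V_pi W pi V) u))]].
Proof.
move=> D delta; have [M bM] := pi_bounded.
have piK : pi_kernel W pi M by split => // z x; exact: bM.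
have lawsO := L2_Omega_laws W_compact X_poisson.
have lawsF := L2_field_laws W_compact W_C2 X_poisson.
have DL F DF : D F DF -> in_l2 F /\ in_l2 DF.
  exact: (D_op_in_l2 W_compact W_C2 X_poisson piK).
have dense := D_densely_defined W_compact W_C2 X_poisson piK.
split.
- split; last exact: dense.
  by split; [exact: DL|exact: (D_op_linear W_compact W_C2 X_poisson)].
- apply: (closable_of_adjoint lawsO lawsF DL) => Y YL Y_orth.
  exact: (orthogonal_to_adjoint_eq0 d_gt0 W_compact W_C2 W_pos theta_gt0
    X_poisson piK pi_C1 YL Y_orth).
- exact: (closable_adjoint lawsO lawsF DL dense).
split.
- by move=> F DF V deltaV FD [_ _ adj]; exact: adj.
- move=> F DF V deltaV; exact: (closure_adjoint lawsO lawsF DL).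
move=> V mV bV; split.
- exact: (V_pi_C1 W_compact W_C2 W_pos piK pi_C1 mV bV).
- exact: (delta_deterministic d_gt0 W_compact W_C2 W_pos theta_gt0 X_poisson
    piK mV bV).
Qed.
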